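(* Let $G$ be a connected finite-dimensional Lie group and let $1\to\mathrm{U}(1)\to\widetilde{\Omega G}\xrightarrow{\pi}\Omega G\to1$ be a disjoint commutative central extension of Fréchet Lie groups. Then the Lie group homomorphism $t:\widetilde{\Omega_{(0,\pi)}G}\to P_eG$, $t(\Phi)=\pi(\Phi)|_{[0,\pi]}$, together with the canonical action $\alpha$ of $P_eG$ on $\widetilde{\Omega_{(0,\pi)}G}$, is a central crossed module of Fréchet Lie groups. Moreover, if $G$ is semisimple, then $\alpha$ is the only action of $P_eG$ on $\widetilde{\Omega_{(0,\pi)}G}$ that turns $t$ into a central crossed module of Fréchet Lie groups.
   Context: A smooth map is flat at a point if all its derivatives of all orders $\geq 1$ vanish there. $S^1=\mathbb{R}/2\pi\mathbb{Z}$, $e\in G$ is the identity, $LG=C^\infty(S^1,G)$. $\Omega G\subset LG$ is the Fréchet Lie group of loops $\gamma$ with $\gamma(0)=e$ that are flat at $0$. For $I\subset S^1$, $\Omega_IG=\{\gamma\in\Omega G\mid\gamma(s)=e\text{ for }s\notin I\}$. $P_eG$ is the Fréchet Lie group (pointwise multiplication) of smooth paths $\gamma:[0,\pi]\to G$ with $\gamma(0)=e$ that are flat at both endpoints. For $\gamma_1,\gamma_2\in P_eG$ with $\gamma_1(\pi)=\gamma_2(\pi)$, $\gamma_1\cup\gamma_2\in\Omega G$ is the loop equal to $\gamma_1(s)$ for $s\in[0,\pi]$ and to $\gamma_2(2\pi-s)$ for $s\in[\pi,2\pi]$. A central extension of a Fréchet Lie group $H$ is a sequence $1\to \mathrm{U}(1)\to\widetilde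 H\xrightarrow{\pi}H\to 1$ of Lie groups and Lie group homomorphisms, exact as groups, with $\mathrm{U}(1)$ central, such that $\widetilde H$ is a smooth principal $\mathrm{U}(1)$-bundle over $H$. For a subgroup $K\subset H$, $\widetilde K:=\pi^{-1}(K)$. A central extension $\widetilde{\Omega G}$ is disjoint commutative if $\widetilde{\Omega_IG}$ and $\widetilde{\Omega_JG}$ commute elementwise for all disjoint $I,J\subset S^1$. Canonical action: $\alpha_\gamma(\Phi)=\widetilde{\gamma\cup\gamma}\cdot\Phi\cdot(\widetilde{\gamma\cup\gamma})^{-1}$ for $\gamma\in P_eG$, $\Phi\in\widetilde{\Omega_{(0,\pi)}G}$, where $\widetilde{\gamma\cup\gamma}\in\widetilde{\Omega G}$ is any lift of $\gamma\cup\gamma$ (the result does not depend on the lift). A crossed module of Fréchet Lie groups is a smooth homomorphism $t:H\to K$ of Fréchet Lie groups together with a smooth map $\alpha:K\times H\to H$, $(g,h)\mapsto\alpha_g(h)$, that is an action of $K$ on $H$ by group homomorphisms, such that $t(\alpha_g(h))=g\,t(h)\,g^{-1}$ and $\alpha_{t(h)}(k)=hkh^{-1}$ for all $g\in K$ and $h,k\in H$. It is central if $\alpha$ restricts to the trivial action on $\ker(t)$. *)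

(* Defs.v *)
From HB Require Import structures.
From mathcomp Require Import all_boot all_order all_algebra.
From mathcomp Require Import complex.
From mathcomp Require Import all_classical all_reals all_analysis.

Set Implicit Arguments.
Unset Strict Implicit.
Unset Printing Implicit Defensive.

Import Order.TTheory GRing.Theory Num.Theory.
Import numFieldNormedType.Exports.

Local Open Scope classical_set_scope.
Local Open Scope ring_scope.

(** A Frechet space is presented as a linear subspace [fsub] of an ambient
    vector space, with a countable family of functions [fsn] that are
    seminorms on [fsub].  Outside [fsub] their values are irrelevant.  With
    this presentation spaces of smooth functions are subspaces of the type of
    all functions, and closed subspaces need no new carrier type. *)

Record frechetModel (R : realType) := FrechetModel {
  fvec :> lmodType R;
  fsub : set fvec;
  fsn : nat -> fvec -> R }.

Arguments fsub {R} _ _.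
Arguments fsn {R} {_} _ _.

Section Frechet.
Context {R : realType}.
Implicit Types E F : frechetModel R.

Record is_frechet E : Prop := {
  frechet0 : fsub E 0;
  frechet_lin : forall (a : R) (x y : E),
    fsub E x -> fsub E y -> fsub E (a *: x + y);
  frechet_triangle : forall k (x y : E),
    fsub E x -> fsub E y -> fsn k (x + y) <= fsn k x + fsn k y;
  frechet_scale : forall k (a : R) (x : E),
    fsub E x -> fsn k (a *: x) = `|a| * fsn k x;
  frechet_separated : forall x : E,
    fsub E x -> (forall k, fsn k x = 0) -> x = 0;
  frechet_complete : forall u : nat -> E,
    (forall i, fsub E (u i)) ->
    (forall k (e : R), 0 < e -> exists N, forall i j, (N <= i)%N -> (N <= j)%N ->
       fsn k (u i - u j) < e) ->
    exists2 l : E, fsub E l &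
      forall k (e : R), 0 < e -> exists N, forall i, (N <= i)%N ->
        fsn k (u i - l) < e }.

Definition fball E (x : E) (k : nat) (e : R) : set E :=
  [set y | fsub E y /\ forall j, (j <= k)%N -> fsn j (y - x) < e].

Definition fopen E (U : set E) : Prop :=
  U `<=` fsub E /\
  forall x, U x -> exists k (e : R), 0 < e /\ fball x k e `<=` U.

Definition prodModel E F : frechetModel R :=
  @FrechetModel R (E * F)%type (fsub E `*` fsub F)
    (fun k x => Num.max (fsn k x.1) (fsn k x.2)).

Definition fcontinuous E F (U : set E) (f : E -> F) : Prop :=
  forall x, U x -> fsub F (f x) /\
    forall k (e : R), 0 < e -> exists l (d : R), 0 < d /\
      forall y, U y -> fball x l d y -> fball (f x) k e (f y).

Definition has_dderiv E F (f : E -> F) (x v : E) (w : F) : Prop :=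
  fsub F w /\
  forall k (e : R), 0 < e -> exists d : R, 0 < d /\
    forall t : R, 0 < `|t| -> `|t| < d ->
      fball w k e (t^-1 *: (f (x + t *: v) - f x)).

(** Maps of class C^k between Frechet spaces (Michal, Bastiani, Hamilton): the
    directional derivative exists and is of class C^(k-1) on [U x E]. *)
Fixpoint fclass (k : nat) E F (U : set E) (f : E -> F) {struct k} : Prop :=
  fcontinuous U f /\
  if k is k'.+1 then
    exists df : prodModel E E -> F,
      (forall x v, U x -> fsub E v -> has_dderiv f x v (df (x, v))) /\
      fclass k' (U `*` fsub E : set (prodModel E E)) df
  else True.

Definition fsmooth E F (U : set E) (f : E -> F) : Prop :=
  forall k, fclass k U f.

Definition eucl (n : nat) : frechetModel R :=
  @FrechetModel R 'rV[R]_n setT (fun _ x => `|x|).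

Definition line : frechetModel R := @FrechetModel R R^o setT (fun _ x => `|x|).

End Frechet.

(** A manifold is a subset [carrier] of an ambient type with an atlas; its
    topology is the one determined by the atlas.  Charts are only meaningful
    on their domain. *)

Record chart (R : realType) (T : Type) (E : frechetModel R) := Chart {
  cdom : set T;
  cmap : T -> E }.

Record mfd (R : realType) (T : Type) (E : frechetModel R) := Mfd {
  carrier : set T;
  atlas : set (chart T E) }.

Section Manifold.
Context {R : realType}.

Definition smooth_map (T T' : Type) (E F : frechetModel R)
    (M : mfd T E) (N : mfd T' F) (f : T -> T') : Prop :=
  (forall x, carrier M x -> carrier N (f x)) /\
  forall c d, atlas M c -> atlas N d ->
    let W := cdom c `&` f @^-1` cdom d in
    fopen (cmap c @` W) /\
    exists2 h : E -> F, fsmooth (cmap c @` W) h &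
      forall x, W x -> h (cmap c x) = cmap d (f x).

Definition mopen (T : Type) (E : frechetModel R) (M : mfd T E) (O : set T) :
    Prop :=
  O `<=` carrier M /\
  forall c, atlas M c -> fopen (cmap c @` (O `&` cdom c)).

(** [mfd_compatible] contains both the openness of the chart images and the
    smoothness of the transition maps. *)
Record is_manifold (T : Type) (E : frechetModel R) (M : mfd T E) : Prop := {
  mfd_model : is_frechet E;
  mfd_dom : forall c, atlas M c -> cdom c `<=` carrier M;
  mfd_inj : forall c, atlas M c ->
    forall x y, cdom c x -> cdom c y -> cmap c x = cmap c y -> x = y;
  mfd_cover : forall x, carrier M x -> exists2 c, atlas M c & cdom c x;
  mfd_compatible : smooth_map M M id;
  mfd_hausdorff : forall x y, carrier M x -> carrier M y -> x <> y ->
    exists O O', [/\ mopen M O, mopen M O', O x, O' y & O `&` O' = set0] }.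

Definition mconnected (T : Type) (E : frechetModel R) (M : mfd T E) : Prop :=
  forall O, mopen M O -> mopen M (carrier M `\` O) ->
    O = set0 \/ O = carrier M.

Definition vecMfd (E : frechetModel R) : mfd E E :=
  @Mfd R E E (fsub E) [set Chart (fsub E) id].

Definition prodMfd (T T' : Type) (E F : frechetModel R)
    (M : mfd T E) (N : mfd T' F) : mfd (T * T') (prodModel E F) :=
  @Mfd R (T * T')%type (prodModel E F) (carrier M `*` carrier N)
    [set c | exists c1 c2, [/\ atlas M c1, atlas N c2 &
       c = @Chart R _ (prodModel E F) (cdom c1 `*` cdom c2)
             (fun x => (cmap c1 x.1, cmap c2 x.2))]].

(** The open submanifold on [W]; only meaningful when [W] is open. *)
Definition restrictMfd (T : Type) (E : frechetModel R) (M : mfd T E)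
    (W : set T) : mfd T E :=
  Mfd (carrier M `&` W)
    [set c | exists2 c0, atlas M c0 & c = Chart (cdom c0 `&` W) (cmap c0)].

Definition diffeo (T T' : Type) (E F : frechetModel R)
    (M : mfd T E) (N : mfd T' F) (f : T -> T') : Prop :=
  smooth_map M N f /\
  exists g : T' -> T, [/\ smooth_map N M g,
    forall x, carrier M x -> g (f x) = x &
    forall y, carrier N y -> f (g y) = y].

End Manifold.

(** A Lie group is a manifold whose carrier is a subgroup of an ambient
    [groupType]. *)

Section LieGroup.
Context {R : realType}.

Record is_lie (T : groupType) (E : frechetModel R) (G : mfd T E) : Prop := {
  lie_mfd : is_manifold G;
  lie1 : carrier G 1%g;
  lieM : forall x y, carrier G x -> carrier G y -> carrier G (x * y)%g;
  lieV : forall x, carrier G x -> carrier G (x^-1)%g;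
  lie_mul_smooth : smooth_map (prodMfd G G) G (fun x => (x.1 * x.2)%g);
  lie_inv_smooth : smooth_map G G (fun x => (x^-1)%g) }.

Definition lie_hom (T T' : groupType) (E F : frechetModel R)
    (G : mfd T E) (H : mfd T' F) (f : T -> T') : Prop :=
  smooth_map G H f /\
  forall x y, carrier G x -> carrier G y -> f (x * y)%g = (f x * f y)%g.

End LieGroup.

Section Circle.
Context (R : realType).

Definition circle := {z : R[i] | `|z| == 1}.

HB.instance Definition _ := Choice.on circle.

Implicit Types u v w : circle.

Fact circle1_proof : `|1 : R[i]| == 1. Proof. by rewrite normr1. Qed.
Fact circleM_proof u v : `|val u * val v| == 1.
Proof. by rewrite normrM (eqP (valP u)) (eqP (valP v)) mulr1. Qed.
Fact circleV_proof u : `|(val u)^-1| == 1.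
Proof. by rewrite normfV (eqP (valP u)) invr1. Qed.

Definition circle1 : circle := exist (fun z => `|z| == 1) _ circle1_proof.
Definition circleM u v : circle :=
  exist (fun z => `|z| == 1) _ (circleM_proof u v).
Definition circleV u : circle := exist (fun z => `|z| == 1) _ (circleV_proof u).

Fact circle_neq0 u : val u != 0.
Proof. by rewrite -normr_eq0 (eqP (valP u)) oner_neq0. Qed.

Fact circleMA : associative circleM.
Proof. by move=> u v w; apply: val_inj; rewrite /= mulrA. Qed.
Fact circle1M : left_id circle1 circleM.
Proof. by move=> u; apply: val_inj; rewrite /= mul1r. Qed.
Fact circleM1 : right_id circle1 circleM.
Proof. by move=> u; apply: val_inj; rewrite /= mulr1. Qed.
Fact circleVM : left_inverse circle1 circleV circleM.
Proof. by move=> u; apply: val_inj; rewrite /= mulVf ?circle_neq0. Qed.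
Fact circleMV : right_inverse circle1 circleV circleM.
Proof. by move=> u; apply: val_inj; rewrite /= mulfV ?circle_neq0. Qed.

HB.instance Definition _ :=
  isGroup.Build circle circleMA circle1M circleM1 circleVM circleMV.

(** The charts are the angle functions on the arcs [(a - pi, a + pi)]. *)
Definition U1 : mfd circle (@line R) :=
  @Mfd R circle line setT
    [set c : chart circle line | exists a : R,
      cdom c = [set u | exists2 s : R, a - pi < s < a + pi &
                          val u = (cos s +i* sin s)%C] /\
      forall (u : circle) (s : R), a - pi < s < a + pi ->
        val u = (cos s +i* sin s)%C -> cmap c u = s].

End Circle.

Section CentralExtension.
Context {R : realType}.

Definition local_triv (T T' : groupType) (F E : frechetModel R)
    (H : mfd T F) (Ht : mfd T' E) (i : circle R -> T') (p : T' -> T)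
    (W : set T) (Th : T * circle R -> T') : Prop :=
  [/\ mopen H W,
      diffeo (restrictMfd (prodMfd H (U1 R)) (W `*` setT))
             (restrictMfd Ht (p @^-1` W)) Th,
      forall w z, W w -> p (Th (w, z)) = w &
      forall w z z', W w -> Th (w, (z * z')%g) = (Th (w, z) * i z')%g].

Record central_extension (T T' : groupType) (F E : frechetModel R)
    (H : mfd T F) (Ht : mfd T' E) (i : circle R -> T') (p : T' -> T) : Prop := {
  cext_base : is_lie H;
  cext_total : is_lie Ht;
  cext_incl : lie_hom (U1 R) Ht i;
  cext_proj : lie_hom Ht H p;
  cext_inj : injective i;
  cext_exact : forall x, carrier Ht x -> (p x = 1%g <-> exists z, x = i z);
  cext_surj : forall y, carrier H y -> exists2 x, carrier Ht x & p x = y;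
  cext_central : forall z x, carrier Ht x -> (i z * x = x * i z)%g;
  cext_bundle : forall y, carrier H y ->
    exists W Th, W y /\ local_triv H Ht i p W Th }.

(** The restriction of a central extension of [H] to a Lie subgroup [K], with
    its structure of (pulled back) principal bundle over [K]: if [Th] is a
    local trivialisation of the extension, the point [Th (w, z)] with [w] in
    [K] has coordinates those of [w] in a chart of [K] and of [z] in a chart
    of U(1). *)
Definition tildeMfd (T T' : groupType) (F E F' : frechetModel R)
    (H : mfd T F) (Ht : mfd T' E) (i : circle R -> T') (p : T' -> T)
    (K : mfd T F') : mfd T' (prodModel F' line) :=
  @Mfd R T' (prodModel F' line)
    (carrier Ht `&` p @^-1` carrier K)
    [set c : chart T' (prodModel F' line) | exists W Th d a,
      [/\ local_triv H Ht i p W Th, atlas K d, atlas (U1 R) a,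
          cdom c = Th @` ((W `&` cdom d) `*` cdom a) &
          forall w z, W w -> cdom d w -> cdom a z ->
            cmap c (Th (w, z)) = (cmap d w, cmap a z)]].

End CentralExtension.

Section CrossedModule.
Context {R : realType}.

Record crossed_module (T T' : groupType) (E F : frechetModel R)
    (H : mfd T E) (K : mfd T' F) (t : T -> T') (alpha : T' -> T -> T) : Prop := {
  cm_source : is_lie H;
  cm_target : is_lie K;
  cm_hom : lie_hom H K t;
  cm_smooth : smooth_map (prodMfd K H) H (fun x => alpha x.1 x.2);
  cm_act1 : forall h, carrier H h -> alpha 1%g h = h;
  cm_actM : forall g g' h, carrier K g -> carrier K g' -> carrier H h ->
    alpha (g * g')%g h = alpha g (alpha g' h);
  cm_autM : forall g h h', carrier K g -> carrier H h -> carrier H h' ->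
    alpha g (h * h')%g = (alpha g h * alpha g h')%g;
  cm_equivariant : forall g h, carrier K g -> carrier H h ->
    t (alpha g h) = (g * t h * g^-1)%g;
  cm_peiffer : forall h k, carrier H h -> carrier H k ->
    alpha (t h) k = (h * k * h^-1)%g }.

Definition central_crossed_module (T T' : groupType) (E F : frechetModel R)
    (H : mfd T E) (K : mfd T' F) (t : T -> T') (alpha : T' -> T -> T) : Prop :=
  crossed_module H K t alpha /\
  forall g h, carrier K g -> carrier H h -> t h = 1%g -> alpha g h = h.

End CrossedModule.

Section FunGroup.
Context (S : Type) (T : groupType).

Definition fun1 : S -> T := fun=> 1%g.
Definition funM (f g : S -> T) : S -> T := fun s => (f s * g s)%g.
Definition funV (f : S -> T) : S -> T := fun s => ((f s)^-1)%g.

Fact funMA : associative funM.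
Proof. by move=> f g h; apply/funext => s; rewrite /funM mulgA. Qed.
Fact fun1M : left_id fun1 funM.
Proof. by move=> f; apply/funext => s; rewrite /funM /fun1 mul1g. Qed.
Fact funM1 : right_id fun1 funM.
Proof. by move=> f; apply/funext => s; rewrite /funM /fun1 mulg1. Qed.
Fact funVM : left_inverse fun1 funV funM.
Proof. by move=> f; apply/funext => s; rewrite /funM /funV /fun1 mulVg. Qed.
Fact funMV : right_inverse fun1 funV funM.
Proof. by move=> f; apply/funext => s; rewrite /funM /funV /fun1 mulgV. Qed.

HB.instance Definition _ :=
  isGroup.Build (S -> T) funMA fun1M funM1 funVM funMV.

End FunGroup.

(** The circle S^1 = R / 2 pi Z is handled through its universal cover: loops
    are 2 pi-periodic functions on R, subsets of S^1 are 2 pi-periodic sets.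
    A path on [0, pi] is a function on R that is constant on (-oo, 0] and on
    [pi, +oo), so that it is determined by its values on [0, pi]. *)

Section Curves.
Context {R : realType}.

(** [eta] is a smooth extension of [gam : A -> M] to a neighbourhood of [s]. *)
Definition local_extension (T : Type) (n : nat) (M : mfd T (eucl n))
    (A : set R) (gam : R -> T) (s e : R) (eta : R -> T) : Prop :=
  [/\ 0 < e,
      smooth_map (restrictMfd (vecMfd (@line R)) `]s - e, s + e[) M eta &
      forall u, A u -> s - e < u < s + e -> eta u = gam u].

Definition smooth_on (T : Type) (n : nat) (M : mfd T (eucl n))
    (A : set R) (gam : R -> T) : Prop :=
  forall s, A s -> exists e eta, local_extension M A gam s e eta.

(** On an interval [A] that is not a point the derivatives at [s] do not depend
    on the extension [eta], nor does their vanishing depend on the chart. *)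
Definition flat_at (T : Type) (n : nat) (M : mfd T (eucl n))
    (A : set R) (gam : R -> T) (s : R) : Prop :=
  forall e eta c, local_extension M A gam s e eta ->
    atlas M c -> cdom c (gam s) ->
    forall k, (0 < k)%N -> derive1n k (fun u => cmap c (eta u) : 'rV[R]_n) s = 0.

Definition loops (T : Type) (n : nat) (M : mfd T (eucl n)) (x0 : T) :
    set (R -> T) :=
  [set gam | [/\ forall s, gam (s + 2 * pi) = gam s,
                 smooth_on M setT gam, gam 0 = x0 &
                 flat_at M setT gam 0]].

Definition loops_in (T : Type) (n : nat) (M : mfd T (eucl n)) (x0 : T)
    (I : set R) : set (R -> T) :=
  [set gam | loops M x0 gam /\ forall s, ~ I s -> gam s = x0].

Definition clamp (s : R) : R := Num.max 0 (Num.min s pi).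

Definition paths (T : Type) (n : nat) (M : mfd T (eucl n)) (x0 : T) :
    set (R -> T) :=
  [set gam | [/\ forall s, gam s = gam (clamp s),
                 smooth_on M `[0, pi] gam, gam 0 = x0,
                 flat_at M `[0, pi] gam 0 &
                 flat_at M `[0, pi] gam pi]].

(** A space of functions into R^n with the C^oo topology: the seminorms are
    the suprema over [(a, b)] of the norms of the derivatives. *)
Definition curveModel (n : nat) (C : set (R -> 'rV[R]_n)) (a b : R) :
    frechetModel R :=
  @FrechetModel R (R -> 'rV[R]_n) C
    (fun k xi => sup [set `|derive1n k xi s| | s in `]a, b[]).

(** The group [C] of functions into a Lie group [G], modelled on the space [D]
    of functions into R^n: around each [g] in [C] a chart is given by
    [gam |-> phi (g^-1 gam) - phi 1], with [phi] a chart of [G] at 1. *)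
Definition curveGroup (T : groupType) (n : nat) (G : mfd T (@eucl R n))
    (C : set (R -> T)) (D : set (R -> 'rV[R]_n)) (a b : R) :
    mfd (R -> T) (curveModel D a b) :=
  @Mfd R (R -> T) (curveModel D a b) C
    [set c | exists phi g,
      [/\ atlas G phi, cdom phi 1%g, C g &
          c = @Chart R _ (curveModel D a b)
            [set gam | C gam /\ forall s, cdom phi ((g s)^-1 * gam s)%g]
            (fun gam s => cmap phi ((g s)^-1 * gam s)%g - cmap phi 1%g)]].

Definition Omega (T : groupType) (n : nat) (G : mfd T (eucl n)) :=
  curveGroup G (loops G 1%g) (loops (vecMfd (eucl n)) 0) 0 (2 * pi).

Definition OmegaIn (T : groupType) (n : nat) (G : mfd T (eucl n)) (I : set R) :=
  curveGroup G (loops_in G 1%g I) (loops_in (vecMfd (eucl n)) 0 I) 0 (2 * pi).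

Definition PathGroup (T : groupType) (n : nat) (G : mfd T (eucl n)) :=
  curveGroup G (paths G 1%g) (paths (vecMfd (eucl n)) 0) 0 pi.

Definition periodic_set (I : set R) : Prop :=
  forall s, I (s + 2 * pi) <-> I s.

(** The image in S^1 of the open interval (0, pi). *)
Definition upper_arc : set R :=
  [set s | exists k : int, 0 < s + k%:~R * (2 * pi) < pi].

(** The representative of [s] in [0, 2 pi). *)
Definition mod2pi (s : R) : R := s - (Num.floor (s / (2 * pi)))%:~R * (2 * pi).

Definition cup (T : Type) (g1 g2 : R -> T) : R -> T :=
  fun s => if mod2pi s <= pi then g1 (mod2pi s) else g2 (2 * pi - mod2pi s).

End Curves.

Section Semisimple.
Context {R : realType} (T : groupType) (n : nat) (G : mfd T (@eucl R n)).
Implicit Types (c : chart T (@eucl R n)) (u v : 'rV[R]_n).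

(** The curve through 1 that is [t |-> c(1) + t u] in the chart [c]. *)
Definition chart_line c u (t : R) : T :=
  xget 1%g [set x | cdom c x /\ cmap c x = cmap c 1%g + t *: u].

(** The bracket [u, v] = d/dt d/ds a(t) b(s) a(t)^-1 (the differential of Ad)
    on the tangent space at 1, identified with R^n by the chart [c]. *)
Definition lie_bracket c u v : 'rV[R]_n :=
  derive1 (fun t : R => derive1 (fun s : R =>
     cmap c (chart_line c u t * chart_line c v s * (chart_line c u t)^-1)%g
       : 'rV[R]_n) 0) 0.

Definition lie_ideal c (I : {vspace 'rV[R]_n}) : Prop :=
  forall u v, v \in I -> lie_bracket c u v \in I.

Definition derived_algebra c (I : {vspace 'rV[R]_n}) : {vspace 'rV[R]_n} :=
  <<[seq lie_bracket c u v | u <- vbasis I, v <- vbasis I]>>%VS.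

Definition lie_solvable c (I : {vspace 'rV[R]_n}) : Prop :=
  exists k, iter k (derived_algebra c) I = 0%VS.

Definition semisimple : Prop :=
  forall c, atlas G c -> cdom c 1%g ->
    forall I, lie_ideal c I -> lie_solvable c I -> I = 0%VS.

End Semisimple.

Section Main.
Context {R : realType} (T T' : groupType) (n : nat) (G : mfd T (@eucl R n))
  (E : frechetModel R) (Ht : mfd T' E) (i : circle R -> T')
  (p : T' -> (R -> T)).

Definition disjoint_commutative : Prop :=
  forall I J : set R, periodic_set I -> periodic_set J -> I `&` J = set0 ->
    forall x y, carrier Ht x -> carrier Ht y ->
      carrier (OmegaIn G I) (p x) -> carrier (OmegaIn G J) (p y) ->
      (x * y = y * x)%g.

Definition tildeOmegaUpper :=
  tildeMfd (Omega G) Ht i p (OmegaIn G upper_arc).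

Definition restrict_path (x : T') : R -> T := fun s => p x (clamp s).

Definition canonical_action (gam : R -> T) (x : T') : T' :=
  let l := xget 1%g [set l | carrier Ht l /\ p l = cup gam gam] in
  (l * x * l^-1)%g.

(** The canonical action does not depend on the chosen lift. *)
Lemma canonical_actionE (gam : R -> T) (x l : T') :
  central_extension (Omega G) Ht i p -> carrier Ht x ->
  carrier Ht l -> p l = cup gam gam ->
  canonical_action gam x = (l * x * l^-1)%g.
Proof.
move=> ce Hx Hl pl; rewrite /canonical_action.
set P := [set l0 | _]; have [Hm pm] : P (xget 1%g P) by apply: xgetPex; exists l.
set m := xget _ _ in Hm pm *.
have [_ pM] := cext_proj ce; have [_ H1 HM HV _ _] := cext_total ce.
have p1 : p 1%g = 1%g.
  by apply: (@mulgI _ (p 1%g)); rewrite -pM // !mulg1.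
have plm : p (l^-1 * m)%g = 1%g.
  rewrite pM//; last exact: HV.
  by rewrite pm -pl -pM ?mulVg//; exact: HV.
have [z zE] := (cext_exact ce (HM _ _ (HV _ Hl) Hm)).1 plm.
have -> : m = (l * i z)%g by rewrite -zE mulgA mulgV mul1g.
by rewrite -(mulgA l) (cext_central ce z Hx) invgM !mulgA mulgK.
Qed.

End Main.

(* Main.v *)
From HB Require Import structures.
Require Import Defs.
From mathcomp Require Import all_boot all_order all_algebra.
From mathcomp Require Import complex.
From mathcomp Require Import all_classical all_reals all_analysis.
From mathcomp Require Import ring lra zify.

Set Implicit Arguments.
Unset Strict Implicit.
Unset Printing Implicit Defensive.

Import Order.TTheory GRing.Theory Num.Theory.
Import numFieldNormedType.Exports.

Local Open Scope classical_set_scope.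
Local Open Scope ring_scope.

(** The two nontrivial points of the crossed module are the Peiffer identity
    and the smoothness of [alpha].  If [x] lies over a loop [om] supported in
    (0, pi), then [cup (t x) (t x)] is the product of [om] and of its mirror
    image, and a lift of the mirror image commutes with everything over
    (0, pi) by disjoint commutativity.  For smoothness, the loops supported in
    (0, pi) and, through [gam |-> cup gam gam], the paths are closed
    submanifolds of [Omega G], so that everything is checked there, with local
    sections of the extension.

    Two actions [alpha] and [beta] differ by a map [chi] to the circle,
    [beta g x = i (chi g x) * alpha g x].  Near 1 it is multiplicative in the
    loop under [x] and then, the loop being fixed, in [g].  The derivative at 1
    of such a local character kills the brackets [(f u) *: [v, w]] of
    [(f u) *: v] and [(h u) *: w], where [h = 1] on the support of [f].  A
    semisimple Lie algebra is perfect, so the derivative vanishes on curves with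
    a plateau; loops are limits of curves supported away from 0 and pi, and for
    paths it also vanishes on curves with endpoint 0 because [chi] is trivial on
    closed paths.  Hence [chi] is trivial near 1.  As [chi g x] depends only on
    the endpoint of [g], it is trivial since [G] is connected.

    Perfectness is Cartan's criterion: an ideal orthogonal to everything for
    the Killing form is solvable, because [ad x] is nilpotent for [x] in its
    stable derived ideal ([tr (ad x * A)] is the sum of the squared moduli of
    the eigenvalues of [ad x] for the derivation [A] with the conjugate
    eigenvalues), and Engel's theorem applies.  So the Killing form is
    nondegenerate, and a vector orthogonal to all brackets is central. *)

(** * Semisimple Lie algebras are perfect *)

(** The obstacle to uniqueness is that multiplicativity of [chi] in the path is not given. There
    [chi] is a crossed homomorphism: [chi (g * g') x] is the product of [chi g' x] and
    [chi g (alpha g' x)]. To replace [alpha g' x] by [x], the two must differ by an element on which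
    every [chi g] is trivial. Hence the neighbourhood on which the loop characters are trivial has
    to be the same for all [g], which is why the vanishing derivative is integrated along rays of
    one fixed chart ball. Triviality on loops is obtained near the unit only, as the loop group may
    be disconnected; the passage to all [x] goes through paths, where the Peiffer identity leaves
    only end points. On the algebraic side, semisimplicity says that solvable ideals vanish, and the
    bracket is an iterated derivative of conjugation. Bilinearity and the Leibniz identity come from
    differentiating identities for conjugation; antisymmetry is then deduced from semisimplicity.
    The conjugate eigenvalues make complexification necessary, while the Killing form stays real. *)

Section Engel.
Context {F : fieldType} {n' : nat}.
Local Notation n := n'.+1.
Implicit Types (h g : {vspace 'M[F]_n}) (s u v : seq 'M[F]_n) (y : 'M[F]_n).

Definition word s : 'M[F]_n := \prod_(a <- s) a.

(** The conclusion of Engel's theorem without a flag: the associative algebra generated by [h],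
    without unit, is nilpotent. *)
Definition nil_words h N := forall s, {subset s <= h} -> (N <= size s)%N -> word s = 0.

Definition commutator_closed h := forall a b, a \in h -> b \in h -> a * b - b * a \in h.

Lemma word_cons a s : word (a :: s) = a * word s.
Proof. by rewrite /word big_cons. Qed.

Lemma word_cat s u : word (s ++ u) = word s * word u.
Proof. by rewrite /word big_cat. Qed.

Lemma word_rcons s a : word (rcons s a) = word s * a.
Proof. by rewrite -cats1 word_cat /word big_seq1. Qed.

(* A bracket with an element of [h] lengthens the words around [y]. *)
Lemma engel_normalizer h g N : nil_words h N -> (h <= g)%VS -> commutator_closed g -> h != g ->
  exists2 y, y \in g & (y \notin h) && `[< forall a, a \in h -> a * y - y * a \in h >].
Proof.
move=> hN hg cg hne.
have [y0 y0g y0h] : exists2 y, y \in g & y \notin h.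
  apply: contrapT => H; move/negP: hne; apply; rewrite eqEsubv hg /=.
  by apply/subvP => y yg; apply: contrapT => /negP yh; apply: H; exists y.
apply: contrapT => H.
have step y : y \in g -> y \notin h -> exists2 a, a \in h & a * y - y * a \notin h.
  move=> yg yh; apply: contrapT => H'; apply: H; exists y => //; rewrite yh.
  by apply/asboolP => a ah; apply: contrapT => /negP K; apply: H'; exists a.
(* Invariant: words around [y] of total length at least [N + N - j] kill it. For [j = 0] one of the
   two words has length at least [N]; for [j = N + N] both may be empty, so [y = 0], which lies in
   [h]. *)
have key j : exists y, [/\ y \in g, y \notin h & forall s u, {subset s <= h} -> {subset u <= h} ->
    (N + N - j <= size s + size u)%N -> word s * y * word u = 0].
  elim: j => [|j [y [yg yh IH]]].
    exists y0; split=> // s u sh uh; rewrite subn0 => su.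
    have [sN|sN] := leqP N (size s); first by rewrite hN// !mul0r.
    by rewrite [X in _ * X]hN ?mulr0//; lia.
  have [a ah ayh] := step y yg yh; exists (a * y - y * a); split=> //.
    by apply: cg => //; apply: (subvP hg).
  move=> s u sh uh su.
  have sa : {subset rcons s a <= h} by move=> b; rewrite mem_rcons inE => /predU1P[->|/sh].
  have ua : {subset a :: u <= h} by move=> b; rewrite inE => /predU1P[->|/uh].
  rewrite mulrBr mulrBl.
  have -> : word s * (a * y) * word u = word (rcons s a) * y * word u.
    by rewrite word_rcons !mulrA.
  have -> : word s * (y * a) * word u = word s * y * word (a :: u).
    by rewrite word_cons !mulrA.
  by rewrite !IH ?subrr// ?size_rcons /=; lia.
have [y [yg yh /(_ [::] [::])]] := key (N + N)%N.
rewrite subnn /word !big_nil mul1r mulr1 => y00.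
by move: yh; rewrite y00 ?mem0v.
Qed.

(** Right multiplication by [y] preserves the space of matrices killed by all words of length at
    least [k] in [h], because [y] normalizes [h]. Modulo this space a word acts on the next larger
    one through a power of [y]; so [m] letters lower [k] by one. *)
Lemma engel_extend h N y m : nil_words h N -> y ^+ m = 0 ->
  (forall a, a \in h -> a * y - y * a \in h) ->
  nil_words (h + <[y]>)%VS (m * N)%N.
Proof.
move=> hN ym hy.
pose V k (X : 'M[F]_n) := forall s, {subset s <= h} -> (k <= size s)%N -> X * word s = 0.
have Vadd k a X Y : V k X -> V k Y -> V k (a *: X + Y).
  by move=> hX hY s sh sk; rewrite mulrDl -scalerAl hX// hY// scaler0 addr0.
have V0 k : V k 0 by move=> s _ _; rewrite mul0r.
have Vh k X a : V k.+1 X -> a \in h -> V k (X * a).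
  move=> hX ah s sh sk; rewrite -mulrA -word_cons; apply: hX => //.
  by move=> b; rewrite inE => /predU1P[->|/sh].
have Vy k X : V k X -> V k (X * y).
  elim: k X => [|k IH] X hX.
    have -> : X = 0 by have := hX [::]; rewrite /word big_nil mulr1; apply.
    by rewrite mul0r.
  case=> [//|a s] sh sk; rewrite word_cons.
  have ah : a \in h by apply: sh; rewrite inE eqxx.
  have sh' : {subset s <= h} by move=> b bs; apply: sh; rewrite inE bs orbT.
  have -> : X * y * (a * word s) = X * a * y * word s - X * (a * y - y * a) * word s.
    by rewrite mulrBr mulrBl !mulrA opprB addrC subrK.
  rewrite (IH (X * a)) ?(Vh k) ?subr0 ?hy//.
  by apply: Vh.
have VS k X : V k X -> V k.+1 X by move=> hX s sh sk; apply: hX => //; exact: ltnW.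
(* Modulo [V k] only the [y] components of the letters survive: a letter from [h] sends [V k.+1]
   into [V k]. *)
have Vw k X s : V k.+1 X -> {subset s <= (h + <[y]>)%VS} ->
    exists a, V k (X * word s - a *: (X * y ^+ size s)).
  move=> hX; elim/last_ind: s => [|s b IH] sh.
    exists 1; rewrite /word big_nil expr0 scale1r subrr; exact: V0.
  have [a Ha] : exists a, V k (X * word s - a *: (X * y ^+ size s)).
    by apply: IH => c cs; apply: sh; rewrite mem_rcons inE cs orbT.
  have /memv_addP[b1 b1h [b2 /vlineP[c ->] bE]] : b \in (h + <[y]>)%VS.
    by apply: sh; rewrite mem_rcons inE eqxx.
  have Hs : V k.+1 (X * word s).
    have -> : X * word s = 1 *: (X * word s - a *: (X * y ^+ size s)) + a *: (X * y ^+ size s).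
      by rewrite scale1r subrK.
    apply: (Vadd); first exact: VS.
    rewrite -[_ *: _]addr0; apply: (Vadd) => //.
    by elim: (size s) => [|j IHj]; [rewrite expr0 mulr1|rewrite exprSr mulrA; exact: Vy].
  exists (c * a); rewrite word_rcons size_rcons bE exprSr.
  have -> : X * (word s * (b1 + c *: y)) - (c * a) *: (X * (y ^+ size s * y)) =
      c *: ((X * word s - a *: (X * y ^+ size s)) * y) + (X * word s) * b1.
    rewrite mulrBl scalerBr -!scalerAl scalerA !mulrDr -!scalerAr !mulrA addrAC.
    by rewrite [LHS](ACl (3*2*1)).
  apply: (Vadd); first exact: Vy.
  exact: Vh.
have main k s : {subset s <= (h + <[y]>)%VS} -> (m * k <= size s)%N -> forall X, V k X ->
    X * word s = 0.
  elim: k s => [|k IH] s sh sk X hX.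
    have -> : X = 0 by have := hX [::]; rewrite /word big_nil mulr1; apply.
    by rewrite mul0r.
  rewrite -(cat_take_drop m s) word_cat mulrA; apply: IH.
  - by move=> b /mem_drop; exact: sh.
  - by rewrite size_drop; lia.
  have [|a] := Vw k X (take m s) hX; first by move=> b /mem_take; exact: sh.
  rewrite size_takel; last by lia.
  by rewrite ym mulr0 scaler0 subr0.
move=> s sh sN; rewrite -[word s]mul1r; apply: (main N) => //.
by move=> u uh uN; rewrite mul1r hN.
Qed.

(** A subalgebra with vanishing long words is enlarged by one normalizing vector at a time, starting
    from 0; the dimension of [g] bounds the process. *)
Lemma engel g : commutator_closed g -> (forall a, a \in g -> exists m, a ^+ m = 0) ->
  exists N, nil_words g N.
Proof.
move=> cg ng.
suff key k : exists h N, [/\ (h <= g)%VS, commutator_closed h, nil_words h N &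
    h = g \/ (k <= \dim h)%N].
  have [h [N [hg _ hN hk]]] := key (\dim g).+1; exists N.
  by case: hk => [<-//|]; rewrite ltnNge dimvS.
elim: k => [|k [h [N [hg ch hN hk]]]].
  exists 0%VS, 1%N; split; last by right.
  - exact: sub0v.
  - by move=> a b; rewrite !memv0 => /eqP-> _; rewrite mul0r mulr0 subrr.
  case=> // a s sh _; have := sh a (mem_head _ _); rewrite memv0 => /eqP->.
  by rewrite word_cons mul0r.
case: hk => [e|hk]; first by exists h, N; split=> //; left.
have [e|hne] := eqVneq h g; first by exists h, N; split=> //; left.
have [y yg /andP[yh /asboolP hy]] := engel_normalizer hN hg cg hne.
have [m ym] := ng y yg.
exists (h + <[y]>)%VS, (m * N)%N; split.
- by rewrite subv_add hg -memvE.
- move=> a b /memv_addP[a1 a1h [a2 /vlineP[c ->] ->]] /memv_addP[b1 b1h [b2 /vlineP[d ->] ->]].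
  have -> : (a1 + c *: y) * (b1 + d *: y) - (b1 + d *: y) * (a1 + c *: y) =
     (a1 * b1 - b1 * a1) + d *: (a1 * y - y * a1) - c *: (b1 * y - y * b1).
    rewrite !mulrDl !mulrDr -!scalerAl -!scalerAr !scalerBr !scalerA [d * c]mulrC.
    by rewrite !opprD !opprK [LHS](AC ((2*2)*(2*2)) (((1*5)*(2*7)*(6*3))*(4*8)))/= subrr addr0.
  by apply: (subvP (addvSl _ _)); apply: memvB; [apply: memvD; [exact: ch|apply: memvZ; exact: hy]|apply: memvZ; exact: hy].
- exact: engel_extend.
right; rewrite dimv_disjoint_sum ?dim_vline.
  by rewrite (_ : y != 0) ?addn1//; apply: contra yh => /eqP->; exact: mem0v.
apply/eqP; rewrite -subv0; apply/subvP => z; rewrite memv_cap => /andP[zh /vlineP[c zE]].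
rewrite memv0 zE; have [->|c0] := eqVneq c 0; first by rewrite scale0r.
by move: yh; rewrite -[y](scalerK c0) -zE memvZ.
Qed.

End Engel.

Section Triangular.
Context {F : comNzRingType} {n' : nat}.
Local Notation n := n'.+1.
Implicit Types A B : 'M[F]_n.

Lemma trigM A B : is_trig_mx A -> is_trig_mx B ->
  is_trig_mx (A * B) /\ forall i, (A * B) i i = A i i * B i i.
Proof.
move=> /is_trig_mxP hA /is_trig_mxP hB; split.
  apply/is_trig_mxP => i j ij; rewrite mxE big1// => k _.
  have [ik|ki] := ltnP i k; first by rewrite hA// mul0r.
  by rewrite hB ?mulr0//; exact: leq_ltn_trans ij.
move=> i; rewrite mxE (bigD1 i)//= big1 ?addr0// => k ki.
have [ik|] := ltnP i k; first by rewrite hA// mul0r.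
rewrite leq_eqVlt => /orP[/eqP e|ik]; last by rewrite hB ?mulr0.
by move: ki; rewrite (val_inj e) eqxx.
Qed.

Lemma trig_horner A (q : {poly F}) : is_trig_mx A ->
  is_trig_mx (horner_mx A q) /\ forall i, (horner_mx A q) i i = q.[A i i].
Proof.
move=> hA; elim/poly_ind: q => [|q c [IH1 IH2]].
  by rewrite rmorph0; split=> [|i]; rewrite ?mx0_is_trig// mxE horner0.
have [h1 h2] := trigM IH1 hA.
rewrite rmorphD rmorphM /= horner_mx_X horner_mx_C; split=> [|i].
  apply/is_trig_mxP => i j ij; move/is_trig_mxP: h1 => h1; rewrite mxE h1// add0r mxE.
  by rewrite -val_eqE (ltn_eqF ij).
by rewrite mxE h2 IH2 mxE eqxx hornerMXaddC.
Qed.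

End Triangular.

(** * Derivations of a bilinear product with conjugate eigenvalues *)

Section ConjugateDerivation.
Context {C : numClosedFieldType} {n' : nat}.
Local Notation n := n'.+1.
Context (A : 'M[C]_n).

(** Chinese remainder theorem for coprime powers: Bezout between the new modulus and the product of
    the old ones corrects [q] without changing its old residues. It will be applied with complex
    conjugation as [f]. *)
Lemma conj_interpolation (s : seq C) (f : C -> C) k : uniq s ->
  exists q : {poly C}, forall t, t \in s -> ('X - t%:P) ^+ k %| q - (f t)%:P.
Proof.
elim: s => [|t s IH] /=; first by exists 0.
move=> /andP[ts /IH[q hq]].
pose P := \prod_(x <- s) ('X - x%:P) ^+ k.
have cop : coprimep P (('X - t%:P) ^+ k).
  rewrite /P big_seq; apply: (big_ind (fun r => coprimep r _)) => [|a b ha hb|x xs].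
  - exact: coprime1p.
  - by rewrite coprimepMl ha.
  apply: coprimep_expl; apply: coprimep_expr.
  by rewrite coprimep_XsubC root_XsubC; apply: contra ts => /eqP->.
have /Bezout_eq1_coprimepP[[u v] /= uv] := cop.
exists (q + u * P * ((f t)%:P - q)) => x; rewrite inE => /predU1P[->|xs].
  have -> : q + u * P * ((f t)%:P - q) - (f t)%:P = (q - (f t)%:P) * v * ('X - t%:P) ^+ k.
    have -> : u * P = 1 - v * ('X - t%:P) ^+ k by rewrite -uv addrK.
    by ring.
  exact: dvdp_mull.
have -> : q + u * P * ((f t)%:P - q) - (f x)%:P = (q - (f x)%:P) + (u * ((f t)%:P - q)) * P by ring.
rewrite dvdp_add ?hq// dvdp_mull// /P (big_rem x)//= dvdp_mulr//.
Qed.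

Definition gen_eigenvector (t : C) k (u : 'rV[C]_n) := u *m (A - t%:M) ^+ k = 0.

Lemma horner_gen_eigenvector t k u (q : {poly C}) c : gen_eigenvector t k u ->
  ('X - t%:P) ^+ k %| q - c%:P -> u *m horner_mx A q = c *: u.
Proof.
move=> hu /dvdpP[r e].
have -> : q = c%:P + ('X - t%:P) ^+ k * r by rewrite mulrC -e addrC subrK.
rewrite rmorphD rmorphM rmorphXn rmorphB /= horner_mx_X !horner_mx_C.
by rewrite mulmxDr mul_mx_scalar mulmxA hu mul0mx addr0.
Qed.

(** The decomposition into generalized eigenspaces as an induction principle, so that no basis has
    to be chosen. The exponent [n] serves every root because multiplicities are bounded by the
    degree of the characteristic polynomial. *)
Lemma gen_eigenvector_span : exists s : seq C, uniq s /\ forall Q : 'rV[C]_n -> Prop,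
  Q 0 -> (forall u v, Q u -> Q v -> Q (u + v)) ->
  (forall t u, t \in s -> gen_eigenvector t n u -> Q u) -> forall u, Q u.
Proof.
have [rs cE] := closed_field_poly_normal (char_poly A).
rewrite (monicP (char_poly_monic A)) scale1r in cE.
have rsn : size rs = n.
  by have := size_char_poly A; rewrite cE size_prod_XsubC => -[].
exists (undup rs); split; first exact: undup_uniq.
move=> Q Q0 QD QE u.
pose p (i : 'I_(size (undup rs))) := ('X - ((undup rs)`_i)%:P) ^+ n.
have dv : mxminpoly A %| \prod_i p i.
  apply: (dvdp_trans (mxminpoly_dvd_char A)); rewrite cE -big_undup_iterop_count.
  rewrite (big_nth 0) big_mkord; apply: (big_ind2 (fun a b => a %| b)) => //.
    by move=> *; exact: dvdp_mul.
  move=> i _; rewrite /p; apply: (@dvdp_trans _ (('X - ((undup rs)`_i)%:P) ^+ (count_mem (undup rs)`_i rs))).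
    by rewrite /GRing.exp; case: count.
  by apply: dvdp_exp2l; rewrite -rsn count_size.
have := submx1 u; rewrite -(kermxpoly_min dv) kermxpoly_prod; last first.
  move=> i j _ _ ij; apply: coprimep_expl; apply: coprimep_expr.
  by rewrite coprimep_XsubC root_XsubC nth_uniq ?undup_uniq// eq_sym.
move=> /sub_sumsmxP[w ->]; apply: big_ind => // i _.
apply: (QE (undup rs)`_i); first exact: mem_nth.
have /sub_kermxP : (w i *m kermxpoly A (p i) <= kermxpoly A (p i))%MS by exact: submxMl.
by rewrite /gen_eigenvector /p rmorphXn rmorphB /= horner_mx_X horner_mx_C.
Qed.

Context (m : 'rV[C]_n -> 'rV[C]_n -> 'rV[C]_n).
Hypothesis mDl : forall a u u' v, m (a *: u + u') v = a *: m u v + m u' v.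
Hypothesis mDr : forall a u v v', m u (a *: v + v') = a *: m u v + m u v'.
Hypothesis mA : forall u v, m u v *m A = m (u *m A) v + m u (v *m A).

Let m0l v : m 0 v = 0.
Proof. by have := mDl (-1) 0 0 v; rewrite scaler0 addr0 scaleN1r addNr. Qed.

Let m0r u : m u 0 = 0.
Proof. by have := mDr (-1) u 0 0; rewrite scaler0 addr0 scaleN1r addNr. Qed.

(** Since [A] is a derivation, [A - (s + t)] applied to [m u v] is the sum of the terms with [A - s]
    applied to [u] and with [A - t] applied to [v]. Each step lowers one of the two exponents, hence
    the induction on their sum. *)
Lemma gen_eigenvectorM s t k l u v : gen_eigenvector s k u -> gen_eigenvector t l v ->
  gen_eigenvector (s + t) (k + l) (m u v).
Proof.
have [N kl] : exists N, (k + l = N)%N by exists (k + l)%N.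
rewrite kl; elim: N k l kl u v => [|N IH] k l kl u v hu hv.
  have [k0 l0] : k = 0%N /\ l = 0%N by lia.
  move: hu; rewrite k0 /gen_eigenvector expr0 mulmx1 => ->.
  by rewrite m0l mul0mx.
have hm : m u v *m (A - (s + t)%:M) = m (u *m (A - s%:M)) v + m u (v *m (A - t%:M)).
  rewrite !mulmxBr !mul_mx_scalar mA.
  have -> : m (u *m A - s *: u) v = m (u *m A) v - s *: m u v.
    by rewrite -scaleNr addrC mDl addrC scaleNr.
  have -> : m u (v *m A - t *: v) = m u (v *m A) - t *: m u v.
    by rewrite -scaleNr addrC mDr addrC scaleNr.
  by rewrite scalerDl opprD addrACA.
have E r w j : gen_eigenvector r j.+1 w -> gen_eigenvector r j (w *m (A - r%:M)).
  by rewrite /gen_eigenvector exprS mulmxA.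
rewrite /gen_eigenvector exprS mulmxA hm mulmxDl.
case: k kl hu => [|k] kl hu.
  move: hu; rewrite /gen_eigenvector expr0 mulmx1 => ->.
  by rewrite mul0mx !m0l !mul0mx addr0.
case: l kl hv => [|l] kl hv.
  move: hv; rewrite /gen_eigenvector expr0 mulmx1 => ->.
  by rewrite mul0mx !m0r !mul0mx addr0.
rewrite (IH k l.+1) ?(IH k.+1 l) ?addr0//; try lia; exact: E.
Qed.

(* [D] acts by the conjugate of [t] on the generalized eigenspace of [t], so
   that the trace of [A D] is the sum of the squared moduli of the eigenvalues. *)
Lemma conjugate_derivation : exists D : 'M[C]_n,
  (forall u v, m u v *m D = m (u *m D) v + m u (v *m D)) /\
  (\tr (A *m D) = 0 -> A ^+ n = 0).
Proof.
have [s [us hs]] := gen_eigenvector_span.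
have [rs cE] := closed_field_poly_normal (char_poly A).
rewrite (monicP (char_poly_monic A)) scale1r in cE.
(* The nodes are the roots [rs], needed for the trace, the eigenvalues [s], and the sums of two of
   them, to which products of eigenvectors belong; for these the exponent is [n + n]. As conjugation
   is additive, [q(A)] obeys the Leibniz rule. *)
have [q hq] := conj_interpolation (fun z => z^*) (n + n)
  (undup_uniq (rs ++ s ++ [seq a + b | a <- s, b <- s])).
exists (horner_mx A q); split.
  apply: (hs) => [v|u1 u2 h1 h2 v|a u as_ hu].
  - by rewrite m0l !mul0mx m0l m0l addr0.
  - have mD1 x y z : m (x + y) z = m x z + m y z by have := mDl 1 x y z; rewrite !scale1r.
    by rewrite mD1 mulmxDl h1 h2 mulmxDl !mD1 addrACA.
  apply: (hs) => [|v1 v2 h1 h2|b v bs hv].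
  - by rewrite m0r !mul0mx !m0r addr0.
  - have mD1 x y z : m z (x + y) = m z x + m z y by have := mDr 1 z x y; rewrite !scale1r.
    by rewrite mD1 mulmxDl h1 h2 mulmxDl !mD1 addrACA.
  have hE r w : r \in s -> gen_eigenvector r n w -> w *m horner_mx A q = r^* *: w.
    move=> rs' hw; apply: (@horner_gen_eigenvector r (n + n)).
      by rewrite /gen_eigenvector exprD mulmxA hw mul0mx.
    by apply: hq; rewrite mem_undup !mem_cat rs' orbT.
  rewrite (hE a u)// (hE b v)// (horner_gen_eigenvector (gen_eigenvectorM hu hv) (c := (a + b)^*)).
    have -> : m (a^* *: u) v = a^* *: m u v by rewrite -[X in m X]addr0 mDl m0l addr0.
    have -> : m u (b^* *: v) = b^* *: m u v by rewrite -[X in m _ X]addr0 mDr m0r addr0.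
    by rewrite rmorphD scalerDl.
  by apply: hq; rewrite mem_undup !mem_cat allpairs_f ?orbT.
(* After unitary triangularization the diagonal of [T] consists of eigenvalues and that of [q(T)] of
   their conjugates. *)
have [P Pu] := Schur A (ltn0Sn n'); rewrite /similar_to conjumx ?unitarymx_unit// => Tt.
set T := P *m A *m invmx P in Tt.
have uP : P \in unitmx by exact: unitarymx_unit.
have [Ht Hd] := trig_horner q Tt; have [_ Hp] := trigM Tt Ht.
have Td i : q.[T i i] = (T i i)^*.
  have Trs : T i i \in rs.
    rewrite -root_prod_XsubC -cE /root -(trig_horner _ Tt).2 /T horner_mx_uconj//.
    by rewrite Cayley_Hamilton mulmx0 mul0mx mxE.
  have := hq (T i i); rewrite mem_undup mem_cat Trs => /(_ isT) /dvdpP[r e].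
  apply/eqP; rewrite -subr_eq0; have := congr1 (horner^~ (T i i)) e.
  by rewrite hornerD hornerN hornerC => ->; rewrite hornerM addnS exprS hornerM hornerXsubC subrr mul0r mulr0.
move=> tr0.
have : \tr (T *m horner_mx T q) = 0.
  rewrite horner_mx_uconj// /T -!mulmxA (mulmxA (invmx P)) mulVmx// mul1mx.
  by rewrite mxtrace_mulC -!mulmxA mulVmx// mulmx1.
rewrite /mxtrace (eq_bigr (fun i => `|T i i| ^+ 2)); last first.
  by move=> i _; rewrite Hp Hd Td normCK.
move=> /eqP; rewrite psumr_eq0; last by move=> i _; rewrite exprn_ge0.
move=> /allP T0; have {}T0 i : T i i = 0.
  by apply/eqP; have := T0 i (mem_index_enum _); rewrite sqrf_eq0 normr_eq0.
(* With zero diagonal the characteristic polynomial of the triangular [T] is a pure power of the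
   indeterminate. *)
have := Cayley_Hamilton T; rewrite char_poly_trig//.
under eq_bigr => i _ do rewrite T0 subr0.
rewrite prodr_const card_ord horner_mx_uconj// rmorphXn /= horner_mx_X => e.
have := congr1 (fun X => invmx P *m X *m P) e.
by rewrite /= mulmx0 mul0mx mulmxA mulmxKV// mulmxA mulVmx// mul1mx.
Qed.

End ConjugateDerivation.

(** * The Killing form, Cartan's criterion and perfectness *)

Section Perfect.
Context {R : rcfType} {n' : nat}.
Local Notation n := n'.+1.
Local Notation C := R[i].
Context (br : 'rV[R]_n -> 'rV[R]_n -> 'rV[R]_n).
Hypothesis brDl : forall a u u' v, br (a *: u + u') v = a *: br u v + br u' v.
Hypothesis brDr : forall a u v v', br u (a *: v + v') = a *: br u v + br u v'.
Hypothesis leibniz : forall u v w, br u (br v w) = br (br u v) w + br v (br u w).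
Implicit Types (I P : {vspace 'rV[R]_n}) (Q : 'rV[R]_n -> Prop).

Definition der I : {vspace 'rV[R]_n} := <<[seq br u v | u <- vbasis I, v <- vbasis I]>>%VS.
Definition is_ideal I := forall u v, v \in I -> br u v \in I.
Hypothesis semi : forall I, is_ideal I -> (exists k, iter k der I = 0%VS) -> I = 0%VS.

(** Subspaces as predicates: linear conditions such as the vanishing of a Killing product can be
    checked on spanning families without being turned into vector spaces. *)
Definition lin_closed Q := Q 0 /\ forall a u v, Q u -> Q v -> Q (a *: u + v).

Lemma br0l v : br 0 v = 0.
Proof. by have := brDl (-1) 0 0 v; rewrite scaler0 addr0 scaleN1r addNr. Qed.

Lemma br0r u : br u 0 = 0.
Proof. by have := brDr (-1) u 0 0; rewrite scaler0 addr0 scaleN1r addNr. Qed.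

Lemma lin_closed_span Q (X : seq 'rV[R]_n) : lin_closed Q -> (forall x, x \in X -> Q x) ->
  forall x, x \in <<X>>%VS -> Q x.
Proof.
move=> [Q0 QD] QX x /(@coord_span _ _ _ (in_tuple X)) ->.
apply: (big_ind Q) => // [u v hu hv|i _]; first by rewrite -[u]scale1r; exact: QD.
by rewrite -[_ *: _]addr0; apply: QD => //; apply: QX; exact: mem_nth.
Qed.

Lemma lin_closed_vbasis Q I : lin_closed Q -> (forall x, x \in (vbasis I : seq _) -> Q x) ->
  forall x, x \in I -> Q x.
Proof.
by move=> lQ h x xI; apply: (lin_closed_span lQ h); rewrite (span_basis (vbasisP I)).
Qed.

Lemma lin_closed_delta Q : lin_closed Q -> (forall i, Q (delta_mx 0 i)) -> forall v, Q v.
Proof.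
move=> [Q0 QD] h v; rewrite (row_sum_delta v); apply: (big_ind Q) => // [u w hu hw|i _].
  by rewrite -[u]scale1r; exact: QD.
by rewrite -[_ *: _]addr0; exact: QD.
Qed.

Lemma lin_closed_memv I : lin_closed (fun x => x \in I).
Proof. by split=> [|a u v uI vI]; rewrite ?mem0v// memvD ?memvZ. Qed.

Lemma lin_closed_brl Q v : lin_closed Q -> lin_closed (fun u => Q (br u v)).
Proof. by move=> [Q0 QD]; split=> [|a u u' h h']; rewrite ?br0l ?brDl//; exact: QD. Qed.

Lemma lin_closed_brr Q u : lin_closed Q -> lin_closed (fun v => Q (br u v)).
Proof. by move=> [Q0 QD]; split=> [|a v v' h h']; rewrite ?br0r ?brDr//; exact: QD. Qed.

Lemma der_elim Q I : lin_closed Q -> (forall u v, u \in I -> v \in I -> Q (br u v)) ->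
  forall x, x \in der I -> Q x.
Proof.
move=> lQ h; apply: lin_closed_span => // x /allpairsP[[u v] [/= uI vI ->]].
by apply: h; exact: vbasis_mem.
Qed.

Lemma mem_der I u v : u \in I -> v \in I -> br u v \in der I.
Proof.
move=> uI vI; have lQ := lin_closed_memv (der I).
apply: (lin_closed_vbasis (lin_closed_brl v lQ) _ uI) => x xb.
apply: (lin_closed_vbasis (lin_closed_brr x lQ) _ vI) => y yb.
by apply: memv_span; exact: allpairs_f.
Qed.

Lemma der_sub I : is_ideal I -> (der I <= I)%VS.
Proof.
move=> hI; apply/subvP; apply: der_elim; first exact: lin_closed_memv.
by move=> u v _ vI; exact: hI.
Qed.

Lemma der_ideal I : is_ideal I -> is_ideal (der I).
Proof.
move=> hI u v; move: v; apply: (der_elim (lin_closed_brr u (lin_closed_memv _))) => a b aI bI.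
by rewrite leibniz; apply: memvD; apply: mem_der => //; exact: hI.
Qed.

(** The derived series strictly loses dimension until it becomes stationary. *)
Lemma der_stable I : is_ideal I -> exists k, der (iter k der I) = iter k der I.
Proof.
move=> hI; have hk k : is_ideal (iter k der I) by elim: k => //= k; exact: der_ideal.
suff key d k : (\dim (iter k der I) < d)%N -> exists k', der (iter k' der I) = iter k' der I.
  exact: (key (\dim I).+1 0%N).
elim: d k => // d IH k kd.
have [e|ne] := eqVneq (der (iter k der I)) (iter k der I); first by exists k.
apply: (IH k.+1); rewrite -ltnS; apply: leq_trans kd; rewrite ltnS /=.
rewrite ltn_neqAle dimvS ?der_sub// andbT.
by rewrite (dimv_leqif_eq (der_sub (hk k))).2.
Qed.

(* The symmetrized brackets act trivially, so they span a solvable ideal. *)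
Lemma br_anti x y : br x y = - br y x.
Proof.
(* This is [leibniz] with equal first arguments, where [br z (br z w)] cancels. *)
have sq z w : br (br z z) w = 0.
  by apply: (@addIr _ (br z (br z w))); rewrite add0r -leibniz.
have bD a b c : br (a + b) c = br a c + br b c by have := brDl 1 a b c; rewrite !scale1r.
have bD' a b c : br c (a + b) = br c a + br c b by have := brDr 1 c a b; rewrite !scale1r.
have sw a b w : br (br a b + br b a) w = 0.
  by have := sq (a + b) w; rewrite !bD !bD' !bD !sq add0r addr0.
pose f (p : 'I_n * 'I_n) := br (delta_mx 0 p.1) (delta_mx 0 p.2) + br (delta_mx 0 p.2) (delta_mx 0 p.1).
pose L := <<codom f>>%VS.
have Lsym a b : br a b + br b a \in L.
  have lQ := lin_closed_memv L.
  have lc c : lin_closed (fun a => br a c + br c a \in L).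
    split=> [|r u v hu hv]; first by rewrite br0l br0r addr0 mem0v.
    by rewrite brDl brDr addrACA -scalerDr; apply: (proj2 lQ).
  move: a; apply: (lin_closed_delta (lc b)) => i; rewrite addrC; move: b.
  apply: (lin_closed_delta (lc _)) => j.
  by apply: memv_span; apply/codomP; exists (j, i).
have Lw z w : z \in L -> br z w = 0.
  have lQ : lin_closed (fun z => br z w = 0).
    by split=> [|r u v hu hv]; rewrite ?br0l// brDl hu hv scaler0 addr0.
  by apply: (lin_closed_span lQ) => ? /codomP[p ->]; exact: sw.
suff L0 : L = 0%VS by apply/eqP; rewrite -addr_eq0 -memv0 -L0; exact: Lsym.
apply: semi => [u z|].
  have lQ := lin_closed_brr u (lin_closed_memv L); move: z.
  apply: (@lin_closed_span (fun z => br u z \in L) (codom f) lQ) => _ /codomP[[a b] ->].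
  have sh c d : br u (br c d + br d c) =
      (br (br u c) d + br d (br u c)) + (br (br u d) c + br c (br u d)).
    by rewrite bD' (leibniz u c d) (leibniz u d c) [LHS](AC (2*2) ((1*4)*(3*2))).
  by rewrite sh; apply: memvD; exact: Lsym.
exists 1%N => /=; apply/eqP; rewrite -subv0; apply/subvP.
apply: der_elim; first exact: lin_closed_memv.
by move=> u v uL _; rewrite Lw// mem0v.
Qed.

Definition ad u : 'M[R]_n := \matrix_i br u (delta_mx 0 i).

Lemma adE u v : v *m ad u = br u v.
Proof.
rewrite mulmx_sum_row {2}(row_sum_delta v).
rewrite (eq_bigr (fun i => v 0 i *: br u (delta_mx 0 i))); last by move=> i _; rewrite rowK.
apply: (big_ind2 (fun a b => a = br u b)) => [|a b c d -> ->|i _]; first by rewrite br0r.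
  by have := brDr 1 u b d; rewrite !scale1r.
by rewrite -[v 0 i *: delta_mx 0 i]addr0 brDr br0r addr0.
Qed.

Lemma ad_inj (A B : 'M[R]_n) : (forall v : 'rV_n, v *m A = v *m B) -> A = B.
Proof. by move=> h; apply/row_matrixP => i; rewrite !rowE. Qed.

Lemma adD a u v : ad (a *: u + v) = a *: ad u + ad v.
Proof. by apply: ad_inj => w; rewrite mulmxDr -scalemxAr !adE brDl. Qed.

(** Matrices act on row vectors from the right, so composition is reversed and the arguments of the
    bracket are swapped. *)
Lemma adB u v : ad u *m ad v - ad v *m ad u = ad (br v u).
Proof.
by apply: ad_inj => w; rewrite mulmxBr !mulmxA !adE leibniz addrK.
Qed.

Local Notation cx := (map_mx (real_complex R)).

(** The complex linear extension of [ad]: [w *m adC z] is the bracket of the complexified Lie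
    algebra, where the eigenvalue argument takes place. *)
Definition adC (z : 'rV[C]_n) : 'M[C]_n := \sum_i z 0 i *: cx (ad (delta_mx 0 i)).

Lemma adCD a z w : adC (a *: z + w) = a *: adC z + adC w.
Proof.
rewrite /adC scaler_sumr -big_split; apply: eq_bigr => i _.
by rewrite !mxE scalerDl scalerA.
Qed.

Lemma adC_cx u : adC (cx u) = cx (ad u).
Proof.
rewrite {2}(row_sum_delta u) /adC.
apply: (big_ind2 (fun a b => a = cx (ad b))) => [|a b c d -> ->|i _].
- have -> : ad 0 = 0 by apply: ad_inj => w; rewrite adE br0l mulmx0.
  by rewrite map_mx0.
- by have := adD 1 b d; rewrite !scale1r => ->; rewrite map_mxD.
have -> : ad (u 0 i *: delta_mx 0 i) = u 0 i *: ad (delta_mx 0 i).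
  by apply: ad_inj => w; rewrite -scalemxAr !adE -[X in br X]addr0 brDl br0l addr0.
by rewrite mxE map_mxZ.
Qed.

(** In matrix form this says that the real [ad x] is a derivation of the complexified bracket, as
    [conjugate_derivation] requires. *)
Lemma adC_bracket x (z : 'rV[C]_n) : adC z *m cx (ad x) - cx (ad x) *m adC z = adC (z *m cx (ad x)).
Proof.
rewrite {3}(row_sum_delta z).
rewrite /(adC z) mulmx_suml mulmx_sumr -sumrB mulmx_suml.
have adC_sum (I : finType) (f : I -> 'rV[C]_n) : adC (\sum_i f i) = \sum_i adC (f i).
  apply: (big_morph adC) => [a b|]; first by have := adCD 1 a b; rewrite !scale1r.
  by rewrite /adC big1// => i _; rewrite mxE scale0r.
rewrite adC_sum; apply: eq_bigr => i _.
rewrite -scalemxAl -scalemxAr -scalerBr -!map_mxM -map_mxB adB.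
have -> : z 0 i *: delta_mx 0 i *m cx (ad x) = z 0 i *: cx (br x (delta_mx 0 i)) + 0.
  by rewrite -scalemxAl addr0 -adE map_mxM map_delta_mx.
rewrite adCD adC_cx; have -> : adC 0 = 0 by rewrite /adC big1// => j _; rewrite mxE scale0r.
by rewrite addr0.
Qed.

Definition killing u v := \tr (ad u *m ad v).

Lemma killing_inv u v w : killing (br u v) w = killing u (br v w).
Proof.
rewrite /killing -!adB mulmxBl mulmxBr !raddfB /= !mulmxA.
by rewrite -[ad v *m ad u *m ad w]mulmxA mxtrace_mulC.
Qed.

(** By linearity take [x = br a b] with [a] and [b] in [P]. Cyclicity of the trace leaves [ad a]
    against the commutator of [ad b] with the derivation [D], which is [adC] of a complex vector up
    to sign. The trace is thus a combination of Killing products of [a] with basis vectors, all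
    zero. *)
Lemma killing_nilpotent P x : (forall u v, u \in P -> killing u v = 0) ->
  x \in der P -> (ad x) ^+ n = 0.
Proof.
move=> kP xP.
have [|||D [hD tD]] := @conjugate_derivation _ _ (cx (ad x)) (fun z w : 'rV[C]_n => w *m adC z).
- by move=> a u u' v; rewrite adCD mulmxDr scalemxAr.
- by move=> a u v v'; rewrite mulmxDl scalemxAl.
- by move=> u v; rewrite -(adC_bracket x u) mulmxBr !mulmxA subrK.
have bD z : adC z *m D - D *m adC z = adC (z *m D).
  apply/row_matrixP => i; rewrite !rowE mulmxBr !mulmxA hD addrK//.
have tr0 : \tr (cx (ad x) *m D) = 0.
  move: x xP {hD tD}; apply: der_elim.
    split; first by have := adC_cx 0; rewrite map_mx0 => <-; rewrite /adC big1 ?mul0mx ?mxtrace0// => i _; rewrite mxE scale0r.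
    move=> a u v hu hv; rewrite adD map_mxD map_mxZ mulmxDl -scalemxAl.
    by rewrite mxtraceD mxtraceZ hu hv mulr0 addr0.
  move=> a b aP bP; rewrite -adB map_mxB !map_mxM mulmxBl raddfB /=.
  have -> : \tr (cx (ad b) *m cx (ad a) *m D) = \tr (cx (ad a) *m (D *m cx (ad b))).
    by rewrite -mulmxA mxtrace_mulC mulmxA.
  rewrite -mulmxA -raddfB /= -mulmxBr -opprB -!adC_cx bD mulmxN raddfN /= adC_cx.
  apply/eqP; rewrite oppr_eq0; apply/eqP.
  rewrite /adC mulmx_sumr (raddf_sum (@mxtrace _ n)) big1// => i _ /=.
  rewrite -scalemxAr mxtraceZ -map_mxM.
  by rewrite trace_map_mx [\tr _](kP a (delta_mx 0 i) aP) rmorph0 mulr0.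
apply/eqP; rewrite -(map_mx_eq0 (real_complex R)) ; apply/eqP.
by have -> : cx (ad x ^+ n) = cx (ad x) ^+ n; [rewrite rmorphXn|exact: tD].
Qed.

(** [S] is the stable member of the derived series. All [ad x] with [x] in [S] are nilpotent, so
    long words in them vanish; but [S = der S] writes every element of [S] as a combination of
    arbitrarily long words applied to [S]. Hence [S = 0], which makes [P] solvable. *)
Lemma killing_radical_solvable P : is_ideal P -> (forall u v, u \in P -> killing u v = 0) ->
  P = 0%VS.
Proof.
move=> hP kP; apply: semi => //; have [k kE] := der_stable hP; exists k.
set S := iter k der P in kE *.
have hS : is_ideal S by rewrite /S; elim: {kE S} k => //= k; exact: der_ideal.
have SP : (S <= P)%VS.
  rewrite /S; elim: {kE S hS} k => //= k IH.
  apply: subv_trans IH; apply: der_sub.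
  by elim: k => //= k; exact: der_ideal.
have adL : linear ad by move=> a u v; exact: adD.
pose adl : {linear 'rV[R]_n -> 'M[R]_n} := HB.pack ad (GRing.isLinear.Build _ _ _ _ ad adL).
pose g := (linfun adl @: S)%VS.
have gP a : a \in g <-> exists2 x, x \in S & a = ad x.
  split=> [/memv_imgP[x xS ->]|[x xS ->]]; first by exists x; rewrite ?lfunE.
  by apply/memv_imgP; exists x; rewrite ?lfunE.
have [N hN] : exists N, nil_words g N.
  apply: engel => [a b /gP[x xS ->] /gP[y yS ->]|a /gP[x xS ->]].
    by apply/gP; exists (br y x); [exact: hS|exact: adB].
  exists n; apply: (killing_nilpotent (P := S)); last by rewrite kE.
  by move=> u v /(subvP SP); exact: kP.
have key j Q : lin_closed Q -> (forall s v, {subset s <= g} -> size s = j -> v \in S ->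
    Q (v *m word s)) -> forall x, x \in S -> Q x.
  elim: j Q => [|j IH] Q lQ h x xS.
    by have := h [::] x; rewrite /word big_nil mulmx1; apply.
  apply: (IH Q) => // s v sg sj; rewrite -{1}kE; move: v; apply: der_elim.
    split; first by rewrite mul0mx; case: lQ.
    by move=> a u v hu hv; rewrite mulmxDl -scalemxAl; apply: (proj2 lQ).
  move=> u v uS vS; rewrite -adE -mulmxA -/(ad u * word s) -word_cons; apply: h => //=.
    by move=> a; rewrite inE => /predU1P[->|/sg//]; apply/gP; exists u.
  by rewrite sj.
apply/eqP; rewrite -subv0; apply/subvP => x xS; rewrite memv0; apply/eqP.
apply: (key N (fun x => x = 0)) => //.
  by split=> // a u v -> ->; rewrite scaler0 addr0.
by move=> s v sg sN vS; rewrite hN ?sN ?mulmx0.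
Qed.

Lemma killingDl w : lin_closed (fun u => killing u w = 0).
Proof.
split=> [|a u v hu hv]; rewrite /killing.
  have -> : ad 0 = 0 by apply: ad_inj => v; rewrite adE br0l mulmx0.
  by rewrite mul0mx mxtrace0.
by rewrite adD mulmxDl -scalemxAl mxtraceD mxtraceZ [\tr _]hu [\tr _]hv mulr0 addr0.
Qed.

Lemma killingZ a u v : killing (a *: u) v = a * killing u v.
Proof.
rewrite /killing; have -> : ad (a *: u) = a *: ad u; last by rewrite -scalemxAl mxtraceZ.
by apply: ad_inj => w; rewrite -scalemxAr !adE -[a *: u]addr0 brDl br0l addr0.
Qed.

Lemma killingC u v : killing u v = killing v u.
Proof. exact: mxtrace_mulC. Qed.

(** The orthogonal space is presented as a kernel, so that it is available as a subspace and its
    dimension can be counted by rank and nullity. *)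
Lemma killing_perp_vspace k (s : 'I_k -> 'rV[R]_n) :
  exists f : 'Hom('rV[R]_n, 'rV[R]_k), forall u, u \in lker f <-> forall j, killing u (s j) = 0.
Proof.
pose g u : 'rV[R]_k := \row_j killing u (s j).
have gl : linear g.
  move=> a u v; apply/rowP => j; rewrite !mxE /killing adD mulmxDl -scalemxAl.
  by rewrite mxtraceD mxtraceZ.
pose gL : {linear 'rV[R]_n -> 'rV[R]_k} := HB.pack g (GRing.isLinear.Build _ _ _ _ g gl).
exists (linfun gL) => u; rewrite memv_ker lfunE /= /g; split=> [/eqP/rowP h j|h].
  by have := h j; rewrite !mxE.
by apply/eqP/rowP => j; rewrite !mxE.
Qed.

Lemma killing_nondegenerate x : (forall v, killing x v = 0) -> x = 0.
Proof.
move=> kx; have [f hf] := killing_perp_vspace (fun i : 'I_n => delta_mx 0 i).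
have SP u : u \in lker f <-> forall v, killing u v = 0.
  rewrite hf; split=> [h|h j]; last exact: h.
  move=> v; rewrite killingC; move: v; apply: (lin_closed_delta (killingDl u)) => i.
  by rewrite killingC.
suff S0 : lker f = 0%VS by apply/eqP; rewrite -memv0 -S0; apply/SP.
apply: killing_radical_solvable; last by move=> u v /SP.
by move=> u v /SP hv; apply/SP => w; rewrite br_anti -scaleN1r killingZ killing_inv hv mulr0.
Qed.

(** The kernel of [f] is the orthogonal of the derived algebra [D]. It consists of central vectors,
    whose lines are abelian ideals, so it is zero; injectivity of [f] into a space of the dimension
    of [D] then forces [D] to be everything. *)
Lemma semisimple_der : der fullv = fullv.
Proof.
set D := der fullv.
have [f hf] := killing_perp_vspace (fun i : 'I_(\dim D) => (vbasis D)`_i).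
have f0 : lker f = 0%VS.
  apply/eqP; rewrite -subv0; apply/subvP => x /hf hx; rewrite memv0.
  have kD d : d \in D -> killing x d = 0.
    rewrite killingC; apply: (lin_closed_vbasis (killingDl x)) => y.
    by move=> /(nthP 0)[j]; rewrite size_tuple => jD <-; rewrite killingC -(hx (Ordinal jD)).
  have xv v : br x v = 0.
    by apply: killing_nondegenerate => w; rewrite killing_inv kD// mem_der ?memvf.
  have bx c v : br (c *: x) v = 0 by rewrite -[c *: x]addr0 brDl br0l xv scaler0 addr0.
  suff e : <[x]>%VS = 0%VS by rewrite -memv0 -e memv_line.
  apply: semi; first by move=> u v /vlineP[c ->]; rewrite br_anti bx oppr0 mem0v.
  exists 1%N => /=; apply/eqP; rewrite -subv0; apply/subvP.
  by apply: der_elim => [|u v /vlineP[c ->] _]; [exact: lin_closed_memv|rewrite bx mem0v].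
apply/eqP; rewrite -(dimv_leqif_eq (subvf D)) eqn_leq dimvS ?subvf//=.
have := limg_ker_dim f fullv; rewrite f0 capv0 dimv0 add0n => <-.
by apply: (leq_trans (dimvS (subvf _))); rewrite dimvf /dim /= mul1n.
Qed.

End Perfect.

(** Perfectness as an induction principle over brackets: the property [Q] will be the vanishing of a
    linear functional. *)
Lemma semisimple_perfect (R : rcfType) n (br : 'rV[R]_n -> 'rV[R]_n -> 'rV[R]_n) :
  (forall a u u' v, br (a *: u + u') v = a *: br u v + br u' v) ->
  (forall a u v v', br u (a *: v + v') = a *: br u v + br u v') ->
  (forall u v w, br u (br v w) = br (br u v) w + br v (br u w)) ->
  (forall I : {vspace 'rV[R]_n}, (forall u v, v \in I -> br u v \in I) ->
    (exists k, iter k (fun J : {vspace 'rV[R]_n} =>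
       <<[seq br u v | u <- vbasis J, v <- vbasis J]>>%VS) I = 0%VS) -> I = 0%VS) ->
  forall Q : 'rV[R]_n -> Prop, Q 0 -> (forall a u v, Q u -> Q v -> Q (a *: u + v)) ->
  (forall u v, Q (br u v)) -> forall v, Q v.
Proof.
case: n br => [|n] br hl hr lb ss Q Q0 QD Qb v; first by rewrite thinmx0.
have := memvf v; rewrite -(semisimple_der hl hr lb ss).
exact: (der_elim (Q := Q)).
Qed.

(** * Calculus in Frechet spaces *)

Section MeanValue.
Context {R : realType}.

(** [D a b] stands for the error over the interval from [a] to [b]. The local bound is asked only
    for intervals containing the point [s], which is what differentiability at [s] provides; the
    supremum of the good right ends then has to be 1. *)
Lemma mean_value_ineq (D : R -> R -> R) (M : R) :
  (forall a b c, 0 <= a -> a <= b -> b <= c -> c <= 1 ->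
     D a c <= D a b + D b c) ->
  (forall s, 0 <= s -> s <= 1 -> exists2 d, 0 < d &
     forall a b, 0 <= a -> a <= s -> s <= b -> b <= 1 -> b - a < d ->
       D a b <= M * (b - a)) ->
  D 0 1 <= M.
Proof.
move=> tri loc.
pose S := [set b | 0 <= b <= 1 /\ D 0 b <= M * b].
have S0 : S 0.
  split; first by rewrite lexx ler01.
  have [d d0 /(_ 0 0)] := loc 0 (lexx _) ler01.
  by rewrite subr0 mulr0; apply => //; exact: ler01.
have ubS : ubound S 1 by move=> b [/andP[]].
have supS : has_sup S by split; [exists 0|exists 1].
set c := sup S.
have c0 : 0 <= c by apply: sup_upper_bound.
have c1 : c <= 1 by apply: ge_sup => //; exists 0.
have [d d0 Hd] := loc c c0 c1.
have d2 : 0 < d / 3 by lra.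
have [b Sb cb] := sup_adherent d2 supS.
have bc : b <= c by apply: sup_upper_bound.
have [/andP[b0 b1] Db] := Sb.
(* Either [b'] exceeds the supremum [c] or it equals 1. *)
pose b' := Num.min 1 (c + d / 3).
have cb' : c <= b' by rewrite le_min; apply/andP; split; lra.
have b'1 : b' <= 1 by rewrite ge_min lexx.
have b'd : b' <= c + d / 3 by rewrite ge_min lexx orbT.
have Db' : D 0 b' <= M * b'.
  apply: (le_trans (tri 0 b b' _ _ _ _)) => //; first lra.
  have := Hd b b' b0 bc cb' b'1; rewrite -/c in cb => H.
  have {}H := H ltac:(lra).
  by rewrite mulrBr in H; lra.
have Sb' : S b' by split=> //; apply/andP; split=> //; lra.
have : b' <= c by apply: sup_upper_bound.
rewrite ge_min => /orP[h1|]; last lra.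
have e1 : b' = 1 by apply/eqP; rewrite eq_le b'1 /= (le_trans h1).
by rewrite e1 mulr1 in Db'.
Qed.

End MeanValue.

Existing Class is_frechet.

Section Seminorms.
Context {R : realType}.
Implicit Types E F : frechetModel R.

Section Algebra.
Context E {hE : is_frechet E}.
Implicit Types x y : E.

Lemma fs0 : fsub E 0. Proof. exact: frechet0. Qed.

Lemma fsZ a x : fsub E x -> fsub E (a *: x).
Proof. by move=> hx; have := frechet_lin hE a hx fs0; rewrite addr0. Qed.

Lemma fsD x y : fsub E x -> fsub E y -> fsub E (x + y).
Proof. by move=> hx hy; have := frechet_lin hE 1 hx hy; rewrite scale1r. Qed.

Lemma fsN x : fsub E x -> fsub E (- x).
Proof. by rewrite -scaleN1r; exact: fsZ. Qed.

Lemma fsB x y : fsub E x -> fsub E y -> fsub E (x - y).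
Proof. by move=> hx hy; apply: fsD => //; exact: fsN. Qed.

Lemma fsn0 k : fsn k (0 : E) = 0.
Proof. by rewrite -(scale0r (0 : E)) frechet_scale ?normr0 ?mul0r//; exact: fs0. Qed.

Lemma fsn_ge0 k x : fsub E x -> 0 <= fsn k x.
Proof.
move=> hx; have := frechet_triangle hE k hx (fsN hx).
by rewrite subrr fsn0 -scaleN1r frechet_scale// normrN1 mul1r; lra.
Qed.

End Algebra.

(** The seminorms [pn k] are increasing in [k] and define the same topology. *)
Fixpoint pn E (k : nat) (x : E) : R :=
  if k is k'.+1 then Num.max (pn k' x) (fsn k x) else fsn 0 x.

Lemma pn_ltP E k (x : E) e :
  pn k x < e <-> forall j, (j <= k)%N -> fsn j x < e.
Proof.
elim: k => [|k IH] /=; first by split=> [h [|//]|]; [|apply].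
rewrite gt_max; split=> [/andP[/IH h1 h2] j|h].
  by rewrite leq_eqVlt ltnS => /orP[/eqP->//|]; exact: h1.
by rewrite h// andbT; apply/IH => j jk; apply: h; rewrite (leq_trans jk).
Qed.

Lemma fballP E (x y : E) k e : fball x k e y <-> fsub E y /\ pn k (y - x) < e.
Proof. by rewrite /fball /= pn_ltP. Qed.

Lemma fsn_le_pn E k (x : E) : fsn k x <= pn k x.
Proof. by case: k => //= k; rewrite le_max lexx orbT. Qed.

Lemma pn_mono E k l (x : E) : (k <= l)%N -> pn k x <= pn l x.
Proof.
elim: l => [|l IH]; first by case: k.
by rewrite leq_eqVlt ltnS => /orP[/eqP->//|/IH] /= h; rewrite le_max h.
Qed.

Section Pn.
Context E {hE : is_frechet E}.
Implicit Types x y : E.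

Lemma pn_ge0 k x : fsub E x -> 0 <= pn k x.
Proof. by move=> hx; apply: le_trans (fsn_le_pn k x); exact: fsn_ge0. Qed.

Lemma pn0 k : pn k (0 : E) = 0.
Proof. by elim: k => [|k IH] /=; rewrite ?fsn0// IH maxxx. Qed.

Lemma pnZ k a x : fsub E x -> pn k (a *: x) = `|a| * pn k x.
Proof.
move=> hx; elim: k => [|k IH] /=; rewrite ?frechet_scale//.
by rewrite IH maxr_pMr.
Qed.

Lemma pnN k x : fsub E x -> pn k (- x) = pn k x.
Proof. by move=> hx; rewrite -scaleN1r pnZ// normrN1 mul1r. Qed.

Lemma pnD k x y : fsub E x -> fsub E y -> pn k (x + y) <= pn k x + pn k y.
Proof.
move=> hx hy; elim: k => [|k IH] /=; first exact: frechet_triangle.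
rewrite ge_max; apply/andP; split.
  by apply: (le_trans IH); apply: lerD; rewrite le_max lexx.
apply: (le_trans (frechet_triangle hE _ hx hy)).
by apply: lerD; rewrite le_max lexx orbT.
Qed.

Lemma pnB k x y : fsub E x -> fsub E y -> pn k (x - y) <= pn k x + pn k y.
Proof. by move=> hx hy; rewrite -(pnN k hy); apply: pnD => //; exact: fsN. Qed.

Lemma pn_sep x : fsub E x -> (forall k e, 0 < e -> pn k x <= e) -> x = 0.
Proof.
move=> hx h; apply: (frechet_separated hE hx) => k.
apply/eqP; rewrite eq_le fsn_ge0// andbT; apply/ler_addgt0Pr => e e0.
by rewrite add0r (le_trans (fsn_le_pn k x))// h.
Qed.

End Pn.

Lemma pn_prod E F k (x : E) (y : F) :
  pn k ((x, y) : prodModel E F) = Num.max (pn k x) (pn k y).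
Proof. by elim: k => [//|k IH] /=; rewrite IH maxACA. Qed.

End Seminorms.

(* Unlike [have :=], this solves the class arguments of [t]. *)
Tactic Notation "note" constr(t) := let h := fresh in pose proof t as h; revert h.

Ltac fsub_step :=
  first [ assumption | exact: fs0 | apply: fsD | apply: fsB | apply: fsZ
        | apply: fsN | by [] ].
Ltac fsub := repeat fsub_step.

Section ProdFrechet.
Context {R : realType}.
Implicit Types E F : frechetModel R.

#[global] Instance prod_frechet E F (hE : is_frechet E) (hF : is_frechet F) :
  is_frechet (prodModel E F).
Proof.
split.
- by split; exact: fs0.
- by move=> a [x1 x2] [y1 y2] [/= ? ?] [/= ? ?]; split; rewrite /=; fsub.
- move=> k [x1 x2] [y1 y2] [/= ? ?] [/= ? ?]; rewrite /= ge_max; apply/andP; split.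
    by apply: (le_trans (frechet_triangle hE _ _ _)) => //; apply: lerD; rewrite le_max lexx.
  by apply: (le_trans (frechet_triangle hF _ _ _)) => //; apply: lerD; rewrite le_max lexx orbT.
- by move=> k a [x1 x2] [/= ? ?]; rewrite /= !frechet_scale// maxr_pMr.
- move=> [x1 x2] [/= h1 h2] h; congr pair.
    apply: (frechet_separated hE h1) => k; apply/eqP; rewrite eq_le fsn_ge0// andbT.
    by rewrite -(h k) /= le_max lexx.
  apply: (frechet_separated hF h2) => k; apply/eqP; rewrite eq_le fsn_ge0// andbT.
  by rewrite -(h k) /= le_max lexx orbT.
- move=> u hu hc.
  have [i|k e e0|l1 h1 c1] := @frechet_complete _ _ hE (fun i => (u i).1).
  + by case: (hu i).
  + have [N HN] := hc k e e0; exists N => i j Ni Nj.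
    by have := HN i j Ni Nj; rewrite /= gt_max => /andP[].
  have [i|k e e0|l2 h2 c2] := @frechet_complete _ _ hF (fun i => (u i).2).
  + by case: (hu i).
  + have [N HN] := hc k e e0; exists N => i j Ni Nj.
    by have := HN i j Ni Nj; rewrite /= gt_max => /andP[].
  exists (l1, l2) => // k e e0.
  have [N1 H1] := c1 k e e0; have [N2 H2] := c2 k e e0.
  exists (maxn N1 N2) => i; rewrite geq_max => /andP[i1 i2] /=.
  by rewrite gt_max H1// H2.
Qed.

#[global] Instance line_frechet : is_frechet (@line R).
Proof.
split=> //.
- by move=> k x y _ _; exact: ler_normD.
- by move=> k a x _; exact: normrM.
- by move=> x _ /(_ 0%N) /eqP; rewrite /= normr_eq0 => /eqP.
- move=> u _ hc.
  have cu : cvgn (u : nat -> R^o).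
    apply: cauchy_cvg; apply/cauchy_ballP => e e0.
    have [N HN] := hc 0%N e e0.
    pose A := (u : nat -> R^o) @` [set i | (N <= i)%N].
    exists (A, A); last by move=> [_ _] [/= [i Ni <-] [j Nj <-]]; exact: HN.
    by split; exists N => // i Ni; exists i.
  exists (limn (u : nat -> R^o)) => // k e e0.
  have /cvgrPdist_lt/(_ e e0) [N _ HN] := cu.
  by exists N => i Ni; rewrite /= distrC; exact: HN.
Qed.

End ProdFrechet.

Section Dderiv.
Context {R : realType}.
Implicit Types E F H : frechetModel R.

Lemma subrBB (V : zmodType) (a b c : V) : (a - b) - (a - c) = c - b.
Proof. by rewrite opprB addrA [LHS](ACl (3*2*(1*4)))/= addrN addr0. Qed.

Lemma pn_prodB E F k (p q : prodModel E F) :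
  pn k (p - q : prodModel E F) = Num.max (pn k (p.1 - q.1)) (pn k (p.2 - q.2)).
Proof. exact: pn_prod. Qed.

Lemma fopenP E (U : set E) : fopen U <-> U `<=` fsub E /\
  forall x, U x -> exists k (d : R), 0 < d /\
    forall y, fsub E y -> pn k (y - x) < d -> U y.
Proof.
split=> -[US h]; split=> // x /h[k [e [e0 H]]]; exists k, e; split=> //.
  by move=> y hy hd; apply: H; apply/fballP.
by move=> y /fballP[]; exact: H.
Qed.

Lemma fcontP E F (U : set E) (f : E -> F) : U `<=` fsub E ->
  fcontinuous U f <-> forall x, U x -> fsub F (f x) /\
    forall k (e : R), 0 < e -> exists l (d : R), 0 < d /\
      forall y, U y -> pn l (y - x) < d -> pn k (f y - f x) < e.
Proof.
move=> US; split=> h x Ux; have [fx H] := h x Ux; split=> // k e e0.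
  have [l [d [d0 Hd]]] := H k e e0; exists l, d; split=> // y Uy yx.
  by have /fballP[] : fball (f x) k e (f y) by apply: Hd => //; apply/fballP; split=> //; exact: US.
have [l [d [d0 Hd]]] := H k e e0; exists l, d; split=> // y Uy /fballP[_ yx].
by apply/fballP; split; [have [] := h y Uy|exact: Hd].
Qed.

Lemma fopen_line E {hE : is_frechet E} (U : set E) x v :
  fopen U -> U x -> fsub E v ->
  exists2 d : R, 0 < d & forall t, `|t| < d -> U (x + t *: v).
Proof.
move=> /fopenP[US oU] Ux hv; have hx := US _ Ux.
have [k [d [d0 Hd]]] := oU _ Ux.
have p0 : 0 < pn k v + 1 by note (pn_ge0 k hv); lra.
exists (d / (pn k v + 1)) => [|t]; first exact: divr_gt0.
rewrite ltr_pdivlMr// => ht; apply: Hd; first by fsub.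
rewrite addrAC subrr add0r pnZ//; apply: le_lt_trans ht.
by apply: ler_wpM2l => //; lra.
Qed.

(** The multiplied form admits [t = 0] and avoids quotients. Openness of [U] keeps [x + t *: v] in
    the domain for small [t], so that the quotients lie in the space. *)
Lemma has_dderivE E F {hE : is_frechet E} {hF : is_frechet F}
    (U : set E) (f : E -> F) x v w :
  fopen U -> (forall y, U y -> fsub F (f y)) -> U x -> fsub E v ->
  has_dderiv f x v w <-> fsub F w /\ forall k (e : R), 0 < e ->
    exists2 d : R, 0 < d & forall t, `|t| < d ->
      pn k (f (x + t *: v) - f x - t *: w) <= e * `|t|.
Proof.
move=> oU fU Ux hv; have fx := fU _ Ux.
note (fopen_line oU Ux hv) => -[d0 d00 Hd0].
split=> -[hw H]; split=> // k e e0.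
  have [d [dp Hd]] := H k e e0; exists (Num.min d d0); first by rewrite lt_min dp.
  move=> t; rewrite lt_min => /andP[td td0].
  have [->|tn0] := eqVneq t 0.
    by rewrite !scale0r addr0 !subr0 subrr pn0 normr0 mulr0.
  have /fballP[q] := Hd t ltac:(by rewrite normr_gt0) td => /ltW h.
  have -> : f (x + t *: v) - f x - t *: w =
      t *: (t^-1 *: (f (x + t *: v) - f x) - w).
    by rewrite scalerBr scalerA divff// scale1r.
  by rewrite pnZ; [rewrite mulrC ler_wpM2r|fsub].
have e2 : 0 < e / 2 by lra.
have [d dp Hd] := H k _ e2; exists (Num.min d d0); split; first by rewrite lt_min dp.
move=> t t0; rewrite lt_min => /andP[td td0].
have ft := fU _ (Hd0 t td0).
apply/fballP; split; first by fsub.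
have tn0 : t != 0 by rewrite -normr_gt0.
have -> : t^-1 *: (f (x + t *: v) - f x) - w =
    t^-1 *: (f (x + t *: v) - f x - t *: w).
  by rewrite [RHS]scalerBr scalerA mulVf// scale1r.
rewrite pnZ; last by fsub.
rewrite normfV mulrC ltr_pdivrMr//; apply: (le_lt_trans (Hd t td)).
by rewrite ltr_pM2r//; lra.
Qed.

(** Differentiability uniform in the base point and in the direction, from continuity of [df] and
    the mean value inequality on segments. In Frechet spaces it takes the place of operator norm
    estimates, both in additivity and in the chain rule. *)
Lemma dderiv_strict E F {hE : is_frechet E} {hF : is_frechet F}
    (U : set E) (f : E -> F) (df : prodModel E E -> F) x v k (e : R) :
  fopen U -> (forall y, U y -> fsub F (f y)) ->
  (forall y u, U y -> fsub E u -> has_dderiv f y u (df (y, u))) ->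
  fcontinuous (U `*` fsub E : set (prodModel E E)) df ->
  U x -> fsub E v -> 0 < e ->
  exists l (d : R), 0 < d /\ forall x' v' t,
    fsub E x' -> pn l (x' - x) < d -> fsub E v' -> pn l (v' - v) < d ->
    `|t| < d -> [/\ U x', U (x' + t *: v') &
      pn k (f (x' + t *: v') - f x' - t *: df (x, v)) <= e * `|t|].
Proof.
move=> oU fU hdf cdf Ux hv e0; have /fopenP[US oU'] := oU.
have hx := US _ Ux.
have e2 : 0 < e / 2 by lra.
have UES : (U `*` fsub E : set (prodModel E E)) `<=` fsub (prodModel E E).
  by move=> [a b] [/= /US].
have hdfx : fsub F (df (x, v)) by have [] := hdf x v Ux hv.
have [_ cx] := (fcontP _ UES).1 cdf (x, v) (conj Ux hv).
have {cx}[l0 [d0 [d00 H0]]] := cx k _ e2.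
have [l1 [d1 [d10 H1]]] := oU' _ Ux.
pose l := maxn l0 l1.
pose m := Num.min d0 d1.
have m0 : 0 < m by rewrite lt_min d00.
note (pn_ge0 l hv) => pv.
(* A point of the segment is off [x] by less than [d] plus [d (pn l v + 1)], which this [d] keeps
   below [m]; it also keeps [v'] closer than [m] to [v]. *)
pose d := Num.min 1 (m / (pn l v + 3)).
have p3 : 0 < pn l v + 3 by lra.
have dp : 0 < d by rewrite lt_min ltr01 divr_gt0.
have d1' : d <= 1 by rewrite ge_min lexx.
have dm : d * (pn l v + 3) <= m.
  by rewrite -ler_pdivlMr// ge_min lexx orbT.
exists l, d; split=> // x' v' t hx' xd hv' vd td.
have pv' : pn l v' <= pn l v + 1.
  have -> : v' = v + (v' - v) by rewrite addrC subrK.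
  by apply: (le_trans (pnD _ _ _)) => //; fsub; lra.
have seg s : 0 <= s -> s <= 1 ->
    fsub E (x' + (s * t) *: v') /\ pn l (x' + (s * t) *: v' - x) < m.
  move=> s0 s1; have ? : fsub E (x' + (s * t) *: v') by fsub.
  split=> //.
  have -> : x' + (s * t) *: v' - x = (x' - x) + (s * t) *: v' by rewrite addrAC.
  apply: (le_lt_trans (pnD _ _ _)); [by fsub|by fsub|].
  rewrite pnZ// normrM (ger0_norm s0).
  have : s * `|t| * pn l v' <= d * (pn l v + 1).
    apply: ler_pM => //; rewrite ?mulr_ge0//; first exact: pn_ge0.
    by rewrite -(mul1r d); apply: ler_pM => //; exact: ltW.
  have dpv : 0 <= d * pn l v by rewrite mulr_ge0// ltW.
  move: dm; rewrite !mulrDr !mulr1; lra.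
have segU s : 0 <= s -> s <= 1 -> U (x' + (s * t) *: v').
  move=> s0 s1; have [? /lt_le_trans h] := seg s s0 s1.
  apply: H1 => //; apply: (le_lt_trans (pn_mono _ (leq_maxr l0 l1))).
  by apply: h; rewrite ge_min lexx orbT.
have Ux' : U x' by have := segU 0 (lexx _) ler01; rewrite mul0r scale0r addr0.
have Ux't : U (x' + t *: v') by have := segU 1 ler01 (lexx _); rewrite mul1r.
split=> //.
have [->|tn0] := eqVneq t 0.
  by rewrite !scale0r addr0 !subr0 subrr pn0 normr0 mulr0.
have segf s : 0 <= s -> s <= 1 -> fsub F (f (x' + (s * t) *: v')).
  by move=> s0 s1; exact/fU/segU.
pose G (s : R) := f (x' + (s * t) *: v').
pose D a b := pn k (G b - G a - ((b - a) * t) *: df (x, v)).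
suff : D 0 1 <= e * `|t|.
  by rewrite /D /G subr0 !mul1r mul0r scale0r addr0.
apply: mean_value_ineq => [a b c a0 ab bc c1|s s0 s1].
  rewrite /D.
  have -> : G c - G a - ((c - a) * t) *: df (x, v) =
      (G b - G a - ((b - a) * t) *: df (x, v)) +
      (G c - G b - ((c - b) * t) *: df (x, v)).
    have -> : (c - a) * t = (b - a) * t + (c - b) * t by ring.
    rewrite scalerDl opprD !addrA.
    by rewrite [RHS](ACl (4*2*3*6*(1*5)))/= addrN addr0.
  have b0 := le_trans a0 ab; have b1 := le_trans bc c1.
  have fa := segf a a0 (le_trans ab b1); have fb := segf b b0 b1.
  have fc := segf c (le_trans b0 bc) c1.
  by apply: pnD; fsub.
set y := x' + (s * t) *: v'.
have Uy : U y by exact: segU.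
have hy : fsub E y by exact: US.
have hw := (hdf y v' Uy hv').1.
note ((has_dderivE _ oU fU Uy hv').1 (hdf y v' Uy hv')) => -[_ /(_ k _ e2)[d' d'0 Hd']].
have dyx : pn k (df (y, v') - df (x, v)) < e / 2.
  apply: H0 => //; rewrite pn_prodB /= gt_max; apply/andP; split.
    apply: (le_lt_trans (pn_mono _ (leq_maxl l0 l1))).
    have [_ /lt_le_trans h] := seg s s0 s1.
    by apply: h; rewrite ge_min lexx.
  apply: (le_lt_trans (pn_mono _ (leq_maxl l0 l1))).
  apply: (lt_le_trans vd); apply: (@le_trans _ _ m); last by rewrite ge_min lexx.
  apply: le_trans dm; have : 0 <= d * pn l v by rewrite mulr_ge0// ltW.
  by rewrite mulrDr; lra.
have step r : `|r * t| < d' -> U (x' + ((s + r) * t) *: v') ->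
    pn k (G (s + r) - G s - (r * t) *: df (x, v)) <= e * `|r * t|.
  move=> rd hU.
  have -> : G (s + r) - G s - (r * t) *: df (x, v) =
      (f (y + (r * t) *: v') - f y - (r * t) *: df (y, v')) +
      (r * t) *: (df (y, v') - df (x, v)).
    rewrite /G -/y mulrDl scalerDl addrA -/y scalerBr addrA.
    by rewrite subrK.
  have fyr : fsub F (f (y + (r * t) *: v')).
    by apply: fU; rewrite /y -addrA -scalerDl -mulrDl.
  have fy := fU _ Uy.
  apply: (le_trans (pnD _ _ _)); [by fsub|by fsub|].
  have := Hd' _ rd; rewrite pnZ; last by fsub.
  have : `|r * t| * pn k (df (y, v') - df (x, v)) <= `|r * t| * (e / 2).
    by apply: ler_wpM2l => //; exact: ltW.
  lra.
exists (d' / `|t|); first by rewrite divr_gt0// normr_gt0.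
move=> a b a0 as_ sb b1; rewrite ltr_pdivlMr ?normr_gt0// => bad.
have ab := le_trans as_ sb.
have t0 : 0 <= `|t| by [].
have tmono u w : u <= w -> u * `|t| <= w * `|t| by move=> ?; rewrite ler_wpM2r.
rewrite /D.
have Hb : pn k (G b - G s - ((b - s) * t) *: df (x, v)) <= e * ((b - s) * `|t|).
  have := step (b - s); rewrite (_ : s + (b - s) = b) ?normrM; last by ring.
  rewrite ger0_norm ?subr_ge0//.
  apply; last by apply: segU; rewrite ?(le_trans s0).
  by apply: le_lt_trans bad; rewrite tmono// lerB.
have Ha : pn k (G a - G s - ((a - s) * t) *: df (x, v)) <= e * ((s - a) * `|t|).
  have := step (a - s); rewrite (_ : s + (a - s) = a) ?normrM; last by ring.
  rewrite [`|a - s|]distrC (ger0_norm (x := s - a)) ?subr_ge0//.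
  apply; last by apply: segU; rewrite ?(le_trans as_).
  by apply: le_lt_trans bad; rewrite tmono// lerB.
have -> : G b - G a - ((b - a) * t) *: df (x, v) =
    (G b - G s - ((b - s) * t) *: df (x, v)) -
    (G a - G s - ((a - s) * t) *: df (x, v)).
  have -> : (b - a) * t = (b - s) * t - (a - s) * t by ring.
  rewrite scalerBl !opprB !addrA.
  by rewrite [RHS](ACl (1*6*4*3*(2*5)))/= addNr addr0.
have fa : fsub F (G a) by apply: segf => //; exact: le_trans as_ _.
have fb : fsub F (G b) by apply: segf => //; exact: le_trans s0 _.
have fs : fsub F (G s) by exact: segf.
apply: (le_trans (pnB _ _ _)); [by fsub|by fsub|].
lra.
Qed.

Lemma dderiv_unique E F {hE : is_frechet E} {hF : is_frechet F}
    (U : set E) (f : E -> F) x v w w' :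
  fopen U -> (forall y, U y -> fsub F (f y)) -> U x -> fsub E v ->
  has_dderiv f x v w -> has_dderiv f x v w' -> w = w'.
Proof.
move=> oU fU Ux hv /(has_dderivE _ oU fU Ux hv)[hw H] /(has_dderivE _ oU fU Ux hv)[hw' H'].
apply/subr0_eq/pn_sep; first by fsub.
move=> k e e0; have e2 : 0 < e / 2 by lra.
have [d d0 Hd] := H k _ e2; have [d' d'0 Hd'] := H' k _ e2.
note (fopen_line oU Ux hv) => -[d1 d10 Hd1].
pose t := Num.min d (Num.min d' d1) / 2.
have t0 : 0 < t by rewrite divr_gt0// !lt_min d0 d'0.
have : t < Num.min d (Num.min d' d1) by rewrite /t; move: t0; rewrite /t; lra.
rewrite -(gtr0_norm t0) !lt_min => /and3P[td td' td1].
have ft := fU _ (Hd1 _ td1); have fx := fU _ Ux.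
rewrite -(ler_pM2l (x := `|t|)) ?normr_gt0 ?gt_eqF// -pnZ; last by fsub.
have -> : t *: (w - w') = (f (x + t *: v) - f x - t *: w') - (f (x + t *: v) - f x - t *: w).
  by rewrite scalerBr subrBB.
apply: (le_trans (pnB _ _ _)); [by fsub|by fsub|].
have := Hd _ td; have := Hd' _ td'; lra.
Qed.

Lemma dderiv_line E F (f : E -> F) (x v : E) w (g : E -> F) (d : R) : 0 < d ->
  (forall t, `|t| < d -> f (x + t *: v) = g (x + t *: v)) ->
  has_dderiv f x v w -> has_dderiv g x v w.
Proof.
move=> d0 fg [hw H]; split=> // k e e0.
have [d' [d'0 H']] := H k e e0.
exists (Num.min d d'); split; first by rewrite lt_min d0.
move=> t t0; rewrite lt_min => /andP[td td'].
have fg0 : f x = g x by have := fg 0; rewrite scale0r addr0 normr0; exact.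
by rewrite -fg// -fg0; exact: H'.
Qed.

Lemma dderiv_congr E F {hE : is_frechet E} (U : set E) (f g : E -> F) x v w :
  fopen U -> (forall y, U y -> f y = g y) -> U x -> fsub E v ->
  has_dderiv f x v w -> has_dderiv g x v w.
Proof.
move=> oU fg Ux hv; note (fopen_line oU Ux hv) => -[d d0 Hd].
by apply: (dderiv_line d0) => t /Hd; exact: fg.
Qed.

Section Additivity.
Context E F {hE : is_frechet E} {hF : is_frechet F}.
Context (U : set E) (f : E -> F) (df : prodModel E E -> F).
Hypothesis oU : fopen U.
Hypothesis fU : forall y, U y -> fsub F (f y).
Hypothesis hdf : forall y u, U y -> fsub E u -> has_dderiv f y u (df (y, u)).

Lemma dderivZ x a v : U x -> fsub E v -> df (x, a *: v) = a *: df (x, v).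
Proof.
move=> Ux hv; have hav : fsub E (a *: v) by fsub.
have [hw H] := (has_dderivE _ oU fU Ux hv).1 (hdf Ux hv).
apply: (dderiv_unique oU fU Ux hav (hdf Ux hav)).
apply/(has_dderivE _ oU fU Ux hav); split; first by fsub.
move=> k e e0; have a1 : 0 < `|a| + 1 by have := normr_ge0 a; lra.
have [d d0 Hd] := H k (e / (`|a| + 1)) ltac:(by rewrite divr_gt0).
exists (d / (`|a| + 1)); first by rewrite divr_gt0.
move=> t; rewrite ltr_pdivlMr// => td.
have tad : `|t * a| <= `|t| * (`|a| + 1) by rewrite normrM ler_wpM2l// lerDl.
have := Hd (t * a) ltac:(lra); rewrite !scalerA => /le_trans; apply.
rewrite -mulrA ler_wpM2l ?(ltW e0)// ler_pdivrMl//.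
by lra.
Qed.

Hypothesis cdf : fcontinuous (U `*` fsub E : set (prodModel E E)) df.

(** The increment along [v + w] is split at the moving point [x + t *: v]; the second half requires
    the strict estimate, the first only the derivative at [x]. *)
Lemma dderivD x v w : U x -> fsub E v -> fsub E w ->
  df (x, v + w) = df (x, v) + df (x, w).
Proof.
move=> Ux hv hw; have hvw : fsub E (v + w) by fsub.
have [hdv Hv] := (has_dderivE _ oU fU Ux hv).1 (hdf Ux hv).
have hdw := (hdf Ux hw).1.
apply: (dderiv_unique oU fU Ux hvw (hdf Ux hvw)).
apply/(has_dderivE _ oU fU Ux hvw); split; first by fsub.
move=> k e e0; have e2 : 0 < e / 2 by lra.
have [d d0 Hd] := Hv k _ e2.
have [l [d1 [d10 Hd1]]] := dderiv_strict k oU fU hdf cdf Ux hw e2.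
have p1 : 0 < pn l v + 1 by note (pn_ge0 l hv); lra.
exists (Num.min d (Num.min d1 (d1 / (pn l v + 1)))).
  by rewrite !lt_min d0 d10 divr_gt0.
move=> t; rewrite !lt_min ltr_pdivlMr// => /and3P[td td1 td2].
have hx : fsub E x by have /fopenP[US _] := oU; exact: US.
have [||//||//|U1 U2 H] := Hd1 (x + t *: v) w t; first by fsub.
- rewrite addrAC subrr add0r pnZ//; apply: le_lt_trans td2.
  by rewrite ler_wpM2l// lerDl.
- by rewrite subrr pn0.
rewrite scalerDr addrA.
have fx := fU Ux; have f1 := fU U1; have f2 := fU U2.
have -> : f (x + t *: v + t *: w) - f x - t *: (df (x, v) + df (x, w)) =
  (f (x + t *: v) - f x - t *: df (x, v)) +
  (f (x + t *: v + t *: w) - f (x + t *: v) - t *: df (x, w)).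
  rewrite scalerDr opprD !addrA.
  by rewrite [RHS](ACl (4*2*3*6*(1*5)))/= addrN addr0.
apply: (le_trans (pnD _ _ _)); [by fsub|by fsub|].
by have := Hd _ td; lra.
Qed.

End Additivity.

Section ChainRule.
Context E F H {hE : is_frechet E} {hF : is_frechet F} {hH : is_frechet H}.
Context (U : set E) (V : set F) (f : E -> F) (g : F -> H) (dg : prodModel F F -> H).
Hypotheses (oU : fopen U) (oV : fopen V).
Hypothesis fU : forall y, U y -> V (f y).
Hypothesis gV : forall y, V y -> fsub H (g y).
Hypothesis hdg : forall y u, V y -> fsub F u -> has_dderiv g y u (dg (y, u)).
Hypothesis cdg : fcontinuous (V `*` fsub F : set (prodModel F F)) dg.

(** Writing [f (x + t *: v)] as [f x + t *: w'] with [w'] close to [w] reduces the claim to the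
    strict estimate for [g] in a varying direction. *)
Lemma dderiv_comp x v w : U x -> fsub E v -> has_dderiv f x v w ->
  has_dderiv (g \o f) x v (dg (f x, w)).
Proof.
move=> Ux hv hf.
have VS : V `<=` fsub F by case/fopenP: oV.
have fS y : U y -> fsub F (f y) by move=> /fU/VS.
have gfS y : U y -> fsub H ((g \o f) y) by move=> /fU/gV.
have [hw Hf] := (has_dderivE _ oU fS Ux hv).1 hf.
have Vfx := fU Ux.
apply/(has_dderivE _ oU gfS Ux hv); split; first exact: (hdg Vfx hw).1.
move=> k e e0.
have [l [d [d0 Hd]]] := dderiv_strict k oV gV hdg cdg Vfx hw e0.
have [d1 d10 Hd1] := Hf l (d / 2) ltac:(lra).
note (fopen_line oU Ux hv) => -[d2 d20 Hd2].
exists (Num.min d (Num.min d1 d2)); first by rewrite !lt_min d0 d10.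
move=> t; rewrite !lt_min => /and3P[td td1 td2].
have [->|tn0] := eqVneq t 0.
  by rewrite !scale0r addr0 !subr0 subrr pn0 normr0 mulr0.
have ft := fS _ (Hd2 _ td2); have fx := fS _ Ux.
pose w' := t^-1 *: (f (x + t *: v) - f x).
have hw' : fsub F w' by rewrite /w'; fsub.
have ew' : f x + t *: w' = f (x + t *: v).
  by rewrite /w' scalerA divff// scale1r addrC subrK.
have [||//|//|_ _] := Hd (f x) w' t fx; rewrite ?subrr ?pn0//.
  have -> : w' - w = t^-1 *: (f (x + t *: v) - f x - t *: w).
    by rewrite [RHS]scalerBr scalerA mulVf// scale1r.
  rewrite pnZ; last by fsub.
  have := Hd1 _ td1; rewrite -ler_pdivrMr ?normr_gt0// normfV mulrC.
  by move=> /le_lt_trans; apply; lra.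
by rewrite ew'.
Qed.

End ChainRule.

Lemma fcontinuous_comp E F H {hE : is_frechet E} {hF : is_frechet F}
    (U : set E) (V : set F) (f : E -> F) (g : F -> H) :
  U `<=` fsub E -> V `<=` fsub F -> (forall y, U y -> V (f y)) ->
  fcontinuous U f -> fcontinuous V g -> fcontinuous U (g \o f).
Proof.
move=> US VS fU /(fcontP _ US) cf /(fcontP _ VS) cg.
apply/(fcontP _ US) => x Ux; have [gx Hg] := cg _ (fU _ Ux); split=> // k e e0.
have [l [d [d0 Hd]]] := Hg k e e0.
have [l' [d' [d'0 Hd']]] := (cf _ Ux).2 l d d0.
exists l', d'; split=> // y Uy yx.
by apply: Hd; [exact: fU|exact: Hd'].
Qed.

Lemma fopen_preimage E F {hE : is_frechet E} {hF : is_frechet F}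
    (U : set E) (V : set F) (f : E -> F) :
  fopen U -> fcontinuous U f -> fopen V -> fopen (U `&` f @^-1` V).
Proof.
move=> oU cf /fopenP[VS oV]; have /fopenP[US oU'] := oU.
have {}cf := (fcontP _ US).1 cf.
apply/fopenP; split=> [x [/US]//|x [Ux Vfx]].
have [k [d [d0 Hd]]] := oV _ Vfx.
have [l [d' [d'0 Hd']]] := (cf _ Ux).2 k d d0.
have [l2 [d2 [d20 Hd2]]] := oU' _ Ux.
exists (maxn l l2), (Num.min d' d2); split; first by rewrite lt_min d'0.
move=> y hy; rewrite lt_min => /andP[y1 y2].
have Uy : U y by apply: Hd2 => //; apply: le_lt_trans y2; apply: pn_mono; exact: leq_maxr.
split=> //; apply: Hd; first by have [] := cf _ Uy.
by apply: Hd' => //; apply: le_lt_trans y1; apply: pn_mono; exact: leq_maxl.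
Qed.

Lemma fopenI E {hE : is_frechet E} (U V : set E) : fopen U -> fopen V -> fopen (U `&` V).
Proof.
move=> /fopenP[US oU] /fopenP[VS oV]; apply/fopenP; split=> [x [/US]//|x [Ux Vx]].
have [k [d [d0 Hd]]] := oU _ Ux; have [l [d' [d'0 Hd']]] := oV _ Vx.
exists (maxn k l), (Num.min d d'); split; first by rewrite lt_min d0.
move=> y hy; rewrite lt_min => /andP[y1 y2]; split.
  by apply: Hd => //; apply: le_lt_trans y1; apply: pn_mono; exact: leq_maxl.
by apply: Hd' => //; apply: le_lt_trans y2; apply: pn_mono; exact: leq_maxr.
Qed.

Lemma fopen_fsub E : fopen (fsub E).
Proof. by apply/fopenP; split=> // x hx; exists 0%N, 1; split. Qed.

Lemma fopen_prod E F (U : set E) (V : set F) : fopen U -> fopen V ->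
  fopen (U `*` V : set (prodModel E F)).
Proof.
move=> /fopenP[US oU] /fopenP[VS oV]; apply/fopenP.
split=> [[x y] [/= /US ? /VS ?]//|[x y] [/= Ux Vy]].
have [k [d [d0 Hd]]] := oU _ Ux; have [l [d' [d'0 Hd']]] := oV _ Vy.
exists (maxn k l), (Num.min d d'); split; first by rewrite lt_min d0.
move=> [x' y'] [/= hx hy]; rewrite pn_prodB /= gt_max !lt_min => /andP[/andP[y1 y2] /andP[y3 y4]]; split=> /=.
  by apply: Hd => //; apply: le_lt_trans y1; apply: pn_mono; exact: leq_maxl.
by apply: Hd' => //; apply: le_lt_trans y4; apply: pn_mono; exact: leq_maxr.
Qed.

Lemma fopen_cover E (U : set E) : (forall x, U x -> exists V, [/\ fopen V, V x & V `<=` U]) ->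
  fopen U.
Proof.
move=> h; apply/fopenP; split=> x Ux; have [V [/fopenP[VS oV] Vx VU]] := h x Ux.
  exact: VS.
have [k [d [d0 Hd]]] := oV _ Vx; exists k, d; split=> // y hy yx.
by apply: VU; exact: Hd.
Qed.

Lemma fopen_ball E {hE : is_frechet E} (x : E) k d : fsub E x -> fopen (fball x k d).
Proof.
move=> hx; apply/fopenP; split=> [y /fballP[]//|y /fballP[hy yx]].
exists k, (d - pn k (y - x)); split; first by rewrite subr_gt0.
move=> z hz zy; apply/fballP; split=> //.
have -> : z - x = (z - y) + (y - x) by rewrite addrA subrK.
by apply: (le_lt_trans (pnD _ _ _)); [by fsub|by fsub|lra].
Qed.

End Dderiv.

(** * Continuous linear maps and the classes of differentiability *)

Section Linear.
Context {R : realType}.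
Implicit Types E F H : frechetModel R.

Record flin E F (L : E -> F) : Prop := {
  flin_lin : forall (a : R) x y, fsub E x -> fsub E y ->
    L (a *: x + y) = a *: L x + L y;
  flin_sub : forall x, fsub E x -> fsub F (L x);
  flin_bound : forall k, exists l C, forall x, fsub E x ->
    pn k (L x) <= C * pn l x }.

Section Props.
Context E F {hE : is_frechet E} {hF : is_frechet F} (L : E -> F).
Hypothesis hL : flin L.

Lemma flinD x y : fsub E x -> fsub E y -> L (x + y) = L x + L y.
Proof. by move=> hx hy; have := flin_lin hL 1 hx hy; rewrite !scale1r. Qed.

Lemma flin0 : L 0 = 0.
Proof. by apply: (addrI (L 0)); rewrite -flinD ?addr0//; exact: fs0. Qed.

Lemma flinZ a x : fsub E x -> L (a *: x) = a *: L x.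
Proof. by move=> hx; have := flin_lin hL a hx (@fs0 _ _ hE); rewrite !addr0 flin0 addr0. Qed.

Lemma flinB x y : fsub E x -> fsub E y -> L (x - y) = L x - L y.
Proof.
move=> hx hy; rewrite -scaleN1r addrC (flin_lin hL)// scaleN1r.
by rewrite addrC.
Qed.

Lemma flin_cont : fcontinuous (fsub E) L.
Proof.
apply/fcontP => // x hx; split; first exact: flin_sub.
move=> k e e0; have [l [C HC]] := flin_bound hL k.
have C1 : 0 < `|C| + 1 by rewrite ltr_wpDl.
exists l, (e / (`|C| + 1)); split; first exact: divr_gt0.
move=> y hy; rewrite ltr_pdivlMr// -flinB// => yx.
have h : fsub E (y - x) by fsub.
apply: le_lt_trans yx; apply: (le_trans (HC _ h)); rewrite mulrC.
by rewrite ler_wpM2l ?pn_ge0// (le_trans (ler_norm C))// lerDl.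
Qed.

Lemma flin_dderiv x v : fsub E x -> fsub E v -> has_dderiv L x v (L v).
Proof.
move=> hx hv; apply/(has_dderivE _ (fopen_fsub E) (flin_sub hL) hx hv).
split; first exact: flin_sub.
move=> k e e0; exists 1 => // t _.
rewrite flinD ?flinZ//; last by fsub.
by rewrite [L x + _]addrC addrK subrr pn0 mulr_ge0// ltW.
Qed.

End Props.

Lemma flin_fst E F : flin (fst : prodModel E F -> E).
Proof.
split=> // [[x y] []//|k]; exists k, 1 => -[x y] _.
by rewrite mul1r pn_prod le_max lexx.
Qed.

Lemma flin_snd E F : flin (snd : prodModel E F -> F).
Proof.
split=> // [[x y] []//|k]; exists k, 1 => -[x y] _.
by rewrite mul1r pn_prod le_max lexx orbT.
Qed.

Lemma flin_id E : flin (id : E -> E).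
Proof. by split=> // k; exists k, 1 => x _; rewrite mul1r. Qed.

Lemma flin_pair E F H (L : E -> F) (L' : E -> H) {hE : is_frechet E} :
  flin L -> flin L' -> flin ((fun x => (L x, L' x)) : E -> prodModel F H).
Proof.
move=> hL hL'; split=> [a x y hx hy|x hx|k].
- by rewrite (flin_lin hL)// (flin_lin hL').
- by split; apply: flin_sub.
have [l [C HC]] := flin_bound hL k; have [l' [C' HC']] := flin_bound hL' k.
exists (maxn l l'), (Num.max `|C| `|C'|) => x hx; rewrite pn_prod ge_max.
apply/andP; split.
  apply: (le_trans (HC _ hx)); apply: (@le_trans _ _ (`|C| * pn l x)).
    by rewrite ler_wpM2r ?ler_norm// pn_ge0.
  by apply: ler_pM; rewrite ?pn_ge0// ?le_max ?lexx// pn_mono// leq_maxl.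
apply: (le_trans (HC' _ hx)); apply: (@le_trans _ _ (`|C'| * pn l' x)).
  by rewrite ler_wpM2r ?ler_norm// pn_ge0.
by apply: ler_pM; rewrite ?pn_ge0// ?le_max ?lexx ?orbT// pn_mono// leq_maxr.
Qed.

Lemma flin_comp E F H {hE : is_frechet E} {hF : is_frechet F}
    (L : E -> F) (L' : F -> H) : flin L -> flin L' -> flin (L' \o L).
Proof.
move=> hL hL'; split=> [a x y hx hy|x hx|k] /=.
- by rewrite (flin_lin hL)// (flin_lin hL')//; exact: flin_sub.
- by apply/(flin_sub hL')/(flin_sub hL).
have [l [C HC]] := flin_bound hL' k.
have [l' [C' HC']] := flin_bound hL l.
exists l', (`|C| * C') => x hx; have hLx := flin_sub hL hx.
apply: (le_trans (HC _ hLx)).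
rewrite -mulrA; apply: (@le_trans _ _ (`|C| * pn l (L x))).
  by rewrite ler_wpM2r ?pn_ge0// ler_norm.
by rewrite ler_wpM2l// HC'.
Qed.

Lemma flin_add E {hE : is_frechet E} :
  flin ((fun p => p.1 + p.2) : prodModel E E -> E).
Proof.
split=> [a [x1 x2] [y1 y2] _ _|[x y] [/= hx hy]|k] /=.
- by rewrite scalerDr addrACA.
- by fsub.
exists k, 2 => -[x y] [/= hx hy]; apply: (le_trans (pnD k hx hy)).
by rewrite pn_prod mulr_natl; apply: lerD; rewrite le_max lexx ?orbT.
Qed.

Lemma flin_scale E {hE : is_frechet E} (a : R) : flin (( *:%R a) : E -> E).
Proof.
split=> [b x y _ _|x hx|k]; first by rewrite scalerDr !scalerA mulrC.
  by fsub.
by exists k, `|a| => x hx; rewrite pnZ.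
Qed.

End Linear.

Section Classes.
Context {R : realType}.
Implicit Types E F H : frechetModel R.

Lemma fclass_cont k E F (U : set E) (f : E -> F) : fclass k U f -> fcontinuous U f.
Proof. by case: k => [|k] []. Qed.

Lemma fclass_sub k E F (U : set E) (f : E -> F) x : fclass k U f -> U x -> fsub F (f x).
Proof. by move=> /fclass_cont h /h[]. Qed.

Lemma fcontinuousS E F (U V : set E) (f : E -> F) : V `<=` U ->
  fcontinuous U f -> fcontinuous V f.
Proof.
move=> VU h x Vx; have [fx H] := h x (VU _ Vx); split=> // k e e0.
have [l [d [d0 Hd]]] := H k e e0; exists l, d; split=> // y Vy; apply: Hd; exact: VU.
Qed.

Lemma fclassS k E F (U V : set E) (f : E -> F) : V `<=` U ->
  fclass k U f -> fclass k V f.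
Proof.
elim: k E F U V f => [|k IH] E F U V f VU [cf].
  by move=> _; split=> //; exact: fcontinuousS cf.
move=> [df [hdf cdf]]; split; first exact: fcontinuousS cf.
exists df; split=> [x v Vx hv|]; first by apply: hdf => //; exact: VU.
by apply: IH cdf => -[x v] [/= /VU ? ?]; split.
Qed.

Lemma fclassW k E F (U : set E) (f : E -> F) : fclass k.+1 U f -> fclass k U f.
Proof.
elim: k E F U f => [|k IH] E F U f [cf [df [hdf cdf]]]; first by split.
by split=> //; exists df; split=> //; exact: IH.
Qed.

Lemma fcontinuous_congr E F (U : set E) (f g : E -> F) :
  (forall x, U x -> f x = g x) -> fcontinuous U f -> fcontinuous U g.
Proof.
move=> fg h x Ux; have [fx H] := h x Ux; rewrite -fg//; split=> // k e e0.
have [l [d [d0 Hd]]] := H k e e0; exists l, d; split=> // y Uy yx.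
by rewrite -fg//; exact: Hd.
Qed.

Lemma fclass_congr k E F {hE : is_frechet E} (U : set E) (f g : E -> F) :
  fopen U -> (forall x, U x -> f x = g x) -> fclass k U f -> fclass k U g.
Proof.
move=> oU fg; case: k => [|k] [cf]; first by split=> //; exact: fcontinuous_congr cf.
move=> [df [hdf cdf]]; split; first exact: fcontinuous_congr cf.
exists df; split=> // x v Ux hv.
by apply: (dderiv_congr oU fg Ux hv); exact: hdf.
Qed.

(** A choice of the derivative that depends on [f] alone. By uniqueness it agrees with any
    derivative given on an open set, so derivatives known locally, or class by class, fit
    together. *)
Definition dfun E F (f : E -> F) : prodModel E E -> F :=
  fun p => xget 0 [set w | has_dderiv f p.1 p.2 w].

Lemma dfunE E F {hE : is_frechet E} {hF : is_frechet F} (U : set E) (f : E -> F) x v w :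
  fopen U -> (forall y, U y -> fsub F (f y)) -> U x -> fsub E v ->
  has_dderiv f x v w -> dfun f (x, v) = w.
Proof.
move=> oU fU Ux hv hw; apply: (dderiv_unique oU fU Ux hv _ hw).
exact: (@xgetPex _ 0 [set w | has_dderiv f x v w] (ex_intro _ w hw)).
Qed.

Lemma fclass_local k E F {hE : is_frechet E} {hF : is_frechet F}
    (U : set E) (f : E -> F) :
  fopen U -> (forall x, U x -> exists V, [/\ fopen V, V x & fclass k V f]) ->
  fclass k U f.
Proof.
elim: k E F hE hF U f => [|k IH] E F hE hF U f oU h.
all: have US : U `<=` fsub E by case/fopenP: oU.
all: have cf : fcontinuous U f.
1,3: apply/(fcontP _ US) => x Ux; have [V [oV Vx /fclass_cont]] := h x Ux.
1,2: have /fopenP[VS oV'] := oV; move=> /(fcontP _ VS)/(_ x Vx)[fx H]; split=> // m e e0.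
1,2: have [l [d [d0 Hd]]] := H m e e0; have [l' [d' [d'0 Hd']]] := oV' x Vx.
1,2: exists (maxn l l'), (Num.min d d'); split; first by rewrite lt_min d0.
1,2: move=> y Uy; rewrite lt_min => /andP[y1 y2]; apply: Hd.
1,3: apply: Hd'; [exact: US|apply: le_lt_trans y2; apply: pn_mono; exact: leq_maxr].
1,2: by apply: le_lt_trans y1; apply: pn_mono; exact: leq_maxl.
  by split.
split=> //; exists (dfun f); split=> [x v Ux hv|].
  have [V [oV Vx [cV [df [hdf cdf]]]]] := h x Ux.
  have fV y : V y -> fsub F (f y) by case/cV.
  by rewrite (dfunE oV fV Vx hv (hdf _ _ Vx hv)); exact: hdf.
apply: IH; first by apply: fopen_prod => //; exact: fopen_fsub.
move=> [x v] [/= Ux hv]; have [V [oV Vx [cV [df [hdf cdf]]]]] := h x Ux.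
have oVE : fopen (V `*` fsub E : set (prodModel E E)) by apply: fopen_prod => //; exact: fopen_fsub.
exists (V `*` fsub E); split=> //; apply: fclass_congr cdf => // -[y u] [/= Vy hu].
have fV z : V z -> fsub F (f z) by case/cV.
by rewrite (dfunE oV fV Vy hu (hdf _ _ Vy hu)).
Qed.

Lemma fclass_lin k E F {hE : is_frechet E} {hF : is_frechet F} (L : E -> F) (U : set E) :
  U `<=` fsub E -> flin L -> fclass k U L.
Proof.
move=> US hL; apply: (fclassS US) => {U US}.
elim: k E F hE hF L hL => [|k IH] E F hE hF L hL; first by split=> //; exact: flin_cont.
split; first exact: flin_cont.
exists (L \o snd); split=> [x v hx hv|]; first exact: flin_dderiv.
by apply: (fclassS _ (IH (prodModel E E) F _ _ (L \o snd) _)) => //; apply: flin_comp => //; exact: flin_snd.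
Qed.

Lemma fcontinuous_pair E F H (U : set E) (f : E -> F) (g : E -> H) : U `<=` fsub E ->
  fcontinuous U f -> fcontinuous U g ->
  fcontinuous U ((fun x => (f x, g x)) : E -> prodModel F H).
Proof.
move=> US /(fcontP _ US) cf /(fcontP _ US) cg; apply/(fcontP _ US) => x Ux.
have [fx Hf] := cf x Ux; have [gx Hg] := cg x Ux; split=> // k e e0.
have [l [d [d0 Hd]]] := Hf k e e0; have [l' [d' [d'0 Hd']]] := Hg k e e0.
exists (maxn l l'), (Num.min d d'); split; first by rewrite lt_min d0.
move=> y Uy; rewrite lt_min => /andP[y1 y2]; rewrite pn_prodB /= gt_max.
apply/andP; split; first by apply: Hd => //; apply: le_lt_trans y1; apply: pn_mono; exact: leq_maxl.
by apply: Hd' => //; apply: le_lt_trans y2; apply: pn_mono; exact: leq_maxr.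
Qed.

Lemma dderiv_pair E F H (f : E -> F) (g : E -> H) x v w w' :
  has_dderiv f x v w -> has_dderiv g x v w' ->
  has_dderiv ((fun x => (f x, g x)) : E -> prodModel F H) x v (w, w').
Proof.
move=> [hw Hf] [hw' Hg]; split=> // k e e0.
have [d [d0 Hd]] := Hf k e e0; have [d' [d'0 Hd']] := Hg k e e0.
exists (Num.min d d'); split; first by rewrite lt_min d0.
move=> t t0; rewrite lt_min => /andP[t1 t2].
have /fballP[h1 h2] := Hd t t0 t1; have /fballP[h3 h4] := Hd' t t0 t2.
by apply/fballP; rewrite pn_prodB gt_max h2 h4.
Qed.

Lemma fclass_pair k E F H (U : set E) (f : E -> F) (g : E -> H) : U `<=` fsub E ->
  fclass k U f -> fclass k U g ->
  fclass k U ((fun x => (f x, g x)) : E -> prodModel F H).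
Proof.
elim: k E F H U f g => [|k IH] E F H U f g US [cf].
  by move=> _ [cg _]; split=> //; exact: fcontinuous_pair.
move=> [df [hdf cdf]] [cg [dg [hdg cdg]]]; split; first exact: fcontinuous_pair.
exists (fun p => (df p, dg p)); split=> [x v Ux hv|].
  by apply: dderiv_pair; [exact: hdf|exact: hdg].
by apply: IH => // -[x v] [/= /US].
Qed.

(** The derivative of [g \o f] is [dg] composed with the tangent map of [f]. This is a composite of
    maps one class lower, but over product spaces, so the induction quantifies over all spaces. *)
Lemma fclass_comp k E F H {hE : is_frechet E} {hF : is_frechet F} {hH : is_frechet H}
    (U : set E) (V : set F) (f : E -> F) (g : F -> H) :
  fopen U -> fopen V -> (forall x, U x -> V (f x)) ->
  fclass k U f -> fclass k V g -> fclass k U (g \o f).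
Proof.
elim: k E F H hE hF hH U V f g => [|k IH] E F H hE hF hH U V f g oU oV fU.
all: have US : U `<=` fsub E by case/fopenP: oU.
all: have VS : V `<=` fsub F by case/fopenP: oV.
  by move=> [cf _] [cg _]; split=> //; exact: (fcontinuous_comp US VS).
move=> fU1 [cg [dg [hdg cdg]]]; have [cf [df [hdf cdf]]] := fU1.
split; first exact: (fcontinuous_comp US VS).
have gV y : V y -> fsub H (g y) by case/cg.
exists (dg \o (fun p => (f p.1, df p))); split=> [x v Ux hv|].
  apply: (dderiv_comp oU oV fU gV hdg (fclass_cont cdg) Ux hv).
  exact: hdf.
have oUE : fopen (U `*` fsub E : set (prodModel E E)).
  by apply: fopen_prod => //; exact: fopen_fsub.
have UES : (U `*` fsub E : set (prodModel E E)) `<=` fsub (prodModel E E).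
  by move=> [x v] [/= /US].
apply: (IH _ _ _ _ _ _ _ (V `*` fsub F : set (prodModel F F))) cdg => //.
- by apply: fopen_prod => //; exact: fopen_fsub.
- by move=> [x v] [/= Ux hv]; split; [exact: fU|exact: (hdf _ _ Ux hv).1].
have fU0 := fclassW fU1.
apply: fclass_pair => //.
apply: (IH (prodModel E E) E F _ _ _ _ U fst f) => //.
- by move=> p [].
by apply: fclass_lin => //; exact: flin_fst.
Qed.

Definition smul F : prodModel (@line R) F -> F := fun p => (p.1 : R) *: p.2.

(** The derivative of scalar multiplication is a sum of two scalar multiplications composed with
    linear projections, so the induction on the class closes up. *)
Lemma fclass_smul k F {hF : is_frechet F} : fclass k (fsub (prodModel line F)) (@smul F).
Proof.
have cs : fcontinuous (fsub (prodModel line F)) (@smul F).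
  apply/fcontP => // -[a x] [/= _ hx]; split=> [|m e e0]; first by rewrite /smul /=; fsub.
  note (pn_ge0 m hx) => px.
  (* The two terms of the increment are bounded by [d * pn m x] and [d * (|a| + 1)]; the second
     bound uses [d <= 1]. *)
  pose d := Num.min 1 (e / (`|a| + pn m x + 2)).
  have D0 : 0 < `|a| + pn m x + 2 by have := normr_ge0 a; lra.
  have d0 : 0 < d by rewrite lt_min ltr01 divr_gt0.
  exists m, d; split=> // -[b y] [/= _ hy]; rewrite pn_prodB /= gt_max => /andP[h1 h2].
  have nb : `|b - a| < d by apply: le_lt_trans h1; exact: (fsn_le_pn m (b - a : line)).
  have -> : smul (b, y) - smul (a, x) = (b - a) *: x + b *: (y - x).
    by rewrite /smul /= scalerBl scalerBr addrA [RHS](ACl (3*2*(1*4)))/= subrr addr0.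
  have hyx : fsub F (y - x) by fsub.
  apply: (le_lt_trans (pnD _ _ _)); [by fsub|by fsub|]; rewrite !pnZ//.
  have d1 : d <= 1 by rewrite ge_min lexx.
  have de : d * (`|a| + pn m x + 2) <= e.
    by rewrite -ler_pdivlMr// ge_min lexx orbT.
  have b1 : `|b| <= `|a| + 1.
    have -> : b = a + (b - a) by rewrite addrC subrK.
    by apply: (le_trans (ler_normD _ _)); rewrite lerD2l (le_trans (ltW nb)).
  have H1 : `|b - a| * pn m x <= d * pn m x by rewrite ler_wpM2r// ltW.
  have H2 : `|b| * pn m (y - x) <= (`|a| + 1) * d.
    by apply: ler_pM; rewrite ?pn_ge0// ltW.
  move: H1 H2 de d0; clear; rewrite !mulrDr mulrDl (mulrC d `|a|); lra.
elim: k => [|k IH]; first by split.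
split=> //.
exists (fun q => smul (q.1.1, q.2.2) + smul (q.2.1, q.1.2)); split.
  move=> [a x] [b y] [/= _ hx] [/= _ hy].
  have hs p : fsub (prodModel line F) p -> fsub F (smul p).
    by case: p => c z [/= _ hz]; rewrite /smul; fsub.
  apply/(has_dderivE _ (fopen_fsub _) hs) => //; split; first by rewrite /smul /=; fsub.
  move=> m e e0; note (pn_ge0 m hy) => py.
  have D0 : 0 < `|b| * pn m y + 1 by rewrite ltr_wpDl// mulr_ge0.
  exists (e / (`|b| * pn m y + 1)); first by rewrite divr_gt0.
  move=> t; rewrite ltr_pdivlMr// => td.
  have -> : smul ((a, x) + t *: (b, y) : prodModel line F) - smul (a, x) -
      t *: (smul (a, y) + smul (b, x)) = (t * t) *: (b *: y).
    rewrite /smul /= !scalerDl !scalerDr !scalerA opprD !addrA.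
    rewrite (mulrC a t) -[(t *: b : R^o) * t]/(t * b * t) (mulrAC t b t).
    rewrite -[(t *: b : R^o)]/(t * b) -?scalerA.
    by rewrite [LHS](ACl (4*(1*5)*(2*6)*(3*7)))/= !subrr !addr0.
  rewrite pnZ; last by fsub.
  rewrite pnZ// normrM mulrAC ler_wpM2r//.
  apply: le_trans (ltW td); rewrite ler_wpM2l// lerDl//.
have S : (fsub (prodModel line F) `*` fsub (prodModel line F) : set (prodModel (prodModel line F) (prodModel line F))) = fsub _ by [].
have oS : fopen (fsub (prodModel (prodModel (@line R) F) (prodModel (@line R) F))) by exact: fopen_fsub.
rewrite S.
have H (L : prodModel (prodModel line F) (prodModel line F) -> prodModel line F) :
    flin L -> fclass k (fsub _) (@smul F \o L).
  move=> hL; apply: (fclass_comp (V := fsub (prodModel line F))) => //; first exact: fopen_fsub.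
    by move=> x; exact: (flin_sub hL).
  exact: fclass_lin.
pose P := (fun q : prodModel (prodModel line F) (prodModel line F) => (smul (q.1.1, q.2.2), smul (q.2.1, q.1.2))) : _ -> prodModel F F.
have -> : (fun q : prodModel (prodModel line F) (prodModel line F) => smul (q.1.1, q.2.2) + smul (q.2.1, q.1.2)) = (fun p => p.1 + p.2) \o P by [].
have PS q : fsub (prodModel (prodModel line F) (prodModel line F)) q -> fsub (prodModel F F) (P q).
  by case: q => -[a x] [b y] [[/= _ hx] [/= _ hy]]; split; rewrite /P /smul /=; fsub.
apply: (fclass_comp (V := fsub (prodModel F F))) => //; first exact: fopen_fsub.
  apply: fclass_pair => //; apply: H.
    by apply: flin_pair; [apply: (flin_comp (flin_fst _ _) (flin_fst _ _))|apply: (flin_comp (flin_snd _ _) (flin_snd _ _))].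
  by apply: flin_pair; [apply: (flin_comp (flin_snd _ _) (flin_fst _ _))|apply: (flin_comp (flin_fst _ _) (flin_snd _ _))].
by apply: fclass_lin => //; exact: flin_add.
Qed.

End Classes.

Section Smooth.
Context {R : realType}.
Implicit Types E F H : frechetModel R.

Lemma fsmooth_comp E F H {hE : is_frechet E} {hF : is_frechet F} {hH : is_frechet H}
    (U : set E) (V : set F) (f : E -> F) (g : F -> H) :
  fopen U -> fopen V -> (forall x, U x -> V (f x)) ->
  fsmooth U f -> fsmooth V g -> fsmooth U (g \o f).
Proof. by move=> oU oV fU sf sg k; exact: (fclass_comp oU oV fU (sf k) (sg k)). Qed.

Lemma fsmooth_pair E F H (U : set E) (f : E -> F) (g : E -> H) : U `<=` fsub E ->
  fsmooth U f -> fsmooth U g ->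
  fsmooth U ((fun x => (f x, g x)) : E -> prodModel F H).
Proof. by move=> US sf sg k; exact: fclass_pair. Qed.

Lemma fsmooth_lin E F {hE : is_frechet E} {hF : is_frechet F} (L : E -> F) (U : set E) :
  U `<=` fsub E -> flin L -> fsmooth U L.
Proof. by move=> US hL k; exact: fclass_lin. Qed.

Lemma fsmooth_pre E F H {hE : is_frechet E} {hF : is_frechet F} {hH : is_frechet H}
    (L : E -> F) (V : set F) (g : F -> H) (U : set E) :
  flin L -> fopen V -> fsmooth V g -> fopen U -> (forall x, U x -> V (L x)) ->
  fsmooth U (g \o L).
Proof.
move=> hL oV sg oU UV; apply: (fsmooth_comp oU oV UV _ sg).
by apply: fsmooth_lin => //; case/fopenP: oU.
Qed.

Lemma fsmooth_cst E F {hE : is_frechet E} {hF : is_frechet F} (U : set E) (y : F) :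
  U `<=` fsub E -> fsub F y -> fsmooth U (fun=> y).
Proof.
move=> US hy.
have ct : fcontinuous U (fun _ : E => y).
  apply/(fcontP _ US) => z _; split=> // k e e0; exists 0%N, 1; split=> // z' _ _.
  by rewrite subrr pn0.
case=> [|k]; split=> //; exists (fun=> 0); split.
  move=> u v _ _; split=> [|k' e e0]; first exact: fs0.
  exists 1; split=> // t _ _; rewrite subrr scaler0; apply/fballP.
  by rewrite subrr pn0; split=> //; exact: fs0.
apply: fclass_lin; first by move=> p [/US].
split=> [a u v _ _|u _|m].
- by rewrite scaler0 addr0.
- exact: fs0.
- by exists 0%N, 0 => u _; rewrite pn0 mul0r.
Qed.

Lemma fsmoothS E F (U V : set E) (f : E -> F) : V `<=` U -> fsmooth U f -> fsmooth V f.
Proof. by move=> VU sf k; exact: fclassS (sf k). Qed.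

Lemma fsmooth_congr E F {hE : is_frechet E} (U : set E) (f g : E -> F) :
  fopen U -> (forall x, U x -> f x = g x) -> fsmooth U f -> fsmooth U g.
Proof. by move=> oU fg sf k; exact: (fclass_congr oU fg). Qed.

Lemma fsmooth_local E F {hE : is_frechet E} {hF : is_frechet F}
    (U : set E) (f : E -> F) :
  fopen U -> (forall x, U x -> exists V, [/\ fopen V, V x & fsmooth V f]) ->
  fsmooth U f.
Proof.
move=> oU h k; apply: fclass_local => // x Ux.
by have [V [oV Vx sV]] := h x Ux; exists V.
Qed.

Lemma fsmooth_sub E F (U : set E) (f : E -> F) x : fsmooth U f -> U x -> fsub F (f x).
Proof. by move=> /(_ 0%N); exact: fclass_sub. Qed.

Lemma fsmooth_cont E F (U : set E) (f : E -> F) : fsmooth U f -> fcontinuous U f.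
Proof. by move=> /(_ 0%N); exact: fclass_cont. Qed.

(** Each class comes with its own derivative; uniqueness identifies all of them with [dfun f], which
    is therefore of every class. *)
Lemma fsmooth_dfun E F {hE : is_frechet E} {hF : is_frechet F} (U : set E) (f : E -> F) :
  fopen U -> fsmooth U f ->
  (forall x v, U x -> fsub E v -> has_dderiv f x v (dfun f (x, v))) /\
  fsmooth (U `*` fsub E : set (prodModel E E)) (dfun f).
Proof.
move=> oU sf.
have fU y : U y -> fsub F (f y) by exact: fsmooth_sub.
have oUE : fopen (U `*` fsub E : set (prodModel E E)).
  by apply: fopen_prod => //; exact: fopen_fsub.
have K k : exists df : prodModel E E -> F,
    [/\ forall x v, U x -> fsub E v -> has_dderiv f x v (df (x, v)),
        fclass k (U `*` fsub E : set (prodModel E E)) df &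
        forall p, (U `*` fsub E : set (prodModel E E)) p -> df p = dfun f p].
  have [_ [df [hdf cdf]]] := sf k.+1; exists df; split=> // -[x v] [/= Ux hv].
  by rewrite (dfunE oU fU Ux hv (hdf _ _ Ux hv)).
split=> [x v Ux hv|k].
  have [df [hdf _ e]] := K 0%N; rewrite -e//; exact: hdf.
by have [df [_ cdf e]] := K k; apply: fclass_congr cdf.
Qed.

Lemma fsmooth_preimage E F {hE : is_frechet E} {hF : is_frechet F}
    (U : set E) (V : set F) (f : E -> F) :
  fopen U -> fsmooth U f -> fopen V -> fopen (U `&` f @^-1` V).
Proof. by move=> oU /fsmooth_cont; exact: fopen_preimage. Qed.

End Smooth.

(** * Manifolds and submanifolds *)

Section SmoothIn.
Context {R : realType}.
Implicit Types E F H : frechetModel R.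

Definition chart_inj T E (c : chart T E) :=
  forall x y, cdom c x -> cdom c y -> cmap c x = cmap c y -> x = y.

(** The pointwise form of [smooth_map] in fixed charts. As [U] lies in the chart image, [h] is
    determined on [U] by [f], which makes gluing possible. *)
Definition smooth_in T T' E F (c : chart T E) (d : chart T' F) (f : T -> T') (x : T) :=
  exists U (h : E -> F), [/\ fopen U, U (cmap c x), fsmooth U h,
     U `<=` cmap c @` cdom c &
     forall y, cdom c y -> U (cmap c y) -> cdom d (f y) /\ h (cmap c y) = cmap d (f y)].

(** Since [c] is injective, all local representatives are restrictions of one function, picked here
    pointwise. *)
Lemma smooth_in_glue T T' E F {hE : is_frechet E} {hF : is_frechet F}
    (c : chart T E) (d : chart T' F) (f : T -> T') : chart_inj c ->
  let W := cdom c `&` f @^-1` cdom d in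
  (forall x, W x -> smooth_in c d f x) ->
  fopen (cmap c @` W) /\
  exists2 h : E -> F, fsmooth (cmap c @` W) h &
    forall x, W x -> h (cmap c x) = cmap d (f x).
Proof.
move=> ic W loc.
pose h (z : E) : F := xget 0 [set w | exists2 y, W y & cmap c y = z /\ w = cmap d (f y)].
have hE' x : W x -> h (cmap c x) = cmap d (f x).
  move=> Wx; rewrite /h; case: xgetP => [w _ [y Wy [yx ->]]|/(_ (cmap d (f x)))[]].
    by congr (cmap d (f _)); apply: ic => //; [case: Wy|case: Wx].
  by exists x.
have K x : W x -> exists V, [/\ fopen V, V (cmap c x), fsmooth V h & V `<=` cmap c @` W].
  move=> /loc[U [g [oU Ux sg Uc Ug]]].
  have UW : U `<=` cmap c @` W.
    move=> z Uz; have [y cy yz] := Uc z Uz.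
    by exists y => //; split=> //; rewrite /preimage /=; have [] := Ug y cy ltac:(by rewrite yz).
  exists U; split=> //; apply: fsmooth_congr sg => // z Uz.
  have [y [cy dy] yz] := UW z Uz.
  rewrite -yz hE'//; have [] := Ug y cy ltac:(by rewrite yz) => _ ->//.
have oW : fopen (cmap c @` W).
  by apply: fopen_cover => z [x Wx <-]; have [V [oV Vx _ VW]] := K x Wx; exists V.
split=> //; exists h => //; apply: fsmooth_local => // z [x Wx <-].
by have [V [oV Vx sV _]] := K x Wx; exists V.
Qed.

Lemma smooth_in_comp T T' T2 E F H {hE : is_frechet E} {hF : is_frechet F}
    {hH : is_frechet H} (c : chart T E) (d : chart T' F) (e : chart T2 H) f g x :
  chart_inj d -> cdom c x -> smooth_in c d f x -> smooth_in d e g (f x) ->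
  smooth_in c e (g \o f) x.
Proof.
move=> id cx [U [h [oU Ux sh Uc Uh]]] [V [k [oV Vx sk Vd Vk]]].
have [dfx hx] := Uh x cx Ux.
exists (U `&` h @^-1` V), (k \o h); split.
- exact: fsmooth_preimage.
- by split=> //; rewrite /preimage /= hx.
- apply: (fsmooth_comp _ oV) sk => //; first exact: fsmooth_preimage.
    by move=> z [].
  by apply: fsmoothS sh => z [].
- by move=> z [/Uc].
move=> y cy [Uy]; rewrite /preimage /=; have [dy ->] := Uh y cy Uy => Vy.
by have [ey ->] := Vk (f y) dy Vy.
Qed.

Lemma smooth_in_pair T T' T2 E F H {hE : is_frechet E}
    (c : chart T E) (d : chart T' F) (e : chart T2 H) f g x :
  smooth_in c d f x -> smooth_in c e g x ->
  smooth_in c (@Chart R _ (prodModel F H) (cdom d `*` cdom e)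
    (fun p => (cmap d p.1, cmap e p.2))) (fun y => (f y, g y)) x.
Proof.
move=> [U [h [oU Ux sh Uc Uh]]] [V [k [oV Vx sk Vc Vk]]].
exists (U `&` V), (fun z => (h z, k z)); split.
- exact: fopenI.
- by [].
- apply: fsmooth_pair; first by have /fopenP[US _] := oU; move=> z [/US].
    by apply: fsmoothS sh => z [].
  by apply: fsmoothS sk => z [].
- by move=> z [/Uc].
by move=> y cy [Uy Vy]; have [? ->] := Uh y cy Uy; have [? ->] := Vk y cy Vy.
Qed.

Lemma smooth_in_congr T T' E F {hE : is_frechet E} (c : chart T E) (d : chart T' F)
    f g x U : chart_inj c -> smooth_in c d f x -> fopen U -> U (cmap c x) ->
  (forall y, cdom c y -> U (cmap c y) -> f y = g y) -> smooth_in c d g x.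
Proof.
move=> ic [V [h [oV Vx sh Vc Vh]]] oU Ux fg.
exists (V `&` U), h; split=> //; first exact: fopenI.
- by apply: fsmoothS sh => z [].
- by move=> z [/Vc].
by move=> y cy [Vy Uy]; rewrite -fg//; exact: Vh.
Qed.

Lemma smooth_map_in T T' E F (M : mfd T E) (N : mfd T' F) f c d x :
  chart_inj c -> smooth_map M N f -> atlas M c -> atlas N d ->
  cdom c x -> cdom d (f x) -> smooth_in c d f x.
Proof.
move=> ic [_ sf] Mc Nd cx dx; have [oW [h sh hE]] := sf c d Mc Nd.
exists (cmap c @` (cdom c `&` f @^-1` cdom d)), h; split=> //.
- by exists x.
- by move=> z [y [cy _] <-]; exists y.
move=> y cy [y' [cy' dy'] /ic e]; rewrite -e//; split=> //.
exact: hE.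
Qed.

End SmoothIn.

Section Premfd.
Context {R : realType}.
Implicit Types E F H : frechetModel R.

(** [is_manifold] without the Hausdorff axiom. *)
Record premfd T E (M : mfd T E) : Prop := {
  pm_model : is_frechet E;
  pm_dom : forall c, atlas M c -> cdom c `<=` carrier M;
  pm_inj : forall c, atlas M c -> chart_inj c;
  pm_cover : forall x, carrier M x -> exists2 c, atlas M c & cdom c x;
  pm_compatible : smooth_map M M id }.

Definition smooth_at T T' E F (M : mfd T E) (N : mfd T' F) (f : T -> T') (x : T) :=
  exists c d, [/\ atlas M c, atlas N d, cdom c x, cdom d (f x) & smooth_in c d f x].

(** Neighbourhoods read off in a chart; [P] is an arbitrary set, so properties and preimages can be
    used without intersecting them with the carrier. *)
Definition mnear T E (M : mfd T E) (x : T) (P : set T) :=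
  exists c U, [/\ atlas M c, cdom c x, fopen U, U (cmap c x) &
    U `<=` cmap c @` (cdom c `&` P)].

End Premfd.

Existing Class premfd.
#[global] Hint Extern 1 (is_frechet _) =>
  match goal with h : premfd _ |- _ => exact (pm_model h) end : typeclass_instances.

Section PremfdTheory.
Context {R : realType}.
Implicit Types E F H : frechetModel R.

Lemma is_manifold_premfd T E (M : mfd T E) : is_manifold M -> premfd M.
Proof. by case=> *; split. Qed.

(** Transition maps of [B] factor as [g] after [f] through a chart of [M], which gives compatibility
    of the atlas. *)
Lemma premfd_of_maps T T' E F (M : mfd T E) (B : mfd T' F) (f : T' -> T) (g : T -> T')
   {hM : premfd M} : is_frechet F ->
  (forall c, atlas B c -> cdom c `<=` carrier B) ->
  (forall c, atlas B c -> chart_inj c) ->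
  (forall x, carrier B x -> exists2 c, atlas B c & cdom c x) ->
  smooth_map B M f -> smooth_map M B g -> (forall x, carrier B x -> g (f x) = x) ->
  premfd B.
Proof.
move=> hF Bd Bi Bc sf sg fK; split=> //; split=> // c d Hc Hd.
apply: (@smooth_in_glue _ _ _ _ _ _ _ c d id) => [|x [cx dx]]; first exact: Bi.
have Bx := Bd _ Hc _ cx; have Mx := sf.1 x Bx.
have [e Me ex] := pm_cover hM Mx.
have h1 := smooth_map_in (Bi _ Hc) sf Hc Me cx ex.
have h2 : smooth_in e d g (f x).
  by apply: (smooth_map_in (pm_inj hM Me) sg Me Hd ex); rewrite fK.
have [U [h [oU Ux sh Uc Uh]]] := smooth_in_comp (pm_inj hM Me) cx h1 h2.
exists U, h; split=> // y cy /(Uh y cy)/=.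
by rewrite fK//; exact: (Bd _ Hc).
Qed.

Section Near.
Context T E (M : mfd T E) {hM : premfd M}.

Lemma mnear_in x P c : mnear M x P -> atlas M c -> cdom c x ->
  exists U, [/\ fopen U, U (cmap c x) & U `<=` cmap c @` (cdom c `&` P)].
Proof.
move=> [c0 [U [Mc0 c0x oU Ux UP]]] Mc cx.
have [V [h [oV Vx sh Vc Vh]]] :=
  smooth_map_in (pm_inj hM Mc) (pm_compatible hM) Mc Mc0 cx c0x.
exists (V `&` h @^-1` U); split.
- exact: fsmooth_preimage.
- by split=> //; have [_] := Vh x cx Vx; rewrite /preimage /= => ->.
move=> z [Vz]; have [y cy yz] := Vc z Vz.
have [c0y] := Vh y cy ltac:(by rewrite yz).
rewrite /preimage /= -yz => -> /UP[y' [c0y' Py']] /(pm_inj hM Mc0 c0y' c0y) e.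
by exists y => //; split=> //; rewrite -e.
Qed.

Lemma mnear_carrier x P : mnear M x P -> carrier M x.
Proof. by move=> [c [U [Mc cx _ _ _]]]; exact: (pm_dom hM Mc). Qed.

Lemma mnear_self x P : mnear M x P -> P x.
Proof.
move=> [c [U [Mc cx oU Ux UP]]]; have [y [cy Py]] := UP _ Ux.
by move=> /(pm_inj hM Mc cy cx) <-.
Qed.

Lemma mnear_sub x (P Q : set T) : mnear M x P ->
  (forall y, carrier M y -> P y -> Q y) -> mnear M x Q.
Proof.
move=> [c [U [Mc cx oU Ux UP]]] PQ; exists c, U; split=> // z /UP[y [cy Py] <-].
by exists y => //; split=> //; apply: PQ => //; exact: (pm_dom hM Mc).
Qed.

Lemma mnearI x P Q : mnear M x P -> mnear M x Q -> mnear M x (P `&` Q).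
Proof.
move=> [c [U [Mc cx oU Ux UP]]] nQ.
have [V [oV Vx VQ]] := mnear_in nQ Mc cx.
exists c, (U `&` V); split=> //; first exact: fopenI.
move=> z [/UP[y [cy Py] <-] /VQ[y' [cy' Qy'] /(pm_inj hM Mc cy' cy) e]].
by rewrite e in Qy'; exists y.
Qed.

Lemma mnearT x : carrier M x -> mnear M x (carrier M).
Proof.
move=> Mx; have [c Mc cx] := pm_cover hM Mx.
have [oW _] := (pm_compatible hM).2 c c Mc Mc.
exists c, (cmap c @` (cdom c `&` id @^-1` cdom c)); split=> //; first by exists x.
by move=> z [y [cy _] <-]; exists y => //; split=> //; exact: (pm_dom hM Mc).
Qed.

Lemma mnear_dom x c : atlas M c -> cdom c x -> mnear M x (cdom c).
Proof.
move=> Mc cx; have [oW _] := (pm_compatible hM).2 c c Mc Mc.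
exists c, (cmap c @` (cdom c `&` id @^-1` cdom c)); split=> //; first by exists x.
Qed.

End Near.

Section Change.
Context T T' E F (M : mfd T E) (N : mfd T' F) {hM : premfd M} {hN : premfd N}.

Lemma smooth_in_change c d c' d' f x : atlas M c -> atlas N d -> atlas M c' ->
  atlas N d' -> cdom c x -> cdom d (f x) -> cdom c' x -> cdom d' (f x) ->
  smooth_in c d f x -> smooth_in c' d' f x.
Proof.
move=> Mc Nd Mc' Nd' cx dx c'x d'x h.
have h1 := smooth_map_in (pm_inj hM Mc') (pm_compatible hM) Mc' Mc c'x cx.
have h2 := smooth_map_in (pm_inj hN Nd) (pm_compatible hN) Nd Nd' dx d'x.
note (smooth_in_comp (pm_inj hM Mc) c'x h1 h) => h3.
exact: (smooth_in_comp (pm_inj hN Nd) c'x h3 h2).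
Qed.

Lemma smooth_at_in f x c d : smooth_at M N f x -> atlas M c -> atlas N d ->
  cdom c x -> cdom d (f x) -> smooth_in c d f x.
Proof.
move=> [c' [d' [Mc' Nd' c'x d'x h]]] Mc Nd cx dx.
by apply: (smooth_in_change Mc' Nd') h.
Qed.

Lemma smooth_mapP f : smooth_map M N f <->
  (forall x, carrier M x -> carrier N (f x)) /\
  (forall x, carrier M x -> smooth_at M N f x).
Proof.
split=> [sf|[fN sf]].
  split=> [|x Mx]; first by case: sf.
  have [c Mc cx] := pm_cover hM Mx; have [d Nd dx] := pm_cover hN (sf.1 _ Mx).
  exists c, d; split=> //; exact: smooth_map_in (pm_inj hM Mc) sf Mc Nd cx dx.
split=> // c d Mc Nd; apply: smooth_in_glue; first exact: pm_inj hM _ Mc.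
move=> x [cx dx]; apply: smooth_at_in => //; apply: sf; exact: (pm_dom hM Mc).
Qed.

Lemma smooth_map_at f x : smooth_map M N f -> carrier M x -> smooth_at M N f x.
Proof. by move=> /smooth_mapP[_]; apply. Qed.

Lemma smooth_at_near f x P : smooth_at M N f x -> mnear N (f x) P ->
  mnear M x (f @^-1` P).
Proof.
move=> [c [d [Mc Nd cx dx [U [h [oU Ux sh Uc Uh]]]]]] nP.
have [V [oV Vx VP]] := mnear_in nP Nd dx.
exists c, (U `&` h @^-1` V); split=> //.
- exact: fsmooth_preimage.
- by split=> //; have [_] := Uh x cx Ux; rewrite /preimage /= => ->.
move=> z [Uz]; have [y cy yz] := Uc z Uz.
have [dy] := Uh y cy ltac:(by rewrite yz).
rewrite /preimage /= -yz => -> /VP[y' [dy' Py'] /(pm_inj hN Nd dy' dy) e].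
by exists y => //; split=> //; rewrite /preimage /= -e.
Qed.

Lemma smooth_at_congr f g x : smooth_at M N f x ->
  mnear M x [set y | f y = g y] -> smooth_at M N g x.
Proof.
move=> [c [d [Mc Nd cx dx h]]] nfg; have e := mnear_self nfg.
exists c, d; split=> //; first by rewrite -e.
have [U [oU Ux UP]] := mnear_in nfg Mc cx.
apply: (smooth_in_congr (pm_inj hM Mc) h oU Ux) => y cy /UP[y' [cy' Py']].
by move=> /(pm_inj hM Mc cy' cy) <-.
Qed.

End Change.

Lemma smooth_at_id T E (M : mfd T E) {hM : premfd M} x : carrier M x -> smooth_at M M id x.
Proof. by move=> Mx; apply: smooth_map_at => //; exact: (pm_compatible hM). Qed.

Lemma smooth_at_comp T T' T2 E F H (M : mfd T E) (N : mfd T' F) (P : mfd T2 H)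
    {hM : premfd M} {hN : premfd N} {hP : premfd P} f g x :
  smooth_at M N f x -> smooth_at N P g (f x) -> smooth_at M P (g \o f) x.
Proof.
move=> [c [d [Mc Nd cx dx h]]] [d' [e [Nd' Pe d'x ex h']]].
exists c, e; split=> //.
have h'' := smooth_in_change Nd' Pe Nd Pe d'x ex dx ex h'.
exact: (smooth_in_comp (pm_inj hN Nd) cx h (h'' _ _)).
Qed.

Lemma smooth_at_pair T T' T2 E F H (M : mfd T E) (N : mfd T' F) (P : mfd T2 H)
    {hM : premfd M} {hN : premfd N} {hP : premfd P} f g x :
  smooth_at M N f x -> smooth_at M P g x ->
  smooth_at M (prodMfd N P) (fun y => (f y, g y)) x.
Proof.
move=> [c [d [Mc Nd cx dx h]]] [c' [e [Mc' Pe c'x ex h']]].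
exists c, (@Chart R _ (prodModel F H) (cdom d `*` cdom e)
    (fun p => (cmap d p.1, cmap e p.2))); split=> //; first by exists d, e.
apply: smooth_in_pair => //.
exact: (smooth_in_change Mc' Pe Mc Pe).
Qed.

Lemma smooth_in_prod T1 T2 S1 S2 E1 E2 F1 F2 {hE1 : is_frechet E1} {hE2 : is_frechet E2}
    {hF1 : is_frechet F1} {hF2 : is_frechet F2}
    (c1 : chart T1 E1) (c2 : chart T2 E2) (d1 : chart S1 F1) (d2 : chart S2 F2)
    (f : T1 -> S1) (g : T2 -> S2) x1 x2 :
  chart_inj c1 -> chart_inj c2 -> smooth_in c1 d1 f x1 -> smooth_in c2 d2 g x2 ->
  smooth_in (@Chart R _ (prodModel E1 E2) (cdom c1 `*` cdom c2)
               (fun p => (cmap c1 p.1, cmap c2 p.2)))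
            (@Chart R _ (prodModel F1 F2) (cdom d1 `*` cdom d2)
               (fun p => (cmap d1 p.1, cmap d2 p.2)))
            (fun p => (f p.1, g p.2)) (x1, x2).
Proof.
move=> i1 i2 [U [h [oU Ux sh Uc Uh]]] [V [k [oV Vx sk Vc Vk]]].
have oUV : fopen (U `*` V : set (prodModel E1 E2)) by exact: fopen_prod.
have UVS : (U `*` V : set (prodModel E1 E2)) `<=` fsub (prodModel E1 E2) by case/fopenP: oUV.
exists (U `*` V), (fun z => (h z.1, k z.2)); split=> //=.
- apply: fsmooth_pair => //.
    by apply: (fsmooth_pre (flin_fst E1 E2) oU sh oUV) => z [].
  by apply: (fsmooth_pre (flin_snd E1 E2) oV sk oUV) => z [].
- by move=> [z1 z2] [/= /Uc[y1 ? <-] /Vc[y2 ? <-]]; exists (y1, y2).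
move=> [y1 y2] [/= c1y c2y] [/= Uy Vy].
by have [? ->] := Uh y1 c1y Uy; have [? ->] := Vk y2 c2y Vy.
Qed.

#[global] Instance prod_premfd T T' E F (M : mfd T E) (N : mfd T' F)
  (hM : premfd M) (hN : premfd N) : premfd (prodMfd M N).
Proof.
have ic c : atlas (prodMfd M N) c -> chart_inj c.
  move=> [c1 [c2 [Mc1 Nc2 ->]]] [x1 x2] [y1 y2] [/= ? ?] [/= ? ?] [e1 e2].
  by rewrite (pm_inj hM Mc1 _ _ e1)// (pm_inj hN Nc2 _ _ e2).
split=> //.
- apply: prod_frechet; exact: pm_model.
- move=> c [c1 [c2 [Mc1 Nc2 ->]]] [x1 x2] [/= h1 h2].
  by split; [exact: (pm_dom hM Mc1)|exact: (pm_dom hN Nc2)].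
- move=> [x1 x2] [/= h1 h2].
  have [c1 Mc1 cx1] := pm_cover hM h1; have [c2 Nc2 cx2] := pm_cover hN h2.
  by eexists; first (by exists c1, c2; split; [exact: Mc1|exact: Nc2|reflexivity]).
split=> // c d Mc Nd; apply: smooth_in_glue; first exact: ic.
move: Mc Nd => [c1 [c2 [Mc1 Nc2 ->]]] [d1 [d2 [Md1 Nd2 ->]]] [x1 x2] [[/= ? ?] [/= ? ?]].
have h1 := smooth_map_in (pm_inj hM Mc1) (pm_compatible hM) Mc1 Md1.
have h2 := smooth_map_in (pm_inj hN Nc2) (pm_compatible hN) Nc2 Nd2.
have [U [h [? ? ? ? Uh]]] := smooth_in_prod (pm_inj hM Mc1) (pm_inj hN Nc2) (h1 x1 ltac:(by []) ltac:(by [])) (h2 x2 ltac:(by []) ltac:(by [])) .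
by exists U, h; split=> // -[y1 y2] /= cy /(Uh _ cy).
Qed.

Lemma smooth_in_vec T E F {hE : is_frechet E} (c : chart T E) (f : E -> F) x (U : set E) :
  U `<=` cmap c @` cdom c -> fopen U -> cdom c x -> U (cmap c x) -> fsmooth U f ->
  smooth_in c (Chart (fsub F) id) (f \o cmap c) x.
Proof.
move=> Uc oU cx Ux sf; exists U, f; split=> // y cy Uy; split=> //.
exact: (fsmooth_sub sf).
Qed.

#[global] Instance vec_premfd E (hE : is_frechet E) : premfd (vecMfd E).
Proof.
split=> //.
- by move=> c ->.
- by move=> c -> x y.
- by move=> x Ex; exists (Chart (fsub E) id).
split=> // c d -> ->; apply: smooth_in_glue => [x y _ _ //|x [Ex _]].
exists (fsub E), id; split=> //; first exact: fopen_fsub.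
  by apply: fsmooth_lin => //; exact: flin_id.
by move=> z Ez; exists z.
Qed.

Lemma smooth_at_vec E F {hE : is_frechet E} {hF : is_frechet F} (f : E -> F) x (U : set E) :
  fopen U -> U x -> fsmooth U f -> smooth_at (vecMfd E) (vecMfd F) f x.
Proof.
move=> oU Ux sf; have US : U `<=` fsub E by case/fopenP: oU.
exists (Chart (fsub E) id), (Chart (fsub F) id); split=> //=; first exact: US.
  exact: fsmooth_sub sf Ux.
apply: (@smooth_in_vec _ _ _ _ (Chart (fsub E) id) f x U) => //=; last exact: US.
by move=> z /US Ez; exists z.
Qed.

Lemma smooth_at_cmap T E (M : mfd T E) {hM : premfd M} c x : atlas M c -> cdom c x ->
  smooth_at M (vecMfd E) (cmap c) x.
Proof.
move=> Mc cx; have [oW _] := (pm_compatible hM).2 c c Mc Mc.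
have WS : cmap c @` (cdom c `&` id @^-1` cdom c) `<=` fsub E by case/fopenP: oW.
exists c, (Chart (fsub E) id); split=> //=; first by apply: WS; exists x.
apply: (@smooth_in_vec _ _ _ _ c id x _ _ oW) => //.
- by move=> z [y [cy _] <-]; exists y.
- by exists x.
by apply: fsmooth_lin => //; exact: flin_id.
Qed.

Definition cinv (T : groupType) E (c : chart T E) (z : E) : T :=
  xget 1%g [set x | cdom c x /\ cmap c x = z].

Lemma cinvK (T : groupType) E (c : chart T E) x : chart_inj c -> cdom c x ->
  cinv c (cmap c x) = x.
Proof.
move=> ic cx; rewrite /cinv; case: xgetP => [y _ [cy e]|/(_ x)[]//].
exact: ic.
Qed.

Lemma cmapK (T : groupType) E (c : chart T E) z : (cmap c @` cdom c) z ->
  cdom c (cinv c z) /\ cmap c (cinv c z) = z.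
Proof.
move=> [x cx xz]; rewrite /cinv; case: xgetP => [y _ []//|/(_ x)[]//].
Qed.

Lemma chart_image_open T E (M : mfd T E) {hM : premfd M} c : atlas M c ->
  fopen (cmap c @` cdom c).
Proof.
move=> Mc; have [oW _] := (pm_compatible hM).2 c c Mc Mc.
by rewrite (_ : cdom c = cdom c `&` id @^-1` cdom c)//; apply/seteqP; split=> // x [].
Qed.

Lemma smooth_at_cinv (T : groupType) E (M : mfd T E) {hM : premfd M} c z :
  atlas M c -> (cmap c @` cdom c) z -> smooth_at (vecMfd E) M (cinv c) z.
Proof.
move=> Mc cz; note (chart_image_open Mc) => oW.
have WS : cmap c @` cdom c `<=` fsub E by case/fopenP: oW.
exists (Chart (fsub E) id), c; split=> //=; first exact: WS.
  by have [] := cmapK cz.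
exists (cmap c @` cdom c), id; split=> //=.
- by apply: fsmooth_lin => //; exact: flin_id.
- by move=> y /WS Ey; exists y.
by move=> y Ey cy; have [] := cmapK cy.
Qed.

Lemma smooth_at_fst T T' E F (M : mfd T E) (N : mfd T' F)
    {hM : premfd M} {hN : premfd N} x : carrier M x.1 -> carrier N x.2 ->
  smooth_at (prodMfd M N) M fst x.
Proof.
move=> Mx Nx; have [c Mc cx] := pm_cover hM Mx; have [d Nd dx] := pm_cover hN Nx.
exists (@Chart R _ (prodModel E F) (cdom c `*` cdom d) (fun p => (cmap c p.1, cmap d p.2))), c.
split=> //; first by exists c, d.
have oU : fopen (cmap c @` cdom c `*` cmap d @` cdom d : set (prodModel E F)).
  by apply: fopen_prod; exact: chart_image_open.
exists (cmap c @` cdom c `*` cmap d @` cdom d), fst; split=> //.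
- by split; [exists x.1|exists x.2].
- by apply: fsmooth_lin; [case/fopenP: oU|exact: flin_fst].
- by move=> [z1 z2] [/= [y1 ? <-] [y2 ? <-]]; exists (y1, y2).
by move=> y [].
Qed.

Lemma smooth_at_snd T T' E F (M : mfd T E) (N : mfd T' F)
    {hM : premfd M} {hN : premfd N} x : carrier M x.1 -> carrier N x.2 ->
  smooth_at (prodMfd M N) N snd x.
Proof.
move=> Mx Nx; have [c Mc cx] := pm_cover hM Mx; have [d Nd dx] := pm_cover hN Nx.
exists (@Chart R _ (prodModel E F) (cdom c `*` cdom d) (fun p => (cmap c p.1, cmap d p.2))), d.
split=> //; first by exists c, d.
have oU : fopen (cmap c @` cdom c `*` cmap d @` cdom d : set (prodModel E F)).
  by apply: fopen_prod; exact: chart_image_open.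
exists (cmap c @` cdom c `*` cmap d @` cdom d), snd; split=> //.
- by split; [exists x.1|exists x.2].
- by apply: fsmooth_lin; [case/fopenP: oU|exact: flin_snd].
- by move=> [z1 z2] [/= [y1 ? <-] [y2 ? <-]]; exists (y1, y2).
by move=> y [].
Qed.

Lemma mopenP T E (M : mfd T E) {hM : premfd M} O : mopen M O <->
  O `<=` carrier M /\ forall x, O x -> mnear M x O.
Proof.
split=> -[OM h]; split=> //.
  move=> x Ox; have [c Mc cx] := pm_cover hM (OM _ Ox).
  exists c, (cmap c @` (O `&` cdom c)); split=> //; [exact: h|by exists x|].
  by move=> z [y [Oy cy] <-]; exists y.
move=> c Mc; apply: fopen_cover => z [x [Ox cx] <-].
have [U [oU Ux UP]] := mnear_in (h x Ox) Mc cx.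
by exists U; split=> // z' /UP[y [cy Oy] <-]; exists y.
Qed.

Lemma mnear_mopen T E (M : mfd T E) {hM : premfd M} x P : mnear M x P ->
  exists O, [/\ mopen M O, O x & O `<=` P].
Proof.
move=> [c [U [Mc cx oU Ux UP]]]; exists [set y | cdom c y /\ U (cmap c y)]; split=> //.
  apply/mopenP; split=> [y [cy _]|y [cy Uy]]; first exact: (pm_dom hM Mc).
  exists c, U; split=> // z Uz; have [y' [cy' _] e] := UP z Uz.
  by exists y' => //; split=> //=; rewrite e.
by move=> y [cy /UP[y' [cy' Py'] /(pm_inj hM Mc cy' cy) <-]].
Qed.

Lemma mnear_chart_ball T E (M : mfd T E) {hM : premfd M} c x P : atlas M c ->
  cdom c x -> mnear M x P -> exists k (e : R), 0 < e /\
    forall z, fsub E z -> pn k (z - cmap c x) < e ->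
      exists y, [/\ cdom c y, P y & cmap c y = z].
Proof.
move=> Mc cx nP; have [U [/fopenP[US oU] Ux UP]] := mnear_in nP Mc cx.
have [k [e [e0 He]]] := oU _ Ux; exists k, e; split=> // z Ez zx.
by have [y [cy Py] yz] := UP z (He z Ez zx); exists y.
Qed.

Lemma mnear_of_ball T E (M : mfd T E) {hM : premfd M} c x (P : set T) k (e : R) : atlas M c ->
  cdom c x -> 0 < e -> (forall y, cdom c y -> pn k (cmap c y - cmap c x) < e -> P y) ->
  mnear M x P.
Proof.
move=> Mc cx e0 h; note (chart_image_open Mc) => oW.
have Ex : fsub E (cmap c x) by case/fopenP: oW => + _; apply; exists x.
exists c, (cmap c @` cdom c `&` fball (cmap c x) k e); split=> //.
- by apply: fopenI => //; exact: fopen_ball.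
- by split; [exists x|apply/fballP; rewrite subrr pn0].
by move=> z [[y cy <-] /fballP[_ hy]]; exists y => //; split=> //; exact: h.
Qed.

Lemma premfd_hausdorff T E (M : mfd T E) {hM : premfd M} :
  (forall x y, carrier M x -> carrier M y -> x <> y ->
    exists A B, [/\ mnear M x A, mnear M y B & A `&` B = set0]) ->
  is_manifold M.
Proof.
move=> h; split; try by case: hM.
move=> x y Mx My /(h x y Mx My)[A [B [nA nB AB]]].
note (mnear_mopen nA) => -[Q1 [qO Ox OA]]; note (mnear_mopen nB) => -[Q2 [qO2 Oy OB]].
exists Q1, Q2; split=> //; rewrite -subset0 -AB => z [/OA ? /OB ?].
by split.
Qed.

Lemma manifold_hausdorff T E (M : mfd T E) x y : is_manifold M -> carrier M x ->
  carrier M y -> x <> y -> exists A B, [/\ mnear M x A, mnear M y B & A `&` B = set0].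
Proof.
move=> mM Mx My xy; have hM := is_manifold_premfd mM.
have [Q1 [Q2 [/mopenP[_ qO] /mopenP[_ qO2] Ox Oy OO2]]] := mfd_hausdorff mM Mx My xy.
by exists Q1, Q2; split=> //; [exact: qO|exact: qO2].
Qed.

End PremfdTheory.

(** * Closed submanifolds and Lie subgroups *)

Section Submanifold.
Context {R : realType}.
Implicit Types E F H : frechetModel R.

(** The embedding preserves each seminorm with its index and has closed image. This transfers
    completeness to [F] and lets derivatives computed in [E] be pulled back. *)
Record closed_embedding E F (io : F -> E) : Prop := {
  ce_0 : fsub F 0;
  ce_cl : forall (a : R) x y, fsub F x -> fsub F y -> fsub F (a *: x + y);
  ce_lin : forall (a : R) x y, fsub F x -> fsub F y ->
    io (a *: x + y) = a *: io x + io y;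
  ce_sub : forall x, fsub F x -> fsub E (io x);
  ce_inj : forall x, fsub F x -> io x = 0 -> x = 0;
  ce_iso : forall k x, fsub F x -> fsn k (io x) = fsn k x;
  ce_closed : forall e, fsub E e ->
    (forall k (d : R), 0 < d -> exists2 x, fsub F x & fsn k (io x - e) < d) ->
    exists2 x, fsub F x & io x = e }.

Section Embedding.
Context E F {hE : is_frechet E} (io : F -> E) (hio : closed_embedding io).

Lemma ceD x y : fsub F x -> fsub F y -> io (x + y) = io x + io y.
Proof. by move=> hx hy; have := ce_lin hio 1 hx hy; rewrite !scale1r. Qed.

Lemma ce0 : io 0 = 0.
Proof. by apply: (addrI (io 0)); rewrite -ceD ?addr0//; exact: (ce_0 hio). Qed.

Lemma ceZ a x : fsub F x -> io (a *: x) = a *: io x.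
Proof. by move=> hx; have := ce_lin hio a hx (ce_0 hio); rewrite !addr0 ce0 addr0. Qed.

Lemma ceB x y : fsub F x -> fsub F y -> io (x - y) = io x - io y.
Proof. by move=> hx hy; rewrite -scaleN1r addrC (ce_lin hio)// scaleN1r addrC. Qed.

Lemma ce_fsB x y : fsub F x -> fsub F y -> fsub F (x - y).
Proof. by move=> hx hy; rewrite -scaleN1r addrC; exact: (ce_cl hio). Qed.

Lemma ce_fsZ a x : fsub F x -> fsub F (a *: x).
Proof. by move=> hx; have := ce_cl hio a hx (ce_0 hio); rewrite addr0. Qed.

Lemma ce_fsD x y : fsub F x -> fsub F y -> fsub F (x + y).
Proof. by move=> hx hy; have := ce_cl hio 1 hx hy; rewrite scale1r. Qed.

Lemma ce_frechet : is_frechet F.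
Proof.
split; [exact: (ce_0 hio)|exact: (ce_cl hio)|..].
- move=> k x y hx hy; rewrite -!(ce_iso hio)//; last exact: ce_fsD.
  by rewrite ceD//; apply: frechet_triangle => //; exact: ce_sub.
- move=> k a x hx; rewrite -!(ce_iso hio)//; last exact: ce_fsZ.
  by rewrite ceZ//; apply: frechet_scale => //; exact: ce_sub.
- move=> x hx h; apply: (ce_inj hio hx); apply: (frechet_separated hE).
    exact: ce_sub.
  by move=> k; rewrite (ce_iso hio).
move=> u hu hc.
have [i|k e e0|l hl cl] := @frechet_complete _ _ hE (io \o u).
- exact: ce_sub.
- have [N HN] := hc k e e0; exists N => i j Ni Nj /=.
  by rewrite -ceB// (ce_iso hio) ?HN//; exact: ce_fsB.
have [|x hx xl] := ce_closed hio hl.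
  by move=> k d d0; have [N HN] := cl k d d0; exists (u N) => //; exact: HN.
exists x => // k e e0; have [N HN] := cl k e e0; exists N => i Ni.
rewrite -(ce_iso hio); last exact: ce_fsB.
by rewrite ceB// xl; exact: HN.
Qed.

Context {hF : is_frechet F}.

Lemma ce_pn k x : fsub F x -> pn k (io x) = pn k x.
Proof. by move=> hx; elim: k => [|k IH] /=; rewrite ?IH (ce_iso hio). Qed.

Lemma ce_flin : flin io.
Proof.
split; [exact: ce_lin|exact: ce_sub|].
by move=> k; exists k, 1 => x hx; rewrite mul1r ce_pn.
Qed.

Lemma ce_injective x y : fsub F x -> fsub F y -> io x = io y -> x = y.
Proof.
move=> hx hy e; apply/subr0_eq/(ce_inj hio); first exact: ce_fsB.
by rewrite ceB// e subrr.
Qed.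

End Embedding.

(** Difference quotients of [io \o f] lie in the closed image of [io], hence so does their limit.
    Its preimage is the derivative of [f], because [io] preserves the seminorms. *)
Lemma fclass_corestrict k D E F {hD : is_frechet D} {hE : is_frechet E}
    {hF : is_frechet F} (io : F -> E) (hio : closed_embedding io)
    (U : set D) (f : D -> F) : fopen U -> (forall x, U x -> fsub F (f x)) ->
  fclass k U (io \o f) -> fclass k U f.
Proof.
elim: k D hD U f => [|k IH] D hD U f oU fU.
all: have US : U `<=` fsub D by case/fopenP: oU.
all: move=> [/(fcontP _ US) cf].
all: have cf' : fcontinuous U f.
1,3: apply/(fcontP _ US) => x Ux; split; first exact: fU.
1,2: move=> m e e0; have [_ /(_ m e e0)[l [d [d0 Hd]]]] := cf x Ux.
1,2: exists l, d; split=> // y Uy yx; have := Hd y Uy yx => /=.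
1,2: have fy := fU y Uy; have fx := fU x Ux; have fyx : fsub F (f y - f x) by fsub.
1,2: by rewrite -(ceB hio)// (ce_pn hio).
  by [].
move=> [dg [hdg cdg]]; split=> //.
have ioS y : U y -> fsub E ((io \o f) y) by move=> Uy; apply: (ce_sub hio); exact: fU.
have K p : (U `*` fsub D : set (prodModel D D)) p -> exists2 w, fsub F w & io w = dg p.
  move: p => [x v] [/= Ux hv]; have [hw H] := hdg x v Ux hv.
  apply: (ce_closed hio hw) => m e e0.
  have [d [d0 Hd]] := H m e e0.
  note (fopen_line oU Ux hv) => -[d1 d10 Hd1].
  pose t := Num.min d d1 / 2.
  have t0 : 0 < t by rewrite divr_gt0// lt_min d0.
  have : t < Num.min d d1 by rewrite /t; move: t0; rewrite /t; lra.
  rewrite -(gtr0_norm t0) lt_min => /andP[td td1].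
  have ft := fU _ (Hd1 _ td1); have fx := fU _ Ux.
  exists (t^-1 *: (f (x + t *: v) - f x)); first by fsub.
  rewrite (ceZ hio) ?(ceB hio)//; last by fsub.
  have [_ /(_ m (leqnn m))] := Hd t ltac:(by rewrite gtr0_norm) td.
  by [].
pose df p := xget 0 [set w | fsub F w /\ io w = dg p].
have dfE p : (U `*` fsub D : set (prodModel D D)) p -> fsub F (df p) /\ io (df p) = dg p.
  move=> /K[w hw e]; exact: (@xgetPex _ 0 [set w | fsub F w /\ io w = dg p] (ex_intro _ w (conj hw e))).
exists df; split.
  move=> x v Ux hv; have [dS dE] := dfE (x, v) (conj Ux hv).
  have [_ H] := (has_dderivE _ oU ioS Ux hv).1 (hdg x v Ux hv).
  apply/(has_dderivE _ oU fU Ux hv); split=> // m e e0.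
  have [d d0 Hd] := H m e e0; note (fopen_line oU Ux hv) => -[d1 d10 Hd1].
  exists (Num.min d d1); first by rewrite lt_min d0.
  move=> t; rewrite lt_min => /andP[td td1].
  have ft := fU _ (Hd1 _ td1); have fx := fU _ Ux.
  have := Hd t td; rewrite -dE /= -(ceZ hio)// -!(ceB hio)//; try by fsub.
  by rewrite (ce_pn hio)//; fsub.
have oUD : fopen (U `*` fsub D : set (prodModel D D)).
  by apply: fopen_prod => //; exact: fopen_fsub.
apply: IH => // [p /dfE[]//|].
by apply: fclass_congr cdg => // p /dfE[_ <-].
Qed.

(** Slice charts: [c] is what [c'] cuts out on [K]. The last clause makes the whole slice consist of
    points of [K], so that the image of [c] is open in [F]. *)
Record chart_ext S T E F (io : F -> E) (K : mfd S F) (j : S -> T)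
    (c : chart S F) (c' : chart T E) : Prop := {
  chx_dom : forall x, cdom c x <-> carrier K x /\ cdom c' (j x);
  chx_map : forall x, cdom c x -> fsub F (cmap c x) /\ cmap c' (j x) = io (cmap c x);
  chx_slice : forall y xi, cdom c' y -> fsub F xi -> cmap c' y = io xi ->
    exists2 x, carrier K x & y = j x }.

Record submfd S T E F (io : F -> E) (K : mfd S F) (M : mfd T E) (j : S -> T) : Prop := {
  sm_emb : closed_embedding io;
  sm_ext : forall c, atlas K c -> exists2 c', atlas M c' & chart_ext io K j c c';
  sm_cover : forall x, carrier K x -> exists2 c, atlas K c & cdom c x;
  sm_carrier : forall x, carrier K x -> carrier M (j x);
  sm_inj : forall x y, carrier K x -> carrier K y -> j x = j y -> x = y }.

Section Sub.
Context S T E F (io : F -> E) (K : mfd S F) (M : mfd T E) (j : S -> T).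
Context {hM : premfd M} (hs : submfd io K M j).

Let hio := sm_emb hs.
Local Instance sub_frechet : is_frechet F := ce_frechet hio (hE := pm_model hM).

Lemma sub_chart_inj c : atlas K c -> chart_inj c.
Proof.
move=> Kc x y cx cy e; have [c' Mc' h] := sm_ext hs Kc.
have [Kx c'x] := (chx_dom h x).1 cx; have [Ky c'y] := (chx_dom h y).1 cy.
apply: (sm_inj hs) => //; apply: (pm_inj hM Mc') => //.
by rewrite (chx_map h cx).2 (chx_map h cy).2 e.
Qed.

Lemma sub_image c c' : chart_ext io K j c c' ->
  cmap c @` cdom c = fsub F `&` io @^-1` (cmap c' @` cdom c').
Proof.
move=> h; apply/seteqP; split=> [z [x cx <-]|z [Fz [y c'y yz]]].
  have [Fx e] := chx_map h cx; split=> //; exists (j x) => //.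
  by case: ((chx_dom h x).1 cx).
have [x Kx e] := chx_slice h c'y Fz yz.
have cx : cdom c x by apply/(chx_dom h); rewrite -e.
exists x => //; have [Fx e'] := chx_map h cx.
by apply: (ce_injective hio) => //; rewrite -e' -e.
Qed.

Lemma sub_in_j c c' x : atlas M c' -> chart_ext io K j c c' -> cdom c x ->
  smooth_in c c' j x.
Proof.
move=> Mc' h cx; note (chart_image_open Mc') => oW.
exists (fsub F `&` io @^-1` (cmap c' @` cdom c')), io; split.
- apply: fopen_preimage => //; first exact: fopen_fsub.
  by apply: flin_cont; exact: ce_flin hio.
- by rewrite -(sub_image h); exists x.
- by apply: fsmooth_lin; [move=> z []|exact: ce_flin hio].
- by rewrite (sub_image h).
move=> y cy _; split; first by case: ((chx_dom h y).1 cy).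
by rewrite (chx_map h cy).2.
Qed.

(** The representative of [j \o f] takes values in the image of [io] wherever [f] stays in [K];
    corestriction along the closed embedding turns it into a representative of [f]. *)
Lemma sub_in_initial S' D (d : chart S' D) {hD : is_frechet D} c c' (f : S' -> S) x U :
  chart_ext io K j c c' -> chart_inj d -> cdom d x -> fopen U -> U (cmap d x) ->
  (forall y, cdom d y -> U (cmap d y) -> carrier K (f y)) ->
  smooth_in d c' (j \o f) x -> smooth_in d c f x.
Proof.
move=> h id dx oU Ux KU [V [g [oV Vx sg Vd Vg]]].
note (fopenI oV oU) => oUV.
have c_f y : cdom d y -> (V `&` U) (cmap d y) -> cdom c (f y).
  by move=> dy [Vy Uy]; apply/(chx_dom h); split; [exact: KU|case: (Vg y dy Vy)].
pose g' z : F := xget 0 [set w | fsub F w /\ io w = g z].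
have g'E y : cdom d y -> (V `&` U) (cmap d y) -> g' (cmap d y) = cmap c (f y).
  move=> dy Vy; have [Fw e] := chx_map h (c_f y dy Vy).
  have [_ ge] := Vg y dy Vy.1; rewrite /= in ge.
  rewrite /g'; case: xgetP => [w _ [Fw' e']|/(_ (cmap c (f y)))[]]; last by split=> //; rewrite ge.
  by apply: (ce_injective hio) => //; rewrite e' ge -e.
exists (V `&` U), g'; split=> //.
- move=> k; apply: (fclass_corestrict hio) => //.
    move=> z [Vz Uz]; have [y dy yz] := Vd z Vz.
    by rewrite -yz g'E//; [case: (chx_map h (c_f y dy _)); rewrite ?yz|rewrite yz].
  apply: (fclass_congr _ (f := g)) => //.
    move=> z [Vz Uz]; have [y dy yz] := Vd z Vz; rewrite /= -yz g'E; rewrite ?yz//.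
    have VUy : (V `&` U) (cmap d y) by rewrite yz.
    by rewrite -(chx_map h (c_f y dy VUy)).2 -yz (Vg y dy VUy.1).2.
  by apply: fclassS (sg k) => z [].
- by move=> z [/Vd].
by move=> y dy VUy; split; [exact: c_f|exact: g'E].
Qed.

Lemma sub_premfd : premfd K.
Proof.
split.
- exact: sub_frechet.
- by move=> c Kc x cx; have [c' _ h] := sm_ext hs Kc; case: ((chx_dom h x).1 cx).
- exact: sub_chart_inj.
- exact: sm_cover hs.
split=> // c d Kc Kd; apply: smooth_in_glue; first exact: sub_chart_inj.
move=> x [cx dx]; have [c' Mc' hc] := sm_ext hs Kc; have [d' Md' hd] := sm_ext hs Kd.
have [Kx c'x] := (chx_dom hc x).1 cx; have [_ d'x] := (chx_dom hd x).1 dx.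
note (chart_image_open Mc') => oW.
apply: (sub_in_initial hd (U := cmap c @` cdom c)) => //.
- exact: sub_chart_inj.
- rewrite (sub_image hc); apply: fopen_preimage => //; first exact: fopen_fsub.
  by apply: flin_cont; exact: ce_flin hio.
- by move=> y cy _; case: ((chx_dom hc y).1 cy).
apply: (smooth_in_comp (d := c') (f := j) (g := id)) => //.
- exact: (pm_inj hM Mc').
- exact: sub_in_j.
exact: smooth_map_in (pm_inj hM Mc') (pm_compatible hM) Mc' Md' c'x d'x.
Qed.

Local Instance sub_premfd_inst : premfd K := sub_premfd.

Lemma sub_smooth_j x : carrier K x -> smooth_at K M j x.
Proof.
move=> Kx; have [c Kc cx] := sm_cover hs Kx; have [c' Mc' h] := sm_ext hs Kc.
exists c, c'; split=> //; first by case: ((chx_dom h x).1 cx).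
exact: sub_in_j.
Qed.

Lemma sub_initial S' D (N : mfd S' D) {hN : premfd N} (f : S' -> S) x :
  mnear N x (f @^-1` carrier K) -> smooth_at N M (j \o f) x -> smooth_at N K f x.
Proof.
move=> nK sj; note (mnear_self nK) => Kfx.
have [c Kc cx] := sm_cover hs Kfx; have [c' Mc' h] := sm_ext hs Kc.
have [d Nd dx] := pm_cover hN (mnear_carrier (hM := hN) nK).
note (mnear_in nK Nd dx) => -[U [oU Ux UP]].
exists d, c; split=> //.
apply: (sub_in_initial h (pm_inj hN Nd) dx oU Ux).
  by move=> y dy /UP[y' [dy' Ky'] /(pm_inj hN Nd dy' dy) <-].
by apply: (smooth_at_in sj Nd Mc' dx); case: ((chx_dom h (f x)).1 cx).
Qed.

Lemma sub_manifold : is_manifold M -> is_manifold K.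
Proof.
move=> mM; apply: premfd_hausdorff => x y Kx Ky xy.
have jxy : j x <> j y by move=> /(sm_inj hs Kx Ky).
have [A [B [nA nB AB]]] := manifold_hausdorff mM (sm_carrier hs Kx) (sm_carrier hs Ky) jxy.
exists (j @^-1` A), (j @^-1` B); split.
- exact: (smooth_at_near (sub_smooth_j Kx) nA).
- exact: (smooth_at_near (sub_smooth_j Ky) nB).
by rewrite -preimage_setI AB preimage_set0.
Qed.

End Sub.

Lemma lie_premfd (T : groupType) E (G : mfd T E) : is_lie G -> premfd G.
Proof. by move=> /lie_mfd/is_manifold_premfd. Qed.

Section LieSmooth.
Context (T : groupType) E (G : mfd T E) (hG : is_lie G).
Local Instance lie_premfd_inst : premfd G := lie_premfd hG.
Context T' F (M : mfd T' F) {hM : premfd M}.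

Lemma smooth_at_mul f g x : smooth_at M G f x -> smooth_at M G g x ->
  smooth_at M G (fun y => f y * g y)%g x.
Proof.
move=> sf sg; have sfg := smooth_at_pair sf sg (hM := hM).
have Gf : carrier G (f x) by move: sf => [c [d [_ Gd _ + _]]]; exact: (pm_dom _ Gd).
have Gg : carrier G (g x) by move: sg => [c [d [_ Gd _ + _]]]; exact: (pm_dom _ Gd).
apply: (smooth_at_comp (g := fun p => (p.1 * p.2)%g)) (sfg _ _) _.
by apply: smooth_map_at => //; exact: lie_mul_smooth.
Qed.

Lemma smooth_at_inv f x : smooth_at M G f x -> smooth_at M G (fun y => (f y)^-1)%g x.
Proof.
move=> sf.
have Gf : carrier G (f x) by move: sf => [c [d [_ Gd _ + _]]]; exact: (pm_dom _ Gd).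
apply: (smooth_at_comp (g := fun p => (p^-1)%g)) sf _.
by apply: smooth_map_at => //; exact: lie_inv_smooth.
Qed.

Lemma smooth_at_cst x y : carrier M x -> carrier G y -> smooth_at M G (fun=> y) x.
Proof.
have hE := pm_model (lie_premfd hG).
move=> Mx Gy; have [c Mc cx] := pm_cover hM Mx; have [d Gd dy] := pm_cover (lie_premfd hG) Gy.
exists c, d; split=> //.
note (chart_image_open Mc) => oW.
exists (cmap c @` cdom c), (fun=> cmap d y); split=> //.
note (chart_image_open Gd) => /fopenP[WS _].
have h : fsub E (cmap d y) by apply: WS; exists y.
have oWS : cmap c @` cdom c `<=` fsub F by case/fopenP: oW.
exact: fsmooth_cst.
Qed.

End LieSmooth.

(** After the inclusion [j] the operations of [K] become those of [M], which are smooth; smoothness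
    into [K] can be tested there. *)
Lemma sub_lie (S T : groupType) E F (io : F -> E) (K : mfd S F) (M : mfd T E) (j : S -> T) :
  is_lie M -> submfd io K M j ->
  carrier K 1%g ->
  (forall x y, carrier K x -> carrier K y -> carrier K (x * y)%g) ->
  (forall x, carrier K x -> carrier K (x^-1)%g) ->
  (forall x y, carrier K x -> carrier K y -> j (x * y)%g = (j x * j y)%g) ->
  is_lie K.
Proof.
move=> lM hs K1 KM KV jM; have hM := lie_premfd lM.
have hK := sub_premfd hs (hM := hM).
have j1 : j 1%g = 1%g by apply: (@mulgI _ (j 1%g)); rewrite -jM// !mulg1.
have jV x : carrier K x -> j (x^-1)%g = ((j x)^-1)%g.
  by move=> Kx; apply: (@mulgI _ (j x)); rewrite -jM//; [rewrite !mulgV j1|exact: KV].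
split=> //.
- exact: sub_manifold hs (lie_mfd lM).
- apply/smooth_mapP; split=> [[x y] [/= Kx Ky]|[x y] [/= Kx Ky]]; first exact: KM.
  apply: (sub_initial hs).
    apply: (mnear_sub (mnearT (M := prodMfd K K) (x := (x, y)) _)) => //.
    by move=> [x' y'] _ [/= Kx' Ky']; exact: KM.
  apply: (smooth_at_congr (f := fun p => (j p.1 * j p.2)%g)).
    apply: (smooth_at_mul lM).
      apply: (smooth_at_comp (N := K) (f := fst) (g := j)) => /=; last exact: sub_smooth_j hs _ _.
      exact: smooth_at_fst.
    apply: (smooth_at_comp (N := K) (f := snd) (g := j)) => /=; last exact: sub_smooth_j hs _ _.
    exact: smooth_at_snd.
  apply: (mnear_sub (mnearT (M := prodMfd K K) (x := (x, y)) _)) => //.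
  by move=> [x' y'] _ [/= Kx' Ky']; rewrite /= jM.
apply/smooth_mapP; split=> [x Kx|x Kx]; first exact: KV.
apply: (sub_initial hs).
  by apply: (mnear_sub (mnearT (M := K) Kx)) => y _; exact: KV.
apply: (smooth_at_congr (f := fun p => ((j p)^-1)%g)).
  by apply: (smooth_at_inv lM); exact: sub_smooth_j hs _ Kx.
by apply: (mnear_sub (mnearT (M := K) Kx)) => y _ Ky; rewrite /= jV.
Qed.

End Submanifold.

(** * Smooth and flat curves *)

Section Curve.
Context {R : realType}.
Implicit Types E F H : frechetModel R.
Local Notation ln := (@line R).

Lemma fopen_lineP (U : set ln) : fopen U <-> forall x, U x ->
  exists2 e : R, 0 < e & forall y : R, `|y - x| < e -> U y.
Proof.
split=> [/fopenP[_ oU] x /oU[k [e [e0 He]]]|h].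
  exists e => // y yx; apply: He => //; apply: le_lt_trans yx.
  by elim: k => [|k IH] //=; rewrite ge_max IH /=.
apply/fopenP; split=> // x /h[e e0 He]; exists 0%N, e; split=> //.
by move=> y _; exact: He.
Qed.

Definition nb (s e : R) : set ln := [set u : R | `|u - s| < e].

Lemma fopen_nb s e : fopen (nb s e).
Proof.
apply/fopen_lineP => x; rewrite /nb /= => xs; exists (e - `|x - s|); first by rewrite subr_gt0.
move=> y yx; have -> : y - s = (y - x) + (x - s) by ring.
by apply: (le_lt_trans (ler_normD _ _)); lra.
Qed.

Lemma nb_self (s e : R) : 0 < e -> nb s e s.
Proof. by rewrite /nb /= subrr normr0. Qed.

Lemma nbS (s e e' : R) : e <= e' -> nb s e `<=` nb s e'.
Proof. by move=> ee u /lt_le_trans; apply. Qed.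

Definition dcurve E (f : ln -> E) : ln -> E := fun x => dfun f (x, 1 : R).

Section OneCurve.
Context E {hE : is_frechet E}.

Lemma dderiv_lineP (U : set ln) (f : ln -> E) (x : R) w :
  fopen U -> (forall y, U y -> fsub E (f y)) -> U x ->
  has_dderiv f x (1 : R) w <-> fsub E w /\ forall k (e : R), 0 < e ->
    exists2 d : R, 0 < d & forall t : R, `|t| < d ->
      pn k (f (x + t) - f x - t *: w) <= e * `|t|.
Proof.
move=> oU fU Ux; rewrite (has_dderivE _ oU fU Ux)//.
by split=> -[hw h]; split=> // k e /(h k e)[d d0 Hd]; exists d => // t /Hd;
   rewrite [t *: (1 : R^o)]mulr1.
Qed.

Lemma dderiv_line_scale (U : set ln) (f : ln -> E) (x v : R) w :
  fopen U -> (forall y, U y -> fsub E (f y)) -> U x ->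
  has_dderiv f x (1 : R) w -> has_dderiv f x v (v *: w).
Proof.
move=> oU fU Ux /(dderiv_lineP _ oU fU Ux)[hw h].
apply/(has_dderivE _ oU fU Ux) => //; split; first by fsub.
move=> k e e0; have v1 : 0 < `|v| + 1 by have := normr_ge0 v; lra.
have [d d0 Hd] := h k (e / (`|v| + 1)) ltac:(by rewrite divr_gt0).
exists (d / (`|v| + 1)); first by rewrite divr_gt0.
move=> t; rewrite ltr_pdivlMr// => td.
have tv : `|t * v| <= `|t| * (`|v| + 1) by rewrite normrM ler_wpM2l// lerDl.
have := Hd (t * v) (le_lt_trans tv td); rewrite scalerA => /le_trans; apply.
by rewrite -mulrA ler_wpM2l ?(ltW e0)// ler_pdivrMl// [leRHS]mulrC.
Qed.

Lemma dcurveP (U : set ln) (f : ln -> E) x : fopen U -> fsmooth U f -> U x ->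
  has_dderiv f x (1 : R) (dcurve f x).
Proof. by move=> oU sf Ux; apply: (fsmooth_dfun oU sf).1. Qed.

Lemma dcurve_fs (U : set ln) (f : ln -> E) x : fopen U -> fsmooth U f -> U x ->
  fsub E (dcurve f x).
Proof. by move=> oU sf Ux; case: (dcurveP oU sf Ux). Qed.

Lemma dcurve_unique (U : set ln) (f : ln -> E) x w : fopen U ->
  (forall y, U y -> fsub E (f y)) -> U x ->
  has_dderiv f x (1 : R) w -> dcurve f x = w.
Proof. by move=> oU fU Ux; exact: dfunE oU fU Ux _. Qed.

Lemma fsmooth_dcurve (U : set ln) (f : ln -> E) : fopen U -> fsmooth U f ->
  fsmooth U (dcurve f).
Proof.
move=> oU sf; have [_ sdf] := fsmooth_dfun oU sf.
have US : U `<=` fsub ln by [].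
apply: (@fsmooth_comp _ ln (prodModel ln ln) E _ _ _ U (U `*` fsub ln) (fun x => (x, 1 : R)) (dfun f)) => //.
- by apply: fopen_prod => //; exact: fopen_fsub.
- apply: fsmooth_pair => //; first by apply: fsmooth_lin => //; exact: flin_id.
  exact: (@fsmooth_cst _ ln ln _ _ U (1 : R)).
Qed.

Lemma fsmooth_iter (U : set ln) (f : ln -> E) k : fopen U -> fsmooth U f ->
  fsmooth U (iter k (@dcurve E) f).
Proof. by move=> oU sf; elim: k => //= k IH; exact: fsmooth_dcurve. Qed.

Lemma dcurve_congr (U : set ln) (f g : ln -> E) x : fopen U -> fsmooth U f ->
  (forall y, U y -> f y = g y) -> U x -> dcurve f x = dcurve g x.
Proof.
move=> oU sf fg Ux; apply/esym; apply: (dcurve_unique oU) => //.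
  by move=> y Uy; rewrite -fg//; exact: fsmooth_sub sf Uy.
by apply: (dderiv_congr oU fg Ux) => //; exact: dcurveP sf Ux.
Qed.

Lemma iter_dcurve_congr (U : set ln) (f g : ln -> E) k x : fopen U -> fsmooth U f ->
  (forall y, U y -> f y = g y) -> U x -> iter k (@dcurve E) f x = iter k (@dcurve E) g x.
Proof.
move=> oU sf fg; elim: k x => [|k IH] x Ux /=; first exact: fg.
by apply: (dcurve_congr oU _ IH Ux); exact: fsmooth_iter.
Qed.

(** A derivative can be computed along increments that stay in [A], since no point of [A] is
    isolated. Inductively the values on [A] determine all derivatives on [A]. *)
Lemma iter_dcurve_dense (U : set ln) (A : set R) (f g : ln -> E) k x : fopen U ->
  fsmooth U f -> fsmooth U g -> A `<=` U ->
  (forall y d, A y -> 0 < d -> exists t, [/\ 0 < `|t|, `|t| < d & A (y + t)]) ->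
  (forall y, A y -> f y = g y) -> A x ->
  iter k (@dcurve E) f x = iter k (@dcurve E) g x.
Proof.
move=> oU sf sg AU dA fg; elim: k x => [|k IH] x Ax /=; first exact: fg.
set f1 := iter _ _ f; set g1 := iter _ _ g.
have sf1 : fsmooth U f1 by exact: fsmooth_iter.
have sg1 : fsmooth U g1 by exact: fsmooth_iter.
have Ux := AU _ Ax.
have fU y : U y -> fsub E (f1 y) by exact: fsmooth_sub.
have gU y : U y -> fsub E (g1 y) by exact: fsmooth_sub.
have [hf Hf] := (dderiv_lineP _ oU fU Ux).1 (dcurveP oU sf1 Ux).
have [hg Hg] := (dderiv_lineP _ oU gU Ux).1 (dcurveP oU sg1 Ux).
apply/subr0_eq/pn_sep; first by fsub.
move=> m e e0; have e2 : 0 < e / 2 by lra.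
have [d d0 Hd] := Hf m _ e2; have [d' d'0 Hd'] := Hg m _ e2.
have [e1 e10 He1] := (fopen_lineP U).1 oU x Ux.
have [t [t0 + At]] := dA x (Num.min d (Num.min d' e1)) Ax ltac:(by rewrite !lt_min d0 d'0).
rewrite !lt_min => /and3P[td td' te].
have Ut : U (x + t) by apply: He1; rewrite addrAC subrr add0r.
have ft := fU _ Ut; have gt := gU _ Ut; have fx := fU _ Ux; have gx := gU _ Ux.
rewrite -(ler_pM2l t0) -pnZ; last by fsub.
have -> : t *: (dcurve f1 x - dcurve g1 x) =
   (g1 (x + t) - g1 x - t *: dcurve g1 x) - (f1 (x + t) - f1 x - t *: dcurve f1 x).
  by rewrite /f1 /g1 !IH// subrBB scalerBr.
apply: (le_trans (pnB _ _ _)); [by fsub|by fsub|].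
by have := Hd _ td; have := Hd' _ td'; lra.
Qed.

Lemma dderiv_fcontinuous (U : set ln) (f f' : ln -> E) : fopen U ->
  (forall y, U y -> fsub E (f y)) ->
  (forall x, U x -> has_dderiv f x (1 : R) (f' x)) -> fcontinuous U f.
Proof.
move=> oU fU hf; have US : U `<=` fsub ln by [].
apply/(fcontP _ US) => x Ux; split; first exact: fU.
move=> m e e0; have [hw H] := (dderiv_lineP _ oU fU Ux).1 (hf x Ux).
have [d d0 Hd] := H m 1 ltr01.
have D0 : 0 < 1 + pn m (f' x) by note (pn_ge0 m hw); lra.
exists 0%N, (Num.min d (e / (1 + pn m (f' x)))); split; first by rewrite lt_min d0 divr_gt0.
move=> y Uy; rewrite lt_min ltr_pdivlMr// => /andP[yd ye].
have fx := fU _ Ux; have fy := fU _ Uy.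
have -> : f y - f x = (f (x + (y - x)) - f x - (y - x : R) *: f' x) + (y - x : R) *: f' x.
  by rewrite subrK [x + _]addrC subrK.
have fy' : fsub E (f (x + (y - x))) by rewrite [x + _]addrC subrK.
apply: (le_lt_trans (pnD _ _ _)); [by fsub|by fsub|].
rewrite pnZ//; apply: le_lt_trans ye; rewrite mulrDr mulr1.
by apply: lerD => //; have := Hd (y - x) yd; rewrite mul1r.
Qed.

(** On the line the differential is [v *: f' x], so its class is that of [f']. *)
Lemma fclass_curveS (U : set ln) (f f' : ln -> E) k : fopen U ->
  (forall y, U y -> fsub E (f y)) ->
  (forall x, U x -> has_dderiv f x (1 : R) (f' x)) ->
  fclass k U f' -> fclass k.+1 U f.
Proof.
move=> oU fU hf cf'; have US : U `<=` fsub ln by [].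
split; first exact: dderiv_fcontinuous hf.
exists (fun p => smul (p.2, f' p.1)); split=> [x v Ux _|].
  exact: (dderiv_line_scale v oU fU Ux (hf x Ux)).
apply: (@fclass_comp _ k (prodModel ln ln) (prodModel ln E) E _ _ _ (U `*` fsub ln)
   (fsub (prodModel ln E)) (fun p => (p.2, f' p.1)) (@smul _ E)) => //.
- by apply: fopen_prod => //; exact: fopen_fsub.
- exact: fopen_fsub.
- by move=> [x v] [/= Ux _]; split=> //=; exact: (fclass_sub cf').
- apply: fclass_pair => //; first by apply: fclass_lin => //; exact: flin_snd.
  apply: (@fclass_comp _ k (prodModel ln ln) ln E _ _ _ (U `*` fsub ln) U fst f') => //.
  + by apply: fopen_prod => //; exact: fopen_fsub.
  + by move=> p [].
  by apply: fclass_lin => //; exact: flin_fst.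
exact: fclass_smul.
Qed.

Definition cflat (f : ln -> E) (s : R) := forall k, iter k.+1 (@dcurve E) f s = 0.

Lemma cflat_congr (U : set ln) (f g : ln -> E) s : fopen U -> fsmooth U f ->
  (forall y, U y -> f y = g y) -> U s -> cflat f s -> cflat g s.
Proof. by move=> oU sf fg Us ff k; rewrite -(ff k); apply/esym; exact: (iter_dcurve_congr _ oU). Qed.

Lemma dcurve_cst (y : E) s : fsub E y -> dcurve (fun=> y) s = 0.
Proof.
move=> hy; apply: (dcurve_unique (U := setT)) => //; first exact: (fopen_fsub ln).
apply/(dderiv_lineP (U := setT)) => //; first exact: (fopen_fsub ln).
split; first exact: fs0.
move=> k e e0; exists 1 => // t _; rewrite subrr scaler0 subrr pn0.
by rewrite mulr_ge0// ltW.
Qed.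

Lemma cflat_cst (y : E) s : fsub E y -> cflat (fun=> y) s.
Proof.
move=> hy k; rewrite iterSr.
have -> : dcurve (fun=> y) = (fun=> 0) by apply/funext => u; exact: dcurve_cst.
have H0 : dcurve (fun=> 0 : E) = (fun=> 0).
  by apply/funext => u; apply: dcurve_cst; exact: fs0.
by have -> : iter k (@dcurve E) (fun=> 0) = (fun=> 0) by elim: k => //= k ->.
Qed.

Lemma cflat_side (U : set ln) (A : set R) (f : ln -> E) s : fopen U -> fsmooth U f ->
  A `<=` U -> (forall y d, A y -> 0 < d -> exists t, [/\ 0 < `|t|, `|t| < d & A (y + t)]) ->
  (forall y, A y -> f y = f s) -> A s -> cflat f s.
Proof.
move=> oU sf AU dA fA As k.
have fs : fsub E (f s) by apply: fsmooth_sub sf _; exact: AU.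
have sc : fsmooth U (fun=> f s) by exact: (fsmooth_cst (E := ln)).
by rewrite (iter_dcurve_dense k.+1 oU sf sc AU dA fA As) cflat_cst.
Qed.

End OneCurve.

Lemma dcurve_pair E F {hE : is_frechet E} {hF : is_frechet F} (U : set ln)
    (f : ln -> E) (g : ln -> F) k x : fopen U -> fsmooth U f -> fsmooth U g -> U x ->
  iter k (@dcurve (prodModel E F)) (fun u => (f u, g u)) x =
  (iter k (@dcurve E) f x, iter k (@dcurve F) g x).
Proof.
move=> oU sf sg; elim: k x => [//|k IH] x Ux /=.
set f1 := iter _ _ f; set g1 := iter _ _ g.
have sf1 : fsmooth U f1 by exact: fsmooth_iter.
have sg1 : fsmooth U g1 by exact: fsmooth_iter.
have sfg : fsmooth U ((fun u => (f1 u, g1 u)) : ln -> prodModel E F) by exact: fsmooth_pair.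
rewrite -(dcurve_congr (E := prodModel E F) (f := fun u => (f1 u, g1 u)) oU)//; last first.
  by move=> y Uy; rewrite IH.
have uU y : U y -> fsub (prodModel E F) (f1 y, g1 y) by exact: fsmooth_sub sfg.
have h : has_dderiv ((fun u => (f1 u, g1 u)) : ln -> prodModel E F) x (1 : R)
    (dcurve f1 x, dcurve g1 x) by apply: dderiv_pair; exact: dcurveP Ux.
exact: (@dcurve_unique (prodModel E F) _ U _ x _ oU uU Ux h).
Qed.

Lemma dcurve_comp E F {hE : is_frechet E} {hF : is_frechet F} (U : set ln) (V : set E)
    (f : ln -> E) (h : E -> F) x : fopen U -> fopen V -> fsmooth U f -> fsmooth V h ->
  (forall y, U y -> V (f y)) -> U x ->
  dcurve (h \o f) x = dfun h (f x, dcurve f x).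
Proof.
move=> oU oV sf sh fV Ux.
have [hdh sdh] := fsmooth_dfun oV sh.
have hS y : V y -> fsub F (h y) by exact: fsmooth_sub.
apply: (dcurve_unique oU) => //; first by move=> y /fV/hS.
apply: (dderiv_comp oU oV fV hS hdh (fsmooth_cont sdh) Ux) => //.
exact: dcurveP sf Ux.
Qed.

(** The derivative of [h \o f] is [dfun h] composed with the curve formed by [f] and its velocity.
    That curve is again flat at [s], so the induction on the order runs over all smooth [h]. *)
Lemma cflat_comp E F {hE : is_frechet E} {hF : is_frechet F} (U : set ln) (V : set E)
    (f : ln -> E) (h : E -> F) s : fopen U -> fopen V -> fsmooth U f -> fsmooth V h ->
  (forall y, U y -> V (f y)) -> U s -> cflat f s -> cflat (h \o f) s.
Proof.
move=> oU oV sf sh fV Us ff k.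
elim: k E F hE hF V f h oV sf sh fV ff => [|k IH] E F hE hF V f h oV sf sh fV ff.
all: have [hdh sdh] := fsmooth_dfun oV sh.
  rewrite /= (dcurve_comp oU oV sf sh fV Us) [dcurve f s](ff 0%N).
  rewrite -(scale0r (0 : E)) (dderivZ oV _ hdh)//; first by rewrite scale0r.
  - by move=> y; exact: fsmooth_sub.
  - exact: fV.
  - exact: fs0.
note (fsmooth_dcurve oU sf) => sdf.
have oVE : fopen (V `*` fsub E : set (prodModel E E)).
  by apply: fopen_prod => //; exact: fopen_fsub.
have sp : fsmooth U ((fun u => (f u, dcurve f u)) : ln -> prodModel E E) by exact: fsmooth_pair.
have pV y : U y -> (V `*` fsub E) (f y, dcurve f y).
  by move=> Uy; split; [exact: fV|exact: fsmooth_sub sdf Uy].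
have shf : fsmooth U (h \o f) by exact: (fsmooth_comp oU oV).
rewrite iterSr.
rewrite (iter_dcurve_congr (g := dfun h \o (fun u => (f u, dcurve f u))) _ oU)//.
- apply: (IH (prodModel E E) F _ _ (V `*` fsub E)) => // j.
  by rewrite (dcurve_pair _ oU)// -iterSr !ff.
- exact: fsmooth_dcurve.
- by move=> y Uy; rewrite (dcurve_comp oU oV sf sh fV Uy).
Qed.

Section Glue.
Context E {hE : is_frechet E} (U : set ln) (s : R) (oU : fopen U) (Us : U s).

Definition splice T (f g : R -> T) : R -> T := fun x => if x <= s then f x else g x.

Lemma splice_dderiv (f g : ln -> E) x : fsmooth U f -> fsmooth U g -> f s = g s ->
  dcurve f s = dcurve g s -> U x ->
  has_dderiv (splice f g : ln -> E) x (1 : R) (splice (dcurve f) (dcurve g) x).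
Proof.
move=> sf sg fg dfg Ux.
have [xs|sx|xs] := ltgtP x s.
- have e0 : 0 < s - x by lra.
  rewrite /splice (ltW xs); apply: (dderiv_line (f := f) e0); last exact: dcurveP Ux.
  move=> t ts; rewrite ifT//= [t *: (1 : R^o)]mulr1.
  by have := ler_norm t; lra.
- have e0 : 0 < x - s by lra.
  rewrite /splice leNgt sx /=; apply: (dderiv_line (f := g) e0); last exact: dcurveP Ux.
  move=> t ts; rewrite ifF//= [t *: (1 : R^o)]mulr1; apply/negbTE; rewrite -ltNge.
  by have := ler_norm (- t); rewrite normrN; lra.
have fU y : U y -> fsub E (f y) by exact: fsmooth_sub.
have gU y : U y -> fsub E (g y) by exact: fsmooth_sub.
have uU y : U y -> fsub E (splice f g y).
  by rewrite /splice; case: ifP => _; [exact: fU|exact: gU].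
have [hf Hf] := (dderiv_lineP _ oU fU Us).1 (dcurveP oU sf Us).
have [hg Hg] := (dderiv_lineP _ oU gU Us).1 (dcurveP oU sg Us).
rewrite xs; apply/(dderiv_lineP _ oU uU Us).
rewrite {1}/splice lexx; split=> // k e e0.
have [d d0 Hd] := Hf k e e0; have [d' d'0 Hd'] := Hg k e e0.
exists (Num.min d d'); first by rewrite lt_min d0.
move=> t; rewrite lt_min => /andP[td td']; rewrite /splice lexx; case: ifP => _.
  exact: Hd.
by rewrite fg dfg; exact: Hd'.
Qed.

(** The derivative of the splice is the splice of the derivatives; flatness provides the agreement
    at [s] that this requires at every order. *)
Lemma splice_fclass (f g : ln -> E) k : fsmooth U f -> fsmooth U g -> f s = g s ->
  cflat f s -> cflat g s -> fclass k U (splice f g : ln -> E).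
Proof.
elim: k f g => [|k IH] f g sf sg fg ff gg.
all: have uU y : U y -> fsub E (splice f g y)
  by rewrite /splice; case: ifP => _ Uy; [exact: fsmooth_sub sf Uy|exact: fsmooth_sub sg Uy].
all: have dfg : dcurve f s = dcurve g s by rewrite [LHS](ff 0%N) [RHS](gg 0%N).
all: have dd := fun x => @splice_dderiv f g x sf sg fg dfg.
all: have sdf : fsmooth U (dcurve f) by exact: fsmooth_dcurve.
all: have sdg : fsmooth U (dcurve g) by exact: fsmooth_dcurve.
  split=> // x Ux; split; first exact: uU.
  have US : U `<=` fsub ln by [].
  have cf := ((fcontP _ US).1 (fsmooth_cont sf) x Ux).2.
  have cg := ((fcontP _ US).1 (fsmooth_cont sg) x Ux).2.
  move=> m e e0.
  have [l [d [d0 Hd]]] := cf m e e0; have [l' [d' [d'0 Hd']]] := cg m e e0.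
  (* Within [e1] of a point other than [s] the splice uses only one of its branches. *)
  pose e1 := if x == s then 1 else `|x - s|.
  have e10 : 0 < e1 by rewrite /e1; case: eqVneq => // xs; rewrite normr_gt0 subr_eq0.
  exists (maxn l l'), (Num.min e1 (Num.min d d')); split; first by rewrite !lt_min e10 d0.
  move=> y Uy /fballP[_]; rewrite !lt_min => /and3P[y1 y2 y3]; apply/fballP; split; first exact: uU.
  have f1 : pn m (f y - f x) < e.
    by apply: Hd => //; apply: le_lt_trans y2; apply: pn_mono; exact: leq_maxl.
  have g1 : pn m (g y - g x) < e.
    by apply: Hd' => //; apply: le_lt_trans y3; apply: pn_mono; exact: leq_maxr.
  have yx : `|y - x| < e1 by apply: le_lt_trans y1; exact: (fsn_le_pn _ (y - x : ln)).
  rewrite /splice; have [xs|sx|xs] := ltgtP x s.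
  - rewrite ifT//; move: yx; rewrite /e1 lt_eqF// ltr_distl => /andP[_].
    by rewrite ltr0_norm ?subr_lt0//; lra.
  - rewrite ifF//; apply/negbTE; rewrite -ltNge; move: yx; rewrite /e1 gt_eqF// ltr_distl.
    by move=> /andP[+ _]; rewrite gtr0_norm ?subr_gt0//; lra.
  - by rewrite xs in f1 g1 *; case: ifP => _ //; rewrite fg.
apply: (fclass_curveS oU uU dd); apply: IH => //.
  by move=> j; rewrite -iterSr ff.
by move=> j; rewrite -iterSr gg.
Qed.

Lemma splice_smooth (f g : ln -> E) : fsmooth U f -> fsmooth U g -> f s = g s ->
  cflat f s -> cflat g s -> fsmooth U (splice f g : ln -> E).
Proof. by move=> sf sg fg ff gg k; exact: splice_fclass. Qed.

Lemma splice_cflat (f g : ln -> E) : fsmooth U f -> fsmooth U g -> f s = g s ->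
  cflat f s -> cflat g s -> cflat (splice f g : ln -> E) s.
Proof.
move=> sf sg fg ff gg k.
suff h j x : U x -> iter j (@dcurve E) (splice f g) x =
    splice (iter j (@dcurve E) f) (iter j (@dcurve E) g) x.
  by rewrite h// /splice lexx ff.
elim: j x => [//|j IH] x Ux /=.
have ffj : cflat (iter j (@dcurve E) f) s by move=> i; rewrite -iterD addSn ff.
have ggj : cflat (iter j (@dcurve E) g) s by move=> i; rewrite -iterD addSn gg.
note (fsmooth_iter j oU sf) => sfj; note (fsmooth_iter j oU sg) => sgj.
have fgj : iter j (@dcurve E) f s = iter j (@dcurve E) g s.
  by case: (j) => [//|i]; rewrite ff gg.
have dfgj : dcurve (iter j (@dcurve E) f) s = dcurve (iter j (@dcurve E) g) s.
  by rewrite -!iterS ff gg.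
note (splice_smooth sfj sgj fgj ffj ggj) => sgl.
rewrite -(dcurve_congr oU sgl (fun y Uy => esym (IH y Uy)) Ux).
apply: (dcurve_unique oU) => //; first by move=> y; exact: fsmooth_sub.
exact: splice_dderiv.
Qed.

End Glue.

End Curve.

(** * Smooth and flat curves in a manifold; loops and paths *)

Section ManifoldCurve.
Context {R : realType}.
Implicit Types E F H : frechetModel R.
Local Notation ln := (@line R).

Lemma fsmooth_affine (b c : R) : fsmooth (setT : set ln) (fun x : ln => (b + c * (x : R) : R) : ln).
Proof.
have oT : fopen (setT : set ln) := fopen_fsub ln.
have h : fsmooth (setT : set ln) (fun x : ln => ((b : ln), (c *: x : ln)) : prodModel ln ln).
  apply: fsmooth_pair => //; first exact: (fsmooth_cst (E := ln) (F := ln)).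
  by apply: fsmooth_lin => //; exact: flin_scale.
have hg : fsmooth (fsub (prodModel ln ln)) ((fun p => p.1 + p.2) : prodModel ln ln -> ln).
  by apply: fsmooth_lin => //; exact: flin_add.
exact: (fsmooth_comp oT (fopen_fsub (prodModel ln ln)) (fun _ _ => conj I I) h hg).
Qed.

Lemma pn_line k (x : ln) : pn k x = `|x : R|.
Proof. by elim: k => //= k ->; rewrite maxxx. Qed.

Lemma mnear_line (s : R) (P : set R) : mnear (vecMfd ln) s P <->
  exists2 e, 0 < e & forall u, `|u - s| < e -> P u.
Proof.
split=> [n|[e e0 h]].
  have [k [e [e0 He]]] := mnear_chart_ball (erefl : atlas (vecMfd ln) (Chart (fsub ln) id)) I n (hM := _).
  exists e => // u us; have [|y [_ Py <-]//] := He u I.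
  by rewrite pn_line.
apply: (mnear_of_ball (k := 0%N) (erefl : atlas (vecMfd ln) (Chart (fsub ln) id)) I e0).
by move=> u _; exact: h.
Qed.

(** [sg] selects a side: the right half of the interval if positive, the left half if negative. The
    increment is taken in the direction of its sign. *)
Lemma half_dense (s m sg : R) : sg != 0 -> forall y d,
  [set u : R | `|u - s| < m /\ 0 <= sg * (u - s)] y -> 0 < d ->
  exists t, [/\ 0 < `|t|, `|t| < d & [set u : R | `|u - s| < m /\ 0 <= sg * (u - s)] (y + t)].
Proof.
move=> sg0 y d [/= ye ys] d0.
pose t := Num.min d (m - `|y - s|) / 2.
have t0 : 0 < t by rewrite divr_gt0// lt_min d0 subr_gt0.
have : t < Num.min d (m - `|y - s|) by rewrite /t; move: t0; rewrite /t; lra.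
rewrite lt_min => /andP[td te].
exists (Num.sg sg * t); rewrite normrM normr_sg sg0 mul1r gtr0_norm//; split=> //.
rewrite /= (_ : y + Num.sg sg * t - s = (y - s) + Num.sg sg * t); last by ring.
split.
  apply: (le_lt_trans (ler_normD _ _)); rewrite normrM normr_sg sg0 mul1r gtr0_norm//.
  lra.
rewrite mulrDr addr_ge0// mulrA mulr_ge0 ?(ltW t0)//.
by rewrite mulrC -normrEsg.
Qed.

Definition csm T F (M : mfd T F) (gam : R -> T) (s : R) := smooth_at (vecMfd ln) M gam s.

Section InManifold.
Context T F (M : mfd T F) {hM : premfd M}.
Implicit Types (c : chart T F) (gam f g : R -> T).

Lemma csmP c gam s : atlas M c -> cdom c (gam s) -> csm M gam s <->
  exists2 e, 0 < e & (forall u, nb s e u -> cdom c (gam u)) /\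
    fsmooth (nb s e) (cmap c \o gam : ln -> F).
Proof.
move=> Mc cs; split=> [sg|[e e0 [dg sg]]].
  have [U [h [oU Us sh _ Uh]]] :=
    smooth_at_in sg (erefl : atlas (vecMfd ln) (Chart (fsub ln) id)) Mc I cs (hM := _) (hN := _).
  have [e e0 He] := (fopen_lineP U).1 oU s Us.
  exists e => //; split=> [u /He Uu|]; first by case: (Uh u I Uu).
  apply: (fsmooth_congr (f := h)) => //; first exact: fopen_nb.
    by move=> u /He Uu; case: (Uh u I Uu).
  by apply: fsmoothS sh.
exists (Chart (fsub ln) id), c; split=> //.
exists (nb s e), (cmap c \o gam); split=> //; first exact: fopen_nb.
  exact: nb_self.
- by move=> u _; exists u.
- by move=> u _ /dg.
Qed.

Lemma csm_carrier gam s : csm M gam s -> carrier M (gam s).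
Proof. by move=> [c [d [_ Md _ ds _]]]; exact: (pm_dom hM Md). Qed.

Lemma csm_congr f g s e : csm M f s -> 0 < e ->
  (forall u, `|u - s| < e -> f u = g u) -> csm M g s.
Proof.
move=> sf e0 fg; apply: (smooth_at_congr sf); apply/mnear_line.
by exists e.
Qed.

Lemma csm_cst x s : carrier M x -> csm M (fun=> x) s.
Proof.
move=> Mx; have [c Mc cx] := pm_cover hM Mx.
apply/(csmP Mc cx); exists 1 => //; split=> //.
apply: (fsmooth_cst (E := ln)) => //.
note (chart_image_open Mc) => /fopenP[+ _]; apply; by exists x.
Qed.

Lemma csm_affine gam b a s : csm M gam (b + a * s) -> csm M (fun u => gam (b + a * u)) s.
Proof.
move=> sg; apply: (smooth_at_comp (N := vecMfd ln) (f := fun u => b + a * u)) sg; first exact: vec_premfd.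
by apply: (smooth_at_vec (U := setT)) => //; [exact: (fopen_fsub ln)|exact: fsmooth_affine].
Qed.

(** One chart suffices: flatness is preserved by smooth maps, in particular by changes of charts. *)
Definition mflat gam (s : R) := exists c,
  [/\ atlas M c, cdom c (gam s) & cflat (cmap c \o gam : ln -> F) s].

Lemma mflat_comp T' F' (N : mfd T' F') {hN : premfd N} (f : T -> T') gam d s :
  csm M gam s -> mflat gam s -> smooth_at M N f (gam s) -> atlas N d ->
  cdom d (f (gam s)) -> cflat (cmap d \o (f \o gam) : ln -> F') s.
Proof.
move=> sg [c [Mc cs fl]] sf Nd ds.
have [e e0 [ce se]] := (csmP Mc cs).1 sg.
note (smooth_at_in sf Mc Nd cs ds) => -[U [h [oU Us sh _ Uh]]].
note (fsmooth_preimage (fopen_nb s e) se oU) => oW.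
set W := _ `&` _ in oW.
have Ws : W s by split=> //; exact: nb_self.
have sW : fsmooth W (cmap c \o gam : ln -> F) by apply: fsmoothS se => u [].
have hf := cflat_comp oW oU sW sh (fun u (Wu : W u) => Wu.2) Ws fl.
apply: (cflat_congr oW _ _ Ws (hf _ _)).
- by apply: (fsmooth_comp oW oU (fun u (Wu : W u) => Wu.2)).
- by move=> u [/ce cu Uu]; case: (Uh (gam u) cu Uu).
Qed.

Lemma mflat_chart gam c s : csm M gam s -> mflat gam s -> atlas M c -> cdom c (gam s) ->
  cflat (cmap c \o gam : ln -> F) s.
Proof.
move=> sg fl Mc cs; apply: (mflat_comp (f := id) sg fl) => //.
by apply: smooth_at_id; exact: csm_carrier.
Qed.

Lemma mflat_congr f g s e : csm M f s -> mflat f s -> 0 < e ->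
  (forall u, `|u - s| < e -> f u = g u) -> mflat g s.
Proof.
move=> sf [c [Mc cs fl]] e0 fg; have fgs : f s = g s by apply: fg; rewrite subrr normr0.
exists c; split=> //; first by rewrite -fgs.
have [e1 e10 [ce se]] := (csmP Mc cs).1 sf.
have m0 : 0 < Num.min e e1 by rewrite lt_min e0.
apply: (cflat_congr (U := nb s (Num.min e e1))) fl; [exact: fopen_nb|..|exact: nb_self].
  by apply: fsmoothS se; apply: nbS; rewrite ge_min lexx orbT.
by move=> u; rewrite /nb /= lt_min => /andP[/fg -> _].
Qed.

Lemma mflat_side gam s e (sg : R) : csm M gam s -> 0 < e -> sg != 0 ->
  (forall u, `|u - s| < e -> 0 <= sg * (u - s) -> gam u = gam s) -> mflat gam s.
Proof.
move=> sgam e0 sg0 h; have [c Mc cs] := pm_cover hM (csm_carrier sgam).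
exists c; split=> //; have [e1 e10 [ce se]] := (csmP Mc cs).1 sgam.
have m0 : 0 < Num.min e e1 by rewrite lt_min e0.
pose A := [set u : R | `|u - s| < Num.min e e1 /\ 0 <= sg * (u - s)].
apply: (cflat_side (U := nb s e1) (A := A)) => //.
- exact: fopen_nb.
- by move=> u [+ _]; rewrite lt_min => /andP[].
- exact: half_dense.
- by move=> y [+ ys]; rewrite lt_min => /andP[ye _] /=; rewrite h.
- by split; rewrite subrr ?normr0// mulr0.
Qed.

Lemma csm_splice f g s : csm M f s -> csm M g s -> f s = g s -> mflat f s ->
  mflat g s -> csm M (splice s f g) s /\ mflat (splice s f g) s.
Proof.
move=> sf sg fgs ff gg; have [c Mc cf] := pm_cover hM (csm_carrier sf).
have cg : cdom c (g s) by rewrite -fgs.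
have [e e0 [ce se]] := (csmP Mc cf).1 sf.
have [e' e'0 [ce' se']] := (csmP Mc cg).1 sg.
pose m := Num.min e e'; have m0 : 0 < m by rewrite lt_min e0.
have cffl := mflat_chart sf ff Mc cf; have cgfl := mflat_chart sg gg Mc cg.
have sfm : fsmooth (nb s m) (cmap c \o f : ln -> F).
  by apply: fsmoothS se; apply: nbS; rewrite ge_min lexx.
have sgm : fsmooth (nb s m) (cmap c \o g : ln -> F).
  by apply: fsmoothS se'; apply: nbS; rewrite ge_min lexx orbT.
have e1 : (cmap c \o f) s = (cmap c \o g) s by rewrite /= fgs.
have gl : cmap c \o splice s f g = splice s (cmap c \o f) (cmap c \o g).
  by apply/funext => u; rewrite /splice /=; case: ifP.
have cgl : cdom c (splice s f g s) by rewrite /splice lexx.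
split.
  apply/(csmP Mc cgl); exists m => //; split.
    move=> u; rewrite /nb /= lt_min => /andP[ue ue']; rewrite /splice.
    by case: ifP => _; [exact: ce|exact: ce'].
  by rewrite gl; apply: splice_smooth => //; [exact: fopen_nb|exact: nb_self].
exists c; split=> //; rewrite gl.
by apply: (splice_cflat (fopen_nb s m)) => //; exact: nb_self.
Qed.

End InManifold.

Lemma csm_vec E {hE : is_frechet E} (xi : ln -> E) :
  (forall s, csm (vecMfd E) xi s) <-> fsmooth (setT : set ln) xi.
Proof.
have oT : fopen (setT : set ln) := fopen_fsub ln.
split=> [h|h s]; last exact: (smooth_at_vec oT).
apply: fsmooth_local => // s _.
have cs : cdom (Chart (fsub E) id) (xi s) by note (csm_carrier (h s)).
have [e e0 [_ se]] := (csmP (erefl : atlas (vecMfd E) (Chart (fsub E) id)) cs (hM := _)).1 (h s).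
by exists (nb s e); split=> //; [exact: fopen_nb|exact: nb_self].
Qed.

Lemma mflat_vec E {hE : is_frechet E} (xi : ln -> E) s : csm (vecMfd E) xi s ->
  mflat (vecMfd E) xi s <-> cflat xi s.
Proof.
move=> sx; split=> [[c [-> _ //]]|h].
by exists (Chart (fsub E) id); split=> //; note (csm_carrier sx).
Qed.

Lemma smooth_in_restrictl T T' E F (c : chart T E) (d : chart T' F) O f x :
  chart_inj c -> smooth_in (Chart (cdom c `&` O) (cmap c)) d f x -> smooth_in c d f x.
Proof.
move=> ic [U [h [oU Ux sh Uc Uh]]]; exists U, h; split=> //.
  by move=> z /Uc[y [cy _] yz]; exists y.
move=> y cy Uy; apply: Uh => //; have [y' [cy' Oy'] /(ic _ _ cy' cy) <-] := Uc _ Uy.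
by split.
Qed.

Lemma smooth_in_restrictr T T' E F (c : chart T E) (d : chart T' F) O f x :
  smooth_in c (Chart (cdom d `&` O) (cmap d)) f x -> smooth_in c d f x.
Proof.
move=> [U [h [oU Ux sh Uc Uh]]]; exists U, h; split=> // y cy Uy.
by have [[? _] ?] := Uh y cy Uy.
Qed.

Lemma smooth_restrict_at T T' E F (M : mfd T E) (N : mfd T' F) {hM : premfd M}
    {hN : premfd N} O f x : smooth_map (restrictMfd M O) N f ->
  carrier M x -> O x -> smooth_at M N f x.
Proof.
move=> sf Mx Ox; have [c Mc cx] := pm_cover hM Mx.
have Nfx := sf.1 x (conj Mx Ox).
have [d Nd dx] := pm_cover hN Nfx.
exists c, d; split=> //; apply: (@smooth_in_restrictl _ _ _ _ _ _ O).
  exact: (pm_inj hM Mc).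
apply: (smooth_map_in _ sf) => //=; last by exists c.
by move=> u v [cu _] [cv _]; exact: (pm_inj hM Mc).
Qed.

Lemma smooth_restrict2_at T T' E F (M : mfd T E) (N : mfd T' F) {hM : premfd M}
    {hN : premfd N} O O' f x : smooth_map (restrictMfd M O) (restrictMfd N O') f ->
  carrier M x -> O x -> smooth_at M N f x.
Proof.
move=> sf Mx Ox; have [c Mc cx] := pm_cover hM Mx.
have [Nfx O'fx] := sf.1 x (conj Mx Ox).
have [d Nd dx] := pm_cover hN Nfx.
exists c, d; split=> //; apply: (@smooth_in_restrictl _ _ _ _ _ _ O).
  exact: (pm_inj hM Mc).
apply: (@smooth_in_restrictr _ _ _ _ _ _ O').
apply: (smooth_map_in _ sf) => //=; [|by exists c|by exists d].
by move=> u v [cu _] [cv _]; exact: (pm_inj hM Mc).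
Qed.

Lemma smooth_restrict T T' E F (M : mfd T E) (N : mfd T' F) {hM : premfd M}
    {hN : premfd N} O f : (forall x, carrier M x -> O x -> mnear M x O) ->
  (forall x, carrier M x -> O x -> smooth_at M N f x) ->
  smooth_map (restrictMfd M O) N f.
Proof.
move=> nO sf; split.
  by move=> x [Mx Ox]; have [c [d [_ Nd _ dx _]]] := sf x Mx Ox; exact: (pm_dom hN Nd).
move=> _ d [c Mc ->] Nd; apply: smooth_in_glue => [u v [cu _] [cv _]|x [[/= cx Ox] dx]].
  exact: (pm_inj hM Mc).
have Mx := pm_dom hM Mc cx.
note (smooth_at_in (sf x Mx Ox) Mc Nd cx dx) => -[U [h [oU Ux sh Uc Uh]]].
note (mnear_in (nO x Mx Ox) Mc cx) => -[V [oV Vx VO]].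
exists (U `&` V), h; split=> //.
- exact: fopenI.
- by apply: fsmoothS sh => u [].
- by move=> z [_ /VO].
by move=> y [cy _] [Uy _]; exact: Uh.
Qed.

End ManifoldCurve.

Section LoopsPaths.
Context {R : realType} (T : Type) (n : nat) (M : mfd T (@eucl R n)) {hM : premfd M}.
Local Notation ln := (@line R).
Implicit Types (gam : R -> T).

Lemma dcurve_derive1 (U : set ln) (f : ln -> eucl n) x : fopen U -> fsmooth U f -> U x ->
  derive1 (f : R -> 'rV[R]_n) x = dcurve f x.
Proof.
move=> oU sf Ux; have hE := pm_model hM.
have fU y : U y -> fsub (eucl n) (f y) by [].
have [_ H] := (dderiv_lineP _ oU fU Ux).1 (dcurveP oU sf Ux).
rewrite /derive1; apply/cvg_lim => //; apply/cvgrPdist_lt => e e0.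
have e2 : 0 < e / 2 by lra.
have [d d0 Hd] := H 0%N _ e2.
near=> t.
have t0 : t != 0 by near: t; exact: nbhs_dnbhs_neq.
have td : `|t| < d by near: t; apply: dnbhs0_lt.
have tp : 0 < `|t| by rewrite normr_gt0.
have := Hd t td; rewrite /= => Ht.
rewrite distrC [t + x]addrC.
have -> : t^-1 *: (f (x + t) - f x) - dcurve f x =
    t^-1 *: ((f (x + t) - f x : 'rV[R]_n) - t *: dcurve f x) :> 'rV[R]_n.
  by rewrite [RHS]scalerBr scalerA mulVf// scale1r.
rewrite normrZ normfV mulrC ltr_pdivrMr//; apply: (le_lt_trans Ht).
by rewrite ltr_pM2r//; lra.
Unshelve. all: by end_near. Qed.

Lemma dcurve_derive1n (U : set ln) (f : ln -> eucl n) k x : fopen U -> fsmooth U f -> U x ->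
  derive1n k (f : R -> 'rV[R]_n) x = iter k (@dcurve R (eucl n)) f x.
Proof.
have hE := pm_model hM.
move=> oU sf; elim: k x => [//|k IH] x Ux; rewrite derive1nS iterS.
note (fsmooth_iter k oU sf) => sk.
have e y : U y -> iter k (@dcurve R (eucl n)) f y = derive1n k (f : R -> 'rV[R]_n) y.
  by move=> Uy; rewrite IH.
rewrite (dcurve_congr oU sk e Ux); apply: (@dcurve_derive1 U) => //.
exact: (fsmooth_congr oU e).
Qed.

Lemma local_extension_csm A gam s e eta u : local_extension M A gam s e eta ->
  `|u - s| < e -> csm M eta u.
Proof.
move=> [e0 se _] us; apply: (smooth_restrict_at se) => //=.
by rewrite in_itv /= -ltr_distl.
Qed.

Lemma csm_local_extension A gam s e eta : 0 < e ->
  (forall u, `|u - s| < e -> csm M eta u) ->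
  (forall u, A u -> `|u - s| < e -> eta u = gam u) ->
  local_extension M A gam s e eta.
Proof.
move=> e0 sc eg; split=> //; last by move=> u Au us; apply: eg => //; rewrite ltr_distl.
apply: smooth_restrict => u _; rewrite /= in_itv /= -ltr_distl => us.
  apply/mnear_line; exists (e - `|u - s|); first by rewrite subr_gt0.
  move=> v vu; rewrite /= in_itv /= -ltr_distl.
  have -> : v - s = (v - u) + (u - s) by ring.
  by apply: (le_lt_trans (ler_normD _ _)); lra.
exact: sc.
Qed.

Lemma smooth_onT gam : smooth_on M setT gam <-> forall s, csm M gam s.
Proof.
split=> [h s|h s _].
  have [e [eta le]] := h s I; have [e0 _ eg] := le.
  apply: (csm_congr (f := eta) _ e0).
    by apply: (local_extension_csm le); rewrite subrr normr0.
  by move=> u us; apply: eg => //; rewrite -ltr_distl.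
by exists 1, gam; apply: csm_local_extension.
Qed.

Lemma flat_at_mflat A gam s e eta : flat_at M A gam s -> A s ->
  local_extension M A gam s e eta -> mflat M eta s.
Proof.
move=> fl As le; have [e0 _ eg] := le.
have es : eta s = gam s by apply: eg => //; lra.
have cs : csm M eta s by apply: (local_extension_csm le); rewrite subrr normr0.
have [c Mc cx] := pm_cover hM (csm_carrier cs).
have [e1 e10 [ce se]] := (csmP Mc cx).1 cs.
exists c; split=> // k.
have := fl e eta c le Mc ltac:(by rewrite -es) k.+1 isT.
by rewrite (@dcurve_derive1n (nb s e1))//; [exact: fopen_nb|exact: nb_self].
Qed.

Lemma mflat_flat_atT gam s : csm M gam s -> mflat M gam s -> flat_at M setT gam s.
Proof.
move=> sg fl e eta c le Mc cs [//|k] _; have [e0 _ eg] := le.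
have es : eta s = gam s by apply: eg => //; lra.
have ce : cdom c (eta s) by rewrite es.
have sce : csm M eta s by apply: (local_extension_csm le); rewrite subrr normr0.
have fle : mflat M eta s.
  by apply: (mflat_congr sg fl e0) => u us; apply/esym/eg => //; rewrite -ltr_distl.
have [e1 e10 [_ se]] := (csmP Mc ce).1 sce.
rewrite (@dcurve_derive1n (nb s e1) (cmap c \o eta))//; [|exact: fopen_nb|exact: nb_self].
exact: (mflat_chart sce fle Mc ce).
Qed.

Lemma loopsP x0 gam : loops M x0 gam <->
  [/\ forall s, gam (s + 2 * pi) = gam s, forall s, csm M gam s, gam 0 = x0 &
      mflat M gam 0].
Proof.
split=> [[per /smooth_onT sm g0 fl]|[per sm g0 fl]].
  split=> //; apply: (flat_at_mflat (e := 1) fl I).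
  exact: csm_local_extension.
by split=> //; [exact/smooth_onT|exact: mflat_flat_atT].
Qed.

End LoopsPaths.

Section Mod2pi.
Context {R : realType}.
Implicit Types s r : R.

Lemma clamp_le0 s : s <= 0 -> clamp s = 0.
Proof. by move=> s0; apply/max_idPl; rewrite ge_min s0. Qed.

Lemma clamp_ge s : pi <= s -> clamp s = pi.
Proof. by move=> sp; rewrite /clamp (min_idPr sp); apply/max_idPr; exact: pi_ge0. Qed.

Lemma clamp_id s : 0 <= s -> s <= pi -> clamp s = s.
Proof. by move=> s0 sp; rewrite /clamp (min_idPl sp); exact/max_idPr. Qed.

Lemma clamp_itv s : 0 <= clamp s <= pi.
Proof.
by rewrite /clamp le_max lexx /= ge_max pi_ge0 ge_min lexx orbT.
Qed.

Lemma clampK s : clamp (clamp s) = clamp s.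
Proof. by have /andP[? ?] := clamp_itv s; rewrite clamp_id. Qed.

Lemma twopi_gt0 : 0 < 2 * pi :> R.
Proof. by rewrite mulr_gt0// pi_gt0. Qed.

Lemma mod2pi_eq r (k : int) : 0 <= r -> r < 2 * pi ->
  mod2pi (r + k%:~R * (2 * pi)) = r.
Proof.
move=> r0 r1; have p0 := twopi_gt0.
have e : (r + k%:~R * (2 * pi)) / (2 * pi) = k%:~R + r / (2 * pi).
  by rewrite addrC mulrDl mulfK// gt_eqF.
rewrite /mod2pi e (@floor_def _ _ k); first by rewrite addrK.
rewrite lerDl divr_ge0 ?(ltW p0)//= intrD ltrD2l.
by rewrite ltr_pdivrMr// mul1r.
Qed.

Lemma mod2pi_id r : 0 <= r -> r < 2 * pi -> mod2pi r = r.
Proof. by move=> r0 r1; have := mod2pi_eq 0 r0 r1; rewrite mul0r addr0. Qed.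

Lemma mod2piP s : exists k : int, [/\ s = mod2pi s + k%:~R * (2 * pi),
  0 <= mod2pi s & mod2pi s < 2 * pi].
Proof.
have p0 := twopi_gt0; set k := Num.floor (s / (2 * pi)).
exists k; rewrite /mod2pi -/k subrK; split=> //.
  by rewrite subr_ge0 -ler_pdivlMr//; exact: floor_le.
rewrite ltrBlDl -[X in _ < _ + X]mul1r -mulrDl -ltr_pdivrMr//.
by have := floorD1_gt (s / (2 * pi)); rewrite -/k intrD.
Qed.

Lemma periodic_int T (f : R -> T) : (forall s, f (s + 2 * pi) = f s) ->
  forall (k : int) s, f (s + k%:~R * (2 * pi)) = f s.
Proof.
move=> per k s.
have pn (m : nat) r : f (r + m%:R * (2 * pi)) = f r.
  elim: m r => [|m IH] r; first by rewrite mul0r addr0.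
  by rewrite -[m.+1]addn1 natrD mulrDl mul1r addrA per.
case: k => m; first exact: pn.
by rewrite NegzE mulrNz mulNr -[LHS](pn m.+1) subrK.
Qed.

Lemma periodic_mod2pi T (f : R -> T) s : (forall s, f (s + 2 * pi) = f s) ->
  f s = f (mod2pi s).
Proof. by move=> per; have [k [e _ _]] := mod2piP s; rewrite {1}e periodic_int. Qed.

End Mod2pi.

Section CupPaths.
Context {R : realType} (T : Type) (n : nat) (M : mfd T (@eucl R n)) {hM : premfd M}.
Local Notation ln := (@line R).
Implicit Types (gam : R -> T).

(** Every smooth extension from [A] agrees with [gam] on a half-neighbourhood of [s], and this
    determines all derivatives at [s]. *)
Lemma flat_at_side A gam s sg e : csm M gam s -> mflat M gam s -> 0 < e -> sg != 0 ->
  (forall u, `|u - s| < e -> 0 <= sg * (u - s) -> A u) -> flat_at M A gam s.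
Proof.
move=> sgam fl e0 sg0 hA e1 eta c le Mc cs [//|k] _; have [e10 _ eg] := le.
have As : A s by apply: hA; rewrite subrr ?normr0// mulr0.
have es : eta s = gam s by apply: eg => //; lra.
have ce : cdom c (eta s) by rewrite es.
have sce : csm M eta s by apply: (local_extension_csm le); rewrite subrr normr0.
have [e2 e20 [_ se]] := (csmP Mc ce).1 sce.
have [e3 e30 [_ se']] := (csmP Mc cs).1 sgam.
pose m := Num.min (Num.min e e1) (Num.min e2 e3).
have m0 : 0 < m by rewrite !lt_min e0 e10 e20.
have m2 : m <= e2 by rewrite !ge_min lexx !orbT.
have m3 : m <= e3 by rewrite !ge_min lexx !orbT.
have me : m <= e by rewrite !ge_min lexx.
have m1 : m <= e1 by rewrite !ge_min lexx !orbT.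
have s1 : fsmooth (nb s m) (cmap c \o eta : ln -> eucl n) by apply: fsmoothS se; exact: nbS.
have s2 : fsmooth (nb s m) (cmap c \o gam : ln -> eucl n) by apply: fsmoothS se'; exact: nbS.
rewrite (@dcurve_derive1n _ _ _ _ _ (nb s m) (cmap c \o eta))//; [|exact: fopen_nb|exact: nb_self].
have hE := pm_model hM.
rewrite (iter_dcurve_dense (g := cmap c \o gam) k.+1 (fopen_nb s m) s1 s2
   (A := [set u : R | `|u - s| < m /\ 0 <= sg * (u - s)])).
- exact: (mflat_chart sgam fl Mc cs).
- by move=> u [].
- exact: half_dense.
- move=> u [um us] /=; congr (cmap c _); apply: eg.
    by apply: hA => //; exact: lt_le_trans um me.
  by rewrite -ltr_distl; exact: lt_le_trans um m1.
- by rewrite /= subrr normr0 mulr0.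
Qed.

(** A path is constant on each side of [0, pi]. Flatness at the end points therefore amounts to
    smoothness on the whole line: a flat extension splices with the constant, and constancy on one
    side forces flatness. *)
Lemma pathsP x0 gam : paths M x0 gam <->
  [/\ forall s, gam s = gam (clamp s), forall s, csm M gam s & gam 0 = x0].
Proof.
have p0 := @pi_gt0 R.
split=> [[cl sm g0 fl0 flp]|[cl sm g0]].
  split=> // s.
  have gle u : u <= 0 -> gam u = gam 0 by move=> u0; rewrite cl clamp_le0.
  have gge u : pi <= u -> gam u = gam pi by move=> u0; rewrite cl clamp_ge.
  have i0 : (`[0, pi]%classic : set R) 0 by rewrite /= in_itv /= lexx ltW.
  have ip : (`[0, pi]%classic : set R) pi by rewrite /= in_itv /= lexx ltW.
  have [s0|s0|s0] := ltgtP s 0.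
  - have M0 : carrier M (gam 0).
      have [e [eta le]] := sm 0 i0; have [e0 _ <-//] := le; last by lra.
      by apply: csm_carrier; apply: (local_extension_csm le); rewrite subrr normr0.
    apply: (csm_congr (csm_cst s M0) (e := - s)); first lra.
    by move=> u us; rewrite [RHS]gle//; have := ler_norm (u - s); lra.
  - have [sp|sp|sp] := ltgtP s pi.
    + have is_ : (`[0, pi]%classic : set R) s by rewrite /= in_itv /= !ltW.
      have [e [eta le]] := sm s is_; have [e0 _ eg] := le.
      apply: (csm_congr (f := eta) (e := Num.min e (Num.min s (pi - s)))).
      * by apply: (local_extension_csm le); rewrite subrr normr0.
      * by rewrite !lt_min e0 s0 subr_gt0.
      move=> u; rewrite !lt_min => /and3P[u1 u2 u3]; apply: eg; last by rewrite -ltr_distl.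
      by rewrite /= in_itv /=; move: u2 u3; rewrite !ltr_distl; lra.
    + have Mp : carrier M (gam pi).
        have [e [eta le]] := sm pi ip; have [e0 _ <-//] := le; last by lra.
        by apply: csm_carrier; apply: (local_extension_csm le); rewrite subrr normr0.
      apply: (csm_congr (csm_cst s Mp) (e := s - pi)); first lra.
      move=> u us; rewrite [RHS]gge//; have := ler_norm (- (u - s)).
      by rewrite normrN; lra.
    rewrite sp; have [e [eta le]] := sm pi ip; have [e0 _ eg] := le.
    have ep : eta pi = gam pi by apply: eg => //; lra.
    have se : csm M eta pi by apply: (local_extension_csm le); rewrite subrr normr0.
    have Mp : carrier M (gam pi) by rewrite -ep; exact: csm_carrier se.
    have sc := csm_cst pi Mp.
    have [s1 _] := csm_splice se (sc hM) ep (flat_at_mflat flp ip le)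
       (mflat_side (sc hM) ltr01 (oner_neq0 R) (fun u _ _ => erefl)).
    apply: (csm_congr s1 (e := Num.min e pi)); first by rewrite lt_min e0.
    move=> u; rewrite lt_min => /andP[u1 u2]; rewrite /splice; case: lerP => up.
      apply: eg; last by rewrite -ltr_distl.
      by rewrite /= in_itv /= up andbT; move: u2; rewrite ltr_distl; lra.
    by rewrite gge// ltW.
  rewrite s0; have [e [eta le]] := sm 0 i0; have [e0 _ eg] := le.
  have ep : gam 0 = eta 0 by apply/esym/eg => //; lra.
  have se : csm M eta 0 by apply: (local_extension_csm le); rewrite subrr normr0.
  have Mp : carrier M (gam 0) by rewrite ep; exact: csm_carrier se.
  have sc := csm_cst 0 Mp.
  have [s1 _] := csm_splice (sc hM) se ep
      (mflat_side (sc hM) ltr01 (oner_neq0 R) (fun u _ _ => erefl)) (flat_at_mflat fl0 i0 le).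
  apply: (csm_congr s1 (e := Num.min e pi)); first by rewrite lt_min e0.
  move=> u; rewrite lt_min => /andP[u1 u2]; rewrite /splice; case: lerP => up.
    by rewrite gle.
  apply: eg; last by rewrite -ltr_distl.
  by rewrite /= in_itv /= ltW//=; move: u2; rewrite ltr_distl; lra.
split=> //.
- by move=> s _; exists 1, gam; apply: csm_local_extension.
- apply: (flat_at_side (sg := 1) (e := pi)) => //.
    apply: (mflat_side (sg := -1) (e := 1)) => //; try by rewrite oppr_eq0 oner_neq0.
    move=> u _; rewrite mulN1r subr0 oppr_ge0 => u0.
    by rewrite cl clamp_le0// [RHS]cl clamp_le0.
  by move=> u; rewrite subr0 mul1r /= in_itv /= => up ->; have := ler_norm u; lra.
apply: (flat_at_side (sg := -1) (e := pi)) => //; first last.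
  move=> u; rewrite mulN1r opprB subr_ge0 /= in_itv /= ltr_distl => /andP[? _] ->.
  by rewrite andbT; lra.
apply: (mflat_side (sg := 1) (e := 1)) => // u _; rewrite mul1r subr_ge0 => u0.
by rewrite cl clamp_ge// [RHS]cl clamp_ge.
Qed.

Lemma paths_le0 x0 gam u : paths M x0 gam -> u <= 0 -> gam u = x0.
Proof. by move=> /pathsP[cl _ <-] u0; rewrite cl clamp_le0. Qed.

Lemma paths_ge x0 gam u : paths M x0 gam -> pi <= u -> gam u = gam pi.
Proof. by move=> /pathsP[cl _ _] u0; rewrite cl clamp_ge. Qed.

Lemma paths_flat0 x0 gam : paths M x0 gam -> mflat M gam 0.
Proof.
move=> h; have /pathsP[cl sm g0] := h.
apply: (mflat_side (sg := -1) (e := 1)) => //; try by rewrite oppr_eq0 oner_neq0.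
by move=> u _; rewrite mulN1r subr0 oppr_ge0 g0; exact: paths_le0.
Qed.

Lemma paths_flatpi x0 gam : paths M x0 gam -> mflat M gam pi.
Proof.
move=> h; have /pathsP[cl sm g0] := h.
apply: (mflat_side (sg := 1) (e := 1)) => // u _; rewrite mul1r subr_ge0.
exact: (paths_ge h).
Qed.

Lemma cup_periodic (f g : R -> T) s : cup f g (s + 2 * pi) = cup f g s.
Proof.
rewrite /cup; have -> // : mod2pi (s + 2 * pi) = mod2pi s.
have [k [e r0 r1]] := mod2piP s; rewrite {1}e -addrA.
have -> : k%:~R * (2 * pi) + 2 * pi = (k + 1)%:~R * (2 * pi) :> R.
  by rewrite intrD mulr1z [RHS]mulrDl mul1r.
by rewrite mod2pi_eq.
Qed.

Lemma cup_mid (f g : R -> T) s : 0 <= s -> s < 2 * pi ->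
  cup f g s = splice pi f (fun u => g (2 * pi - u)) s.
Proof. by move=> s0 s1; rewrite /cup /splice mod2pi_id. Qed.

Lemma cup_low (f g : R -> T) s : 0 <= s -> s <= pi -> cup f g s = f s.
Proof.
move=> s0 s1; rewrite cup_mid// /splice ?s1//.
by have := @pi_gt0 R; lra.
Qed.

Lemma cup_near0 (f g : R -> T) s : f 0 = g 0 -> `|s| < pi ->
  cup f g s = splice 0 (fun u => g (0 + -1 * u)) f s.
Proof.
have p0 := @pi_gt0 R.
move=> fg; rewrite ltr_norml /splice => /andP[sp ps]; case: (ltgtP s 0) => s0.
- rewrite -cup_periodic cup_mid; [|lra|lra]; rewrite /splice ifF; last by apply/negbTE; rewrite -ltNge; lra.
  by congr g; ring.
- by rewrite cup_low// ltW.
by rewrite s0 cup_low// ?(ltW p0)// mulr0 addr0.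
Qed.

Section Cup.
Context (x0 : T) (f g : R -> T) (hf : paths M x0 f) (hg : paths M x0 g).
Hypothesis fg : f pi = g pi.

Lemma cup_csm_mid s : 0 < s -> s < 2 * pi -> csm M (cup f g) s.
Proof.
move=> s0 s1; have p0 := @pi_gt0 R.
have /pathsP[_ sf _] := hf; have /pathsP[_ sg _] := hg.
have sg' u : csm M (fun u => g (2 * pi - u)) u.
  have -> : (fun u => g (2 * pi - u)) = (fun u => g (2 * pi + -1 * u)).
    by apply/funext => v; rewrite mulN1r.
  exact: csm_affine.
suff h : csm M (splice pi f (fun u => g (2 * pi - u))) s.
  apply: (csm_congr h (e := Num.min s (2 * pi - s))); first by rewrite lt_min s0 subr_gt0.
  by move=> u; rewrite lt_min !ltr_distl => /andP[u1 u2]; rewrite cup_mid//; lra.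
have [sp|sp|->] := ltgtP s pi.
- apply: (csm_congr (sf s) (e := pi - s)); first lra.
  by move=> u; rewrite ltr_distl => us; rewrite /splice ifT//; lra.
- apply: (csm_congr (sg' s) (e := s - pi)); first lra.
  move=> u; rewrite ltr_distl => us; rewrite /splice ifF//; apply/negbTE.
  by rewrite -ltNge; lra.
have e2 : 2 * pi - pi = pi :> R by ring.
apply: (csm_splice _ _ _ _ _).1 => //; first by rewrite e2.
  exact: paths_flatpi hf.
apply: (mflat_side (sg := -1) (e := 1)) => //; try by rewrite oppr_eq0 oner_neq0.
move=> u _; rewrite mulN1r opprB subr_ge0 => up; rewrite e2 (paths_ge hg)//; lra.
Qed.

Lemma cup_flatpi : mflat M (cup f g) pi.
Proof.
have p0 := @pi_gt0 R.
have /pathsP[_ sf _] := hf; have /pathsP[_ sg _] := hg.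
have sg' u : csm M (fun u => g (2 * pi - u)) u.
  have -> : (fun u => g (2 * pi - u)) = (fun u => g (2 * pi + -1 * u)).
    by apply/funext => v; rewrite mulN1r.
  exact: csm_affine.
have e2 : 2 * pi - pi = pi :> R by ring.
have fg' : f pi = g (2 * pi - pi) by rewrite e2.
have fl : mflat M (fun u => g (2 * pi - u)) pi.
  apply: (mflat_side (sg := -1) (e := 1)) => //; try by rewrite oppr_eq0 oner_neq0.
  by move=> u _; rewrite mulN1r opprB subr_ge0 => up; rewrite e2 (paths_ge hg)//; lra.
have [h1 h2] := csm_splice (sf pi) (sg' pi) fg' (paths_flatpi hf) fl.
apply: (mflat_congr h1 h2 p0) => u; rewrite ltr_distl => us.
by rewrite cup_mid//; lra.
Qed.

(** Inside (0, 2 pi) the two paths are spliced at pi; at 0 the reversed [g] is spliced with [f];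
    periodicity does the rest. *)
Lemma cup_loops : loops M x0 (cup f g).
Proof.
have p0 := @pi_gt0 R.
have /pathsP[_ sf f0] := hf; have /pathsP[_ sg g0] := hg.
have fg0 : f 0 = g 0 by rewrite f0.
have sg' u : csm M (fun u => g (0 + -1 * u)) u by exact: csm_affine.
have e0 : g (0 + -1 * 0) = f 0 by rewrite mulr0 addr0.
have fl : mflat M (fun u => g (0 + -1 * u)) 0.
  apply: (mflat_side (sg := 1) (e := 1)) => //.
  move=> u _; rewrite mul1r subr0 => u0; rewrite e0 f0 (paths_le0 hg)//; lra.
have [h1 h2] := csm_splice (sg' 0) (sf 0) e0 fl (paths_flat0 hf).
have hc u : `|u - 0| < pi -> splice 0 (fun u => g (0 + -1 * u)) f u = cup f g u.
  by rewrite subr0 => up; rewrite cup_near0.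
have c0 : csm M (cup f g) 0 by exact: (csm_congr h1 p0 hc).
apply/loopsP; split; [exact: cup_periodic|..|by rewrite cup_low// ltW|exact: (mflat_congr h1 h2 p0 hc)].
move=> s; have [k [e r0 r1]] := mod2piP s.
have cr : csm M (cup f g) (mod2pi s).
  by move: r0; rewrite le_eqVlt => /orP[/eqP <-//|r0]; exact: cup_csm_mid.
have -> : cup f g = (fun u => cup f g (- (k%:~R * (2 * pi)) + 1 * u)).
  apply/funext => u; rewrite mul1r addrC -[LHS](periodic_int (cup_periodic f g) (- k)).
  by rewrite mulrNz mulNr.
by apply: csm_affine; rewrite mul1r {1}e addrC addrK.
Qed.

End Cup.

Lemma clamp_paths x0 om : loops M x0 om -> mflat M om pi -> paths M x0 (om \o clamp).
Proof.
have p0 := @pi_gt0 R.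
move=> /loopsP[per sm o0 fl0] flp; apply/pathsP; split=> [s|s|]; last by rewrite /= clamp_le0.
  by rewrite /= clampK.
have M0 : carrier M (om 0) by exact: csm_carrier (sm 0).
have Mp : carrier M (om pi) by exact: csm_carrier (sm pi).
note (csm_cst 0 M0) => sc0; note (csm_cst pi Mp) => scp.
have [s0|s0|->] := ltgtP s 0.
- apply: (csm_congr (csm_cst s M0) (e := - s)); first lra.
  by move=> u us; rewrite /= clamp_le0//; have := ler_norm (u - s); lra.
- have [sp|sp|->] := ltgtP s pi.
  + apply: (csm_congr (sm s) (e := Num.min s (pi - s))); first by rewrite lt_min s0 subr_gt0.
    by move=> u; rewrite lt_min !ltr_distl => us; rewrite /= clamp_id//; lra.
  + apply: (csm_congr (csm_cst s Mp) (e := s - pi)); first lra.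
    by move=> u; rewrite ltr_distl => us; rewrite /= clamp_ge//; lra.
  have [s1 _] := csm_splice (sm pi) scp erefl flp
     (mflat_side scp ltr01 (oner_neq0 R) (fun u _ _ => erefl)).
  apply: (csm_congr s1 p0) => u; rewrite ltr_distl => us; rewrite /splice /=.
  by case: lerP => up; [rewrite clamp_id//; lra|rewrite clamp_ge// ltW].
have [s1 _] := csm_splice sc0 (sm 0) erefl
     (mflat_side sc0 ltr01 (oner_neq0 R) (fun u _ _ => erefl)) fl0.
apply: (csm_congr s1 p0) => u; rewrite ltr_distl => us; rewrite /splice /=.
by case: lerP => up; [rewrite clamp_le0|rewrite clamp_id//; lra].
Qed.

(** This inverts [gam |-> cup gam gam] on the loops that are symmetric about pi. *)
Lemma cup_clamp (om : R -> T) : (forall s, om (s + 2 * pi) = om s) ->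
  (forall r, pi < r -> r < 2 * pi -> om r = om (2 * pi - r)) ->
  cup (om \o clamp) (om \o clamp) = om.
Proof.
move=> per sym; apply/funext => s; rewrite [RHS](periodic_mod2pi s per).
have [k [_ r0 r1]] := mod2piP s; rewrite /cup /=; case: lerP => rp.
  by rewrite clamp_id.
by rewrite clamp_id; [exact/esym/sym|lra|lra].
Qed.

End CupPaths.

Section CurveDerivatives.
Context {R : realType}.
Implicit Types E F H : frechetModel R.
Local Notation ln := (@line R).
Let oT : fopen (setT : set ln) := fopen_fsub ln.

Lemma iter_dcurve_lin E F {hE : is_frechet E} {hF : is_frechet F} (L : E -> F)
    (f : ln -> E) k : flin L -> fsmooth setT f ->
  iter k (@dcurve R F) (L \o f) = L \o iter k (@dcurve R E) f.
Proof.
move=> hL sf; elim: k => [//|k IH]; rewrite !iterS IH; apply/funext => x /=.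
note (fsmooth_iter k oT sf) => sk.
have sL : fsmooth (fsub E) L by apply: fsmooth_lin.
rewrite (dcurve_comp oT (fopen_fsub E) sk sL)//; last by move=> y _; exact: fsmooth_sub sk _.
have fx : fsub E (iter k (@dcurve R E) f x) by exact: fsmooth_sub sk _.
apply: (dfunE (fopen_fsub E)) => //; first exact: (flin_sub hL).
  exact: (dcurve_fs oT sk).
by apply: flin_dderiv => //; exact: (dcurve_fs oT sk).
Qed.

Lemma flin_diff E {hE : is_frechet E} : flin ((fun p => p.1 - p.2) : prodModel E E -> E).
Proof.
have h : flin ((fun p => (p.1, -1 *: p.2)) : prodModel E E -> prodModel E E).
  apply: flin_pair; first exact: flin_fst.
  by apply: (flin_comp (flin_snd E E) (flin_scale (-1))).
have -> : ((fun p => p.1 - p.2) : prodModel E E -> E) =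
    (fun p => p.1 + p.2) \o (fun p => (p.1, -1 *: p.2)).
  by apply/funext => p /=; rewrite scaleN1r.
exact: flin_comp h flin_add.
Qed.

Lemma iter_dcurveB E {hE : is_frechet E} (f g : ln -> E) k s :
  fsmooth setT f -> fsmooth setT g ->
  iter k (@dcurve R E) (fun u => f u - g u) s =
  iter k (@dcurve R E) f s - iter k (@dcurve R E) g s.
Proof.
move=> sf sg.
have sp : fsmooth setT ((fun u => (f u, g u)) : ln -> prodModel E E) by exact: fsmooth_pair.
rewrite -[LHS]/(iter k (@dcurve R E) ((fun p : prodModel E E => p.1 - p.2) \o
  (fun u => (f u, g u))) s).
rewrite (iter_dcurve_lin k (flin_diff (E := E)) sp) /=.
by rewrite (dcurve_pair k oT sf sg).
Qed.

Lemma fsmooth_addZ E F {hE : is_frechet E} {hF : is_frechet F} (U : set E) (a : R) (f g : E -> F) :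
  fopen U -> fsmooth U f -> fsmooth U g -> fsmooth U (fun x => a *: f x + g x).
Proof.
move=> oU sf sg; have US : U `<=` fsub E by case/fopenP: oU.
have sa : fsmooth U (fun x => a *: f x).
  apply: (fsmooth_comp (V := fsub F) oU (fopen_fsub F) _ sf (g := *:%R a)).
    by move=> x; exact: fsmooth_sub.
  by apply: fsmooth_lin => //; exact: flin_scale.
apply: (fsmooth_comp (V := fsub (prodModel F F)) oU (fopen_fsub _) _ (fsmooth_pair US sa sg)
   (g := fun p => p.1 + p.2)).
  by move=> x Ux; split; [exact: fsmooth_sub sa Ux|exact: fsmooth_sub sg Ux].
by apply: fsmooth_lin => //; exact: flin_add.
Qed.

Lemma dcurve_affine E {hE : is_frechet E} (f : ln -> E) (b c : R) : fsmooth setT f ->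
  dcurve (fun u => f (b + c * u : R)) = (fun u => c *: dcurve f (b + c * u : R)).
Proof.
move=> sf; apply/funext => x.
have fU y : setT y -> fsub E (f y) by exact: fsmooth_sub.
apply: (dcurve_unique oT) => //; first by move=> y _; exact: fU.
have := dderiv_line_scale c oT fU I (dcurveP oT sf (x := (b + c * x : R)) I).
move=> [hw H]; split=> // k e /(H k e)[d [d0 Hd]]; exists d; split=> // t t0 td.
have := Hd t t0 td.
have -> // : b + c * x + t *: (c : R^o) = b + c * (x + t *: (1 : R^o)) :> R.
by change (b + c * x + t * c = b + c * (x + t * 1)); ring.
Qed.

Lemma fsmooth_affine_comp E {hE : is_frechet E} (f : ln -> E) (b c : R) :
  fsmooth setT f -> fsmooth setT (fun u : ln => f (b + c * u : R)).
Proof. by move=> sf; exact: (fsmooth_comp oT oT _ (fsmooth_affine b c) sf). Qed.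

Lemma iter_dcurve_affine E {hE : is_frechet E} (f : ln -> E) (b c : R) k : fsmooth setT f ->
  iter k (@dcurve R E) (fun u => f (b + c * u : R)) =
  (fun u => c ^+ k *: iter k (@dcurve R E) f (b + c * u : R)).
Proof.
elim: k f => [|k IH] f sf; first by apply/funext => x; rewrite expr0 scale1r.
note (fsmooth_dcurve oT sf) => sdf.
rewrite !iterSr (dcurve_affine b c sf).
rewrite -[LHS]/(iter k (@dcurve R E) (( *:%R c) \o (fun u => dcurve f (b + c * u : R)))).
rewrite (iter_dcurve_lin k (flin_scale c) (fsmooth_affine_comp b c sdf)) IH//.
by apply/funext => x /=; rewrite scalerA exprS.
Qed.

End CurveDerivatives.

Lemma cup_self_sym (R : realType) T (f : R -> T) (y : R) : 0 < y -> y < 2 * pi ->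
  cup f f y = cup f f (2 * pi + -1 * y).
Proof.
move=> y0 y1; rewrite [LHS]cup_mid; [|lra|lra]; rewrite [RHS]cup_mid; [|lra|lra].
rewrite /splice; case: (ltgtP y pi) => yp.
- rewrite ifF; first by congr f; ring.
  by apply/negbTE; rewrite -ltNge; lra.
- by rewrite ifT; [congr f; ring|lra].
by rewrite ifT; [congr f; lra|lra].
Qed.

(** * Seminorms on curves and closed subspaces of the space of loops *)

Section SupSeminorm.
Context {R : realType} (n : nat) {hE : is_frechet (@eucl R n)}.
Local Notation ln := (@line R).
Local Notation D := (@dcurve R (eucl n)).
Let oT : fopen (setT : set ln) := fopen_fsub ln.
Implicit Types (xi : ln -> @eucl R n) (C : set (R -> 'rV[R]_n)).

Lemma norm_curve_continuous xi : fsmooth setT xi ->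
  continuous ((fun s => `|xi s : 'rV[R]_n|) : R -> R).
Proof.
move=> sx s; apply/cvgrPdist_lt => e e0.
have US : (setT : set ln) `<=` fsub ln by [].
have [_ /(_ 0%N e e0)[l [d [d0 Hd]]]] := (fcontP _ US).1 (fsmooth_cont sx) s I.
near=> t; apply: (@le_lt_trans _ _ (`|xi s - xi t : 'rV[R]_n|)).
  exact: ler_dist_dist.
rewrite distrC; apply: (Hd t I); rewrite pn_line distrC.
by near: t; exact: cvgr_dist_lt.
Unshelve. all: by end_near. Qed.

Lemma derive1n_dcurve xi k s : fsmooth setT xi ->
  derive1n k (xi : R -> 'rV[R]_n) s = iter k D xi s.
Proof.
by move=> sx; rewrite (@dcurve_derive1n _ _ _ _ (vec_premfd hE) setT).
Qed.

Lemma curve_bounded xi (a b : R) : fsmooth setT xi -> a < b ->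
  exists B : R, forall s, a <= s -> s <= b -> `|xi s : 'rV[R]_n| <= B.
Proof.
move=> sx ab.
have [||c _ H] := @EVT_max R (fun s => `|xi s : 'rV[R]_n|) a b; first exact: ltW.
  by apply: continuous_subspaceT; exact: norm_curve_continuous.
by exists `|xi c : 'rV[R]_n| => s sa sb; apply: H; rewrite in_itv /= sa.
Qed.

Lemma curve_has_sup xi (a b : R) k : fsmooth setT xi -> a < b ->
  has_sup [set `|derive1n k (xi : R -> 'rV[R]_n) s| | s in `]a, b[].
Proof.
move=> sx ab; split.
  exists `|derive1n k (xi : R -> 'rV[R]_n) ((a + b) / 2)|; exists ((a + b) / 2) => //.
  by rewrite /= in_itv /=; lra.
have [B HB] := curve_bounded (fsmooth_iter k oT sx) ab.
exists B => _ [s + <-]; rewrite /= in_itv /= => /andP[sa sb].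
by rewrite derive1n_dcurve// HB// ltW.
Qed.

(** The supremum in the seminorm runs over the open interval; the end points are reached by
    continuity of the derivative. *)
Lemma fsn_curve_ub C (a b : R) xi k s : fsmooth setT xi -> a < b -> a <= s -> s <= b ->
  `|iter k D xi s : 'rV[R]_n| <= @fsn R (curveModel C a b) k xi.
Proof.
move=> sx ab sa sb; have hs := curve_has_sup k sx ab.
have inside t : a < t -> t < b -> `|iter k D xi t : 'rV[R]_n| <= @fsn R (curveModel C a b) k xi.
  move=> ta tb; apply: sup_upper_bound => //; exists t; first by rewrite /= in_itv /= ta.
  by rewrite derive1n_dcurve.
apply/ler_addgt0Pr => e e0.
have US : (setT : set ln) `<=` fsub ln by [].
note (fsmooth_iter k oT sx) => sk.
have [_ /(_ 0%N e e0)[l [d [d0 Hd]]]] := (fcontP _ US).1 (fsmooth_cont sk) s I.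
have [t [ta tb ts]] : exists t, [/\ a < t, t < b & `|t - s| < d].
  (* A step of length [m] towards the middle of the interval stays inside it and closer than [d] to
     [s]. *)
  pose m := Num.min d (b - a) / 3.
  have mm0 : 0 < Num.min d (b - a) by rewrite lt_min d0 subr_gt0.
  have m0 : 0 < m by rewrite divr_gt0.
  have mba : m <= (b - a) / 3 by rewrite ler_pM2r// ge_min lexx orbT.
  have md : m < d.
    have : Num.min d (b - a) <= d by rewrite ge_min lexx.
    by move: mm0; rewrite /m; lra.
  have [sm|sm] := lerP s ((a + b) / 2).
    exists (s + m); rewrite addrAC subrr add0r gtr0_norm//; split=> //; clear -sa sm mba m0 ab; lra.
  exists (s - m); rewrite addrAC subrr add0r normrN gtr0_norm//; split=> //; clear -sb sm mba m0 ab; lra.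
have := Hd t I; rewrite pn_line => /(_ ts); rewrite /= => h.
apply: (@le_trans _ _ (`|iter k D xi t : 'rV[R]_n| + `|iter k D xi t - iter k D xi s : 'rV[R]_n|)).
  rewrite -[X in `|X| <= _](subKr (iter k D xi t : 'rV[R]_n)).
  exact: ler_normB.
by apply: lerD; [exact: inside|exact: ltW].
Qed.

Lemma fsn_curve_le C (a b : R) xi k B : fsmooth setT xi -> a < b ->
  (forall s, a < s -> s < b -> `|iter k D xi s : 'rV[R]_n| <= B) ->
  @fsn R (curveModel C a b) k xi <= B.
Proof.
move=> sx ab h; apply: ge_sup; first by case: (curve_has_sup k sx ab).
by move=> _ [s + <-]; rewrite /= in_itv /= => /andP[sa sb]; rewrite derive1n_dcurve// h.
Qed.

Lemma loops_vec xi : loops (vecMfd (eucl n)) 0 xi <->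
  [/\ forall s : R, xi (s + 2 * pi) = xi s, fsmooth setT xi, xi 0 = 0 & cflat xi 0].
Proof.
rewrite loopsP; split=> [[per /csm_vec sx x0 fl]|[per sx x0 fl]].
  split=> //; apply/mflat_vec => //; exact: ((csm_vec xi).2 sx).
note ((csm_vec (E := eucl n) xi).2 sx) => h.
by split=> //; apply/mflat_vec.
Qed.

Lemma paths_vec xi : paths (vecMfd (eucl n)) 0 xi <->
  [/\ forall s : R, xi s = xi (clamp s), fsmooth setT xi & xi 0 = 0].
Proof.
rewrite pathsP; split=> -[cl sx x0]; split=> //; exact/csm_vec.
Qed.

Lemma cflatD (a : R) xi xi' s : fsmooth setT xi -> fsmooth setT xi' ->
  cflat xi s -> cflat xi' s -> cflat (fun u => a *: xi u + xi' u : eucl n) s.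
Proof.
move=> sx sx' fx fx' k.
have sa : fsmooth setT (( *:%R (- a)) \o xi : ln -> eucl n).
  apply: (fsmooth_comp oT (fopen_fsub (eucl n)) _ sx) => //.
  by apply: fsmooth_lin => //; exact: flin_scale.
have -> : (fun u => a *: xi u + xi' u : eucl n) = (fun u => xi' u - (( *:%R (- a)) \o xi) u).
  by apply/funext => u /=; rewrite scaleNr opprK addrC.
rewrite iter_dcurveB// (iter_dcurve_lin _ (flin_scale (- a)) sx) fx' /=.
by rewrite -iterS fx scaler0 subrr.
Qed.

Lemma paths_lin (a : R) xi xi' : paths (vecMfd (eucl n)) 0 xi ->
  paths (vecMfd (eucl n)) 0 xi' -> paths (vecMfd (eucl n)) 0 (fun u => a *: xi u + xi' u).
Proof.
move=> /paths_vec[cl sx x0] /paths_vec[cl' sx' x0']; apply/paths_vec; split.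
- by move=> s; rewrite cl cl'.
- exact: fsmooth_addZ.
- by rewrite x0 x0' scaler0 addr0.
Qed.

Lemma loops_lin (a : R) xi xi' : loops (vecMfd (eucl n)) 0 xi ->
  loops (vecMfd (eucl n)) 0 xi' -> loops (vecMfd (eucl n)) 0 (fun u => a *: xi u + xi' u).
Proof.
move=> /loops_vec[cl sx x0 fx] /loops_vec[cl' sx' x0' fx']; apply/loops_vec; split.
- by move=> s; rewrite cl cl'.
- exact: fsmooth_addZ.
- by rewrite x0 x0' scaler0 addr0.
- exact: cflatD.
Qed.

Lemma loops_cst0 : @loops R _ n (vecMfd (@eucl R n)) 0 (fun=> 0).
Proof.
apply/loops_vec; split=> //; first exact: (fsmooth_cst (E := ln)).
by apply: cflat_cst.
Qed.

Lemma paths_cst0 : @paths R _ n (vecMfd (@eucl R n)) 0 (fun=> 0).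
Proof. by apply/paths_vec; split=> //; exact: (fsmooth_cst (E := ln)). Qed.

Local Notation PM := (@curveModel R n (@paths R _ n (vecMfd (@eucl R n)) 0) 0 pi).
Local Notation LM := (@curveModel R n (@loops R _ n (vecMfd (@eucl R n)) 0) 0 (2 * pi)).

Lemma cup_fsmooth xi : paths (vecMfd (eucl n)) 0 xi -> fsmooth setT (cup xi xi : ln -> eucl n).
Proof. by move=> px; note (cup_loops px px erefl) => /loops_vec[]. Qed.

Lemma iter_dcurve_cup xi k (s : R) : paths (vecMfd (eucl n)) 0 xi -> 0 < s -> s <= pi ->
  iter k D (cup xi xi) s = iter k D xi s.
Proof.
move=> px s0 sp; have /paths_vec[_ sx _] := px.
pose A := [set u : R | 0 < u /\ u <= pi].
apply: (iter_dcurve_dense (U := setT) (A := A)) => //; first exact: cup_fsmooth.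
- move=> y d [y0 yp] d0; exists (- (Num.min d y / 2)); rewrite normrN.
  have m0 : 0 < Num.min d y / 2 by rewrite divr_gt0// lt_min d0.
  have : Num.min d y / 2 < Num.min d y by lra.
  by rewrite lt_min gtr0_norm// => /andP[h1 h2]; split=> //; split; lra.
- by move=> y [y0 yp]; rewrite cup_low// ltW.
Qed.

(** The second half of [cup xi xi] mirrors the first, so its derivatives have the same norms, and
    the seminorms over (0, 2 pi) and (0, pi) agree. The image is closed because symmetry about pi
    and the vanishing of derivatives at pi survive limits. *)
Lemma cup_embedding : closed_embedding (E := LM) (F := PM) (fun xi => cup xi xi).
Proof.
have p0 := @pi_gt0 R; have p2 := @twopi_gt0 R.
split.
- exact: paths_cst0.
- exact: paths_lin.
- move=> a x y _ _; apply/funext => s.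
  change (cup (a *: x + y) (a *: x + y) s = a *: (cup x x s : 'rV[R]_n) + cup y y s).
  by rewrite /cup; case: ifP.
- by move=> x px; exact: cup_loops.
- move=> x px /(congr1 (fun f => f \o clamp)) e; apply/funext => s.
  have /paths_vec[cl _ _] := px; rewrite cl; have /andP[c0 cp] := clamp_itv s.
  by rewrite -(cup_low x x c0 cp); exact: (congr1 (fun f => f s) e).
- move=> k x px; have /paths_vec[_ sx _] := px; have scx := cup_fsmooth px.
  apply/eqP; rewrite eq_le; apply/andP; split.
    apply: fsn_curve_le => // s s0 s1; have [sp|sp] := lerP s pi.
      by rewrite iter_dcurve_cup//; apply: fsn_curve_ub => //; exact: ltW.
    pose c' := (fun u : ln => (cup x x : ln -> eucl n) (2 * pi + -1 * u : R)).
    have -> : iter k D (cup x x) s = iter k D c' s.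
      apply: (iter_dcurve_congr k (U := [set u : ln | 0 < (u : R) < 2 * pi])).
      - apply/fopen_lineP => u /andP[u0 u1]; exists (Num.min u (2 * pi - u)).
          by rewrite lt_min u0 subr_gt0.
        by move=> y; rewrite lt_min !ltr_distl /= => ?; lra.
      - exact: fsmoothS scx.
      - by move=> y /andP[]; exact: cup_self_sym.
      - by rewrite /= s0.
    rewrite /c' iter_dcurve_affine// normrZ normrX normrN1 expr1n mul1r.
    rewrite iter_dcurve_cup//; [|lra|lra]; apply: fsn_curve_ub => //; lra.
  apply: fsn_curve_le => // s s0 s1; rewrite -iter_dcurve_cup//; last exact: ltW.
  by apply: fsn_curve_ub => //; lra.
move=> e le H; have /loops_vec[per se e0 fe] := le.
have sub x : paths (vecMfd (eucl n)) 0 x -> forall k s, 0 <= s -> s <= 2 * pi ->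
    `|iter k D (cup x x) s - iter k D e s : 'rV[R]_n| <=
    @fsn R LM k ((cup x x : LM) - (e : LM)).
  move=> px k s s0 s1; have scx := cup_fsmooth px.
  rewrite -iter_dcurveB//; apply: fsn_curve_ub => //.
  have -> : (fun u : ln => cup x x u - e u : eucl n) = (fun u => -1 *: e u + cup x x u : eucl n).
    by apply/funext => u; rewrite scaleN1r addrC.
  exact: fsmooth_addZ.
have sym r : pi < r -> r < 2 * pi -> e r = e (2 * pi - r).
  move=> rp r2; apply/subr0_eq/eqP; rewrite -normr_eq0 eq_le normr_ge0 andbT.
  apply/ler_addgt0Pr => d d0; rewrite add0r.
  have [x px Hx] := H 0%N (d / 2) ltac:(lra).
  have cr : cup x x r = cup x x (2 * pi - r).
    rewrite [LHS]cup_mid; [|lra|lra]; rewrite [RHS]cup_low; [|lra|lra].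
    by rewrite /splice ifF//; apply/negbTE; rewrite -ltNge.
  have h1 := sub x px 0%N r ltac:(lra) ltac:(lra).
  have h2 := sub x px 0%N (2 * pi - r) ltac:(lra) ltac:(lra).
  rewrite /= in h1 h2.
  have -> : e r - e (2 * pi - r) = (cup x x (2 * pi - r) - e (2 * pi - r)) - (cup x x r - e r) :> 'rV[R]_n.
    by rewrite cr subrBB.
  apply: (le_trans (ler_normB _ _)); rewrite /= in Hx; lra.
have flp : mflat (vecMfd (eucl n)) e pi.
  apply/mflat_vec; first exact: ((csm_vec (E := eucl n) e).2 se).
  move=> k; apply/eqP; rewrite -normr_eq0 eq_le normr_ge0 andbT.
  apply/ler_addgt0Pr => d d0; rewrite add0r.
  have [x px Hx] := H k.+1 d d0.
  have := sub x px k.+1 pi ltac:(lra) ltac:(lra).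
  note ((csm_vec (E := eucl n) _).2 (cup_fsmooth px)) => sc.
  note ((mflat_vec (sc pi)).1 (cup_flatpi px px erefl)) => -> .
  by rewrite sub0r normrN => /le_trans; apply; exact: ltW.
exists (e \o clamp); first exact: clamp_paths.
exact: cup_clamp.
Qed.

Local Notation LIM I := (@curveModel R n (@loops_in R _ n (vecMfd (@eucl R n)) 0 I) 0 (2 * pi)).

Lemma loops_in_embedding I : closed_embedding (E := LM) (F := LIM I) id.
Proof.
have p2 := @twopi_gt0 R.
split=> //.
- by split=> //; exact: loops_cst0.
- move=> a x y [lx Ix] [ly Iy]; split; first exact: loops_lin.
  move=> s Is; change (a *: (x s : 'rV[R]_n) + y s = 0).
  by rewrite Ix// Iy// scaler0 addr0.
- by move=> x [].
move=> e le H; have /loops_vec[per se e0 fe] := le; exists e => //; split=> // s Is.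
apply/eqP; rewrite -normr_eq0 eq_le normr_ge0 andbT.
apply/ler_addgt0Pr => d d0; rewrite add0r.
have [x [lx Ix] Hx] := H 0%N d d0; have /loops_vec[perx sx x0 fx] := lx.
have [k [es r0 r1]] := mod2piP s.
have xr : x (mod2pi s) = 0 by rewrite -periodic_mod2pi// Ix.
rewrite (periodic_mod2pi s per).
have -> : e (mod2pi s) = - (x (mod2pi s) - e (mod2pi s)) by rewrite xr sub0r opprK.
rewrite normrN; apply: (le_trans _ (ltW Hx)).
apply: (@fsn_curve_ub _ 0 (2 * pi) (fun u => x u - e u) 0%N) => //; last exact: ltW.
have -> : (fun u : ln => x u - e u : eucl n) = (fun u => -1 *: e u + x u : eucl n).
  by apply/funext => u; rewrite scaleN1r addrC.
exact: fsmooth_addZ.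
Qed.

End SupSeminorm.

(** * Groups of curves *)

Section CurveGroups.
Context {R : realType}.
Local Notation ln := (@line R).

Lemma mflat_pair T T' F F' (M : mfd T F) (N : mfd T' F') {hM : premfd M} {hN : premfd N}
    (f : R -> T) (g : R -> T') s : csm M f s -> csm N g s ->
  mflat M f s -> mflat N g s -> mflat (prodMfd M N) (fun u => (f u, g u)) s.
Proof.
move=> sf sg [c [Mc cs fc]] [d [Nd ds fd]].
exists (@Chart R _ (prodModel F F') (cdom c `*` cdom d) (fun p => (cmap c p.1, cmap d p.2))).
split=> //; first by exists c, d.
move=> k; have [e e0 [_ se]] := (csmP Mc cs).1 sf; have [e' e'0 [_ se']] := (csmP Nd ds).1 sg.
have m0 : 0 < Num.min e e' by rewrite lt_min e0.
have s1 : fsmooth (nb s (Num.min e e')) (cmap c \o f : ln -> F).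
  by apply: fsmoothS se; apply: nbS; rewrite ge_min lexx.
have s2 : fsmooth (nb s (Num.min e e')) (cmap d \o g : ln -> F').
  by apply: fsmoothS se'; apply: nbS; rewrite ge_min lexx orbT.
note (dcurve_pair k.+1 (fopen_nb s (Num.min e e')) s1 s2 (nb_self s m0)) => h.
by rewrite (_ : _ \o _ = (fun u => ((cmap c \o f) u, (cmap d \o g) u)))// h fc fd.
Qed.

Lemma fsmooth_subc (E : frechetModel R) {hE : is_frechet E} (w : E) : fsub E w -> fsmooth (fsub E) (fun v => v - w).
Proof.
move=> hw.
have sp : fsmooth (fsub E) ((fun v => (v, w)) : E -> prodModel E E).
  apply: fsmooth_pair => //; first by apply: fsmooth_lin => //; exact: flin_id.
  exact: fsmooth_cst.
apply: (fsmooth_comp (V := fsub (prodModel E E)) (fopen_fsub E) (fopen_fsub _) _ sp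
  (g := fun p => p.1 - p.2)) => //.
by apply: fsmooth_lin => //; exact: flin_diff.
Qed.

Lemma csm_comp T T' F F' (M : mfd T F) (N : mfd T' F') {hM : premfd M} {hN : premfd N}
    (f : R -> T) (g : T -> T') s :
  csm M f s -> smooth_at M N g (f s) -> csm N (g \o f) s.
Proof. by move=> sf sg; apply: (smooth_at_comp (M := vecMfd ln) sf sg). Qed.

Lemma fun_mulE S (T : groupType) (f g : S -> T) s : (f * g)%g s = (f s * g s)%g.
Proof. by []. Qed.

Lemma fun_invE S (T : groupType) (f : S -> T) s : (f^-1)%g s = ((f s)^-1)%g.
Proof. by []. Qed.

Lemma fun_oneE S (T : groupType) (s : S) : (1 : S -> T)%g s = 1%g.
Proof. by []. Qed.

Section Group.
Context (T : groupType) (n : nat) (G : mfd T (@eucl R n)) (hG : is_lie G).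
Let hGp : premfd G := lie_premfd hG.
Local Instance G_premfd : premfd G := hGp.
Let hE : is_frechet (@eucl R n) := pm_model hGp.
Local Instance eucl_frechet : is_frechet (@eucl R n) := hE.

Lemma csm_mul (f g : R -> T) s : csm G f s -> csm G g s -> csm G (fun u => f u * g u)%g s.
Proof. by move=> sf sg; apply: (smooth_at_mul hG (M := vecMfd ln)). Qed.

Lemma csm_inv (f : R -> T) s : csm G f s -> csm G (fun u => (f u)^-1)%g s.
Proof. by move=> sf; apply: (smooth_at_inv hG (M := vecMfd ln)). Qed.

Lemma mflat_mul (f g : R -> T) s : csm G f s -> csm G g s -> mflat G f s -> mflat G g s ->
  mflat G (fun u => f u * g u)%g s.
Proof.
move=> sf sg ff fg; have Gf := csm_carrier sf; have Gg := csm_carrier sg.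
have [d Gd ds] := pm_cover hGp (lieM hG (Gf hGp) (Gg hGp)).
exists d; split=> //.
apply: (mflat_comp (M := prodMfd G G) (f := (fun p => p.1 * p.2)%g) (gam := fun u => (f u, g u))) => //.
- by apply: smooth_at_pair.
- by apply: mflat_pair.
apply: smooth_map_at; first exact: lie_mul_smooth.
by split; [exact: Gf|exact: Gg].
Qed.

Lemma csm_chart phi (w : R -> T) s : atlas G phi -> csm G w s -> cdom phi (w s) ->
  cdom phi 1%g ->
  csm (vecMfd (eucl n)) (fun u => cmap phi (w u) - cmap phi 1%g) s.
Proof.
move=> Gphi sw ws p1.
have h : csm (vecMfd (eucl n)) (cmap phi \o w) s.
  by apply: csm_comp sw _; exact: smooth_at_cmap.
apply: (csm_comp (g := fun v => v - cmap phi 1%g) h).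
by apply: (smooth_at_vec (fopen_fsub (eucl n))) => //; exact: fsmooth_subc.
Qed.

Lemma paths1 : paths G 1%g (fun=> 1%g).
Proof. by apply/pathsP; split=> // s; apply: csm_cst; exact: lie1. Qed.

Lemma pathsM f g : paths G 1%g f -> paths G 1%g g -> paths G 1%g (f * g)%g.
Proof.
move=> /pathsP[cf sf f0] /pathsP[cg sg g0]; apply/pathsP; split.
- by move=> s; rewrite !fun_mulE -cf -cg.
- by move=> s; exact: csm_mul.
- by rewrite !fun_mulE f0 g0 mulg1.
Qed.

Lemma pathsV f : paths G 1%g f -> paths G 1%g (f^-1)%g.
Proof.
move=> /pathsP[cf sf f0]; apply/pathsP; split.
- by move=> s; rewrite !fun_invE -cf.
- by move=> s; exact: csm_inv.
- by rewrite !fun_invE f0 invg1.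
Qed.

(** The chart of [Omega G] at [cup g g] with the same [phi] is a slice chart: a symmetric coordinate
    comes from a symmetric loop because [phi] is injective, and the loop is flat at pi because its
    coordinate is. *)
Lemma PathGroup_sub : submfd (E := curveModel (loops (vecMfd (eucl n)) 0) 0 (2 * pi))
   (F := curveModel (paths (vecMfd (eucl n)) 0) 0 pi)
   (fun xi => cup xi xi) (PathGroup G) (Omega G) (fun gam => cup gam gam).
Proof.
have p0 := @pi_gt0 R.
split.
- exact: cup_embedding.
- move=> _ [phi [g [Gphi p1 pg ->]]]; have lg := cup_loops pg pg erefl.
  have /pathsP[cg sg g0] := pg.
  exists (@Chart R _ (curveModel (loops (vecMfd (eucl n)) 0) 0 (2 * pi))
     [set gam | loops G 1%g gam /\ forall s, cdom phi ((cup g g s)^-1 * gam s)%g]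
     (fun gam s => cmap phi ((cup g g s)^-1 * gam s)%g - cmap phi 1%g)).
    by exists phi, (cup g g); split=> //; exact: lg.
  split=> /=.
  + move=> x; split=> [[px dx]|[px [_ dx]]].
      split=> //; split; first exact: cup_loops.
      by move=> s; rewrite /cup; case: ifP.
    split=> // s; have /pathsP[cx _ _] := px; have /andP[c0 cp] := clamp_itv s.
    by rewrite cg cx -(cup_low g g c0 cp) -(cup_low x x c0 cp).
  + move=> x [px dx]; have /pathsP[cx sx x0] := px; split; last first.
      by apply/funext => s; rewrite /cup; case: ifP.
    apply: (paths_vec (hE := hE) _).2; split=> [s||].
    * by rewrite cg cx.
    * apply: (csm_vec (E := eucl n) _).1 => s.
      apply: (csm_chart Gphi (w := (fun s => (g s)^-1 * x s)%g)) => //.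
      by apply: csm_mul => //; exact: csm_inv.
    * by rewrite g0 x0 invg1 mulg1 subrr.
  move=> y xi [ly dy] pxi /(congr1 (fun f => (fun s => f s))) e.
  have {}e s : cmap phi ((cup g g s)^-1 * y s)%g - cmap phi 1%g = cup xi xi s.
    by have := congr1 (fun f => f s) e.
  have /loopsP[pery sy y0 fy] := ly.
  have /loopsP[perg scg cg0 fcg] := lg hGp.
  pose w s := ((cup g g s)^-1 * y s)%g.
  have sw s : csm G w s by apply: csm_mul => //; exact: csm_inv.
  have yw : y = (fun u => cup g g u * w u)%g by apply/funext => s; rewrite /w mulVKg.
  have symy r : pi < r -> r < 2 * pi -> y r = y (2 * pi - r).
    move=> r1 r2; have r0 : 0 < r by lra.
    have er : 2 * pi - r = 2 * pi + -1 * r by ring.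
    have wr : w r = w (2 * pi - r).
      apply: (pm_inj hGp Gphi); [exact: dy|exact: dy|].
      apply: (addIr (- cmap phi 1%g)); rewrite !e er.
      exact: cup_self_sym.
    by rewrite yw wr er (cup_self_sym g r0 r2).
  have scx : fsmooth setT (cup xi xi : ln -> eucl n) by exact: cup_fsmooth.
  have fw : mflat G w pi.
    exists phi; split=> //; first exact: dy.
    move=> k.
    note ((mflat_vec ((csm_vec (E := eucl n) _).2 scx pi)).1 (cup_flatpi (hM := vec_premfd hE) pxi pxi erefl)) => fl.
    have -> : (cmap phi \o w : ln -> eucl n) =
       (fun u => (cup xi xi : ln -> eucl n) u - ((fun=> - cmap phi 1%g) : ln -> eucl n) u).
      by apply/funext => s; rewrite /= opprK -e subrK.
    have sc : fsmooth setT ((fun=> - cmap phi 1%g) : ln -> eucl n).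
      exact: (fsmooth_cst (E := ln) (F := eucl n)).
    by rewrite iter_dcurveB// fl cflat_cst// subrr.
  have fy' : mflat G y pi.
    by note (mflat_mul (scg pi) (sw pi) (cup_flatpi pg pg erefl) fw); rewrite -yw.
  exists (y \o clamp); first exact: clamp_paths.
  by rewrite cup_clamp.
- move=> x px; have [phi Gphi p1] := pm_cover hGp (lie1 hG).
  eexists; first by exists phi, x; split=> //; reflexivity.
  by split=> //= s; rewrite mulVg.
- by move=> x px; exact: cup_loops.
- move=> x y px py e; apply/funext => s; have /pathsP[cx _ _] := px.
  have /pathsP[cy _ _] := py; have /andP[c0 cp] := clamp_itv s.
  by rewrite cx cy -(cup_low x x c0 cp) e cup_low.
Qed.

Context (hO : is_lie (Omega G)).

Lemma PathGroup_lie : is_lie (PathGroup G).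
Proof.
apply: (sub_lie hO PathGroup_sub).
- exact: paths1.
- exact: pathsM.
- exact: pathsV.
- by move=> x y _ _; apply/funext => s; rewrite fun_mulE /cup; case: ifP.
Qed.

(** Outside [I] the base loop [g] is trivial, so by injectivity of [phi] a coordinate that vanishes
    there belongs to a loop that is trivial there. *)
Lemma OmegaIn_sub I : submfd (E := curveModel (loops (vecMfd (eucl n)) 0) 0 (2 * pi))
   (F := curveModel (loops_in (vecMfd (eucl n)) 0 I) 0 (2 * pi))
   id (OmegaIn G I) (Omega G) id.
Proof.
split=> //; first exact: loops_in_embedding; last by move=> x [].
- move=> _ [phi [g [Gphi p1 [lg gI] ->]]].
  exists (@Chart R _ (curveModel (loops (vecMfd (eucl n)) 0) 0 (2 * pi))
     [set gam | loops G 1%g gam /\ forall s, cdom phi ((g s)^-1 * gam s)%g]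
     (fun gam s => cmap phi ((g s)^-1 * gam s)%g - cmap phi 1%g)).
    by exists phi, g; split.
  have /loopsP[perg sg g0 fg] := lg.
  split=> /=.
  + by move=> x; split=> [[[lx xI] dx]|[[lx xI] [_ dx]]].
  + move=> x [[lx xI] dx]; split=> //; have /loopsP[perx sx x0 fx] := lx.
    pose w s := ((g s)^-1 * x s)%g.
    have sw s : csm G w s by apply: csm_mul => //; exact: csm_inv.
    have lxO : carrier (Omega G) x by [].
    have lw : loops G 1%g w.
      exact: (lieM hO (lieV hO (lg : carrier (Omega G) g)) lxO).
    have /loopsP[perw _ w0 fw] := lw.
    have sc : fsmooth setT ((fun=> cmap phi 1%g) : ln -> eucl n).
      exact: (fsmooth_cst (E := ln) (F := eucl n)).
    have sw' s : csm (vecMfd (eucl n)) (cmap phi \o w) s.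
      apply: csm_comp (sw s) _; apply: smooth_at_cmap => //; exact: dx.
    split; last by move=> s Is; rewrite gI// xI// invg1 mulg1 subrr.
    apply/loops_vec; split.
    * by move=> s; rewrite perg perx.
    * apply: (csm_vec (E := eucl n) _).1 => s; apply: (csm_chart Gphi (sw s)) => //; exact: dx.
    * by rewrite g0 x0 invg1 mulg1 subrr.
    * move=> k; rewrite -[LHS]/(iter k.+1 (@dcurve R (eucl n)) (fun u => (cmap phi \o w : ln -> eucl n) u - ((fun=> cmap phi 1%g) : ln -> eucl n) u) 0).
      rewrite iter_dcurveB//; last exact: ((csm_vec (E := eucl n) (cmap phi \o w)).1 sw').
      rewrite [X in _ - X]cflat_cst// subr0.
      exact: (mflat_chart (sw 0) fw Gphi (dx 0)).
  move=> y xi [ly dy] [lxi xiI] e; exists y => //; split=> // s Is.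
  have e' : cmap phi ((g s)^-1 * y s)%g - cmap phi 1%g = xi s.
    exact: (congr1 (fun f => f s) e).
  have : cmap phi ((g s)^-1 * y s)%g = cmap phi 1%g.
    by apply/subr0_eq; rewrite e' xiI.
  move=> /(pm_inj hGp Gphi (dy s) p1); rewrite gI// invg1 mul1g.
  by [].
move=> x [lx xI]; have [phi Gphi p1] := pm_cover hGp (lie1 hG).
eexists; first by exists phi, x; split=> //; reflexivity.
by split=> //= s; rewrite mulVg.
Qed.

Lemma loops_inM I f g : loops_in G 1%g I f -> loops_in G 1%g I g -> loops_in G 1%g I (f * g)%g.
Proof.
move=> [lf fI] [lg gI]; split; first exact: (lieM hO (lf : carrier (Omega G) f)).
by move=> s Is; rewrite fun_mulE fI// gI// mulg1.
Qed.

Lemma loops_inV I f : loops_in G 1%g I f -> loops_in G 1%g I (f^-1)%g.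
Proof.
move=> [lf fI]; split; first exact: (lieV hO (lf : carrier (Omega G) f)).
by move=> s Is; rewrite !fun_invE fI// invg1.
Qed.

Lemma loops_in1 I : loops_in G 1%g I 1%g.
Proof. by split=> //; exact: (lie1 hO). Qed.

Lemma OmegaIn_lie I : is_lie (OmegaIn G I).
Proof.
apply: (sub_lie hO (OmegaIn_sub I)) => //.
- exact: loops_in1.
- exact: loops_inM.
- exact: loops_inV.
Qed.

End Group.
End CurveGroups.

(** * Central extensions *)

Section CircleManifold.
Context {R : realType}.
Local Notation ln := (@line R).

Definition cis (s : R) : R[i] := (cos s +i* sin s)%C.

Lemma cis_norm s : `|cis s| == 1.
Proof. by rewrite normc_def /= cos2Dsin2 sqrtr1. Qed.

Definition circ (s : R) : circle R := exist (fun z : R[i] => `|z| == 1) (cis s) (cis_norm s).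

Lemma cisD s t : cis (s + t) = cis s * cis t.
Proof.
rewrite /cis cosD sinD; apply/eqP; rewrite eq_complex /=; apply/andP; split=> //.
by rewrite addrC eqxx.
Qed.

(** By the double angle formula [cos s = 1] makes [sin (s / 2)] vanish, and the sine has no zero
    strictly between 0 and pi. *)
Lemma cis_eq1 (s : R) : - (2 * pi) < s -> s < 2 * pi -> cis s = 1 -> s = 0.
Proof.
have p0 := @pi_gt0 R.
move=> s0 s1 [cs _]; pose y := s / 2.
have ys : s = y *+ 2 by rewrite /y -mulr_natr mulfVK.
have sy : sin y = 0.
  move: cs; rewrite ys cos_mulr2n => /eqP; rewrite subr_eq -mulr2n => /eqP h.
  have : (cos y) ^+ 2 = 1.
    by move: h; rewrite -[1 *+ 2]/(2 : R) -mulr_natr; lra.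
  have := cos2Dsin2 y => /[swap] ->; rewrite addrC => /eqP.
  by rewrite -subr_eq0 addrK sqrf_eq0 => /eqP.
rewrite ys; have [y0|y0|->] := ltgtP y 0; last by rewrite mul0rn.
- have : 0 < sin (- y) by apply: sin_gt0_pi; rewrite /y in y0 *; lra.
  by rewrite sinN sy oppr0 ltxx.
have : 0 < sin y by apply: sin_gt0_pi; rewrite /y in y0 *; lra.
by rewrite sy ltxx.
Qed.

Lemma cisN s : cis (- s) * cis s = 1.
Proof.
rewrite -cisD addNr /cis cos0 sin0; apply/eqP.
by rewrite eq_complex /= !eqxx.
Qed.

Lemma cis_inj (a s t : R) : a - pi < s < a + pi -> a - pi < t < a + pi ->
  cis s = cis t -> s = t.
Proof.
move=> hs ht e; apply/subr0_eq/cis_eq1; [lra|lra|].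
by rewrite addrC cisD e cisN.
Qed.

Lemma cis_surj (z : circle R) : exists s, val z = cis s.
Proof.
case: z => -[x y] /=; rewrite normc_def /= => /eqP[] n1.
have xy : x ^+ 2 + y ^+ 2 = 1.
  have h : 0 <= x ^+ 2 + y ^+ 2 by rewrite addr_ge0// sqr_ge0.
  by rewrite -(sqr_sqrtr h) n1 expr1n.
have x1 : -1 <= x <= 1.
  rewrite -ler_norml -(ler_pXn2r (n := 2)) ?nnegrE// expr1n real_normK ?num_real//.
  by rewrite -xy lerDl sqr_ge0.
have sq : Num.sqrt (1 - x ^+ 2) = `|y| by rewrite -xy addrAC subrr add0r sqrtr_sqr.
have [y0|y0] := lerP 0 y.
  exists (acos x); rewrite /cis acosK ?in_itv// sin_acos// sq ger0_norm//.
exists (- acos x); rewrite /cis cosN sinN acosK ?in_itv// sin_acos// sq.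
by rewrite ltr0_norm// opprK.
Qed.

Lemma circ_surj (z : circle R) : exists s, z = circ s.
Proof. by have [s e] := cis_surj z; exists s; apply: val_inj. Qed.

Lemma U1_chartP c : atlas (U1 R) c -> exists a : R,
  (forall u, cdom c u <-> exists2 s, a - pi < s < a + pi & u = circ s) /\
  (forall s, a - pi < s < a + pi -> cmap c (circ s) = s).
Proof.
move=> [a [dc mc]]; exists a; split=> [u|s hs]; last exact: mc.
rewrite dc; split=> -[s hs e]; exists s => //; first exact: val_inj.
by rewrite e.
Qed.

Lemma U1_inj c : atlas (U1 R) c -> chart_inj c.
Proof.
move=> /U1_chartP[a [dc mc]] u v /dc[s hs ->] /dc[t ht ->].
by rewrite !mc// => ->.
Qed.

Lemma U1_cover (z : circle R) : exists2 c, atlas (U1 R) c & cdom c z.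
Proof.
have [a e] := circ_surj z; have p0 := @pi_gt0 R.
exists (Chart [set u : circle R | exists2 s : R, a - pi < s < a + pi &
   val u = (cos s +i* sin s)%C]
  (fun u => xget 0 [set s : R | a - pi < s < a + pi /\ val u = (cos s +i* sin s)%C] : ln)).
  exists a; split=> // u s hs us /=.
  case: xgetP => [t _ [ht e']|/(_ s)[]//].
  by apply: (@cis_inj a) => //; rewrite /cis -e' -us.
by exists a; [lra|rewrite e].
Qed.

Lemma U1_premfd : premfd (U1 R).
Proof.
have p0 := @pi_gt0 R.
split=> //; first exact: line_frechet.
- exact: U1_inj.
- by move=> z _; exact: U1_cover.
split=> // c d Uc Ud; apply: smooth_in_glue; first exact: U1_inj.
have [a [dc mc]] := U1_chartP Uc; have [b [dd md]] := U1_chartP Ud.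
move=> u [/dc[s hs us] /dd[t ht ut]].
have e1 : cis (t - s) = 1.
  have e : cis s = cis t by have := congr1 val us; rewrite {1}ut => /esym.
  by rewrite addrC cisD -e cisN.
pose e := Num.min (Num.min (s - (a - pi)) (a + pi - s)) (Num.min (t - (b - pi)) (b + pi - t)).
have e0 : 0 < e by rewrite !lt_min; lra.
(* Two angles of one point differ by a period, so the transition map is the translation by [t - s];
   [e] keeps both angles inside their arcs. *)
exists (nb s e), (fun x : ln => ((t - s) + 1 * (x : R) : R) : ln); split.
- exact: fopen_nb.
- by rewrite us mc//; exact: nb_self.
- by apply: fsmoothS (fsmooth_affine (t - s) 1).
- move=> x; rewrite /nb /= !lt_min !ltr_distl => hx; exists (circ x); last by rewrite mc//; lra.
  by apply/dc; exists x => //; lra.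
move=> v /dc[x hx ->]; rewrite mc// /nb /= !lt_min !ltr_distl => hx'.
have ex : circ x = circ (t - s + 1 * x).
  by apply: val_inj; rewrite /= cisD e1 !mul1r.
split; first by rewrite ex; apply/dd; exists (t - s + 1 * x) => //; lra.
by rewrite ex md//; lra.
Qed.

End CircleManifold.

#[global] Existing Instance U1_premfd.

Section LieTransfer.
Context {R : realType}.
Implicit Types E F : frechetModel R.

(** One group with two atlases: separation and smoothness of the operations pass through the
    identity map, which is smooth both ways. *)
Lemma premfd_lie_transfer (T : groupType) E F (G : mfd T E) (B : mfd T F) :
  is_lie G -> premfd B -> carrier B = carrier G ->
  (forall x, carrier G x -> smooth_at B G id x) ->
  (forall x, carrier G x -> smooth_at G B id x) -> is_lie B.
Proof.
move=> lG hB cB sBG sGB; have hG := lie_premfd lG.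
split.
- apply: premfd_hausdorff => x y; rewrite cB => Gx Gy xy.
  have [A1 [A2 [n1 n2 A12]]] := manifold_hausdorff (lie_mfd lG) Gx Gy xy.
  exists A1, A2; split=> //; [exact: (smooth_at_near (sBG _ Gx) n1)|exact: (smooth_at_near (sBG _ Gy) n2)].
- by rewrite cB; exact: lie1.
- by rewrite cB; exact: lieM.
- by rewrite cB; exact: lieV.
- apply/smooth_mapP; split=> [[x y]|[x y]] [/=]; rewrite cB => Gx Gy; first exact: lieM.
  apply: (smooth_at_comp (N := G) (f := fun p => (p.1 * p.2)%g) (g := id)); last first.
    by apply: sGB; exact: lieM.
  apply: (smooth_at_mul lG).
    apply: (smooth_at_comp (N := B) (f := fst) (g := id)) => /=; last exact: sBG.
    by apply: smooth_at_fst; rewrite /= cB.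
  apply: (smooth_at_comp (N := B) (f := snd) (g := id)) => /=; last exact: sBG.
  by apply: smooth_at_snd; rewrite /= cB.
apply/smooth_mapP; split=> x; rewrite cB => Gx; first exact: lieV.
apply: (smooth_at_comp (N := G) (f := fun p => (p^-1)%g) (g := id)); last first.
  by apply: sGB; exact: lieV.
by apply: (smooth_at_inv lG); exact: sBG.
Qed.

Lemma closed_embedding_prod E F H {hE : is_frechet E} {hH : is_frechet H} (io : F -> E) :
  closed_embedding io ->
  closed_embedding ((fun q => (io q.1, q.2)) : prodModel F H -> prodModel E H).
Proof.
move=> hio; have hF := ce_frechet hio; split.
- by split; [exact: ce_0 hio|exact: fs0].
- move=> a [x1 x2] [y1 y2] [/= ? ?] [/= ? ?].
  by split; [exact: (ce_cl hio)|rewrite /=; fsub].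
- by move=> a [x1 x2] [y1 y2] [/= ? ?] [/= ? ?]; rewrite (ce_lin hio).
- by move=> [x1 x2] [/= ? ?]; split=> //=; exact: (ce_sub hio).
- by move=> [x1 x2] [/= h1 h2] [e ->]; congr pair; exact: (ce_inj hio).
- by move=> k [x1 x2] [/= ? ?]; rewrite (ce_iso hio).
move=> [e1 e2] [/= h1 h2] H0.
have [k d d0|x hx xe] := ce_closed hio h1.
  have [[x1 x2] [/= hx1 _]] := H0 k d d0; rewrite /= gt_max => /andP[? _].
  by exists x1.
by exists (x, e2); rewrite ?xe.
Qed.

End LieTransfer.

Section Bundle.
Context {R : realType} (T T' : groupType) (F E : frechetModel R)
  (H : mfd T F) (Ht : mfd T' E) (i : circle R -> T') (p : T' -> T)
  (ce : central_extension H Ht i p).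
Local Notation ln := (@line R).
Let hHl : is_lie H := cext_base ce.
Let hTl : is_lie Ht := cext_total ce.
Local Instance bH_premfd : premfd H := lie_premfd (cext_base ce).
Local Instance bT_premfd : premfd Ht := lie_premfd (cext_total ce).

Local Instance bF_frechet : is_frechet F := pm_model (lie_premfd (cext_base ce)).
Local Instance bE_frechet : is_frechet E := pm_model (lie_premfd (cext_total ce)).

Lemma cext_p_carrier x : carrier Ht x -> carrier H (p x).
Proof. exact: (cext_proj ce).1.1. Qed.

Lemma cext_p_smooth x : carrier Ht x -> smooth_at Ht H p x.
Proof. by move=> hx; apply: smooth_map_at => //; exact: (cext_proj ce).1. Qed.

Lemma cext_pM x y : carrier Ht x -> carrier Ht y -> p (x * y)%g = (p x * p y)%g.
Proof. exact: (cext_proj ce).2. Qed.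

Lemma cext_p1 : p 1%g = 1%g.
Proof.
by apply: (@mulgI _ (p 1%g)); rewrite -cext_pM ?mulg1//; exact: lie1.
Qed.

Lemma cext_pV x : carrier Ht x -> p (x^-1)%g = ((p x)^-1)%g.
Proof.
move=> hx; apply: (@mulgI _ (p x)); rewrite -cext_pM//; last exact: lieV.
by rewrite !mulgV cext_p1.
Qed.

Lemma cext_i_carrier z : carrier Ht (i z).
Proof. exact: (cext_incl ce).1.1. Qed.

Lemma cext_iM z z' : i (z * z')%g = (i z * i z')%g.
Proof. exact: (cext_incl ce).2. Qed.

Lemma cext_pi z : p (i z) = 1%g.
Proof. by apply/(cext_exact ce (cext_i_carrier z)); exists z. Qed.

(** The content of a local trivialisation at single points, with its inverse named so that the first
    component of the inverse can be identified with [p]. *)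
Definition triv_inv W (Th : T * circle R -> T') (g : T' -> T * circle R) :=
  [/\ forall q, W q.1 -> smooth_at (prodMfd H (U1 R)) Ht Th q,
      forall x, carrier Ht x -> W (p x) ->
        smooth_at Ht (prodMfd H (U1 R)) g x,
      forall q, W q.1 -> g (Th q) = q,
      forall x, carrier Ht x -> W (p x) -> Th (g x) = x /\ (g x).1 = p x &
      forall q, W q.1 -> carrier Ht (Th q)].

Lemma local_triv_inv W Th : local_triv H Ht i p W Th -> exists g, triv_inv W Th g.
Proof.
move=> [/mopenP[WH oW] [sTh [g [sg gK gK']]] pTh _]; exists g; split.
- by move=> [w z] /= Ww; apply: (smooth_restrict2_at sTh) => //; split=> //=; exact: WH.
- by move=> x hx Wx; exact: (smooth_restrict2_at sg).
- by move=> [w z] Ww; apply: gK; split=> //; split=> //=; exact: WH.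
- move=> x hx Wx; have e : Th (g x) = x by exact: gK'.
  split=> //; have [_ [Wg _]] := sg.1 x (conj hx Wx).
  by rewrite -{2}e [g x]surjective_pairing pTh.
- by move=> [w z] Ww; have [] := sTh.1 (w, z) (conj (conj (WH _ Ww) I) (conj Ww I)).
Qed.

Section TildeK.
Context (F' : frechetModel R) (io : F' -> F) (K : mfd T F').
Hypothesis hs : submfd io K H id.

Local Notation KT := (tildeMfd H Ht i p K).

Definition tilde_chart W (Th : T * circle R -> T') (g : T' -> T * circle R)
    (F0 : frechetModel R) (d : chart T F0) (a : chart (circle R) ln) :
    chart T' (prodModel F0 ln) :=
  @Chart R T' (prodModel F0 ln) (Th @` ((W `&` cdom d) `*` cdom a))
    (fun x => (cmap d (g x).1, cmap a (g x).2)).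

Lemma tilde_chartP W Th g d a : local_triv H Ht i p W Th -> triv_inv W Th g ->
  atlas K d -> atlas (U1 R) a -> atlas KT (tilde_chart W Th g d a).
Proof.
move=> lt [_ _ gK _ _] Kd Ua; exists W, Th, d, a; split=> // w z Ww _ _ /=.
by rewrite gK.
Qed.

End TildeK.

Local Notation B := (tildeMfd H Ht i p H).

(** A bundle chart reads base and circle coordinates through a trivialisation, which is a
    diffeomorphism; hence it is compatible with every chart of [Ht]. So the bundle atlas over the
    whole base may replace the given atlas of the extension. *)
Lemma B_chart_smooth c e x : atlas B c -> atlas Ht e -> cdom c x -> cdom e x ->
  smooth_in c e id x /\ smooth_in e c id x.
Proof.
move=> [W [Th [d [a [lt Hd Ua cc mc]]]]] He; rewrite cc => -[[w z] [[/= Ww dw] az] <-] ex.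
have [g [sTh sg gK gK' cTh]] := local_triv_inv lt; have [oW _ pTh _] := lt.
pose da := @Chart R _ (prodModel F ln) (cdom d `*` cdom a) (fun q => (cmap d q.1, cmap a q.2)).
have Pda : atlas (prodMfd H (U1 R)) da by exists d, a.
have ida := pm_inj (prod_premfd _ _) Pda.
have daq : cdom da (w, z) by [].
have [WH nW] := (mopenP W).1 oW.
split.
  note (smooth_at_in (sTh (w, z) Ww) Pda He daq ex) => -[U [h [oU Ux sh Uc Uh]]].
  note (mnear_in (nW w Ww) Hd dw) => -[V [oV Vw VW]].
  note (chart_image_open Ua) => oA.
  have oVA : fopen (V `*` (cmap a @` cdom a) : set (prodModel F ln)) by exact: fopen_prod.
  exists (U `&` (V `*` (cmap a @` cdom a))), h; split.
  - exact: fopenI.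
  - by rewrite mc//; split=> //; split=> //; exists z.
  - by apply: fsmoothS sh => q [].
  - move=> [q1 q2] [Uq [/= /VW[w' [dw' Ww'] <-] [z' az' <-]]].
    by exists (Th (w', z')); [rewrite cc; exists (w', z')|rewrite mc].
  move=> y; rewrite cc => -[[w' z'] [[/= Ww' dw'] az'] <-]; rewrite mc// => -[Uq _].
  by exact: (Uh (w', z') (conj dw' az')).
have hTh := cTh (w, z) Ww.
have gq : g (Th (w, z)) = (w, z) by rewrite gK.
have sgx := sg _ hTh ltac:(by rewrite pTh).
note (smooth_at_in sgx He Pda ex ltac:(by rewrite gq)) => -[U [h [oU Ux sh Uc Uh]]].
note (smooth_at_near (cext_p_smooth hTh) (P := W) ltac:(by rewrite pTh//; exact: nW)) => nP.
note (mnear_in nP He ex) => -[V [oV Vx VP]].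
exists (U `&` V), h; split.
- exact: fopenI.
- by [].
- by apply: fsmoothS sh => q [].
- by move=> q [/Uc].
move=> y ey [Uy Vy]; have [/= [dy ay] hy] := Uh y ey Uy.
have Wy : W (p y) by have [y' [ey' Wy'] /(pm_inj bT_premfd He ey' ey) <-] := VP _ Vy.
have hy' := pm_dom bT_premfd He ey.
have [gy gp] := gK' y hy' Wy.
have Wg : W (g y).1 by rewrite gp.
split; first by rewrite cc; exists (g y) => //; split.
have := mc (g y).1 (g y).2 Wg dy ay; rewrite -surjective_pairing gy => ->.
exact: hy.
Qed.

Lemma B_dom c : atlas B c -> cdom c `<=` carrier Ht.
Proof.
move=> [W [Th [d [a [lt Hd Ua cc mc]]]]] x; rewrite cc => -[q [[/= Ww dw] az] <-].
by have [g [_ _ _ _ cTh]] := local_triv_inv lt; exact: cTh.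
Qed.

Lemma B_inj c : atlas B c -> chart_inj c.
Proof.
move=> [W [Th [d [a [lt Hd Ua cc mc]]]]] x y; rewrite cc.
move=> [[w z] [[/= Ww dw] az] <-] [[w' z'] [[/= Ww' dw'] az'] <-].
rewrite !mc// => -[/(pm_inj bH_premfd Hd dw dw') -> /(U1_inj Ua az az') ->].
by [].
Qed.

Lemma tilde_cover F' (K : mfd T F') : (forall x, carrier K x -> exists2 c, atlas K c & cdom c x) ->
  (forall x, carrier K x -> carrier H x) ->
  forall x, carrier Ht x -> carrier K (p x) ->
  exists2 c, atlas (tildeMfd H Ht i p K) c & cdom c x.
Proof.
move=> Kc KH x hx Kpx; have [d Kd dx] := Kc _ Kpx.
have [W [Th [Wx lt]]] := cext_bundle ce (KH _ Kpx).
have [g tg] := local_triv_inv lt; have [_ _ _ gK' _] := tg.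
have [gx gp] := gK' x hx Wx.
have [a Ua az] := U1_cover (g x).2.
exists (tilde_chart W Th g d a); first exact: tilde_chartP lt tg Kd Ua.
by exists (g x) => //; split=> //; split; rewrite /= gp.
Qed.

Lemma B_smooth_map : smooth_map B Ht id /\ smooth_map Ht B id.
Proof.
split; split=> //.
- by move=> x [].
- move=> c e Bc He; apply: smooth_in_glue; first exact: B_inj.
  by move=> x [cx ex]; case: (B_chart_smooth Bc He cx ex).
- by move=> x hx; split=> //; exact: cext_p_carrier.
- move=> e c He Bc; apply: smooth_in_glue; first exact: (pm_inj bT_premfd He).
  by move=> x [ex cx]; case: (B_chart_smooth Bc He cx ex).
Qed.

Lemma B_premfd : premfd B.
Proof.
have [s1 s2] := B_smooth_map.
apply: (premfd_of_maps _ _ _ _ s1 s2) => //.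
- by move=> c Bc x cx; split; [exact: (B_dom Bc)|exact/cext_p_carrier/(B_dom Bc)].
- exact: B_inj.
- by move=> x [hx Hx]; apply: tilde_cover => // y; exact: (pm_cover bH_premfd).
Qed.

Local Instance B_premfd_inst : premfd B := B_premfd.

Lemma B_carrier : carrier B = carrier Ht.
Proof. by apply/seteqP; split=> [x []//|x hx]; split=> //; exact: cext_p_carrier. Qed.

Lemma B_to x : carrier Ht x -> smooth_at B Ht id x.
Proof. by move=> hx; apply: smooth_map_at; [exact: B_smooth_map.1|rewrite B_carrier]. Qed.

Lemma B_from x : carrier Ht x -> smooth_at Ht B id x.
Proof. by move=> hx; apply: smooth_map_at => //; exact: B_smooth_map.2. Qed.

Lemma B_lie : is_lie B.
Proof. by apply: (premfd_lie_transfer hTl) => //; [exact: B_carrier|exact: B_to|exact: B_from]. Qed.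

Section TildeSub.
Context (F' : frechetModel R) (io : F' -> F) (K : mfd T F').
Hypothesis hs : submfd io K H id.
Local Notation KT := (tildeMfd H Ht i p K).

(** In bundle coordinates the restriction to [K] is a slice for [K] times the circle; the embedding
    of the base is extended by the identity of the line. *)
Lemma tilde_sub : submfd (E := prodModel F ln) (F := prodModel F' ln)
  (fun q => (io q.1, q.2)) KT B id.
Proof.
have KH x : carrier K x -> carrier H x by exact: (sm_carrier hs).
split.
- exact: (closed_embedding_prod (H := ln) (sm_emb hs)).
- move=> c [W [Th [d [a [lt Kd Ua cc mc]]]]].
  have [d' Hd' h] := sm_ext hs Kd.
  have [g tg] := local_triv_inv lt; have [_ _ gK gK' cTh] := tg.
  have [_ _ pTh _] := lt.
  exists (tilde_chart W Th g d' a); first exact: tilde_chartP lt tg Hd' Ua.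
  split.
  + move=> x; rewrite cc /=; split.
      move=> [[w z] [[/= Ww dw] az] <-]; have [Kw d'w] := (chx_dom h w).1 dw.
      split; last by exists (w, z).
      by split; [exact: (cTh (w, z))|rewrite /preimage /= pTh].
    move=> [[hx Kx] [[w z] [[/= Ww dw] az] e]]; exists (w, z) => //; split=> //=.
    split=> //; apply/(chx_dom h); split=> //.
    by rewrite -(pTh w z)// e.
  + move=> x; rewrite cc => -[[w z] [[/= Ww dw] az] <-]; rewrite mc// /= gK//=.
    by have [? ->] := chx_map h dw.
  move=> y [xi r] [[w z] [[/= Ww d'w] az] <-] [/= hxi _]; rewrite gK//= => -[e _].
  have [x Kx e'] := chx_slice h d'w hxi e.
  exists (Th (w, z)) => //; split; first exact: (cTh (w, z)).
  by rewrite /preimage /= pTh// e'.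
- by move=> x [hx Kx]; apply: tilde_cover => //; exact: (sm_cover hs).
- by move=> x [hx Kx]; split=> //; exact: KH.
- by [].
Qed.

Lemma tilde_lie : is_lie K -> is_lie KT.
Proof.
move=> lK; apply: (sub_lie B_lie tilde_sub) => //.
- by split; [exact: lie1|rewrite /preimage /= cext_p1; exact: lie1].
- move=> x y [hx Kx] [hy Ky]; split; first exact: lieM.
  by rewrite /preimage /= cext_pM//; exact: lieM.
- move=> x [hx Kx]; split; first exact: lieV.
  by rewrite /preimage /= cext_pV//; exact: lieV.
Qed.

Local Instance tilde_premfd : premfd KT := sub_premfd tilde_sub (hM := B_premfd).

Lemma tilde_incl x : carrier KT x -> smooth_at KT Ht id x.
Proof.
move=> hx; apply: (smooth_at_comp (N := B) (f := id) (g := id)).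
  exact: (sub_smooth_j tilde_sub (hM := B_premfd) hx).
by apply: B_to; case: hx.
Qed.

Lemma tilde_corestrict S D (N : mfd S D) {hN : premfd N} (f : S -> T') x :
  mnear N x (f @^-1` carrier KT) -> smooth_at N Ht f x -> smooth_at N KT f x.
Proof.
move=> nf sf; apply: (sub_initial tilde_sub (hM := B_premfd)) => //.
apply: (smooth_at_comp (N := Ht) (f := f) (g := id)) => //.
by apply: B_from; note (mnear_self nf) => -[].
Qed.

End TildeSub.

Lemma local_section y : carrier H y -> exists sec : T -> T',
  smooth_at H Ht sec y /\ mnear H y [set w | carrier Ht (sec w) /\ p (sec w) = w].
Proof.
move=> Hy; have [W [Th [Wy lt]]] := cext_bundle ce Hy.
have [g [sTh _ _ _ cTh]] := local_triv_inv lt; have [oW _ pTh _] := lt.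
have [WH nW] := (mopenP W).1 oW.
exists (fun w => Th (w, 1%g)); split; last first.
  by apply: (mnear_sub (nW y Wy)) => w _ Ww; split; [exact: cTh|exact: pTh].
apply: (smooth_at_comp (N := prodMfd H (U1 R)) (f := fun w => (w, 1%g : circle R)) (g := Th)).
  apply: smooth_at_pair; first exact: smooth_at_id.
  have [a Ua a1] := U1_cover (1%g : circle R).
  have [d Hd dy] := pm_cover bH_premfd Hy.
  note (chart_image_open Hd) => oD.
  exists d, a; split=> //; exists (cmap d @` cdom d), (fun=> cmap a 1%g); split=> //.
  by apply: fsmooth_cst => //; case/fopenP: oD.
exact: sTh.
Qed.

End Bundle.

(** * The canonical crossed module *)

Section UpperArc.
Context {R : realType}.
Local Notation ln := (@line R).

Lemma upper_arcP (s : R) : upper_arc s <-> 0 < mod2pi s < pi.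
Proof.
have p0 := @pi_gt0 R; split=> [[k hk]|h].
  have -> : mod2pi s = s + k%:~R * (2 * pi).
    rewrite -[RHS](mod2pi_eq (- k)); [|lra|lra].
    by rewrite mulrNz mulNr addrK.
  exact: hk.
have [k [e _ _]] := mod2piP s; exists (- k).
by have -> : s + (- k)%:~R * (2 * pi) = mod2pi s by rewrite mulrNz mulNr {1}e addrK.
Qed.

Lemma upper_arc_periodic : periodic_set (@upper_arc R).
Proof.
move=> s; rewrite !upper_arcP; have -> // : mod2pi (s + 2 * pi) = mod2pi s.
have [k [e r0 r1]] := mod2piP s; rewrite {1}e -addrA.
have -> : k%:~R * (2 * pi) + 2 * pi = (k + 1)%:~R * (2 * pi) :> R.
  by rewrite intrD mulr1z [RHS]mulrDl mul1r.
by rewrite mod2pi_eq.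
Qed.

Lemma upper_arc_off (r : R) : pi <= r -> r <= 2 * pi -> ~ upper_arc r.
Proof.
have p0 := @pi_gt0 R.
move=> r0; rewrite le_eqVlt => /orP[/eqP->|r1] /upper_arcP.
  by have := @mod2pi_eq R 0 1 (lexx _) (twopi_gt0 (R := R)); rewrite add0r mul1r => ->; lra.
by rewrite mod2pi_id; lra.
Qed.

Definition reflect_loop T (om : R -> T) : R -> T := fun u => om (2 * pi + -1 * u).

Definition lower_arc : set R := [set s | upper_arc (2 * pi + -1 * s)].

Lemma lower_arc_periodic : periodic_set lower_arc.
Proof.
move=> s; rewrite /lower_arc /=.
have -> : 2 * pi + -1 * s = (2 * pi + -1 * (s + 2 * pi)) + 2 * pi by ring.
by split=> /upper_arc_periodic.
Qed.

Lemma upper_lower_disjoint : upper_arc `&` lower_arc = set0.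
Proof.
have p0 := @pi_gt0 R; rewrite -subset0 => s [/upper_arcP h1 /upper_arcP].
have [k [e r0 r1]] := mod2piP s.
have -> : 2 * pi + -1 * s = (2 * pi - mod2pi s) + (- k)%:~R * (2 * pi).
  by rewrite {1}e mulrNz; ring.
by rewrite mod2pi_eq; lra.
Qed.

Section Loops.
Context (T : Type) (n : nat) (M : mfd T (@eucl R n)) {hM : premfd M} (x0 : T).

Lemma upper_loop_off om r : loops_in M x0 upper_arc om -> pi <= r -> r <= 2 * pi -> om r = x0.
Proof. by move=> [_ off] r0 r1; apply: off; exact: upper_arc_off. Qed.

Lemma upper_loop_path om : loops_in M x0 upper_arc om -> paths M x0 (om \o clamp).
Proof.
move=> lom; have [lo off] := lom; have /loopsP[per sm o0 fl] := lo.
have p0 := @pi_gt0 R; apply: (clamp_paths lo).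
apply: (mflat_side (sg := 1) (e := pi) (sm pi) p0 (oner_neq0 R)) => u; rewrite ltr_distl mul1r subr_ge0 => up u0.
by rewrite !(upper_loop_off lom)//; lra.
Qed.

Lemma reflect_loops om : loops_in M x0 upper_arc om -> loops M x0 (reflect_loop om).
Proof.
move=> lom; have [lo off] := lom; have /loopsP[per sm o0 fl] := lo.
have p0 := @pi_gt0 R.
have sr s : csm M (reflect_loop om) s by exact: csm_affine.
have r0 : reflect_loop om 0 = x0 by rewrite /reflect_loop mulr0 addr0 -[2 * pi]add0r per.
apply/loopsP; split; [|exact: sr|exact: r0|].
  move=> s; rewrite /reflect_loop -[RHS](periodic_int per (-1)); congr om.
  by rewrite mulN1r; ring.
apply: (mflat_side (sg := 1) (e := pi) (sr 0) p0 (oner_neq0 R)) => u; rewrite ltr_distl mul1r subr0 => up u0.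
by rewrite r0 /reflect_loop (upper_loop_off lom)//; lra.
Qed.

Lemma reflect_loops_in om : loops_in M x0 upper_arc om ->
  loops_in M x0 lower_arc (reflect_loop om).
Proof.
move=> lom; split; first exact: reflect_loops.
by move=> s ls; apply: lom.2 => h; apply: ls.
Qed.

End Loops.

Lemma cup_upper (T : groupType) (n : nat) (M : mfd T (@eucl R n)) {hM : premfd M} om :
  loops_in M 1%g upper_arc om ->
  cup (om \o clamp) (om \o clamp) = (om * reflect_loop om)%g.
Proof.
move=> lom; have [lo off] := lom; have /loopsP[per sm o0 fl] := lo.
note (reflect_loops lom) => /loopsP[perr _ _ _].
have p0 := @pi_gt0 R; apply/funext => s; rewrite fun_mulE.
rewrite (periodic_mod2pi s per) (periodic_mod2pi s perr) /cup /reflect_loop /=.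
have [k [e r0 r1]] := mod2piP s; case: lerP => rp.
  rewrite clamp_id// (upper_loop_off (r := 2 * pi + -1 * mod2pi s) lom) ?mulg1//; lra.
rewrite clamp_id; [|lra|lra].
rewrite (upper_loop_off (r := mod2pi s) lom) ?mul1g//; [|lra|lra].
by congr om; ring.
Qed.

End UpperArc.

Lemma pn_le (R : realType) (E F : frechetModel R) (x : E) (y : F) k :
  (forall j, fsn j x <= fsn j y) -> pn k x <= pn k y.
Proof.
move=> h; elim: k => [|k IH] /=; first exact: h.
by rewrite ge_max !le_max IH h orbT.
Qed.

Section ReflectSmooth.
Context {R : realType} (T : groupType) (n : nat) (G : mfd T (@eucl R n)) (hG : is_lie G)
  (hO : is_lie (Omega G)).
Local Notation ln := (@line R).
Local Instance rG_premfd : premfd G := lie_premfd hG.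
Local Instance rE_frechet : is_frechet (@eucl R n) := pm_model (lie_premfd hG).
Local Instance rO_premfd : premfd (Omega G) := lie_premfd hO.
Local Instance rU_premfd I : premfd (OmegaIn G I) := lie_premfd (OmegaIn_lie hG hO I).

Local Notation LM := (@curveModel R n (@loops R _ n (vecMfd (@eucl R n)) 0) 0 (2 * pi)).
Local Notation LUM := (@curveModel R n (@loops_in R _ n (vecMfd (@eucl R n)) 0 upper_arc) 0 (2 * pi)).

Local Instance LM_frechet : is_frechet LM := pm_model (lie_premfd hO).
Local Instance LUM_frechet : is_frechet LUM := pm_model (lie_premfd (OmegaIn_lie hG hO upper_arc)).

Lemma reflect_flin : flin (E := LUM) (F := LM) (@reflect_loop R _).
Proof.
split=> //; first by move=> x; exact: reflect_loops.
move=> k; exists k, 1 => x [lx _]; rewrite mul1r.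
have /loops_vec[_ sx _ _] := lx.
have h j : @fsn R LM j (reflect_loop x) <= @fsn R LUM j x.
  have p2 := @twopi_gt0 R.
  apply: fsn_curve_le => //; first exact: fsmooth_affine_comp.
  move=> s s0 s1; rewrite iter_dcurve_affine// normrZ normrX normrN1 expr1n mul1r.
  by apply: fsn_curve_ub => //; lra.
exact: pn_le.
Qed.

(** In charts centred at [om] and at its mirror image, built from the same [phi], reflection of
    loops is the linear reflection of coordinates. *)
Lemma reflect_smooth om : loops_in G 1%g upper_arc om ->
  smooth_at (OmegaIn G upper_arc) (Omega G) (@reflect_loop R T) om.
Proof.
move=> lom; have [phi Gphi p1] := pm_cover rG_premfd (lie1 hG).
pose c := @Chart R _ LUM
   [set gam | loops_in G 1%g upper_arc gam /\ forall s, cdom phi ((om s)^-1 * gam s)%g]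
   (fun gam s => cmap phi ((om s)^-1 * gam s)%g - cmap phi 1%g).
pose d := @Chart R _ LM
   [set gam | loops G 1%g gam /\ forall s, cdom phi ((reflect_loop om s)^-1 * gam s)%g]
   (fun gam s => cmap phi ((reflect_loop om s)^-1 * gam s)%g - cmap phi 1%g).
have Kc : atlas (OmegaIn G upper_arc) c by exists phi, om.
have Kd : atlas (Omega G) d.
  by exists phi, (reflect_loop om); split=> //; exact: reflect_loops.
note (chart_image_open Kc) => oW.
have cx : cdom c om by split=> // s; rewrite mulVg.
exists c, d; split=> //.
  by split; [exact: reflect_loops|move=> s; rewrite mulVg].
exists (cmap c @` cdom c), (@reflect_loop R _); split=> //.
- by apply: fsmooth_lin; [case/fopenP: oW|exact: reflect_flin].
move=> y [ly dy] _; split=> //; split; first exact: reflect_loops.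
by move=> s; exact: dy.
Qed.

End ReflectSmooth.

Section CanonicalAction.
Context {R : realType} (T : groupType) (n : nat) (G : mfd T (@eucl R n)) (hG : is_lie G)
  (T' : groupType) (E : frechetModel R) (Ht : mfd T' E)
  (i : circle R -> T') (p : T' -> (R -> T)) (ce : central_extension (Omega G) Ht i p)
  (hdc : disjoint_commutative G Ht p).
Local Notation ln := (@line R).
Local Notation KT := (tildeOmegaUpper G Ht i p).
Local Notation P := (PathGroup G).
Let hO : is_lie (Omega G) := cext_base ce.
Let hT : is_lie Ht := cext_total ce.
Let subU := OmegaIn_sub hG hO (@upper_arc R).
Let lU := OmegaIn_lie hG hO (@upper_arc R).
Let lP := PathGroup_lie hG hO.
Local Instance cG_premfd : premfd G := lie_premfd hG.
Local Instance cO_premfd : premfd (Omega G) := lie_premfd hO.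
Local Instance cT_premfd : premfd Ht := lie_premfd hT.
Local Instance cU_premfd : premfd (OmegaIn G upper_arc) := lie_premfd lU.
Local Instance cP_premfd : premfd P := lie_premfd lP.

Lemma tildeUpper_lie : is_lie KT.
Proof. exact: (tilde_lie ce subU lU). Qed.

Local Instance cK_premfd : premfd KT := lie_premfd tildeUpper_lie.

Lemma restrict_path_upper x : carrier KT x ->
  cup (restrict_path p x) (restrict_path p x) = (p x * reflect_loop (p x))%g.
Proof. by move=> [hx Kx]; exact: (cup_upper Kx). Qed.

Lemma tilde_p_smooth x : carrier KT x -> smooth_at KT (OmegaIn G upper_arc) p x.
Proof.
move=> hx; apply: (sub_initial subU).
  by apply: (mnear_sub (mnearT hx)) => y [].
apply: (smooth_at_comp (N := Ht) (f := id) (g := p)); first exact: (tilde_incl ce subU hx).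
by apply: (cext_p_smooth ce); case: hx.
Qed.

Lemma restrict_path_carrier x : carrier KT x -> carrier P (restrict_path p x).
Proof. by move=> [hx Kx]; exact: (upper_loop_path Kx). Qed.

(** Tested through the embedding [gam |-> cup gam gam], the restriction becomes the product of [p x]
    with its mirror image, and both factors are smooth in [x]. *)
Lemma restrict_path_smooth : smooth_map KT P (restrict_path p).
Proof.
apply/smooth_mapP; split=> x hx; first exact: restrict_path_carrier.
apply: (sub_initial (PathGroup_sub hG)).
  by apply: (mnear_sub (mnearT hx)) => y _; exact: restrict_path_carrier.
apply: (smooth_at_congr (f := fun y => (p y * reflect_loop (p y))%g)); last first.
  by apply: (mnear_sub (mnearT hx)) => y _ hy; rewrite /= -restrict_path_upper.
apply: (smooth_at_mul hO).
  apply: (smooth_at_comp (N := OmegaIn G upper_arc) (f := p) (g := id)).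
    exact: tilde_p_smooth.
  by apply: (sub_smooth_j subU); case: hx.
apply: (smooth_at_comp (N := OmegaIn G upper_arc) (f := p) (g := @reflect_loop R T)).
  exact: tilde_p_smooth.
by apply: (reflect_smooth hG hO); case: hx.
Qed.

Lemma cup_lift gam : carrier P gam -> exists2 l, carrier Ht l & p l = cup gam gam.
Proof. by move=> pg; apply: (cext_surj ce); exact: (cup_loops pg pg erefl). Qed.

Lemma conj_upper l x : carrier Ht l -> carrier KT x -> carrier KT (l * x * l^-1)%g.
Proof.
move=> hl [hx [lx offx]]; have hV := lieV hT hl; have hm := lieM hT hl hx.
split; first exact: lieM.
rewrite /preimage /= (cext_pM ce)// (cext_pM ce)// (cext_pV ce)//.
have Hl := cext_p_carrier ce hl; split.
  by apply: (lieM hO); [exact: (lieM hO)|exact: (lieV hO)].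
by move=> s ns; rewrite !fun_mulE fun_invE offx// mulg1 mulgV.
Qed.

Lemma canonical_carrier gam x : carrier P gam -> carrier KT x ->
  carrier KT (canonical_action Ht p gam x).
Proof.
move=> pg hx; have [l hl pl] := cup_lift pg.
by rewrite (canonical_actionE ce hx.1 hl pl); exact: conj_upper.
Qed.

(** A smooth local section at [cup gam gam] supplies the lift for all nearby paths, and the action
    does not depend on the lift. *)
Lemma canonical_smooth : smooth_map (prodMfd P KT) KT
  (fun q => canonical_action Ht p q.1 q.2).
Proof.
have sub := PathGroup_sub hG.
apply/smooth_mapP; split=> -[gam x] [/= pg hx]; first exact: canonical_carrier.
have nPK := mnearT (M := prodMfd P KT) (x := (gam, x)) (conj pg hx).
apply: (tilde_corestrict ce subU).
  by apply: (mnear_sub (nPK _)) => -[gam' x'] _ [/= ? ?]; exact: canonical_carrier.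
have lg : carrier (Omega G) (cup gam gam) by exact: (cup_loops pg pg erefl).
have [sec [ssec nsec]] := local_section ce lg.
have sj : smooth_at (prodMfd P KT) (Omega G) (fun q => cup q.1 q.1) (gam, x).
  apply: (smooth_at_comp (N := P) (f := fst) (g := fun gam => cup gam gam)).
    exact: smooth_at_fst.
  exact: (sub_smooth_j sub).
have sl : smooth_at (prodMfd P KT) Ht (fun q => sec (cup q.1 q.1)) (gam, x).
  exact: (smooth_at_comp (N := Omega G) (g := sec) sj ssec).
apply: (smooth_at_congr (f := fun q => (sec (cup q.1 q.1) * q.2 * (sec (cup q.1 q.1))^-1)%g)).
  apply: (smooth_at_mul hT); last exact: (smooth_at_inv hT).
  apply: (smooth_at_mul hT) => //.
  apply: (smooth_at_comp (N := KT) (f := snd) (g := id)); first exact: smooth_at_snd.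
  exact: (tilde_incl ce subU hx).
have n1 := smooth_at_near sj nsec.
apply: (mnear_sub (mnearI (n1 _ _) (nPK _))) => -[gam' x'] _ [[/= hs ps] [/= pg' hx']].
by rewrite (canonical_actionE ce hx'.1 hs ps).
Qed.

(** The loop [p x] is trivial on [0, pi] by assumption and on the other half by its support. *)
Lemma restrict_path_ker x : carrier KT x -> restrict_path p x = 1%g -> exists z, x = i z.
Proof.
move=> [hx [lx offx]] tx; apply/(cext_exact ce hx); apply/funext => s.
have /loopsP[per _ _ _] := lx; have [k [e r0 r1]] := mod2piP s.
rewrite (periodic_mod2pi s per) fun_oneE; have [rp|rp] := lerP (mod2pi s) pi.
  by have := congr1 (fun f => f (mod2pi s)) tx; rewrite /restrict_path clamp_id.
by rewrite offx//; apply: upper_arc_off; exact: ltW.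
Qed.

Lemma canonical_crossed_module :
  central_crossed_module KT P (restrict_path p) (canonical_action Ht p).
Proof.
have caE gam x l := @canonical_actionE R T T' n G E Ht i p gam x l ce.
split; first split.
- exact: tildeUpper_lie.
- exact: lP.
- split; first exact: restrict_path_smooth.
  move=> x y [hx _] [hy _]; apply/funext => s.
  by rewrite /restrict_path (cext_pM ce).
- exact: canonical_smooth.
- move=> h [hh _]; rewrite (caE _ _ 1%g) ?invg1 ?mulg1 ?mul1g//; first exact: lie1 hT.
  by rewrite (cext_p1 ce); apply/funext => s; rewrite /cup; case: ifP.
- move=> g g' h pg pg' hh; have [l hl pl] := cup_lift pg; have [l' hl' pl'] := cup_lift pg'.
  rewrite (caE g' h l') ?(caE g _ l)//; [|exact: (conj_upper hl' hh).1|exact: hh.1].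
  rewrite (caE (g * g')%g h (l * l')%g); [|exact: hh.1|exact: lieM|].
    by rewrite invgM !mulgA.
  by rewrite (cext_pM ce)// pl pl'; apply/funext => s; rewrite fun_mulE /cup; case: ifP.
- move=> g h h' pg hh hh'; have [l hl pl] := cup_lift pg.
  have hhh := lieM tildeUpper_lie hh hh'.
  rewrite !(caE g _ l) ?(hh.1) ?hh'.1 ?hhh.1//; [|exact: hh'.1|exact: hh.1|exact: hhh.1].
  by rewrite !mulgA mulgVK.
- move=> g h pg hh; have [l hl pl] := cup_lift pg.
  rewrite (caE g h l)//; last exact: hh.1.
  have /pathsP[cg _ _] := pg.
  apply/funext => s; rewrite /restrict_path !fun_mulE fun_invE.
  have hV := lieV hT hl; have hm := lieM hT hl hh.1.
  rewrite (cext_pM ce)// (cext_pM ce)//; last exact: hh.1.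
  rewrite (cext_pV ce)// !fun_mulE fun_invE pl.
  by have /andP[c0 cp] := clamp_itv s; rewrite cup_low// -cg.
- move=> h k hh hk; have lh := hh.2.
  have [m hm pm] := cext_surj ce (reflect_loops lh : carrier (Omega G) (reflect_loop (p h))).
  have mk : (m * k = k * m)%g.
    apply/esym/(hdc upper_arc_periodic lower_arc_periodic upper_lower_disjoint).
    - exact: hk.1.
    - exact: hm.
    - exact: hk.2.
    - by rewrite pm; exact: reflect_loops_in.
  rewrite (caE _ k (h * m)%g); [|exact: hk.1|by apply: lieM => //; exact: hh.1|].
    by rewrite invgM -!mulgA (mulgA m k) mk -!mulgA mulVKg.
  by rewrite (cext_pM ce)//; [rewrite pm restrict_path_upper|exact: hh.1].
move=> g h pg hh /(restrict_path_ker hh)[z ->]; have [l hl pl] := cup_lift pg.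
rewrite (caE g _ l)//; last exact: cext_i_carrier ce z.
by rewrite -(cext_central ce z hl) mulgK.
Qed.

End CanonicalAction.

(** * Plateau functions *)

Section Bumps.
Context {R : realType}.
Local Notation ln := (@line R).
Let oT : fopen (setT : set ln) := fopen_fsub ln.

Lemma is_derive_dderiv (f : R -> R) (x w : R) : is_derive x 1 f w ->
  has_dderiv (f : ln -> ln) x (1 : R) w.
Proof.
move=> [df fw]; split=> // k e e0.
have /cvgrPdist_lt/(_ e e0) : h^-1 *: (f (h *: 1 + x) - f x) @[h --> (0 : R)^'] --> w.
  by rewrite -fw; exact: df.
rewrite /dnbhs near_withinE => /nbhs_ballP[d /= d0 H]; exists d; split=> // t t0 td.
split=> // j _ /=; have := H t; rewrite /ball /= sub0r normrN distrC => /(_ td).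
by rewrite -normr_gt0 => /(_ t0); rewrite [t *: _ + x]addrC.
Qed.

(** The derivative of each member is a combination of members, so in the induction all members gain
    one class at once. *)
Lemma smooth_system (f : nat -> R -> R) (a b : nat -> R) (p q : nat -> nat) :
  (forall i x, has_dderiv (f i : ln -> ln) x (1 : R) (a i * f (p i) x + b i * f (q i) x)) ->
  forall i, fsmooth (setT : set ln) (f i : ln -> ln).
Proof.
move=> hf i k; elim: k i => [|k IH] i.
  split=> //; apply: (dderiv_fcontinuous oT) => //.
  by move=> x _; exact: hf.
apply: (fclass_curveS (f' := fun x => a i * f (p i) x + b i * f (q i) x) oT) => //.
pose L : prodModel ln ln -> ln := fun z => (a i * (z.1 : R) + b i * (z.2 : R) : R).
have hL : flin L.
  split=> // [c x y _ _|l]; first by rewrite /L /= /GRing.scale /=; ring.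
  exists 0%N, (`|a i| + `|b i|) => -[x1 x2] _; rewrite pn_line pn_prod !pn_line mulrDl.
  apply: (le_trans (ler_normD _ _)); rewrite !normrM.
  by apply: lerD; rewrite ler_wpM2l// le_max lexx ?orbT.
apply: (@fclass_comp _ k ln (prodModel ln ln) ln _ _ _ setT (fsub (prodModel ln ln))
  (fun x => (f (p i) x, f (q i) x)) L) => //.
- exact: fopen_fsub.
- by apply: fclass_pair.
- exact: fclass_lin.
Qed.

Lemma smooth_sin_cos : fsmooth (setT : set ln) (sin : ln -> ln) /\
  fsmooth (setT : set ln) (cos : ln -> ln).
Proof.
pose f i : R -> R := if i is 0%N then sin else cos.
have H := @smooth_system f (fun i => if i is 0%N then 1 else -1) (fun=> 0)
  (fun i => if i is 0%N then 1%N else 0%N) id.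
suff K : forall i, fsmooth (setT : set ln) (f i : ln -> ln) by split; [exact: (K 0%N)|exact: (K 1%N)].
by apply: H => -[|i] x; rewrite /= mul0r addr0 ?mul1r ?mulN1r; apply: is_derive_dderiv.
Qed.

(** The classical [x^-m exp (-1 / x)]. The whole family is taken because differentiating member [m]
    produces members [m + 1] and [m + 2]. *)
Definition flat_exp m (x : R) : R := if 0 < x then x^-1 ^+ m * expR (- x^-1) else 0.

(** From [z <= exp z] with [z = 1 / (x (m + 2))], raised to the power [m + 2]. The factor [x ^+ 2]
    is what gives derivative 0 at the origin. *)
Lemma flat_exp_bound m x : 0 < x -> flat_exp m x <= m.+2%:R ^+ m.+2 * x ^+ 2.
Proof.
move=> x0; rewrite /flat_exp x0; set y := x^-1.
have y0 : 0 < y by rewrite invr_gt0.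
have n0 : (0 : R) < m.+2%:R by rewrite ltr0n.
have : (y / m.+2%:R) ^+ m.+2 <= expR y.
  have -> : expR y = expR (y / m.+2%:R) ^+ m.+2.
    by rewrite -expRM_natl mulrC divfK// gt_eqF.
  apply: lerXn2r; rewrite ?nnegrE ?expR_ge0 ?divr_ge0 ?(ltW y0)//.
  by apply: le_trans (expR_ge1Dx _); rewrite lerDr.
rewrite expRN -ler_pV2 ?inE ?unitfE ?gt_eqF ?exprn_gt0 ?divr_gt0 ?expR_gt0// => h.
apply: (le_trans (ler_wpM2l (exprn_ge0 m (ltW y0)) h)).
rewrite expr_div_n invf_div mulrCA -[in X in y ^+ m / X]addn2 exprD invfM mulrA.
by rewrite mulrA mulfK ?expf_neq0 ?gt_eqF// -exprVn /y invrK.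
Qed.

Lemma flat_exp_dderiv m x :
  has_dderiv (flat_exp m : ln -> ln) x (1 : R) (1 * flat_exp m.+2 x + (- m%:R) * flat_exp m.+1 x).
Proof.
have fE0 j z : z <= 0 -> flat_exp j z = 0 by rewrite /flat_exp ltNge => ->.
have [x0|x0|->] := ltgtP x 0.
- rewrite !fE0 ?(ltW x0)// !mulr0 addr0.
  apply: (@dderiv_line _ ln ln (fun=> 0) x (1 : R) 0 (flat_exp m) (- x)); first by lra.
    move=> t; rewrite ltr_norml => /andP[_ tx]; rewrite fE0//.
    by rewrite [t *: _]mulr1; lra.
  by apply: is_derive_dderiv; exact: is_derive_cst.
- rewrite /flat_exp x0 mul1r.
  apply: (@dderiv_line _ ln ln (fun z : R => z^-1 ^+ m * expR (- z^-1) : R) x (1 : R) _ (flat_exp m) x x0).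
    move=> t; rewrite ltr_norml [t *: (1 : R^o)]mulr1 /flat_exp => /andP[tx _].
    by have -> : 0 < x + t by lra.
  apply: is_derive_dderiv.
  have xn0 : x != 0 by rewrite gt_eqF.
  have dV : is_derive x 1 (fun y : R => y^-1) (- x ^- 2).
    rewrite -[- _]mulr1; exact: (is_deriveV (f := id) xn0 (is_derive_id x 1)).
  have dE : is_derive x 1 (fun y : R => expR (- y^-1)) (expR (- x^-1) * (x ^- 2)).
    have -> : x ^- 2 = - (- x ^- 2) by rewrite opprK.
    by apply: (is_derive1_comp (f := expR) (g := fun y => - y^-1)); exact: is_derive_expR.
  have dX : is_derive x 1 (fun y : R => y^-1 ^+ m) (- m%:R * x^-1 ^+ m.+1).
    have := is_deriveX m dV; rewrite exprfctE.
    have -> // : (m%:R * x^-1 ^+ m.-1) *: - x ^- 2 = - m%:R * x^-1 ^+ m.+1 :> R.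
    case: m => [|j]; first by rewrite mul0r scale0r oppr0 mul0r.
    by rewrite /GRing.scale /= mulrN mulNr -exprVn -mulrA -exprD addn2.
  have := is_deriveM dX dE; rewrite mulrfctE.
  have -> // : (x^-1 ^+ m *: (expR (- x^-1) / x ^+ 2) + expR (- x^-1) *: (- m%:R * x^-1 ^+ m.+1)) =
    x^-1 ^+ m.+2 * expR (- x^-1) + (- m%:R) * (x^-1 ^+ m.+1 * expR (- x^-1)) :> R.
  by rewrite /GRing.scale /= -exprVn !exprS expr0; ring.
rewrite !fE0 ?mulr0 ?addr0//.
apply/(dderiv_lineP _ oT) => //; split=> // k e e0; set M := m.+2%:R ^+ m.+2 : R.
have M0 : 0 < M by rewrite exprn_gt0 ?ltr0n.
exists (e / M) => [|t]; first by rewrite divr_gt0.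
rewrite ltr_pdivlMr// => tM; rewrite pn_line scaler0 subr0 add0r [flat_exp m 0]fE0// subr0.
have [t0|t0] := lerP t 0; first by rewrite fE0// normr0 mulr_ge0// ltW.
rewrite ger0_norm; last by rewrite /flat_exp t0 mulr_ge0 ?expR_ge0 ?exprn_ge0 ?invr_ge0 ?(ltW t0).
apply: (le_trans (flat_exp_bound m t0)); move: tM; rewrite gtr0_norm// => /ltW tM.
by rewrite expr2 mulrA ler_pM2r// mulrC.
Qed.

Lemma flat_exp_smooth m : fsmooth (setT : set ln) (flat_exp m : ln -> ln).
Proof. by move: m; apply: smooth_system => i x; exact: flat_exp_dderiv. Qed.

Lemma smooth_affine_scale (a b : R) (f : ln -> ln) : fsmooth setT f ->
  fsmooth setT (fun x : ln => a + b * (f x : R) : ln).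
Proof.
move=> sf; apply: (@fsmooth_comp _ ln ln ln _ _ _ setT setT f (fun x : ln => (a + b * (x : R) : R))) => //.
exact: fsmooth_affine.
Qed.

(* With [E x = exp (- 1 / x)] the function [e E (1 - e E (1 - x))] vanishes for
   [x <= 0], where [e E (1 - x) >= 1], and is 1 for [1 <= x]. *)
Lemma smooth_step : exists S : R -> R, [/\ fsmooth (setT : set ln) (S : ln -> ln),
  forall x, x <= 0 -> S x = 0 & forall x, 1 <= x -> S x = 1].
Proof.
pose e := expR 1 : R.
pose S (x : R) : R := 0 + e * flat_exp 0 (1 + (- e) * flat_exp 0 (1 + (-1) * x)).
have e0 : 0 < e by exact: expR_gt0.
exists S; split.
- apply: smooth_affine_scale.
  apply: (@fsmooth_comp _ ln ln ln _ _ _ setT setT (fun x : R => 1 + (- e) * flat_exp 0 (1 + (-1) * x)) (flat_exp 0)) => //;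
    last exact: flat_exp_smooth.
  apply: smooth_affine_scale.
  apply: (@fsmooth_comp _ ln ln ln _ _ _ setT setT (fun x : R => 1 + (-1) * x) (flat_exp 0)) => //;
    last exact: flat_exp_smooth.
  exact: fsmooth_affine.
- move=> x x0; rewrite /S [flat_exp 0 (1 + - e * _)]/flat_exp ltNge.
  suff -> : 1 + - e * flat_exp 0 (1 + -1 * x) <= 0 by rewrite mulr0 addr0.
  have x1 : 0 < 1 + -1 * x by lra.
  rewrite /flat_exp x1 expr0 mul1r [- e * _]mulNr subr_le0 /e -expRD -[leLHS]expR0 ler_expR.
  rewrite subr_ge0 invf_le1//; lra.
move=> x x1; rewrite /S [flat_exp 0 (1 + -1 * x)]/flat_exp.
have -> : (0 < 1 + -1 * x) = false by apply/negbTE; rewrite -leNgt; lra.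
by rewrite mulr0 addr0 /flat_exp ltr01 expr0 mul1r add0r invr1 /e -expRD subrr expR0.
Qed.

End Bumps.

(** * Velocities and the Lie bracket *)

Section Tangent.
Context {R : realType}.
Implicit Types E F : frechetModel R.
Local Notation ln := (@line R).
Let oT : fopen (setT : set ln) := fopen_fsub ln.

Definition tangent E (g : R -> E) (w : E) := has_dderiv (g : ln -> E) (0 : R) (1 : R) w.

Lemma tangentP E {hE : is_frechet E} (g : R -> E) w : (forall t, fsub E (g t)) ->
  tangent g w <-> fsub E w /\ forall k (e : R), 0 < e ->
    exists2 d : R, 0 < d & forall t : R, `|t| < d -> pn k (g t - g 0 - t *: w) <= e * `|t|.
Proof.
move=> gS; rewrite /tangent (dderiv_lineP (U := setT) w oT)//.
by split=> -[hw h]; split=> // k e /(h k e)[d d0 Hd]; exists d => // t /Hd; rewrite add0r.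
Qed.

Lemma tangent_near E (g h : R -> E) w d : 0 < d -> (forall t, `|t| < d -> g t = h t) ->
  tangent g w -> tangent h w.
Proof.
move=> d0 gh; apply: (dderiv_line (E := ln) d0) => t td.
by rewrite add0r [t *: _]mulr1 gh.
Qed.

Lemma tangent_unique E {hE : is_frechet E} (g : R -> E) w w' : (forall t, fsub E (g t)) ->
  tangent g w -> tangent g w' -> w = w'.
Proof. by move=> gS; apply: (dderiv_unique (U := setT) oT). Qed.

Lemma tangent_affine E {hE : is_frechet E} (x v : E) : fsub E x -> fsub E v ->
  tangent (fun t => x + t *: v) v.
Proof.
move=> hx hv; apply/tangentP; first by move=> t; fsub.
split=> // k e e0; exists 1 => // t _.
by rewrite scale0r addr0 [x + _]addrC addrK subrr pn0 mulr_ge0// ltW.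
Qed.

Lemma tangent_cst E {hE : is_frechet E} (x : E) : fsub E x -> tangent (fun=> x) 0.
Proof.
move=> hx; apply: (tangent_near ltr01 (g := fun t => x + t *: 0)).
  by move=> t _; rewrite scaler0 addr0.
by apply: tangent_affine => //; exact: fs0.
Qed.

Lemma tangent_pair E F (g : R -> E) (h : R -> F) v w : tangent g v -> tangent h w ->
  tangent (fun t => (g t, h t) : prodModel E F) (v, w).
Proof. exact: (dderiv_pair (E := ln)). Qed.

Lemma tangent_in E {hE : is_frechet E} (g : R -> E) w (U : set E) : (forall t, fsub E (g t)) ->
  tangent g w -> fopen U -> U (g 0) -> exists2 d : R, 0 < d & forall t, `|t| < d -> U (g t).
Proof.
move=> gS /(tangentP _ gS)[hw H] /fopenP[_ oU] /oU[k [e [e0 He]]].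
have [d d0 Hd] := H k 1 ltr01; have p0 : 0 < 1 + pn k w by note (pn_ge0 k hw); lra.
exists (Num.min d (e / (1 + pn k w))) => [|t]; first by rewrite lt_min d0 divr_gt0.
rewrite lt_min ltr_pdivlMr// => /andP[td te]; apply: He => //.
have -> : g t - g 0 = (g t - g 0 - t *: w) + t *: w by rewrite subrK.
have gt := gS t; have g0 := gS 0.
apply: (le_lt_trans (pnD _ _ _)); [by fsub|by fsub|].
rewrite pnZ//; apply: le_lt_trans te; rewrite mulrDr mulr1.
by apply: lerD => //; have := Hd t td; rewrite mul1r.
Qed.

Lemma tangent_comp E F {hE : is_frechet E} {hF : is_frechet F} (U : set E) (f : E -> F)
    (g : R -> E) w : fopen U -> fsmooth U f -> (forall t, fsub E (g t)) -> U (g 0) ->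
  tangent g w -> tangent (fun t => f (g t)) (dfun f (g 0, w)).
Proof.
move=> oU sf gS U0 hg; note (tangent_in gS hg oU U0) => -[d d0 Hd].
have [sd cd] := fsmooth_dfun oU sf.
apply: (@dderiv_comp _ ln E F _ _ _ (nb 0 d) U g f (dfun f)) => //.
- exact: fopen_nb.
- by move=> y; rewrite /nb /= subr0 => /Hd.
- by move=> y Uy; exact: fsmooth_sub sf Uy.
- exact: fsmooth_cont cd.
- exact: nb_self.
Qed.

Lemma tangent_lin E {hE : is_frechet E} (a : R) (g h : R -> E) v w :
  (forall t, fsub E (g t)) -> (forall t, fsub E (h t)) -> tangent g v -> tangent h w ->
  tangent (fun t => a *: g t + h t) (a *: v + w).
Proof.
move=> gS hS tg th.
have fl : flin (fun p : prodModel E E => a *: p.1 + p.2).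
  apply: (@flin_comp _ (prodModel E E) (prodModel E E) E _ _ (fun p => (a *: p.1, p.2)) (fun p => p.1 + p.2)).
    by apply: flin_pair; [apply: (flin_comp (L' := *:%R a)); [exact: flin_fst|exact: flin_scale]|exact: flin_snd].
  exact: flin_add.
have [[hv _] [hw _]] := (tg, th).
have -> : a *: v + w = dfun (fun p : prodModel E E => a *: p.1 + p.2) ((g 0, h 0), (v, w)).
  apply/esym; apply: (@dfunE _ (prodModel E E) E _ _ (fsub (prodModel E E))) => //.
  - exact: fopen_fsub.
  - by move=> y; exact: flin_sub fl y.
  - by split; [exact: gS|exact: hS].
  - by apply: (flin_dderiv fl); split=> /=.
apply: (@tangent_comp (prodModel E E) E _ _ (fsub (prodModel E E)) (fun p => a *: p.1 + p.2)
   (fun t => (g t, h t)));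
  first [exact: fopen_fsub|by apply: fsmooth_lin|exact: tangent_pair|by move=> t; split; [exact: gS|exact: hS]
    |by split; [exact: gS|exact: hS]].
Qed.

Lemma tangent_derive1 n {hE : is_frechet (@eucl R n)} (g : R -> @eucl R n) w : tangent g w ->
  derive1 (g : R -> 'rV[R]_n) 0 = w.
Proof.
move=> /tangentP H; have {H}[//|_ H] := H.
rewrite /derive1; apply/cvg_lim => //; apply/cvgrPdist_lt => e e0.
have e2 : 0 < e / 2 by lra.
have [d d0 Hd] := H 0%N _ e2.
near=> t.
have t0 : t != 0 by near: t; exact: nbhs_dnbhs_neq.
have td : `|t| < d by near: t; apply: dnbhs0_lt.
have tp : 0 < `|t| by rewrite normr_gt0.
have := Hd t td; rewrite /= => Ht.
rewrite distrC addr0.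
have -> : t^-1 *: (g t - g 0) - w = t^-1 *: ((g t - g 0 : 'rV[R]_n) - t *: w) :> 'rV[R]_n.
  by rewrite [RHS]scalerBr scalerA mulVf// scale1r.
rewrite normrZ normfV mulrC ltr_pdivrMr//; apply: (le_lt_trans Ht).
by rewrite ltr_pM2r//; lra.
Unshelve. all: by end_near. Qed.

Lemma smooth_at_vecP E F {hE : is_frechet E} {hF : is_frechet F} (f : E -> F) x :
  smooth_at (vecMfd E) (vecMfd F) f x -> exists U, [/\ fopen U, U x & fsmooth U f].
Proof.
move=> [c [d [-> -> /= hx hfx [U [h [oU Ux sh _ Uh]]]]]]; exists U; split=> //.
by apply: (fsmooth_congr oU _ sh) => y Uy; case: (Uh y) => //; case/fopenP: oU => US _; exact: US.
Qed.

Lemma mnear_vecP E {hE : is_frechet E} x (P : set E) : mnear (vecMfd E) x P ->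
  exists U, [/\ fopen U, U x & U `<=` P].
Proof.
move=> [c [U [-> /= hx oU Ux UP]]]; exists U; split=> // y /UP[z [_ Pz] <-].
exact: Pz.
Qed.

End Tangent.

Lemma quotient_cancel (R : fieldType) (V : lmodType R) (t : R) (a b : V) : t != 0 ->
  t^-1 *: (t *: a + b - b) - a = 0.
Proof. by move=> t0; rewrite addrK scalerA mulVf// scale1r subrr. Qed.

(** * The adjoint representation in a chart: [F] plays conjugation and [o] the coordinate of the
    unit *)

Section LocalConjugation.
Context {R : realType} {n : nat} {hE : is_frechet (@eucl R n)}.
Local Notation E := (@eucl R n).
Local Notation E2 := (prodModel E E).
Context (F : E2 -> E) (o : E) (W : set E2).
Hypotheses (oW : fopen W) (Woo : W (o, o)) (sF : fsmooth W F).
Hypothesis F_unit : forall x, F (x, o) = o.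
Hypothesis F_one : forall y, W (o, y) -> F (o, y) = y.
Hypothesis F_conj : forall x y z, W (x, y) -> W (y, z) -> W (x, z) ->
  F (x, F (y, z)) = F (F (x, y), F (x, z)).

Let S (x : E) : fsub E x := I.
Let S2 (x : E2) : fsub E2 x := conj I I.

(* [adj (x, v)] is [Ad(g) v] for the group element [g] with coordinate [x]. *)
Definition adj (q : E2) : E := dfun F ((q.1, o), (0, q.2)).
Let V : set E2 := [set q | W (q.1, o)].

Let ins_smooth : fsmooth (fsub E2) (fun q : E2 => ((q.1, o), (0, q.2)) : prodModel E2 E2).
Proof.
have US : fsub E2 `<=` fsub E2 by [].
apply: fsmooth_pair => //; apply: fsmooth_pair => //.
- by apply: fsmooth_lin => //; exact: flin_fst.
- exact: fsmooth_cst.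
- exact: fsmooth_cst.
- by apply: fsmooth_lin => //; exact: flin_snd.
Qed.

Let oV : fopen V.
Proof.
have -> : V = fsub E2 `&` (fun q : E2 => (q.1, o) : E2) @^-1` W.
  by apply/seteqP; split=> [q|q []].
apply: fsmooth_preimage => //; first exact: fopen_fsub.
apply: fsmooth_pair => //; [by apply: fsmooth_lin => //; exact: flin_fst|exact: fsmooth_cst].
Qed.

Lemma adj_smooth : fsmooth V adj.
Proof.
have [_ sd] := fsmooth_dfun oW sF.
apply: (@fsmooth_comp _ E2 (prodModel E2 E2) E _ _ _ V (W `*` fsub E2) (fun q => ((q.1, o), (0, q.2))) (dfun F)) => //.
  by apply: fopen_prod => //; exact: fopen_fsub.
exact: (fsmoothS _ ins_smooth).
Qed.

Lemma adj_tangent x v : W (x, o) -> tangent (fun t => F (x, o + t *: v)) (adj (x, v)).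
Proof.
move=> Wx; have h := @tangent_comp _ E2 E _ _ W F (fun t => (x, o + t *: v)) (0, v) oW sF
  (fun=> S2 _); move: h; rewrite scale0r addr0; apply=> //.
apply: tangent_pair; first exact: tangent_cst.
exact: tangent_affine.
Qed.

Lemma adj_lin x a v w : W (x, o) -> adj (x, a *: v + w) = a *: adj (x, v) + adj (x, w).
Proof.
move=> Wx; have [hd sd] := fsmooth_dfun oW sF.
have cd := fsmooth_cont sd.
have FS y : W y -> fsub E (F y) by [].
rewrite /adj /=.
have -> : ((0, a *: v + w) : E2) = a *: ((0, v) : E2) + ((0, w) : E2).
  transitivity ((a *: 0 + 0, a *: v + w) : E2); last by [].
  by rewrite scaler0 addr0.
rewrite (dderivD oW FS hd cd Wx (S2 _) (S2 _)).
by rewrite (dderivZ oW FS hd a Wx (S2 _)).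
Qed.

Lemma adj_one v : adj (o, v) = v.
Proof.
have Vo : W (o, o + 0 *: v) by rewrite scale0r addr0.
have [d d0 Hd] := @tangent_in _ E2 _ (fun t => (o, o + t *: v)) (0, v) W (fun=> S2 _)
  (tangent_pair (tangent_cst (S o)) (tangent_affine (S o) (S v))) oW Vo.
apply: (tangent_unique (g := fun t => o + t *: v)) => //; last exact: tangent_affine.
by apply: (tangent_near d0 (g := fun t => F (o, o + t *: v))) => [t /Hd/F_one|]; last exact: adj_tangent.
Qed.

(** The differential of the adjoint representation at the unit, hence the Lie bracket of [q.1] and
    [q.2]. *)
Definition bra (q : E2) : E := dfun adj ((o, q.2), (q.1, 0)).

Lemma bra_tangent (g : R -> E) u v : g 0 = o -> tangent g u ->
  tangent (fun t => adj (g t, v)) (bra (u, v)).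
Proof.
move=> g0 tg; have h := @tangent_comp _ E2 E _ _ V adj (fun t => (g t, v)) (u, 0) oV adj_smooth
  (fun=> S2 _); move: h; rewrite g0; apply=> //.
by apply: tangent_pair => //; exact: tangent_cst.
Qed.

Lemma bra_linl a u u' v : bra (a *: u + u', v) = a *: bra (u, v) + bra (u', v).
Proof.
have [hd sd] := fsmooth_dfun oV adj_smooth; have cd := fsmooth_cont sd.
have FS y : V y -> fsub E (adj y) by [].
have Vo : V (o, v) by [].
rewrite /bra /=.
have -> : ((a *: u + u', 0) : E2) = a *: ((u, 0) : E2) + ((u', 0) : E2).
  transitivity ((a *: u + u', a *: 0 + 0) : E2); last by [].
  by rewrite scaler0 addr0.
rewrite (dderivD oV FS hd cd Vo (S2 _) (S2 _)).
by rewrite (dderivZ oV FS hd a Vo (S2 _)).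
Qed.

Let near_o (u : E) : exists2 d : R, 0 < d & forall t, `|t| < d -> W (o + t *: u, o).
Proof.
apply: (@tangent_in _ E2 _ (fun t => (o + t *: u, o)) (u, 0) W) => //.
  by apply: tangent_pair; [exact: tangent_affine|exact: tangent_cst].
by rewrite scale0r addr0.
Qed.

Lemma bra_linr a u v v' : bra (u, a *: v + v') = a *: bra (u, v) + bra (u, v').
Proof.
have tu : tangent (fun t => o + t *: u) u by exact: tangent_affine.
have g0 : o + 0 *: u = o by rewrite scale0r addr0.
have [d d0 Hd] := near_o u.
apply: (tangent_unique (g := fun t => adj (o + t *: u, a *: v + v'))) => //.
  exact: bra_tangent.
apply: (tangent_near d0 (g := fun t => a *: adj (o + t *: u, v) + adj (o + t *: u, v'))).
  by move=> t /Hd Wt; rewrite adj_lin.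
by apply: tangent_lin => //; exact: bra_tangent.
Qed.

Lemma bra_smooth : fsmooth (fsub E2) bra.
Proof.
have [_ sd] := fsmooth_dfun oV adj_smooth.
have US : fsub E2 `<=` fsub E2 by [].
apply: (@fsmooth_comp _ E2 (prodModel E2 E2) E _ _ _ (fsub E2) (V `*` fsub E2)
   (fun q => ((o, q.2), (q.1, 0))) (dfun adj)) => //.
- exact: fopen_fsub.
- by apply: fopen_prod => //; exact: fopen_fsub.
apply: fsmooth_pair => //; apply: fsmooth_pair => //.
- exact: fsmooth_cst.
- by apply: fsmooth_lin => //; exact: flin_snd.
- by apply: fsmooth_lin => //; exact: flin_fst.
- exact: fsmooth_cst.
Qed.

Let bra0l v : bra (0, v) = 0.
Proof. by have := bra_linl (-1) 0 0 v; rewrite scaler0 addr0 scaleN1r addNr. Qed.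

Let bra0r u : bra (u, 0) = 0.
Proof. by have := bra_linr (-1) u 0 0; rewrite scaler0 addr0 scaleN1r addNr. Qed.

(** [F_conj] differentiated in [z] at [o]. *)
Lemma adj_comp x y w : W (x, y) -> W (y, o) -> W (x, o) -> W (F (x, y), o) ->
  adj (x, adj (y, w)) = adj (F (x, y), adj (x, w)).
Proof.
move=> Wxy Wy Wx WF.
have N z : W (z, o) -> exists2 d : R, 0 < d & forall t, `|t| < d -> W (z, o + t *: w).
  move=> Wz; apply: (@tangent_in _ E2 _ (fun t => (z, o + t *: w)) (0, w) W) => //.
    by apply: tangent_pair; [exact: tangent_cst|exact: tangent_affine].
  by rewrite scale0r addr0.
have [dx dx0 Hx] := N x Wx; have [dy dy0 Hy] := N y Wy.
have dd : 0 < Num.min dx dy by rewrite lt_min dx0.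
have chain z (g : R -> E) v : W (z, o) -> g 0 = o -> tangent g v ->
    tangent (fun t => F (z, g t)) (adj (z, v)).
  move=> Wz g0 tg; have h := @tangent_comp _ E2 E _ _ W F (fun t => (z, g t)) (0, v) oW sF
    (fun=> S2 _); move: h; rewrite g0; apply=> //.
  by apply: tangent_pair => //; exact: tangent_cst.
have g0 z : F (z, o + 0 *: w) = o by rewrite scale0r addr0.
apply: (tangent_unique (g := fun t => F (x, F (y, o + t *: w)))) => //.
  by apply: chain => //; exact: adj_tangent.
apply: (tangent_near dd (g := fun t => F (F (x, y), F (x, o + t *: w)))).
  by move=> t; rewrite lt_min => /andP[/Hx tx /Hy ty]; exact: (esym (F_conj Wxy ty tx)).
by apply: chain => //; exact: adj_tangent.
Qed.

(** [adj_comp] differentiated in [y] at [o]: the adjoint action is by automorphisms of the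
    bracket. *)
Lemma adj_bra x v w : W (x, o) -> adj (x, bra (v, w)) = bra (adj (x, v), adj (x, w)).
Proof.
move=> Wx; pose y t := o + t *: v : E.
have y0 : y 0 = o by rewrite /y scale0r addr0.
have ty : tangent y v by exact: tangent_affine.
have tF : tangent (fun t => F (x, y t)) (adj (x, v)) by exact: adj_tangent.
have F0 : F (x, y 0) = o by rewrite y0.
have [d1 d10 H1] := near_o v.
have [d2 d20 H2] : exists2 d : R, 0 < d & forall t, `|t| < d -> W (x, y t).
  apply: (@tangent_in _ E2 _ (fun t => (x, y t)) (0, v) W) => //; last by rewrite y0.
  by apply: tangent_pair => //; exact: tangent_cst.
have [d3 d30 H3] : exists2 d : R, 0 < d & forall t, `|t| < d -> W (F (x, y t), o).
  apply: (@tangent_in _ E2 _ (fun t => (F (x, y t), o)) (adj (x, v), 0) W) => //; last by rewrite F0.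
  by apply: tangent_pair => //; exact: tangent_cst.
have dd : 0 < Num.min d1 (Num.min d2 d3) by rewrite !lt_min d10 d20.
have T1 : tangent (fun t => adj (x, adj (y t, w))) (bra (adj (x, v), adj (x, w))).
  apply: (tangent_near dd (g := fun t => adj (F (x, y t), adj (x, w)))); last exact: bra_tangent.
  move=> t; rewrite !lt_min => /and3P[/H1 h1 /H2 h2 /H3 h3].
  exact: (esym (adj_comp w h2 h1 Wx h3)).
have T2 : tangent (fun t => adj (x, adj (y t, w))) (dfun adj ((x, adj (y 0, w)), (0, bra (v, w)))).
  apply: (@tangent_comp _ E2 E _ _ V adj (fun t => (x, adj (y t, w))) (0, bra (v, w)) oV adj_smooth
    (fun=> S2 _) Wx).
  by apply: tangent_pair; [exact: tangent_cst|exact: bra_tangent].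
(* [adj] is linear in its second slot, so its partial derivative there is [adj] itself. *)
rewrite -(tangent_unique (fun=> S _) T2 T1); apply/esym.
apply: (@dfunE _ E2 E _ _ V) => [||||]; [exact: oV|by []|exact: Wx|exact: S2|].
split; first by [].
move=> k e e0; exists 1; split; first exact: ltr01.
move=> t t0 _; split; first by [].
move=> j _; have tn : t != 0 by rewrite -normr_gt0.
rewrite -[(x, adj (y 0, w)) + _]/((x + t *: 0, adj (y 0, w) + t *: bra (v, w)) : E2).
rewrite scaler0 addr0 [adj (y 0, w) + _]addrC (adj_lin _ _ _ Wx).
rewrite (quotient_cancel _ _ tn) (@fsn0 _ _ hE); exact: e0.
Qed.

(** [adj_bra] differentiated in [x] at [o]; on the right the chain rule and bilinearity of [bra]
    give the two terms. *)
Lemma bra_leibniz u v w : bra (u, bra (v, w)) = bra (bra (u, v), w) + bra (v, bra (u, w)).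
Proof.
pose y t := o + t *: u : E.
have y0 : y 0 = o by rewrite /y scale0r addr0.
have ty : tangent y u by exact: tangent_affine.
have [d d0 Hd] := near_o u.
apply: (tangent_unique (g := fun t => adj (y t, bra (v, w)))); [by []|exact: bra_tangent|].
apply: (tangent_near d0 (g := fun t => bra (adj (y t, v), adj (y t, w)))).
  by move=> t /Hd Wt; rewrite adj_bra.
have h := @tangent_comp _ E2 E _ _ (fsub E2) bra (fun t => (adj (y t, v), adj (y t, w)))
  (bra (u, v), bra (u, w)) (fopen_fsub E2) bra_smooth (fun=> S2 _) (S2 _)
  (tangent_pair (bra_tangent v y0 ty) (bra_tangent w y0 ty)).
move: h; rewrite y0 !adj_one.
have [hd sd] := fsmooth_dfun (fopen_fsub E2) bra_smooth; have cd := fsmooth_cont sd.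
have -> : ((bra (u, v), bra (u, w)) : E2) = ((bra (u, v), 0) : E2) + ((0, bra (u, w)) : E2).
  by congr pair; rewrite ?addr0 ?add0r.
have FS y' : fsub E2 y' -> fsub E (bra y') by [].
rewrite (dderivD (fopen_fsub E2) FS hd cd (S2 _) (S2 _) (S2 _)).
have E1 : dfun bra ((v, w), (bra (u, v), 0)) = bra (bra (u, v), w).
  apply: (@dfunE _ E2 E _ _ (fsub E2)) => [||||]; [exact: fopen_fsub|by []|exact: S2|exact: S2|].
  split; first by [].
  move=> k e e0; exists 1; split; first exact: ltr01.
  move=> t t0 _; split; first by [].
  move=> j _; have tn : t != 0 by rewrite -normr_gt0.
  rewrite -[(v, w) + _]/((v + t *: bra (u, v), w + t *: 0) : E2).
  rewrite [v + _]addrC scaler0 addr0 bra_linl.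
  rewrite (quotient_cancel _ _ tn) (@fsn0 _ _ hE); exact: e0.
have E3 : dfun bra ((v, w), (0, bra (u, w))) = bra (v, bra (u, w)).
  apply: (@dfunE _ E2 E _ _ (fsub E2)) => [||||]; [exact: fopen_fsub|by []|exact: S2|exact: S2|].
  split; first by [].
  move=> k e e0; exists 1; split; first exact: ltr01.
  move=> t t0 _; split; first by [].
  move=> j _; have tn : t != 0 by rewrite -normr_gt0.
  rewrite -[(v, w) + _]/((v + t *: 0, w + t *: bra (u, w)) : E2).
  rewrite [w + _]addrC scaler0 addr0 bra_linr.
  rewrite (quotient_cancel _ _ tn) (@fsn0 _ _ hE); exact: e0.
rewrite E1 E3 => h; exact: (h _ _).
Qed.

Lemma bra_derive1 u v : derive1 (fun t : R => derive1 (fun s : R =>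
  F (o + t *: u, o + s *: v) : 'rV[R]_n) 0 : 'rV[R]_n) 0 = bra (u, v).
Proof.
have [d d0 Hd] := near_o u.
apply: tangent_derive1; apply: (tangent_near d0 (g := fun t => adj (o + t *: u, v))).
  by move=> t /Hd Wt; apply/esym/tangent_derive1; exact: adj_tangent.
by apply: bra_tangent; [rewrite scale0r addr0|exact: tangent_affine].
Qed.

End LocalConjugation.

Section Bracket.
Context {R : realType} (T : groupType) (n : nat) (G : mfd T (@eucl R n)) (hG : is_lie G).
Context (c : chart T (@eucl R n)) (Gc : atlas G c) (c1 : cdom c 1%g).
Local Notation E := (@eucl R n).
Local Notation E2 := (prodModel E E).
Local Instance brG_premfd : premfd G := lie_premfd hG.
Local Instance brE_frechet : is_frechet E := pm_model (lie_premfd hG).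

Definition conj_chart (q : E2) : E :=
  cmap c (cinv c q.1 * cinv c q.2 * (cinv c q.1)^-1)%g.
Let o := cmap c 1%g.
Let ci : chart_inj c := pm_inj brG_premfd Gc.
Let co : cinv c o = 1%g := cinvK ci c1.

Lemma conj_chart_smooth : exists W : set E2, [/\ fopen W, W (o, o), fsmooth W conj_chart &
  forall q, W q -> [/\ (cmap c @` cdom c) q.1, (cmap c @` cdom c) q.2 &
    cdom c (cinv c q.1 * cinv c q.2 * (cinv c q.1)^-1)%g]].
Proof.
have oc : (cmap c @` cdom c) o by exists 1%g.
have o2 : fopen (fsub E2) by exact: fopen_fsub.
have s1 : smooth_at (vecMfd E2) G (fun q => cinv c q.1) (o, o).
  apply: (smooth_at_comp (M := vecMfd E2) (N := vecMfd E) (f := fst) (g := cinv c)); last exact: smooth_at_cinv.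
  by apply: (smooth_at_vec o2) => //; apply: fsmooth_lin => //; exact: flin_fst.
have s2 : smooth_at (vecMfd E2) G (fun q => cinv c q.2) (o, o).
  apply: (smooth_at_comp (M := vecMfd E2) (N := vecMfd E) (f := snd) (g := cinv c)); last exact: smooth_at_cinv.
  by apply: (smooth_at_vec o2) => //; apply: fsmooth_lin => //; exact: flin_snd.
note (smooth_at_mul hG (smooth_at_mul hG s1 s2) (smooth_at_inv hG s1)) => s3.
have e1 : (cinv c o * cinv c o * (cinv c o)^-1)%g = 1%g by rewrite co mulg1 mulgV.
have s4 : smooth_at (vecMfd E2) (vecMfd E) conj_chart (o, o).
  apply: (smooth_at_comp (M := vecMfd E2) (N := G) (g := cmap c)); first exact: s3.
  by rewrite /= e1; exact: smooth_at_cmap.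
have [W1 [oW1 W1o sW1]] := smooth_at_vecP s4.
have n1 : mnear (vecMfd E2) (o, o) (fun q => cdom c (cinv c q.1 * cinv c q.2 * (cinv c q.1)^-1)%g).
  by apply: (smooth_at_near s3); rewrite /= e1; exact: mnear_dom.
have [W2 [oW2 W2o W2c]] := mnear_vecP n1.
note (chart_image_open Gc) => oI.
exists (W1 `&` W2 `&` ((cmap c @` cdom c) `*` (cmap c @` cdom c))); split.
- by apply: fopenI; [exact: fopenI|exact: fopen_prod].
- by split; [split|split].
- by apply: (fsmoothS _ sW1) => q [[]].
by move=> q [[_ /W2c] h] [h1 h2]; split.
Qed.

Lemma conj_chart_unit x : conj_chart (x, o) = o.
Proof. by rewrite /conj_chart /= co mulg1 mulgV. Qed.

Context (W : set E2) (oW : fopen W) (Woo : W (o, o)) (sW : fsmooth W conj_chart).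
Hypothesis WP : forall q, W q -> [/\ (cmap c @` cdom c) q.1, (cmap c @` cdom c) q.2 &
    cdom c (cinv c q.1 * cinv c q.2 * (cinv c q.1)^-1)%g].

Lemma conj_chart_one y : W (o, y) -> conj_chart (o, y) = y.
Proof. by move=> /WP[_ /cmapK[_ /= e] _]; rewrite /conj_chart /= co mul1g invg1 mulg1. Qed.

Lemma conj_chart_conj x y z : W (x, y) -> W (y, z) -> W (x, z) ->
  conj_chart (x, conj_chart (y, z)) = conj_chart (conj_chart (x, y), conj_chart (x, z)).
Proof.
move=> /WP[_ _ /= h1] /WP[_ _ /= h2] /WP[_ _ /= h3].
rewrite /conj_chart /= !cinvK//; congr (cmap c _).
by rewrite !invgM invgK !mulgA !mulgVK.
Qed.

(** [chart_line] unfolds to [cinv] along a line through [o], so after [bra_derive1] both sides are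
    convertible. *)
Lemma lie_bracketE u v : lie_bracket c u v = bra conj_chart o (u, v).
Proof.
have h := bra_derive1 oW Woo sW u v.
by rewrite -h.
Qed.

Lemma lie_semisimple_perfect : semisimple G -> forall Q : 'rV[R]_n -> Prop, Q 0 ->
  (forall a u v, Q u -> Q v -> Q (a *: u + v)) ->
  (forall u v, Q (bra conj_chart o (u, v))) -> forall v, Q v.
Proof.
move=> ss Q Q0 QD Qb.
apply: (semisimple_perfect (br := lie_bracket c)) => //.
- by move=> a u u' v; rewrite !lie_bracketE; exact: (bra_linl oW Woo sW).
- by move=> a u v v'; rewrite !lie_bracketE; exact: (bra_linr oW Woo sW).
- move=> u v w; rewrite !lie_bracketE.
  exact: (bra_leibniz oW Woo sW conj_chart_unit conj_chart_one conj_chart_conj).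
- move=> J hJ sJ; refine (ss c Gc c1 J hJ _); case: sJ => k kE; exists k; exact: kE.
by move=> u v; rewrite lie_bracketE.
Qed.

End Bracket.

(** * Local characters *)

Section TangentNear.
Context {R : realType}.
Implicit Types E F : frechetModel R.
Local Notation ln := (@line R).

Lemma tangent_comp_near E F {hE : is_frechet E} {hF : is_frechet F} (U : set E) (f : E -> F)
    (g : R -> E) w d : fopen U -> fsmooth U f -> 0 < d ->
  (forall t, `|t| < d -> fsub E (g t)) -> U (g 0) ->
  tangent g w -> tangent (fun t => f (g t)) (dfun f (g 0, w)).
Proof.
move=> oU sf d0 gS U0 tg; pose g' t := if `|t| < d then g t else 0.
have g'E t : `|t| < d -> g t = g' t by rewrite /g' => ->.
have g0 : g 0 = g' 0 by apply: g'E; rewrite normr0.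
apply: (tangent_near d0 (g := fun t => f (g' t))) => [t td|]; first by rewrite g'E.
rewrite g0; apply: (tangent_comp oU sf) => [t||].
- by rewrite /g'; case: ifP => [/gS//|_]; exact: fs0.
- by rewrite -g0.
exact: (tangent_near d0 g'E tg).
Qed.

Lemma dfun_flin E F {hE : is_frechet E} {hF : is_frechet F} (L : E -> F) x v : flin L ->
  fsub E x -> fsub E v -> dfun L (x, v) = L v.
Proof.
move=> hL hx hv; apply: (dfunE (U := fsub E)) => //; first exact: fopen_fsub.
  by move=> z; exact: flin_sub.
exact: flin_dderiv.
Qed.

Lemma tangent_flin E F {hE : is_frechet E} {hF : is_frechet F} (L : E -> F) (g : R -> E) w d :
  flin L -> 0 < d -> (forall t, `|t| < d -> fsub E (g t)) -> tangent g w ->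
  tangent (fun t => L (g t)) (L w).
Proof.
move=> hL d0 gS tg; have g0 : fsub E (g 0) by apply: gS; rewrite normr0.
have [hw _] := tg; rewrite -(dfun_flin hL g0 hw).
apply: (tangent_comp_near (U := fsub E) _ _ d0) => //; first exact: fopen_fsub.
exact: fsmooth_lin.
Qed.

Lemma dfun0 E F {hE : is_frechet E} {hF : is_frechet F} (U : set E) (f : E -> F) x :
  fopen U -> fsmooth U f -> U x -> dfun f (x, 0) = 0.
Proof.
move=> oU sf Ux; have [hd _] := fsmooth_dfun oU sf.
have fU y : U y -> fsub F (f y) by exact: fsmooth_sub.
by note (dderivZ oU fU hd 0 Ux (@fs0 _ E hE)); rewrite scaler0 scale0r.
Qed.

Lemma flin_scale_vec E {hE : is_frechet E} (xi : E) : fsub E xi ->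
  flin ((fun t => (t : R) *: xi) : ln -> E).
Proof.
move=> hx; split=> [a x y _ _|t _|k].
- by rewrite scalerDl scalerA.
- exact: fsZ.
by exists 0%N, (pn k xi) => t _; rewrite pnZ// pn_line mulrC.
Qed.

(** At each point the increments are bounded by an arbitrarily small slope, which the mean value
    inequality carries over to the whole interval. *)
Lemma tangent0_const (f : R -> R) :
  (forall s, 0 <= s -> s <= 1 -> tangent ((fun h => f (s + h)) : R -> ln) 0) -> f 1 = f 0.
Proof.
move=> hf; apply/eqP; rewrite -subr_eq0 -normr_le0; apply/ler_addgt0Pr => e e0; rewrite add0r.
apply: (@mean_value_ineq R (fun a b => `|f b - f a|) e).
  move=> a b c _ _ _ _; have -> : f c - f a = (f b - f a) + (f c - f b) by rewrite [RHS]addrC addrA subrK.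
  exact: ler_normD.
move=> s s0 s1; have [_ H] := (@tangentP _ ln _ (fun h => f (s + h)) 0 (fun=> I)).1 (hf s s0 s1).
have [d d0 Hd] := H 0%N e e0; exists d => // a b a0 as_ sb b1 bad.
have P t : `|t| < d -> `|f (s + t) - f s| <= e * `|t|.
  by move=> /Hd; rewrite pn_line scaler0 subr0 addr0.
have h1 := P (b - s); have h2 := P (a - s).
rewrite !subrKC in h1 h2.
have {}h1 : `|f b - f s| <= e * (b - s).
  by have := h1; rewrite ger0_norm ?subr_ge0//; apply; lra.
have {}h2 : `|f a - f s| <= e * (s - a).
  by have := h2; rewrite [`|a - s|]distrC ger0_norm ?subr_ge0//; apply; lra.
have -> : f b - f a = (f b - f s) - (f a - f s) by rewrite opprB addrA subrK.
apply: (le_trans (ler_normB _ _)).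
have -> : e * (b - a) = e * (b - s) + e * (s - a) by ring.
exact: lerD.
Qed.

(** Multiplying a point of the circle by [cis (th h)] gives real and imaginary parts of this shape;
    an angle of velocity 0 leaves them with velocity 0. *)
Lemma tangent_sin_cos (p q : R) (th : R -> R) : tangent (th : R -> ln) 0 ->
  tangent ((fun h => p * cos (th h) + q * sin (th h)) : R -> ln) 0.
Proof.
move=> tth; have oT : fopen (setT : set ln) by exact: fopen_fsub.
have [ss sc] := @smooth_sin_cos R.
have sg : fsmooth (setT : set ln) (fun x : ln => p *: (cos (x : R) : ln) + (q *: (sin (x : R) : ln) + 0)).
  apply: (@fsmooth_addZ _ ln ln _ _ setT p cos) => //.
  by apply: (@fsmooth_addZ _ ln ln _ _ setT q sin) => //; exact: fsmooth_cst.
note (@tangent_comp R ln ln _ _ setT _ (th : R -> ln) 0 oT sg (fun=> I) I tth).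
rewrite (dfun0 oT sg)//; apply: (tangent_near (E := ln) ltr01) => t _.
by rewrite addr0.
Qed.

End TangentNear.

Lemma mnear_open_vec (R : realType) (E : frechetModel R) {hE : is_frechet E} (x : E) (U : set E) :
  fopen U -> U x -> mnear (vecMfd E) x U.
Proof.
move=> oU Ux; have US : U `<=` fsub E by case/fopenP: oU.
exists (Chart (fsub E) id), U; split=> //=; first exact: US.
by move=> z Uz; exists z => //; split=> //; exact: US.
Qed.

(** [lam] is the angle in a chart of the circle around [y x]. It depends on the value of [y] alone,
    even off the chart; the last clause keeps this, so that equal values of [y] can be used at any
    points. *)
Lemma circle_lift (R : realType) T E (M : mfd T E) {hM : premfd M} (y : T -> circle R) x :
  smooth_at M (U1 R) y x -> exists lam : T -> R,
  [/\ smooth_at M (vecMfd (@line R)) (lam : T -> @line R) x,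
      mnear M x (fun k => y k = circ (lam k)) &
      forall k k', y k = y k' -> lam k = lam k'].
Proof.
move=> sy; have [a Ua ax] := U1_cover (y x).
exists (fun k => cmap a (y k)); split; last by move=> k k' ->.
  by apply: (smooth_at_comp sy); exact: smooth_at_cmap.
have [r [dE cE]] := U1_chartP Ua.
apply: (mnear_sub (smooth_at_near sy (mnear_dom Ua ax))) => k _ /dE[s sr e].
by rewrite e cE.
Qed.

(** * Circle-valued maps [y] multiplicative near the unit, with local angle [lam] and differential
    [ell] *)

Section LocalCharacter.
Context {R : realType} (T : groupType) (E : frechetModel R) (K : mfd T E) (hK : is_lie K).
Context (c : chart T E) (Kc : atlas K c) (c1 : cdom c 1%g) (c0 : cmap c 1%g = 0).
Local Notation ln := (@line R).
Local Notation ln2 := (prodModel ln ln).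
Local Instance lcK_premfd : premfd K := lie_premfd hK.
Local Instance lcE_frechet : is_frechet E := pm_model (lie_premfd hK).
Context (y : T -> circle R) (N : set T) (nN : mnear K 1%g N).
Hypothesis yM : forall k l, carrier K k -> carrier K l -> N l -> y (k * l)%g = (y k * y l)%g.
Context (lam : T -> R) (slam : smooth_at K (vecMfd ln) (lam : T -> ln) 1%g).
Hypothesis nlam : mnear K 1%g (fun k => y k = circ (lam k)).
Hypothesis lamE : forall k k', y k = y k' -> lam k = lam k'.

Let ci : chart_inj c := pm_inj lcK_premfd Kc.
Let cS x : cdom c x -> fsub E (cmap c x).
Proof.
by move=> cx; note (chart_image_open Kc) => /fopenP[US _]; apply: US; exists x.
Qed.
Let cinv0 : cinv c 0 = 1%g.
Proof. by rewrite -c0 cinvK. Qed.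
Let img0 : (cmap c @` cdom c) 0.
Proof. by exists 1%g. Qed.
Let f0 : fsub E 0 := @fs0 _ E _.
Let cC x : cdom c x -> carrier K x := @pm_dom _ _ _ _ lcK_premfd c Kc x.

Definition Lam : E -> ln := fun xi => lam (cinv c xi).
Definition ell (xi : E) : R := dfun Lam (0, xi).

Lemma Lam_smooth : exists U, [/\ fopen U, U 0 & fsmooth U Lam].
Proof.
apply: smooth_at_vecP; apply: (smooth_at_comp (M := vecMfd E) (N := K) (g := (lam : T -> ln))).
  exact: smooth_at_cinv.
by rewrite cinv0.
Qed.

Lemma ell_lin a xi eta : fsub E xi -> fsub E eta -> ell (a *: xi + eta) = a * ell xi + ell eta.
Proof.
move=> hx he; have [U [oU U0 sU]] := Lam_smooth.
have [hd sd] := fsmooth_dfun oU sU; have cd := fsmooth_cont sd.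
have FS z : U z -> fsub ln (Lam z) by [].
rewrite /ell (dderivD oU FS hd cd U0 (fsZ a hx) he).
by rewrite (dderivZ oU FS hd a U0 hx).
Qed.

(** Continuity of the differential at (0, 0) bounds [ell] by 1 where [pn k] is less than [d];
    scaling into half that radius gives the general bound. *)
Lemma ell_cont : exists k C, forall xi, fsub E xi -> `|ell xi| <= C * pn k xi.
Proof.
have [U [oU U0 sU]] := Lam_smooth; have [hd sd] := fsmooth_dfun oU sU.
have US : (U `*` fsub E : set (prodModel E E)) `<=` fsub (prodModel E E) by move=> [a b] [/= Ua hb]; split=> //; case/fopenP: oU => + _; exact.
have [_ cd] := (fcontP _ US).1 (fsmooth_cont sd) (0, 0) (conj U0 f0).
have [k [d [d0 Hd]]] := cd 0%N 1 ltr01.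
exists k, (2 / d) => xi hx.
have e0 : dfun Lam ((0, 0) : prodModel E E) = 0 by rewrite (dfun0 oU sU U0).
have H eta : fsub E eta -> pn k eta < d -> `|ell eta| < 1.
  move=> he ed; have h : pn k ((0, eta) - (0, 0) : prodModel E E) < d.
    by rewrite pn_prodB /= !subr0 pn0 gt_max d0.
  have := Hd (0, eta) (conj U0 he) h.
  by rewrite e0 [X in pn _ X]subr0 pn_line.
note (pn_ge0 k hx) => p0.
(* Where the seminorm vanishes all multiples of [xi] are small, so [ell xi] has to be 0. *)
have [p00|pn0'] := eqVneq (pn k xi) 0.
  rewrite p00 mulr0; apply/ler_addgt0Pr => e e1; rewrite add0r.
  have he : fsub E (e^-1 *: xi) by fsub.
  have := H _ he; rewrite pnZ// p00 mulr0 => /(_ d0).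
  have -> : ell (e^-1 *: xi) = e^-1 * ell xi.
    have := ell_lin e^-1 hx f0; rewrite addr0 => ->.
    by rewrite /ell (dfun0 oU sU U0) addr0.
  by rewrite normrM gtr0_norm ?invr_gt0// ltr_pdivrMl// mulr1 => /ltW.
have pp : 0 < pn k xi by rewrite lt_def pn0'.
pose r := d / (2 * pn k xi).
have r0 : 0 < r by rewrite divr_gt0// mulr_gt0.
have he : fsub E (r *: xi) by fsub.
have := H _ he; rewrite pnZ// gtr0_norm// /r.
have -> : d / (2 * pn k xi) * pn k xi = d / 2 by field.
have -> : ell (d / (2 * pn k xi) *: xi) = r * ell xi.
  have := ell_lin r hx f0; rewrite addr0 => ->.
  by rewrite /ell (dfun0 oU sU U0) addr0.
have d2 : d / 2 < d by lra.
move=> /(_ d2); rewrite normrM gtr0_norm// -ltr_pdivlMl// mulr1 => /ltW h.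
have -> // : 2 / d * pn k xi = r^-1.
by rewrite /r; field; rewrite pn0' gt_eqF.
Qed.

Lemma ell_flin : flin (ell : E -> ln).
Proof.
split=> // [a u v hu hv|k]; first exact: ell_lin.
have [l [C H]] := ell_cont; exists l, C => x hx; rewrite pn_line; exact: H.
Qed.

Lemma char1 : y 1%g = 1%g.
Proof.
have C1 := cC c1; note (yM C1 C1 (mnear_self nN)).
by rewrite mulg1 => /(congr1 (fun z => (y 1%g)^-1 * z)%g); rewrite mulVg mulKg.
Qed.

(** Along the ray [g r = cinv c (r *: xi)] an increment is right multiplication by an element near
    1, whose angle has a velocity in the range of [ell], hence 0. So the real and imaginary parts of
    [y] are constant along the ray. The conclusion holds on the whole chart ball, whatever the size
    of [N]. *)
Lemma ell0_trivial k (e : R) : (forall xi, fsub E xi -> ell xi = 0) -> 0 < e ->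
  (forall xi, fsub E xi -> pn k xi < e -> (cmap c @` cdom c) xi) ->
  forall xi, fsub E xi -> pn k xi < e -> y (cinv c xi) = 1%g.
Proof.
move=> l0 e0 im xi hxi xe; pose g r := cinv c (r *: xi).
have ims s : 0 <= s -> s <= 1 -> (cmap c @` cdom c) (s *: xi).
  move=> s0 s1; apply: im; first by fsub.
  rewrite pnZ// ger0_norm//; apply: le_lt_trans xe.
  by rewrite -[leRHS]mul1r ler_wpM2r// pn_ge0.
have main s : 0 <= s -> s <= 1 -> exists d (th : R -> R), [/\ 0 < d, tangent (th : R -> ln) 0 &
    forall h, `|h| < d -> y (g (s + h)) = (y (g s) * circ (th h))%g].
  move=> s0 s1; have [cs _] := cmapK (ims s s0 s1).
  have sg : csm K g s.
    apply: (smooth_at_comp (M := vecMfd ln) (N := vecMfd E) (g := cinv c)).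
      apply: (smooth_at_vec (U := setT)) => //; first exact: fopen_fsub ln.
      by apply: fsmooth_lin => //; exact: flin_scale_vec.
    by apply: smooth_at_cinv => //; exact: ims.
  pose m h := ((g s)^-1 * g (s + 1 * h))%g.
  have sm : csm K m 0.
    apply: (smooth_at_mul hK (M := vecMfd ln)).
      by apply: csm_cst; apply: (lieV hK); exact: cC.
    by apply: csm_affine; rewrite mulr0 addr0.
  have m0 : m 0 = 1%g by rewrite /m mulr0 addr0 mulVg.
  have cm0 : cdom c (m 0) by rewrite m0.
  have [d1 d10 [dm smu]] := (csmP Kc cm0).1 sm.
  have nN' : mnear (vecMfd ln) (0 : R) (m @^-1` (N `&` (fun k => y k = circ (lam k)))).
    by apply: (smooth_at_near sm); rewrite m0; exact: mnearI.
  have [d2 d20 H2] := (mnear_line _ _).1 nN'.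
  have [U [oU U0 sU]] := Lam_smooth.
  have dd : 0 < Num.min d1 d2 by rewrite lt_min d10.
  exists (Num.min d1 d2), (fun h => Lam (cmap c (m h))); split=> //.
    have nb0 : nb 0 d1 0 by exact: nb_self.
    note (dcurveP (fopen_nb 0 d1) smu nb0) => tm.
    have mS t : `|t| < d1 -> fsub E ((cmap c \o m) t).
      by move=> td; apply: cS; apply: dm; rewrite /nb /= subr0.
    have U0' : U ((cmap c \o m) 0) by rewrite /= m0 c0.
    note (tangent_comp_near oU sU d10 mS U0' tm).
    by rewrite /= m0 c0 -/(ell _) l0//; case: tm.
  move=> h; rewrite lt_min => /andP[h1 h2].
  have ch : cdom c (m h) by apply: dm; rewrite /nb /= subr0.
  have [Nm ym] : N (m h) /\ y (m h) = circ (lam (m h)) by apply: H2; rewrite subr0.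
  rewrite /Lam cinvK// -ym -yM//; last exact: cC.
    by rewrite /m mul1r mulVKg.
  exact: cC.
have g0 : y (g 0) = 1%g by rewrite /g scale0r cinv0 char1.
have Re1 : complex.Re (val (y (g 1))) = complex.Re (val (y (g 0))).
  apply: (tangent0_const (f := fun r => complex.Re (val (y (g r))))) => s s0 s1.
  have [d [th [d0 tth H]]] := main s s0 s1.
  apply: (tangent_near (E := ln) d0 _ (tangent_sin_cos (complex.Re (val (y (g s))))
    (- complex.Im (val (y (g s)))) tth)) => h hd.
  by rewrite H//= /cis; case: (val (y (g s))) => u v /=; rewrite mulNr.
have Im1 : complex.Im (val (y (g 1))) = complex.Im (val (y (g 0))).
  apply: (tangent0_const (f := fun r => complex.Im (val (y (g r))))) => s s0 s1.
  have [d [th [d0 tth H]]] := main s s0 s1.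
  apply: (tangent_near (E := ln) d0 _ (tangent_sin_cos (complex.Im (val (y (g s))))
    (complex.Re (val (y (g s)))) tth)) => h hd.
  by rewrite H//= /cis; case: (val (y (g s))) => u v /=; rewrite addrC.
have -> : xi = 1 *: xi by rewrite scale1r.
rewrite -g0; apply: val_inj; apply/eqP; rewrite eq_complex -/(g 1).
by rewrite Re1 Im1 !eqxx.
Qed.

Section Conjugation.
Context (xi eta : E) (hxi : fsub E xi) (heta : fsub E eta).

Definition conj2 (q : ln2) : T :=
  (cinv c ((q.1 : R) *: xi) * cinv c ((q.2 : R) *: eta) * (cinv c ((q.1 : R) *: xi))^-1)%g.

Let P (q : ln2) : E := cmap c (conj2 q).

Let conj2_0 t : cdom c (cinv c (t *: xi)) -> conj2 (t, 0) = 1%g.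
Proof. by rewrite /conj2 /= scale0r cinv0 mulg1 mulgV. Qed.

Lemma conj_domain : exists W : set ln2, [/\ fopen W, W (0, 0), fsmooth W P &
  forall q, W q -> [/\ (cmap c @` cdom c) ((q.1 : R) *: xi), (cmap c @` cdom c) ((q.2 : R) *: eta),
    cdom c (conj2 q), N (cinv c ((q.1 : R) *: xi)) & N (cinv c ((q.2 : R) *: eta))]].
Proof.
have o2 : fopen (fsub ln2) by exact: fopen_fsub.
have s1 : smooth_at (vecMfd ln2) (vecMfd E) (fun q : ln2 => (q.1 : R) *: xi) (0, 0).
  apply: (smooth_at_vec o2) => //; apply: fsmooth_lin => //.
  apply: (flin_comp (L' := fun t : ln => (t : R) *: xi)); [exact: flin_fst|exact: flin_scale_vec].
have s2 : smooth_at (vecMfd ln2) (vecMfd E) (fun q : ln2 => (q.2 : R) *: eta) (0, 0).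
  apply: (smooth_at_vec o2) => //; apply: fsmooth_lin => //.
  apply: (flin_comp (L' := fun t : ln => (t : R) *: eta)); [exact: flin_snd|exact: flin_scale_vec].
have s3 : smooth_at (vecMfd ln2) K (fun q : ln2 => cinv c ((q.1 : R) *: xi)) (0, 0).
  apply: (smooth_at_comp (M := vecMfd ln2) (N := vecMfd E) (g := cinv c)); first exact: s1.
  by rewrite scale0r; exact: smooth_at_cinv.
have s4 : smooth_at (vecMfd ln2) K (fun q : ln2 => cinv c ((q.2 : R) *: eta)) (0, 0).
  apply: (smooth_at_comp (M := vecMfd ln2) (N := vecMfd E) (g := cinv c)); first exact: s2.
  by rewrite scale0r; exact: smooth_at_cinv.
have s5 : smooth_at (vecMfd ln2) K conj2 (0, 0).
  note (smooth_at_mul hK (smooth_at_mul hK s3 s4) (smooth_at_inv hK s3)) => h; exact: h.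
have e1 : conj2 (0, 0) = 1%g by apply: conj2_0; rewrite scale0r cinv0.
have s6 : smooth_at (vecMfd ln2) (vecMfd E) P (0, 0).
  apply: (smooth_at_comp (M := vecMfd ln2) (N := K) (g := cmap c)); first exact: s5.
  by rewrite e1; exact: smooth_at_cmap.
have [W [oW W0 sW]] := smooth_at_vecP s6.
have n5 : mnear (vecMfd ln2) (0, 0) (conj2 @^-1` cdom c).
  by apply: (smooth_at_near s5); rewrite e1; exact: mnear_dom.
have n3 : mnear (vecMfd ln2) (0, 0) ((fun q : ln2 => cinv c ((q.1 : R) *: xi)) @^-1` N).
  by apply: (smooth_at_near s3); rewrite scale0r cinv0.
have n4 : mnear (vecMfd ln2) (0, 0) ((fun q : ln2 => cinv c ((q.2 : R) *: eta)) @^-1` N).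
  by apply: (smooth_at_near s4); rewrite scale0r cinv0.
have nim : mnear (vecMfd E) 0 (cmap c @` cdom c).
  by note (chart_image_open Kc) => h; exact: (mnear_open_vec h).
have n1 : mnear (vecMfd ln2) (0, 0) ((fun q : ln2 => (q.1 : R) *: xi) @^-1` (cmap c @` cdom c)).
  by apply: (smooth_at_near s1); rewrite scale0r.
have n2 : mnear (vecMfd ln2) (0, 0) ((fun q : ln2 => (q.2 : R) *: eta) @^-1` (cmap c @` cdom c)).
  by apply: (smooth_at_near s2); rewrite scale0r.
have [W' [oW' W'0 W'P]] := mnear_vecP (mnearI n5 (mnearI n3 (mnearI n4 (mnearI n1 n2)))).
exists (W `&` W'); split; first exact: fopenI.
- by split.
- by apply: (fsmoothS _ sW) => q [].
by move=> q [_ /W'P[h5 [h3 [h4 [h1 h2]]]]]; split.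
Qed.

Context (W : set ln2) (oW : fopen W) (W0 : W (0, 0)) (sW : fsmooth W P).
Hypothesis WP : forall q, W q -> [/\ (cmap c @` cdom c) ((q.1 : R) *: xi),
  (cmap c @` cdom c) ((q.2 : R) *: eta), cdom c (conj2 q), N (cinv c ((q.1 : R) *: xi))
  & N (cinv c ((q.2 : R) *: eta))].

(** The adjoint action of [cinv c (t *: xi)] on the tangent vector [eta]; its derivative
    [conj_bracket] at [t = 0] is the bracket of [xi] and [eta] in the Lie algebra of [K]. *)
Definition conj_velocity (t : R) : E := dfun P (((t, 0) : ln2), ((0, 1) : ln2)).
Definition conj_bracket : E := dcurve (conj_velocity : ln -> E) 0.

Let S2 (q : ln2) : fsub ln2 q := conj I I.

Let P0 t : W (t, 0) -> P (t, 0) = 0.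
Proof. by move=> /WP[/cmapK[h _] _ _ _ _]; rewrite /P conj2_0. Qed.

Lemma near_line0 : exists2 d : R, 0 < d & forall t, `|t| < d -> W (t, 0).
Proof.
have tg : tangent (fun t : R => ((0 + t *: (1 : ln), 0) : ln2)) (1, 0).
  by apply: tangent_pair; [exact: tangent_affine|exact: tangent_cst].
have Wg : W (0 + 0 *: (1 : ln), 0) by rewrite scale0r addr0.
note (tangent_in (fun=> S2 _) tg oW Wg) => -[d d0 Hd].
by exists d => // t /Hd; rewrite add0r [t *: _]mulr1.
Qed.

Lemma near_line t : W (t, 0) -> exists2 d : R, 0 < d & forall s, `|s| < d -> W (t, s).
Proof.
move=> Wt; have tg : tangent (fun s : R => ((t, 0 + s *: (1 : ln)) : ln2)) (0, 1).
  by apply: tangent_pair; [exact: tangent_cst|exact: tangent_affine].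
have Wg : W (t, 0 + 0 *: (1 : ln)) by rewrite scale0r addr0.
note (tangent_in (fun=> S2 _) tg oW Wg) => -[d d0 Hd].
by exists d => // s /Hd; rewrite add0r [s *: _]mulr1.
Qed.

Lemma conj_velocity_tangent t : W (t, 0) -> tangent (fun s => P (t, s)) (conj_velocity t).
Proof.
move=> Wt; have h : tangent (fun s : R => ((t, 0 + s *: (1 : ln)) : ln2)) (0, 1).
  by apply: tangent_pair; [exact: tangent_cst|exact: tangent_affine].
have Wt' : W (t, 0 + 0 *: (1 : ln)) by rewrite scale0r addr0.
have h2 := @tangent_comp _ ln2 E _ _ W P _ _ oW sW (fun=> S2 _) Wt' h.
apply: (tangent_near ltr01 (g := fun s : R => P (t, 0 + s *: (1 : ln)))).
  by move=> s _; rewrite add0r [s *: _]mulr1.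
by move: h2; rewrite scale0r addr0; apply.
Qed.

Lemma conj_velocity_smooth : exists2 d : R, 0 < d &
  fsmooth (nb 0 d) (conj_velocity : ln -> E) /\ forall t, `|t| < d -> W (t, 0).
Proof.
have [d d0 Hd] := near_line0; exists d => //; split=> //.
have [_ sd] := fsmooth_dfun oW sW.
apply: (@fsmooth_comp _ ln (prodModel ln2 ln2) E _ _ _ (nb 0 d) (W `*` fsub ln2)
  (fun t => ((t, 0), (0, 1))) (dfun P)) => //.
- exact: fopen_nb.
- by apply: fopen_prod => //; exact: fopen_fsub.
- by move=> t; rewrite /nb /= subr0 => /Hd.
apply: fsmooth_pair => //; last exact: fsmooth_cst.
apply: fsmooth_pair => //; last exact: fsmooth_cst.
by apply: fsmooth_lin => //; exact: flin_id.
Qed.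

Lemma conj_bracket_tangent : tangent conj_velocity conj_bracket.
Proof.
have [d d0 [sA _]] := conj_velocity_smooth.
by apply: (dcurveP (fopen_nb 0 d)) => //; exact: nb_self.
Qed.

(** A multiplicative map to the commutative circle does not see conjugation, so [ell] has the
    constant value [ell eta] along [conj_velocity]; then the derivative at 0 is differentiated
    away. *)
Lemma ell_bracket : ell conj_bracket = 0.
Proof.
have [d d0 [sA dW]] := conj_velocity_smooth.
have AS t : `|t| < d -> fsub E (conj_velocity t).
  by move=> td; apply: (fsmooth_sub sA); rewrite /nb /= subr0.
have [U [oU U0 sU]] := Lam_smooth.
have const t : `|t| < d -> ell (conj_velocity t) = ell eta.
  move=> /dW Wt; have [e e0 He] := near_line Wt.
  have PS s : `|s| < e -> fsub E (P (t, s)) by move=> /He/WP[_ _ h _ _]; exact: cS.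
  apply: (tangent_unique (E := ln) (g := fun s => Lam (P (t, s)))) => //.
    have U0' : U (P (t, 0)) by rewrite P0.
    by note (tangent_comp_near oU sU e0 PS U0' (conj_velocity_tangent Wt)); rewrite /= P0.
  apply: (tangent_near e0 (g := fun s => Lam (0 + s *: eta))).
    move=> s /He/WP[/= hx he hc Nx Ne].
    have [cx _] := cmapK hx; have [ce _] := cmapK he.
    rewrite /Lam add0r /P cinvK//; apply: lamE.
    have Cx := cC cx; have Ce := cC ce; have Cc := cC hc.
    (* Only right factors in [N] may be split off, so two factorizations of one element are
       compared: the conjugate times the first element, and the first element times the second. *)
    have h1 := yM Cc Cx Nx.
    have h2 := yM Cx Ce Ne.
    rewrite /conj2 /= mulgVK in h1.
    apply/esym; apply: (@mulIg _ (y (cinv c (t *: xi)))); rewrite -h1 h2.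
    by apply: val_inj; rewrite /= mulrC.
  have := tangent_comp oU sU (g := fun s => 0 + s *: eta) (w := eta); rewrite scale0r addr0.
  by apply=> //; [move=> s; fsub|exact: tangent_affine].
apply: (tangent_unique (E := ln) (g := fun t => ell (conj_velocity t))) => //.
  exact: (tangent_flin ell_flin d0 AS conj_bracket_tangent).
apply: (tangent_near (E := ln) d0 (g := fun=> ell eta)) => [t td|]; first by rewrite const.
exact: tangent_cst.
Qed.

End Conjugation.

End LocalCharacter.

Section CurveCharacter.
Context {R : realType} (T : groupType) (n : nat) (G : mfd T (@eucl R n)) (hG : is_lie G).
Context (phi : chart T (@eucl R n)) (Gphi : atlas G phi) (phi1 : cdom phi 1%g).
Context (Cs : set (R -> T)) (D : set (R -> 'rV[R]_n)) (a b : R).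
Local Notation ln := (@line R).
Local Notation En := (@eucl R n).
Local Notation K := (curveGroup G Cs D a b).
Local Notation FD := (curveModel D a b).
Hypothesis hK : is_lie K.
Hypothesis ev : forall u : R, flin ((fun xi => xi u) : FD -> En).
Local Instance ccG_premfd : premfd G := lie_premfd hG.
Local Instance ccE_frechet : is_frechet En := pm_model (lie_premfd hG).
Local Instance ccK_premfd : premfd K := lie_premfd hK.
Local Instance ccD_frechet : is_frechet FD := pm_model (lie_premfd hK).
Let o := cmap phi 1%g.

Definition curve_chart : chart (R -> T) FD :=
  @Chart R _ FD [set gam | Cs gam /\ forall s, cdom phi (((1 : R -> T)%g s)^-1 * gam s)%g]
    (fun gam s => cmap phi (((1 : R -> T)%g s)^-1 * gam s)%g - cmap phi 1%g).

Lemma curve_chart_atlas : atlas K curve_chart.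
Proof. by exists phi, 1%g; split=> //; exact: lie1 hK. Qed.

Lemma curve_chartP gam : cdom curve_chart gam <-> Cs gam /\ forall s, cdom phi (gam s).
Proof.
by split=> -[h1 h2]; split=> // s; have := h2 s; rewrite /= fun_oneE invg1 mul1g.
Qed.

Lemma curve_chartE gam s : cmap curve_chart gam s = cmap phi (gam s) - o.
Proof. by rewrite /= fun_oneE invg1 mul1g. Qed.

Lemma curve_chart1 : cdom curve_chart 1%g.
Proof. by apply/curve_chartP; split=> //; exact: lie1 hK. Qed.

Lemma curve_chart0 : cmap curve_chart 1%g = 0.
Proof. by apply/funext => s; rewrite curve_chartE subrr. Qed.

Lemma curve_cinvE (xi : FD) u : (cmap curve_chart @` cdom curve_chart) xi ->
  cinv curve_chart xi u = cinv phi (o + xi u).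
Proof.
move=> /cmapK[/curve_chartP[_ /(_ u) h] e].
have := congr1 (fun g : FD => g u) e.
rewrite -[LHS]/(cmap curve_chart _ u) curve_chartE => <-.
by rewrite addrC subrK cinvK//; exact: pm_inj Gphi.
Qed.

Context (y : (R -> T) -> circle R) (N : set (R -> T)) (nN : mnear K 1%g N).
Hypothesis yM : forall k l, carrier K k -> carrier K l -> N l -> y (k * l)%g = (y k * y l)%g.
Context (lam : (R -> T) -> R) (slam : smooth_at K (vecMfd ln) (lam : (R -> T) -> ln) 1%g).
Hypothesis nlam : mnear K 1%g (fun k => y k = circ (lam k)).
Hypothesis lamE : forall k k', y k = y k' -> lam k = lam k'.

Section Pointwise.
Context (W : set (prodModel En En)) (oW : fopen W) (Woo : W (o, o))
  (sW : fsmooth W (conj_chart phi)).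

(** Evaluation at [u] is continuous and linear, so it commutes with both derivatives; at each [u]
    conjugation of curves is conjugation in [G], and bilinearity of [bra] collects the scalars. *)
Lemma curve_bracketE (f h : R -> R) (v w : En) :
  fsub FD (fun u => f u *: v) -> fsub FD (fun u => h u *: w) ->
  conj_bracket curve_chart (fun u => f u *: v) (fun u => h u *: w) =
  (fun u => (f u * h u) *: bra (conj_chart phi) o (v, w)).
Proof.
move=> hf hh; set xi := fun u => f u *: v; set eta := fun u => h u *: w.
have [V [oV V0 sV VP]] := conj_domain hK curve_chart_atlas curve_chart1 curve_chart0 nN hf hh.
apply/funext => u.
have [d1 d10 [sA dV]] := conj_velocity_smooth hK oV V0 sV.
note (bra_linl oW Woo sW) => bL; note (bra_linr oW Woo sW) => bR.
have b0l z : bra (conj_chart phi) o (0, z) = 0.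
  by have := bL (-1) 0 0 z; rewrite scaler0 addr0 scaleN1r addNr.
have b0r z : bra (conj_chart phi) o (z, 0) = 0.
  by have := bR (-1) z 0 0; rewrite scaler0 addr0 scaleN1r addNr.
have -> : (f u * h u) *: bra (conj_chart phi) o (v, w) = bra (conj_chart phi) o (f u *: v, h u *: w).
  by rewrite -[f u *: v]addr0 bL b0l addr0 -[h u *: w]addr0 bR b0r addr0 scalerA.
have tz (z : En) : tangent (fun t => o + t *: z) z by exact: tangent_affine.
have o0 (z : En) : o + 0 *: z = o by rewrite scale0r addr0.
have [d2 d20 H2] : exists2 d : R, 0 < d & forall t, `|t| < d -> W (o + t *: (f u *: v), o).
  apply: (@tangent_in _ (prodModel En En) _ (fun t => (o + t *: (f u *: v), o)) (f u *: v, 0) W) => //.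
    by apply: tangent_pair => //; exact: tangent_cst.
  by rewrite o0.
have AS t : `|t| < d1 -> fsub FD (conj_velocity curve_chart xi eta t).
  by move=> td; apply: (fsmooth_sub sA); rewrite /nb /= subr0.
have vel t : `|t| < Num.min d1 d2 ->
    conj_velocity curve_chart xi eta t u = adj (conj_chart phi) o (o + t *: (f u *: v), h u *: w).
  rewrite lt_min => /andP[t1 t2]; have Vt := dV t t1.
  have [e e0 He] := near_line oV Vt.
  have PS s : `|s| < e -> fsub FD (cmap curve_chart (conj2 curve_chart xi eta (t, s))).
    move=> /He/VP[_ _ hc _ _]; note (chart_image_open curve_chart_atlas) => /fopenP[US _].
    by apply: US; eexists; [exact: hc|].
  have T1 : tangent (fun s => cmap curve_chart (conj2 curve_chart xi eta (t, s)) u : En)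
      (conj_velocity curve_chart xi eta t u).
    exact: (tangent_flin (ev u) e0 PS (conj_velocity_tangent hK oV sV Vt)).
  have T2 : tangent (fun s => 1 *: conj_chart phi (o + t *: (f u *: v), o + s *: (h u *: w)) + - o)
      (1 *: adj (conj_chart phi) o (o + t *: (f u *: v), h u *: w) + 0).
    by apply: tangent_lin => //; [exact: (adj_tangent oW sW _ (H2 t t2))|exact: tangent_cst].
  rewrite -[RHS]addr0 -[adj _ _ _]scale1r.
  apply: (tangent_unique (E := En) _ _ T2) => //.
  apply: (tangent_near (E := En) e0 _ T1) => s /He/VP[/= hx he hc _ _].
  rewrite -[LHS]/(cmap curve_chart _ u) curve_chartE scale1r; congr (_ - o).
  by rewrite /conj_chart /conj2 /= !fun_mulE fun_invE !curve_cinvE.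
have dd : 0 < Num.min d1 d2 by rewrite lt_min d10.
have T1 : tangent (fun t => conj_velocity curve_chart xi eta t u : En) (conj_bracket curve_chart xi eta u).
  exact: (tangent_flin (ev u) d10 AS (conj_bracket_tangent hK oV V0 sV)).
note (bra_tangent oW Woo sW (h u *: w) (o0 (f u *: v)) (tz (f u *: v))) => T2.
apply: (tangent_unique (E := En) _ T1) => //.
by apply: (tangent_near (E := En) dd _ T2) => t td; rewrite vel.
Qed.

End Pointwise.

Lemma ell_scalar (ss : semisimple G) (f h : R -> R) : (forall u, f u * h u = f u) ->
  (forall v : En, fsub FD (fun u => f u *: v)) -> (forall v : En, fsub FD (fun u => h u *: v)) ->
  forall v : En, ell curve_chart lam (fun u => f u *: v) = 0.
Proof.
move=> fh hf hh.
have [W [oW Woo sW WP]] := conj_chart_smooth hG Gphi phi1.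
apply: (lie_semisimple_perfect hG Gphi phi1 oW Woo sW WP ss).
- have -> : (fun u => f u *: (0 : En)) = (0 : FD) by apply/funext => u; rewrite scaler0.
  have z : fsub FD 0 by exact: fs0.
  by have := ell_lin hK curve_chart_atlas curve_chart1 curve_chart0 slam (-1) z z;
    rewrite scaler0 addr0 mulN1r addNr.
- move=> r v w hv hw.
  have -> : (fun u => f u *: (r *: v + w)) = r *: (fun u => f u *: v : En) + (fun u => f u *: w) :> FD.
    apply/funext => u; transitivity (r *: (f u *: v) + f u *: w); last by [].
    by rewrite scalerDr !scalerA mulrC.
  by rewrite (ell_lin hK curve_chart_atlas curve_chart1 curve_chart0 slam)// hv hw mulr0 addr0.
move=> v w.
have [V [oV V0 sV VP]] := conj_domain hK curve_chart_atlas curve_chart1 curve_chart0 nN (hf v) (hh w).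
rewrite -(ell_bracket hK curve_chart_atlas curve_chart1 curve_chart0 yM slam lamE (hh w) oV V0 sV VP).
rewrite (curve_bracketE oW Woo sW (hf v) (hh w)); congr ell.
by apply/funext => u; rewrite fh.
Qed.

End CurveCharacter.

Lemma pn_le_bound (R : realType) (E : frechetModel R) k (x : E) (B : R) :
  (forall j, (j <= k)%N -> fsn j x <= B) -> pn k x <= B.
Proof.
move=> h; apply/ler_addgt0Pr => e e0; apply/ltW/pn_ltP => j jk.
by apply: (le_lt_trans (h j jk)); rewrite ltrDl.
Qed.

(** * Functionals on loops and paths that kill curves with a plateau *)

Section UpperLoops.
Context {R : realType} (n : nat) {hE : is_frechet (@eucl R n)}.
Local Notation ln := (@line R).
Local Notation En := (@eucl R n).
Local Notation D := (@dcurve R En).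
Implicit Types (xi : ln -> En) (s u : R).
Let oT : fopen (setT : set ln) := fopen_fsub ln.

Lemma coord_flin (j : 'I_n) : flin ((fun x : 'rV[R]_n => x 0 j) : En -> ln).
Proof.
split=> // [a x y _ _|k]; first by rewrite !mxE.
exists 0%N, 1 => x _; rewrite pn_line mul1r /= /Num.norm/= mx_normrE.
exact: (le_bigmax _ (fun ij : 'I_1 * 'I_n => `|x ij.1 ij.2|) (0, j)).
Qed.

Lemma smooth_scalar (f : R -> R) (v : En) : fsmooth (setT : set ln) (f : ln -> ln) ->
  fsmooth (setT : set ln) ((fun u => f u *: v) : ln -> En).
Proof.
move=> sf; apply: (@fsmooth_comp _ ln ln En _ _ _ setT setT f (fun t : ln => (t : R) *: v)) => //.
by apply: fsmooth_lin => //; exact: flin_scale_vec.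
Qed.

Lemma smooth_mul_curve (f : R -> R) xi : fsmooth (setT : set ln) (f : ln -> ln) ->
  fsmooth (setT : set ln) xi -> fsmooth (setT : set ln) ((fun u => f u *: xi u) : ln -> En).
Proof.
move=> sf sx; apply: (@fsmooth_comp _ ln (prodModel ln En) En _ _ _ setT (fsub (prodModel ln En))
  (fun u => (f u, xi u)) (@smul R En)) => //.
- exact: fopen_fsub.
- exact: fsmooth_pair.
by move=> k; exact: fclass_smul.
Qed.

Lemma sin2pi_periodic u : sin (u + 2 * pi) = sin u :> R.
Proof. by rewrite (_ : 2 * pi = pi *+ 2) ?sinD2pi// mulr2n mulrDl mul1r. Qed.

Lemma cos2pi_periodic u : cos (u + 2 * pi) = cos u :> R.
Proof. by rewrite (_ : 2 * pi = pi *+ 2) ?cosD2pi// mulr2n mulrDl mul1r. Qed.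

(** The arc is the positivity set of a smooth periodic function, so cutoffs can be written as
    functions of sine and cosine and are periodic by construction. *)
Lemma upper_arc_sin u : upper_arc u <-> 0 < sin u.
Proof.
rewrite upper_arcP; have [k [e r0 r1]] := mod2piP u.
rewrite (periodic_mod2pi u sin2pi_periodic); set r := mod2pi u in e r0 r1 *.
split=> [h|h]; first exact: sin_gt0_pi.
rewrite lt_def r0 andbT; apply/andP; split.
  by apply: contraTN h => /eqP->; rewrite sin0 ltxx.
rewrite ltNge; apply: contraTN h => rp; rewrite -leNgt.
have -> : r = (r - pi) + pi by rewrite subrK.
rewrite sinDpi oppr_le0; apply: sin_ge0_pi; rewrite subr_ge0 rp /=.
lra.
Qed.

(** Flatness at 0 follows from smoothness, since the curve vanishes on the whole interval (-pi,
    0]. *)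
Lemma upper_loopsP xi : loops_in (vecMfd En) 0 upper_arc xi <->
  [/\ forall u, xi (u + 2 * pi) = xi u, fsmooth setT xi & forall u, sin u <= 0 -> xi u = 0].
Proof.
split=> [[/loops_vec[per sx _ _] off]|[per sx off]].
  by split=> // u su; apply: off => /upper_arc_sin; rewrite ltNge su.
split; last by move=> s ns; apply: off; rewrite leNgt; apply/negP => /upper_arc_sin.
have x0 : xi 0 = 0 by apply: off; rewrite sin0.
apply/loops_vec; split=> //.
have p0 := @pi_gt0 R.
pose A := [set u : R | `|u - 0| < pi /\ 0 <= -1 * (u - 0)].
apply: (cflat_side (U := setT) (A := A) oT sx) => //.
- by apply: half_dense; rewrite oppr_eq0 oner_neq0.
- move=> u; rewrite /A /= subr0 ltr_norml => -[/andP[u1 u2] u3]; rewrite x0; apply: off.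
  by rewrite -oppr_ge0 -sinN; apply: sin_ge0_pi; apply/andP; split; lra.
by rewrite /A /= subrr normr0 mulr0.
Qed.

Local Notation LU := (@curveModel R n (@loops_in R _ n (vecMfd En) 0 upper_arc) 0 (2 * pi)).

Lemma upper_ev u : flin ((fun xi => xi u) : LU -> En).
Proof.
have p2 := @twopi_gt0 R.
split=> // k; exists 0%N, 1 => xi /upper_loopsP[per sx _].
have -> : pn k (xi u : En) = `|xi u : 'rV[R]_n| by elim: k => //= k ->; rewrite maxxx.
rewrite mul1r; have [j [e r0 r1]] := mod2piP u.
rewrite e (periodic_int per).
exact: (@fsn_curve_ub R n hE _ 0 _ _ 0 _ sx p2 r0 (ltW r1)).
Qed.

Lemma upper_scalar (f : R -> R) : fsmooth (setT : set ln) (f : ln -> ln) ->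
  (forall u, f (u + 2 * pi) = f u) -> (forall u, sin u <= 0 -> f u = 0) ->
  forall v : En, fsub LU (fun u => f u *: v).
Proof.
move=> sf per off v; apply/upper_loopsP; split=> [u||u su]; rewrite ?per//.
  exact: smooth_scalar.
by rewrite off// scale0r.
Qed.

Lemma smooth_curve_lipschitz xi (B : R) : fsmooth setT xi -> 0 <= B ->
  (forall s, `|D xi s : 'rV[R]_n| <= B) ->
  forall s t : R, `|xi (s + t) - xi s : 'rV[R]_n| <= B * `|t|.
Proof.
move=> sx B0 hB s t; apply/ler_addgt0Pr => e e0.
pose g r := xi (s + t * r).
have -> : xi (s + t) - xi s = g 1 - g 0 :> 'rV[R]_n by rewrite /g mulr1 mulr0 addr0.
apply: (@mean_value_ineq R (fun a b => `|g b - g a : 'rV[R]_n|) (B * `|t| + e)).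
  move=> a b c _ _ _ _; have -> : g c - g a = (g b - g a) + (g c - g b) :> 'rV[R]_n.
    by rewrite [RHS]addrC addrA subrK.
  exact: ler_normD.
have sg : fsmooth setT (g : ln -> En) by exact: fsmooth_affine_comp.
have dg r : D g r = t *: D xi (s + t * r) by rewrite /g dcurve_affine.
move=> r _ _; have [_ H] := (dderiv_lineP (f := g : ln -> En) _ oT (fun _ _ => I) (I : setT r)).1
  (dcurveP oT sg (I : setT r)).
have [d d0 Hd] := H 0%N e e0; exists d => // a b _ ar rb _ bad.
have P h : `|h| < d -> `|g (r + h) - g r : 'rV[R]_n| <= (B * `|t| + e) * `|h|.
  move=> /Hd /= h1; have -> : g (r + h) - g r = (g (r + h) - g r - h *: D g r) + h *: D g r :> 'rV[R]_n.
    by rewrite subrK.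
  apply: (le_trans (ler_normD _ _)); rewrite mulrDl addrC; apply: lerD => //.
  by rewrite dg !normrZ mulrC ler_wpM2r// mulrC ler_wpM2r.
have h1 := P (b - r); have h2 := P (a - r); rewrite !subrKC in h1 h2.
have {}h1 : `|g b - g r : 'rV[R]_n| <= (B * `|t| + e) * (b - r).
  by have := h1; rewrite ger0_norm ?subr_ge0//; apply; lra.
have {}h2 : `|g a - g r : 'rV[R]_n| <= (B * `|t| + e) * (r - a).
  by have := h2; rewrite [`|a - r|]distrC ger0_norm ?subr_ge0//; apply; lra.
have -> : g b - g a = (g b - g r) - (g a - g r) :> 'rV[R]_n by rewrite opprB addrA subrK.
apply: (le_trans (ler_normB _ _)).
have -> : (B * `|t| + e) * (b - a) = (B * `|t| + e) * (b - r) + (B * `|t| + e) * (r - a) by ring.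
exact: lerD.
Qed.

(** A translation changes a derivative by at most the supremum of the next derivative times the
    length of the translation; this costs one seminorm. *)
Lemma translation_close (xi : LU) k : fsub LU xi ->
  forall t : R, fsub LU (fun u => xi (t + 1 * u)) ->
  pn k ((fun u => xi (t + 1 * u)) - xi : LU) <= pn k.+1 xi * `|t|.
Proof.
move=> hx t ht; have p2 := @twopi_gt0 R.
have /upper_loopsP[per sx _] := hx.
have M0 j : 0 <= @fsn R LU j xi.
  by apply: le_trans (@fsn_curve_ub R n hE _ 0 _ _ j 0 sx p2 (lexx _) (ltW p2)).
have key j : @fsn R LU j ((fun u => xi (t + 1 * u)) - xi : LU) <= @fsn R LU j.+1 xi * `|t|.
  have st : fsmooth setT ((fun u => xi (t + 1 * u)) : ln -> En) by exact: fsmooth_affine_comp.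
  apply: fsn_curve_le => //.
    rewrite (_ : _ - _ = (fun u => -1 *: xi u + xi (t + 1 * u))); first exact: fsmooth_addZ.
    by apply/funext => u; rewrite scaleN1r addrC.
  move=> s _ _; rewrite (iter_dcurveB j s st sx) iter_dcurve_affine// expr1n scale1r mul1r addrC [t + s]addrC.
  rewrite addrC; apply: smooth_curve_lipschitz => //; first exact: fsmooth_iter.
  move=> r; have [i [e r0 r1]] := mod2piP r.
  have perD : forall u : R, iter j.+1 D xi (u + 2 * pi) = iter j.+1 D xi u.
    move=> u; have e1 : xi = (fun u => xi (2 * pi + 1 * u)) by apply/funext => z; rewrite mul1r addrC per.
    by rewrite [in RHS]e1 iter_dcurve_affine// expr1n scale1r mul1r addrC.
  rewrite -iterS e (periodic_int perD).
  exact: (@fsn_curve_ub R n hE _ 0 _ _ j.+1 _ sx p2 r0 (ltW r1)).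
apply: pn_le_bound => j jk; apply: (le_trans (key j)); rewrite ler_wpM2r//.
by apply: (le_trans (fsn_le_pn _ _)); exact: pn_mono.
Qed.

Section UpperFunctional.
Variable L : LU -> ln.
Hypotheses (hLU : is_frechet LU) (hL : flin L).
Hypothesis L_plateau : forall f h : R -> R, (forall u, f u * h u = f u) ->
  (forall v : En, fsub LU (fun u => f u *: v)) -> (forall v : En, fsub LU (fun u => h u *: v)) ->
  forall v : En, L (fun u => f u *: v) = 0.

Lemma functional_sum0 (I : Type) (r : seq I) (F : I -> LU) :
  (forall j, fsub LU (F j) /\ L (F j) = 0) ->
  fsub LU (\sum_(j <- r) F j) /\ L (\sum_(j <- r) F j) = 0.
Proof.
move=> h; elim: r => [|j r [IH1 IH2]]; first by rewrite big_nil; split; [exact: fs0|exact: flin0].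
have [h1 h2] := h j; rewrite big_cons; split; first exact: fsD.
by rewrite (flinD hL h1 IH1) h2 IH2 addr0.
Qed.

Lemma functional_away0 (d : R) (xi : LU) : 0 < d -> fsub LU xi ->
  (forall u, xi u <> 0 -> d <= sin u) -> L xi = 0.
Proof.
move=> d0 hx away; have [S [sS S0 S1]] := @smooth_step R.
have /upper_loopsP[per sx off] := hx; have [ssin _] := @smooth_sin_cos R.
(* [h] is 0 where [sin u <= d / 2] and 1 where [d <= sin u], hence 1 wherever [xi] is not zero. *)
pose h u : R := S (-1 + (2 / d) * sin u).
have h0 u : sin u <= 0 -> h u = 0.
  move=> su; apply: S0; have := mulr_ge0_le0 (ltW (divr_gt0 (ltr0Sn R 1) d0)) su; lra.
have h1 u : d <= sin u -> h u = 1.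
  move=> su; apply: S1; have : 2 <= 2 / d * sin u.
    by rewrite mulrAC ler_pdivlMr//; lra.
  lra.
have sh : fsmooth (setT : set ln) (h : ln -> ln).
  apply: (@fsmooth_comp _ ln ln ln _ _ _ setT setT (sin : ln -> ln)
    ((fun t => S (-1 + (2 / d) * t)) : ln -> ln)) => //.
  exact: fsmooth_affine_comp.
have hD v : fsub LU (fun u => h u *: v).
  by apply: upper_scalar => // u; rewrite /h sin2pi_periodic.
pose f j u : R := (xi u : 'rV[R]_n) 0 j.
have sf j : fsmooth (setT : set ln) (f j : ln -> ln).
  apply: (@fsmooth_comp _ ln En ln _ _ _ setT setT xi ((fun x : 'rV[R]_n => x 0 j) : En -> ln)) => //.
    exact: (fopen_fsub En).
  by apply: fsmooth_lin => //; exact: coord_flin.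
have f0 j u : sin u <= 0 -> f j u = 0 by move=> su; rewrite /f off// mxE.
have fD j v : fsub LU (fun u => f j u *: v).
  by apply: upper_scalar; [exact: sf|move=> u; rewrite /f per|exact: f0].
have fh j u : f j u * h u = f j u.
  have [x0|/eqP x0] := eqVneq (xi u) 0; first by rewrite /f x0 mxE mul0r.
  by rewrite h1 ?mulr1//; exact: away.
have -> : xi = \sum_(j < n) (fun u => f j u *: (delta_mx 0 j : 'rV[R]_n)) :> LU.
  apply/funext => u; rewrite [LHS]row_sum_delta.
  by rewrite /= fct_sumE.
apply: (@functional_sum0 _ _ (fun j => (fun u => f j u *: (delta_mx 0 j : 'rV[R]_n))) _).2 => j.
by split; [exact: fD|exact: (L_plateau (fh j))].
Qed.

(* A curve that touches the ends of the arc on one side only is a limit of its translates, which stay away from the ends. *)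
Lemma functional_onesided0 (tau : R) (xi : LU) : tau ^+ 2 = 1 -> fsub LU xi ->
  (forall u, xi u <> 0 -> - 2^-1 <= tau * cos u) -> L xi = 0.
Proof.
move=> tau2 hx side; have /upper_loopsP[per sx off] := hx.
have p0 := @pi_gt0 R.
have pos w : xi w <> 0 -> 0 < sin w by move=> nz; rewrite ltNge; apply/negP => /off.
have tauN : `|tau| = 1 by apply/eqP; rewrite -(@eqrXn2 _ 2)// ?expr1n -?normrX ?tau2 ?normr1.
have sintau e : sin (tau * e) = tau * sin e.
  have : (tau == 1) || (tau == -1) by rewrite -sqrf_eq1 tau2.
  by case/orP => /eqP->; rewrite ?mul1r// !mulN1r sinN.
have costau e : cos (tau * e) = cos e.
  have : (tau == 1) || (tau == -1) by rewrite -sqrf_eq1 tau2.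
  by case/orP => /eqP->; rewrite ?mul1r// !mulN1r cosN.
have [k [C HC]] := flin_bound hL 0%N.
have small e : 0 < e -> e < pi / 4 -> `|L xi : R| <= (`|C| * pn k.+1 xi) * e.
  move=> e0 e1; have se : 0 < sin e by apply: sin_gt0_pi; apply/andP; split; lra.
  have ce : sin e < cos e.
    by rewrite -cosBpihalf -cosN opprB ltr_cos ?in_itv/=; first lra; apply/andP; split; lra.
  pose xe : LU := fun u => xi (- (tau * e) + 1 * u).
  (* With [c = tau * cos w] and [s = sin w] one has [sin u = s cos e + c sin e]. If [c >= 1/2] this
     is at least [sin e / 2]; otherwise [c] lies between -1/2 and 1/2, so [s >= 1/2], and the value
     is at least half of [cos e - sin e]. *)
  have away u : xe u <> 0 -> Num.min (sin e / 2) ((cos e - sin e) / 2) <= sin u.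
    rewrite /xe; set w := - _ + _ => nz.
    have -> : u = w + tau * e by rewrite /w mul1r addrC addrA subrr add0r.
    rewrite sinD sintau costau.
    have := side _ nz; have := pos _ nz; have := cos2Dsin2 w.
    have : (tau * cos w) ^+ 2 = cos w ^+ 2 by rewrite exprMn tau2 mul1r.
    rewrite mulrA [cos w * tau]mulrC; set c := tau * cos w; set s := sin w => <- cs s0 c0.
    rewrite ge_min; have [c1|c1] := lerP 2^-1 c.
      apply/orP; left; nra.
    apply/orP; right; have s1 : 2^-1 <= s by nra.
    nra.
  have hxe : fsub LU xe.
    apply/upper_loopsP; split=> [u||u su].
    - by rewrite /xe mul1r mul1r addrA per.
    - exact: fsmooth_affine_comp.
    apply/eqP; apply/negP => /negP/eqP/away; rewrite leNgt (le_lt_trans su)//.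
    by rewrite lt_min; apply/andP; split; lra.
  have Lxe : L xe = 0.
    by apply: (functional_away0 _ hxe away); rewrite lt_min; apply/andP; split; lra.
  have -> : L xi = - L (xe - xi) by rewrite (flinB hL hxe hx) Lxe sub0r opprK.
  have h1 : `|L (xe - xi) : R| <= C * pn k (xe - xi) by apply: (HC (xe - xi)); exact: fsB.
  rewrite normrN; apply: (le_trans h1); rewrite -mulrA.
  apply: (@le_trans _ _ (`|C| * pn k (xe - xi))).
    by rewrite ler_wpM2r ?ler_norm//; apply: pn_ge0; exact: fsB.
  rewrite ler_wpM2l//.
  have := translation_close k hx hxe; rewrite normrN normrM tauN mul1r gtr0_norm//.
apply/normr0_eq0/le_anti; rewrite normr_ge0 andbT; apply/ler_addgt0Pr => e e0; rewrite add0r.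
pose B := `|C| * pn k.+1 xi; have B0 : 0 <= B by rewrite /B mulr_ge0//; apply: (pn_ge0 _ hx).
pose d := Num.min (pi / 8) (e / (B + 1)).
have d1 : d <= pi / 8 by rewrite ge_min lexx.
have d2 : d <= e / (B + 1) by rewrite ge_min lexx orbT.
have d0 : 0 < d by rewrite lt_min divr_gt0//= divr_gt0// ltr_wpDl.
apply: (le_trans (small d d0 _)); first by lra.
have B1 : 0 < B + 1 by rewrite ltr_wpDl.
move: d2; rewrite ler_pdivlMr// => d2; apply: (le_trans _ d2); rewrite -/B mulrC ler_wpM2l ?lerDl//; exact: ltW.
Qed.

Lemma upper_functional0 (xi : LU) : fsub LU xi -> L xi = 0.
Proof.
move=> hx; have [S [sS S0 S1]] := @smooth_step R.
have /upper_loopsP[per sx off] := hx; have [_ scos] := @smooth_sin_cos R.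
(* [rho] is 0 where the cosine is at most -1/2 and 1 where it is at least 1/2, so [rho *: xi] keeps
   away from pi and the remainder from 0. *)
pose rho u : R := S (2^-1 + 1 * cos u).
have srho : fsmooth (setT : set ln) (rho : ln -> ln).
  apply: (@fsmooth_comp _ ln ln ln _ _ _ setT setT (cos : ln -> ln)
    ((fun t => S (2^-1 + 1 * t)) : ln -> ln)) => //.
  exact: fsmooth_affine_comp.
pose a : LU := fun u => rho u *: xi u.
have ha : fsub LU a.
  apply/upper_loopsP; split=> [u||u su]; last by rewrite /a off// scaler0.
    by rewrite /a /rho cos2pi_periodic per.
  exact: smooth_mul_curve.
have La : L a = 0.
  apply: (@functional_onesided0 1); rewrite ?expr1n// => u nz; rewrite mul1r leNgt.
  apply/negP => cu; apply: nz; rewrite /a /rho S0 ?scale0r//; lra.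
have hb : fsub LU (xi - a) by exact: fsB.
have Lb : L (xi - a) = 0.
  apply: (@functional_onesided0 (-1)); rewrite ?sqrrN ?expr1n// => u nz; rewrite mulN1r lerNl opprK leNgt.
  apply/negP => cu; apply: nz; rewrite !fctE /a /rho S1 ?scale1r ?subrr//; lra.
by rewrite -[xi](subrK a) (flinD hL hb ha) La Lb addr0.
Qed.

End UpperFunctional.

End UpperLoops.

Section PathFunctional.
Context {R : realType} (n : nat) {hE : is_frechet (@eucl R n)}.
Local Notation ln := (@line R).
Local Notation En := (@eucl R n).
Local Notation PU := (@curveModel R n (@paths R _ n (vecMfd En) 0) 0 pi).
Variable L : PU -> ln.
Hypotheses (hPU : is_frechet PU) (hL : flin L).
Hypothesis L_plateau : forall f h : R -> R, (forall u, f u * h u = f u) ->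
  (forall v : En, fsub PU (fun u => f u *: v)) -> (forall v : En, fsub PU (fun u => h u *: v)) ->
  forall v : En, L (fun u => f u *: v) = 0.
Hypothesis L_closed : forall xi : PU, fsub PU xi -> xi pi = 0 -> L xi = 0.

Lemma path_ev u : flin ((fun xi => xi u) : PU -> En).
Proof.
have p0 := @pi_gt0 R.
split=> // k; exists 0%N, 1 => xi /paths_vec[cl sx _].
have -> : pn k (xi u : En) = `|xi u : 'rV[R]_n| by elim: k => //= k ->; rewrite maxxx.
rewrite mul1r cl; have /andP[c0 c1] := clamp_itv u.
exact: (@fsn_curve_ub R n hE _ 0 _ _ 0 _ sx p0 c0 c1).
Qed.

Lemma step_path (f : R -> R) (v : En) : fsmooth (setT : set ln) (f : ln -> ln) ->
  (forall u, u <= 0 -> f u = 0) -> (forall u, pi / 2 <= u -> f u = 1) ->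
  fsub PU (fun u => f u *: v).
Proof.
move=> sf f0 f1; have p0 := @pi_gt0 R.
apply: (paths_vec _).2; split=> [u||]; last by rewrite f0// scale0r.
  have [u0|u0] := lerP u 0; first by rewrite clamp_le0// !f0.
  have [up|up] := lerP pi u; first by rewrite clamp_ge// !f1//; lra.
  by rewrite clamp_id//; exact: ltW.
exact: smooth_scalar.
Qed.

(** [f] is 0 up to pi / 4 and 1 from pi / 2 on, so subtracting [f *: xi pi] leaves a curve ending at
    0. The subtracted curve has a plateau, since the value at pi is free and [h] may be 1 from pi /
    4 on. *)
Lemma path_functional0 (xi : PU) : fsub PU xi -> L xi = 0.
Proof.
move=> hx; have [S [sS S0 S1]] := @smooth_step R.
have p0 := @pi_gt0 R.
pose f u : R := S (-1 + (4 / pi) * u); pose h u : R := S (0 + (8 / pi) * u).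
have sf : fsmooth (setT : set ln) (f : ln -> ln) by exact: fsmooth_affine_comp.
have sh : fsmooth (setT : set ln) (h : ln -> ln) by exact: fsmooth_affine_comp.
have f0 u : u <= pi / 4 -> f u = 0.
  by move=> up; apply: S0; rewrite mulrAC addrC subr_le0 ler_pdivrMr//; lra.
have f1 u : pi / 2 <= u -> f u = 1.
  move=> up; apply: S1; have : 2 <= 4 / pi * u by rewrite mulrAC ler_pdivlMr//; lra.
  lra.
have h0 u : u <= 0 -> h u = 0.
  by move=> up; apply: S0; rewrite add0r mulrAC ler_pdivrMr//; lra.
have h1 u : pi / 4 <= u -> h u = 1.
  by move=> up; apply: S1; rewrite add0r mulrAC ler_pdivlMr//; lra.
have fD v : fsub PU (fun u => f u *: v) by apply: step_path => // u up; apply: f0; lra.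
have hD v : fsub PU (fun u => h u *: v) by apply: step_path => // u up; apply: h1; lra.
have fh u : f u * h u = f u.
  have [up|up] := lerP u (pi / 4); first by rewrite f0// mul0r.
  by rewrite h1 ?mulr1//; exact: ltW.
pose b : PU := fun u => f u *: xi pi.
have hb : fsub PU b by exact: fD.
have ha : fsub PU (xi - b) by exact: fsB.
have La : L (xi - b) = 0.
  apply: L_closed => //; have -> : (xi - b) pi = xi pi - f pi *: xi pi :> 'rV[R]_n by [].
  by rewrite f1 ?scale1r ?subrr//; lra.
by rewrite -[xi](subrK b) (flinD hL ha hb) La add0r (L_plateau fh).
Qed.

End PathFunctional.

Lemma ell_const0 (R : realType) (T : groupType) (E : frechetModel R) (K : mfd T E)
    (hK : is_lie K) (c : chart T E) (Kc : atlas K c) (c1 : cdom c 1%g) (c0 : cmap c 1%g = 0)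
    (lam : T -> R) (slam : smooth_at K (vecMfd (@line R)) (lam : T -> @line R) 1%g) (xi : E) (d : R) :
  fsub E xi -> 0 < d -> (forall t, `|t| < d -> lam (cinv c (t *: xi)) = lam 1%g) ->
  ell c lam xi = 0.
Proof.
move=> hxi d0 h; note (lie_premfd hK) => hKp; note (pm_model hKp) => hE.
have [U [oU U0 sU]] := Lam_smooth hK Kc c1 c0 slam.
have hxi' : fsub E (0 : E) by exact: fs0.
have T1 : tangent (fun t => 0 + t *: xi) xi by exact: tangent_affine.
have T2 : tangent ((fun t => Lam c lam (0 + t *: xi)) : R -> @line R) (ell c lam xi).
  have e0 : 0 + 0 *: xi = 0 by rewrite scale0r addr0.
  rewrite /ell -{2}e0; apply: (tangent_comp oU sU) => //; last by rewrite e0.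
  by move=> t; rewrite add0r; exact: fsZ.
apply: (tangent_unique (E := @line R) _ T2) => //.
apply: (tangent_near (E := @line R) d0 _ (tangent_cst (x := lam 1%g : @line R) _)) => // t td.
by rewrite /Lam add0r h.
Qed.

(** * Characters of the loop group and of the path group *)

Section CurveTrivial.
Context {R : realType} (T : groupType) (n : nat) (G : mfd T (@eucl R n)) (hG : is_lie G)
  (hO : is_lie (Omega G)) (ss : semisimple G).
Local Notation ln := (@line R).
Local Notation En := (@eucl R n).
Local Notation Up := (OmegaIn G upper_arc).
Local Notation P := (PathGroup G).
Let lU := OmegaIn_lie hG hO (@upper_arc R).
Let lP := PathGroup_lie hG hO.
Local Instance ctG_premfd : premfd G := lie_premfd hG.
Local Instance ctE_frechet : is_frechet En := pm_model (lie_premfd hG).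
Local Instance ctU_premfd : premfd Up := lie_premfd lU.
Local Instance ctP_premfd : premfd P := lie_premfd lP.

(* The point is that [B] does not depend on [y]. *)
Lemma upper_character_trivial : exists2 B, mnear Up 1%g B &
  forall (y : (R -> T) -> circle R) N lam, mnear Up 1%g N ->
    (forall k l, carrier Up k -> carrier Up l -> N l -> y (k * l)%g = (y k * y l)%g) ->
    smooth_at Up (vecMfd ln) (lam : (R -> T) -> ln) 1%g ->
    mnear Up 1%g (fun k => y k = circ (lam k)) ->
    (forall k k', y k = y k' -> lam k = lam k') ->
    forall g, B g -> y g = 1%g.
Proof.
have [phi Gphi phi1] := pm_cover ctG_premfd (lie1 hG).
pose c := curve_chart phi (loops_in G 1%g upper_arc) (loops_in (vecMfd En) 0 upper_arc) 0 (2 * pi).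
have Kc : atlas Up c := curve_chart_atlas Gphi phi1 lU.
have c1 : cdom c 1%g := curve_chart1 phi1 lU.
have c0 : cmap c 1%g = 0 := curve_chart0 _ _ _ _ _.
have [k [e [e0 He]]] := mnear_chart_ball Kc c1 (mnearT (lie1 lU)).
rewrite c0 in He.
exists [set g | cdom c g /\ pn k (cmap c g) < e].
  have n1 := mnear_dom Kc c1.
  apply: (mnear_of_ball (k := k) Kc c1 e0) => g cg; rewrite c0 subr0 => ge; by split.
move=> y N lam nN yM slam nlam lamE g [cg ge].
note (chart_image_open (M := Up) Kc) => cim.
have hg : fsub _ (cmap c g) by case/fopenP: cim => h _; apply: h; exists g.
have l0 : forall xi, fsub _ xi -> ell c lam xi = 0.
  note (pm_model ctU_premfd) => hLU.
  move=> xi hxi; apply: (upper_functional0 hLU (ell_flin lU Kc c1 c0 slam) _ hxi) => f h fh fD hD v.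
  exact: (ell_scalar hG Gphi phi1 lU (fun u => upper_ev u) nN yM slam lamE ss fh fD hD).
have := ell0_trivial lU Kc c1 c0 nN yM slam nlam l0 e0 _ hg ge.
rewrite (cinvK (pm_inj ctU_premfd Kc) cg); apply=> xi hxi xe.
have [|x [cx _ <-]] := He xi hxi; first by rewrite subr0.
by exists x.
Qed.

Lemma path_character_trivial (y : (R -> T) -> circle R) N lam : mnear P 1%g N ->
  (forall k l, carrier P k -> carrier P l -> N l -> y (k * l)%g = (y k * y l)%g) ->
  smooth_at P (vecMfd ln) (lam : (R -> T) -> ln) 1%g ->
  mnear P 1%g (fun k => y k = circ (lam k)) ->
  (forall k k', y k = y k' -> lam k = lam k') ->
  (forall k, carrier P k -> k pi = 1%g -> y k = 1%g) ->
  mnear P 1%g [set g | y g = 1%g].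
Proof.
move=> nN yM slam nlam lamE closed.
have [phi Gphi phi1] := pm_cover ctG_premfd (lie1 hG).
pose c := curve_chart phi (paths G 1%g) (paths (vecMfd En) 0) 0 pi.
have Kc : atlas P c := curve_chart_atlas Gphi phi1 lP.
have c1 : cdom c 1%g := curve_chart1 phi1 lP.
have c0 : cmap c 1%g = 0 := curve_chart0 _ _ _ _ _.
have [k [e [e0 He]]] := mnear_chart_ball Kc c1 (mnearT (lie1 lP)).
rewrite c0 in He.
note (pm_model ctP_premfd) => hPU.
have im xi : fsub _ xi -> pn k xi < e -> (cmap c @` cdom c) xi.
  move=> hxi xe; have [|x [cx _ <-]] := He xi hxi; first by rewrite subr0.
  by exists x.
have l0 xi : fsub _ xi -> ell c lam xi = 0.
  move=> hxi; apply: (path_functional0 hPU (ell_flin lP Kc c1 c0 slam) _ _ hxi) => [f h fh fD hD v|z hz z0].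
    exact: (ell_scalar hG Gphi phi1 lP (fun u => path_ev u) nN yM slam lamE ss fh fD hD).
  (* Within this bound [t *: z] stays in the chart ball, where it is the coordinate of a path ending
     at 1, on which [y] is trivial by [closed]. *)
  pose d := e / (pn k z + 1).
  have pz : 0 < pn k z + 1 by rewrite ltr_wpDl//; exact: pn_ge0.
  have d0 : 0 < d by exact: divr_gt0.
  apply: (ell_const0 lP Kc c1 c0 slam hz d0) => t td; apply: lamE.
  have [cx ex] : cdom c (cinv c (t *: z)) /\ cmap c (cinv c (t *: z)) = t *: z.
    apply: cmapK; apply: im; first exact: fsZ.
    rewrite pnZ//; move: td; rewrite /d ltr_pdivlMr//; apply: le_lt_trans.
    by rewrite ler_wpM2l// lerDl.
  rewrite !closed//; [exact: lie1 lP|by have /curve_chartP[] := cx|].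
  rewrite (curve_cinvE hG Gphi)//; last by exists (cinv c (t *: z)).
  have -> : (t *: z) pi = t *: z pi by [].
  by rewrite z0 scaler0 addr0 cinvK//; exact: (pm_inj ctG_premfd Gphi).
apply: (mnear_of_ball (k := k) Kc c1 e0) => g cg; rewrite c0 subr0 => ge.
note (chart_image_open (M := P) Kc) => cim.
have hg : fsub _ (cmap c g) by case/fopenP: cim => h _; apply: h; exists g.
have := ell0_trivial lP Kc c1 c0 nN yM slam nlam l0 e0 im hg ge.
by rewrite (cinvK (pm_inj ctP_premfd Kc) cg).
Qed.

Lemma pn_big_sum (E : frechetModel R) {hE : is_frechet E} (I : Type) (r : seq I) (F : I -> E) k :
  (forall j, fsub E (F j)) ->
  fsub E (\sum_(j <- r) F j) /\ pn k (\sum_(j <- r) F j) <= \sum_(j <- r) pn k (F j).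
Proof.
move=> h; elim: r => [|j r [IH1 IH2]]; first by rewrite !big_nil pn0; split=> //; exact: fs0.
rewrite !big_cons; split; first exact: fsD.
by apply: (le_trans (pnD k (h j) IH1)); rewrite lerD2l.
Qed.

(** A nearby [b] is reached by the path with coordinate [f *: v], where [v] is the coordinate of [b]
    relative to 1 and [f] goes from 0 to 1. This is linear in [v], so its seminorms are at most a
    constant times the norm of [v]. *)
Lemma endpoints_near V : mnear P 1%g V -> mnear G 1%g [set b | exists2 g, V g & g pi = b].
Proof.
move=> nV.
have [phi Gphi phi1] := pm_cover ctG_premfd (lie1 hG).
pose c := curve_chart phi (paths G 1%g) (paths (vecMfd En) 0) 0 pi.
have Kc : atlas P c := curve_chart_atlas Gphi phi1 lP.
have c1 : cdom c 1%g := curve_chart1 phi1 lP.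
have c0 : cmap c 1%g = 0 := curve_chart0 _ _ _ _ _.
have [k [e [e0 He]]] := mnear_chart_ball Kc c1 nV.
rewrite c0 in He.
note (pm_model ctP_premfd) => hPU.
have p0 := @pi_gt0 R.
have [S [sS S0 S1]] := @smooth_step R.
pose f u : R := S (0 + (2 / pi) * u).
have sf : fsmooth (setT : set ln) (f : ln -> ln) by exact: fsmooth_affine_comp.
have f0 u : u <= 0 -> f u = 0.
  by move=> up; apply: S0; rewrite add0r mulrAC ler_pdivrMr//; lra.
have f1 u : pi / 2 <= u -> f u = 1.
  by move=> up; apply: S1; rewrite add0r mulrAC ler_pdivlMr//; lra.
have fD (v : En) : paths (vecMfd En) 0 (fun u => f u *: v) by exact: step_path.
pose PU := @curveModel R n (paths (vecMfd En) 0) 0 pi.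
have fS (v : En) : fsub PU (fun u => f u *: v) := fD v.
pose C := \sum_(j < n) pn k ((fun u => f u *: (delta_mx 0 j : 'rV[R]_n)) : PU).
have C0 : 0 < C + 1 by rewrite ltr_wpDl// sumr_ge0// => j _; apply: (@pn_ge0 _ PU hPU); exact: fS.
have bound (v : En) : pn k ((fun u => f u *: v) : PU) <= `|v : 'rV[R]_n| * C.
  have -> : (fun u => f u *: v) = \sum_(j < n) v 0 j *: ((fun u => f u *: (delta_mx 0 j : 'rV[R]_n)) : PU) :> PU.
    apply/funext => u.
    have ev (F : 'I_n -> PU) : (\sum_(j < n) F j) u = \sum_(j < n) F j u :> 'rV[R]_n.
      exact: (big_morph (fun g : PU => g u)).
    rewrite ev {1}[v]row_sum_delta scaler_sumr; apply: eq_bigr => j _.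
    transitivity (v 0 j *: (f u *: (delta_mx 0 j : 'rV[R]_n))); last by [].
    by rewrite !scalerA mulrC.
  have hs (j : 'I_n) : fsub PU (v 0 j *: ((fun u => f u *: (delta_mx 0 j : 'rV[R]_n)) : PU)) by apply: (@fsZ _ PU hPU); exact: fS.
  apply: (le_trans (pn_big_sum (index_enum 'I_n) k hs).2).
  rewrite /C mulr_sumr; apply: ler_sum => j _; have h1 := fS (delta_mx 0 j : 'rV[R]_n).
  rewrite (@pnZ _ PU hPU _ _ _ h1) ler_wpM2r ?(@pn_ge0 _ PU hPU _ _ h1)//.
  by rewrite [leRHS]/Num.norm/= mx_normrE; exact: (le_bigmax _ (fun ij : 'I_1 * 'I_n => `|v ij.1 ij.2|) (0, j)).
apply: (mnear_of_ball (k := 0) Gphi phi1 (divr_gt0 e0 C0)) => b pb /= bd.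
pose v : En := cmap phi b - cmap phi 1%g.
have [||g [cg Vg eg]] := He (fun u => f u *: v); first exact: fD.
  rewrite subr0; apply: (le_lt_trans (bound v)).
  move: bd; rewrite ltr_pdivlMr//; apply: le_lt_trans.
  by rewrite ler_wpM2l// lerDl.
exists g => //; have /curve_chartP[_ /(_ pi) gp] := cg.
apply: (pm_inj ctG_premfd Gphi gp pb).
have := congr1 (fun z : R -> 'rV[R]_n => z pi) eg.
rewrite -[LHS]/(cmap c g pi) curve_chartE f1 ?scale1r; last by lra.
by rewrite /v => /(congr1 (fun z => z + cmap phi 1%g)); rewrite !subrK.
Qed.

End CurveTrivial.

Lemma circle_mulC (R : realType) (u v : circle R) : (u * v = v * u)%g.
Proof. by apply: val_inj; rewrite /= mulrC. Qed.

Lemma circD (R : realType) (s t : R) : circ (s + t) = (circ s * circ t)%g.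
Proof. by apply: val_inj; rewrite /= cisD. Qed.

(** * Uniqueness of the action *)

Section InclusionLift.
Context {R : realType} (T T' : groupType) (F E : frechetModel R)
  (H : mfd T F) (Ht : mfd T' E) (i : circle R -> T') (p : T' -> T)
  (ce : central_extension H Ht i p).
Local Notation ln := (@line R).
Local Instance ilH_premfd : premfd H := lie_premfd (cext_base ce).
Local Instance ilT_premfd : premfd Ht := lie_premfd (cext_total ce).

Lemma cext_i1 : i 1%g = 1%g.
Proof. by apply: (@mulgI _ (i 1%g)); rewrite -(cext_iM ce) !mulg1. Qed.

(* In a trivialisation around [1] the inclusion of the circle is a translate of the second coordinate. *)
Lemma incl_lift S D (M : mfd S D) {hM : premfd M} (f : S -> T') (chi : S -> circle R) m :
  smooth_at M Ht f m -> f m = 1%g -> mnear M m [set k | f k = i (chi k)] ->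
  exists lam : S -> R, [/\ smooth_at M (vecMfd ln) (lam : S -> ln) m,
    mnear M m (fun k => chi k = circ (lam k)) & forall k k', chi k = chi k' -> lam k = lam k'].
Proof.
move=> sf fm nf.
have [W [Th [W1 lt]]] := cext_bundle ce (lie1 (cext_base ce)).
have [g [sTh sg gK gK' cTh]]  := local_triv_inv ce lt; have [oW _ pTh Thi] := lt.
have T1 := lie1 (cext_total ce).
have Wp : W (p 1%g) by rewrite (cext_p1 ce).
have [g1 g2] := gK' _ T1 Wp; set z0 := (g 1%g).2.
have gi z : g (i z) = (1%g, (z0 * z)%g).
  rewrite -(gK (1%g, z0 * z)%g)//; congr g; rewrite Thi//.
  have -> : (1%g, z0) = g 1%g by rewrite /z0 -(cext_p1 ce) -g2; case: (g 1%g).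
  by rewrite g1 mul1g.
have chim : chi m = 1%g.
  apply: (cext_inj ce); rewrite cext_i1 -fm; apply/esym.
  by note (mnear_self nf) => h; exact: h.
have sy : smooth_at M (U1 R) (fun k => (z0 * chi k)%g) m.
  apply: (smooth_at_congr (f := fun k => (g (f k)).2)); last first.
    by apply: (mnear_sub nf) => k _ e; rewrite /= e gi.
  apply: (smooth_at_comp (N := prodMfd H (U1 R)) (f := fun k => g (f k)) (g := snd)).
    by apply: (smooth_at_comp (N := Ht) (f := f) (g := g)) => //; rewrite fm; exact: sg.
  by apply: smooth_at_snd => //=; rewrite fm g2 (cext_p1 ce); exact: lie1 (cext_base ce).
have [lam' [sl nl lE]] := circle_lift sy.
exists (fun k => - lam' m + 1 * lam' k); split.
- apply: (smooth_at_comp (N := vecMfd ln) (f := lam' : S -> ln) (g := (fun x : ln => - lam' m + 1 * (x : R)) : ln -> ln)) => //.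
  by apply: (smooth_at_vec (fopen_fsub ln)) => //; exact: fsmooth_affine.
- apply: (mnear_sub nl) => k _ e; note (mnear_self nl) => em.
  have z0E : z0 = circ (lam' m) by rewrite -em chim mulg1.
  apply: (@mulgI _ z0); rewrite e mul1r [in RHS]z0E -circD; congr circ; by rewrite addrA addrN add0r.
by move=> k k' e; rewrite (lE k k')// e.
Qed.

End InclusionLift.

Section Uniqueness.
Context {R : realType} (T : groupType) (n : nat) (G : mfd T (@eucl R n)) (hG : is_lie G)
  (T' : groupType) (E : frechetModel R) (Ht : mfd T' E)
  (i : circle R -> T') (p : T' -> (R -> T)) (ce : central_extension (Omega G) Ht i p).
Local Notation ln := (@line R).
Local Notation KT := (tildeOmegaUpper G Ht i p).
Local Notation P := (PathGroup G).
Local Notation Up := (OmegaIn G upper_arc).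
Local Notation t := (restrict_path p).
Let hO : is_lie (Omega G) := cext_base ce.
Let hT : is_lie Ht := cext_total ce.
Let subU := OmegaIn_sub hG hO (@upper_arc R).
Let lU := OmegaIn_lie hG hO (@upper_arc R).
Let lP := PathGroup_lie hG hO.
Let lK := tildeUpper_lie hG ce.
Local Instance uG_premfd : premfd G := lie_premfd hG.
Local Instance uO_premfd : premfd (Omega G) := lie_premfd hO.
Local Instance uT_premfd : premfd Ht := lie_premfd hT.
Local Instance uU_premfd : premfd Up := lie_premfd lU.
Local Instance uP_premfd : premfd P := lie_premfd lP.
Local Instance uK_premfd : premfd KT := lie_premfd lK.

(** The constant 1 on the lower half completes the closed path to a loop, and a lift of that loop
    restricts to [gam]. *)
Lemma closed_path_lift gam : carrier P gam -> gam pi = 1%g ->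
  exists2 h, carrier KT h & t h = gam.
Proof.
move=> pg g1; have /pathsP[cg _ g0] := pg.
note (cup_loops pg (paths1 hG) g1) => lo.
have off s : ~ upper_arc s -> cup gam (fun=> 1%g) s = 1%g.
  move=> /upper_arcP ns; rewrite /cup; case: ifP => // sp.
  have [k [_ r0 _]] := mod2piP s; move: r0; rewrite le_eqVlt => /orP[/eqP<-//|r0].
  move: sp; rewrite le_eqVlt => /orP[/eqP->//|sp].
  by case: ns; rewrite r0.
have [h hh ph] := cext_surj ce lo; exists h; first by split=> //; rewrite /preimage /= ph.
apply/funext => s; rewrite /restrict_path ph cg.
by have /andP[? ?] := clamp_itv s; rewrite cup_low.
Qed.

Lemma incl_upper z : carrier KT (i z) /\ t (i z) = 1%g.
Proof.
split; last by apply/funext => s; rewrite /restrict_path (cext_pi ce).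
by split; [exact: cext_i_carrier ce z|rewrite /preimage /= (cext_pi ce); exact: lie1 lU].
Qed.

Context (alpha beta : (R -> T) -> T' -> T')
  (ha : central_crossed_module KT P t alpha) (hb : central_crossed_module KT P t beta).

Definition chi g x : circle R := xget 1%g [set z | beta g x = (i z * alpha g x)%g].

Lemma act_carrier a (hca : central_crossed_module KT P t a) g x : carrier P g -> carrier KT x -> carrier KT (a g x).
Proof. by move=> pg hx; have [/(_ (g, x)) h _] := cm_smooth hca.1; apply: h. Qed.

(** Both actions are equivariant, so their values have the same image under [t], whose kernel is the
    circle. *)
Lemma chiP g x : carrier P g -> carrier KT x -> beta g x = (i (chi g x) * alpha g x)%g.
Proof.
move=> pg hx; pose S := [set z | beta g x = (i z * alpha g x)%g].
suff : S (xget 1%g S) by [].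
apply: xgetPex; have ca := act_carrier ha pg hx; have cb := act_carrier hb pg hx.
have [z zE] : exists z, (beta g x * (alpha g x)^-1)%g = i z.
  apply: (restrict_path_ker hG ce); first by apply: (lieM lK) => //; exact: (lieV lK).
  apply: (@mulIg _ (t (alpha g x))); rewrite -(cm_hom ha.1).2//; last first.
    by apply: (lieM lK) => //; exact: (lieV lK).
  by rewrite mulgVK mul1g (cm_equivariant ha.1)// (cm_equivariant hb.1).
by exists z; rewrite /S /= -zE mulgVK.
Qed.

Lemma chi_eq g x z : carrier P g -> carrier KT x -> beta g x = (i z * alpha g x)%g -> chi g x = z.
Proof. by move=> pg hx; rewrite (chiP pg hx) => /mulIg/(cext_inj ce). Qed.

Lemma chiM g x x' : carrier P g -> carrier KT x -> carrier KT x' ->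
  chi g (x * x')%g = (chi g x * chi g x')%g.
Proof.
move=> pg hx hx'; apply: chi_eq => //; first exact: (lieM lK).
rewrite (cm_autM ha.1)// (cm_autM hb.1)// !chiP// (cext_iM ce) !mulgA; congr (_ * _)%g.
by rewrite -!mulgA (cext_central ce (chi g x') (act_carrier ha pg hx).1).
Qed.

Lemma chi_incl g z : carrier P g -> chi g (i z) = 1%g.
Proof.
move=> pg; have [iz tz] := incl_upper z; apply: chi_eq => //.
by rewrite (ha.2 g _ pg iz tz) (hb.2 g _ pg iz tz) (cext_i1 ce) mul1g.
Qed.

(** Two lifts of a loop differ by an element of the circle, on which [chi g] is trivial because both
    crossed modules are central. *)
Lemma chi_lift g x x' : carrier P g -> carrier KT x -> carrier KT x' -> p x = p x' ->
  chi g x = chi g x'.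
Proof.
move=> pg hx hx' e; have cV := lieV hT hx.1.
have [z zE] : exists z, (x^-1 * x')%g = i z.
  apply/(cext_exact ce (lieM hT cV hx'.1)).
  by rewrite (cext_pM ce cV hx'.1) (cext_pV ce hx.1) e mulVg.
have -> : x' = (x * i z)%g by rewrite -zE mulVKg.
by rewrite chiM ?chi_incl ?mulg1//; case: (incl_upper z).
Qed.

(** The circle element coming from [g'] is fixed by [beta g]; what remains is [chi g] at the moved
    point [alpha g' x]. *)
Lemma chi_comp g g' x : carrier P g -> carrier P g' -> carrier KT x ->
  chi (g * g')%g x = (chi g' x * chi g (alpha g' x))%g.
Proof.
move=> pg pg' hx; have hx' := act_carrier ha pg' hx.
have [iz tz] := incl_upper (chi g' x).
apply: chi_eq => //; first exact: (lieM lP).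
rewrite (cm_actM ha.1)// (cm_actM hb.1)// (chiP pg' hx) (cm_autM hb.1)//.
by rewrite (hb.2 g _ pg iz tz) (chiP pg hx') (cext_iM ce) mulgA.
Qed.

Lemma chi_peiffer h x : carrier KT h -> carrier KT x -> chi (t h) x = 1%g.
Proof.
move=> hh hx; apply: chi_eq => //; first exact: (cm_hom ha.1).1.1.
by rewrite (cm_peiffer ha.1)// (cm_peiffer hb.1)// (cext_i1 ce) mul1g.
Qed.

(** The quotient of the two actions is smooth in the parameters and lies in the circle, so
    [incl_lift] provides a smooth angle. [y] may be any function that agrees with [chi] near [m]. *)
Lemma chi_local_lift S D (M : mfd S D) {hM : premfd M} (a : S -> R -> T) (b : S -> T')
    (y : S -> circle R) m : smooth_at M P a m -> smooth_at M KT b m ->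
  chi (a m) (b m) = 1%g -> mnear M m [set s | y s = chi (a s) (b s)] ->
  exists lam : S -> R, [/\ smooth_at M (vecMfd ln) (lam : S -> ln) m,
    mnear M m (fun k => y k = circ (lam k)) & forall k k', y k = y k' -> lam k = lam k'].
Proof.
move=> sa sb e ny.
have Pa : carrier P (a m) by case: sa => c [d [_ Pd _ dx _]]; exact: (pm_dom uP_premfd Pd).
have Kb : carrier KT (b m) by case: sb => c [d [_ Pd _ dx _]]; exact: (pm_dom uK_premfd Pd).
note (smooth_at_near sa (mnearT Pa)) => na.
note (smooth_at_near sb (mnearT Kb)) => nb.
have act c (hc : central_crossed_module KT P t c) : smooth_at M Ht (fun s => c (a s) (b s)) m.
  apply: (smooth_at_comp (N := KT) (f := fun s => c (a s) (b s)) (g := id)); last first.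
    by apply: (tilde_incl ce subU); exact: (act_carrier hc).
  apply: (smooth_at_comp (N := prodMfd P KT) (f := fun s => (a s, b s)) (g := fun q => c q.1 q.2)).
    exact: smooth_at_pair.
  exact: (smooth_map_at (cm_smooth hc.1)).
have key s : carrier P (a s) -> carrier KT (b s) ->
    (beta (a s) (b s) * (alpha (a s) (b s))^-1)%g = i (chi (a s) (b s)).
  by move=> pa hb'; rewrite chiP// mulgK.
apply: (incl_lift ce (f := fun s => (beta (a s) (b s) * (alpha (a s) (b s))^-1)%g)).
- by apply: (smooth_at_mul hT); [exact: act|apply: (smooth_at_inv hT); exact: act].
- by rewrite key ?e ?(cext_i1 ce).
apply: (mnear_sub (mnearI (mnearI na nb) ny)) => s _ [[/= pa hb'] es].
by rewrite key// es.
Qed.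

Context (ss : semisimple G).

Lemma chi_trivial_near : exists2 B, mnear Up 1%g B &
  forall g x, carrier P g -> carrier KT x -> B (p x) -> chi g x = 1%g.
Proof.
have [B nB HB] := upper_character_trivial hG hO ss; exists B => // g x pg hx Bx.
(* [lift] is an arbitrary choice over all loops and gives exact multiplicativity; smoothness is
   borrowed from the local section [sec], since [chi g] does not distinguish lifts. *)
pose lift w := xget 1%g [set x | carrier KT x /\ p x = w].
have liftP w : carrier Up w -> carrier KT (lift w) /\ p (lift w) = w.
  move=> Uw; have [l hl pl] := cext_surj ce Uw.1.
  by apply: (@xgetPex _ 1%g [set x | carrier KT x /\ p x = w]); exists l; split=> //; split=> //; rewrite /preimage /= pl.
have [hl pl] := liftP _ hx.2.
rewrite -(chi_lift pg hl hx pl).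
have [sec [ssec nsec]] := local_section ce (lie1 hO).
note (sub_smooth_j subU (lie1 lU)) => sU.
note (mnearI (smooth_at_near sU nsec) (mnearT (lie1 lU))) => nU.
have nK : mnear Up 1%g [set w | carrier KT (sec w) /\ p (sec w) = w].
  by apply: (mnear_sub nU) => w _ [[/= h1 h2] h3]; split=> //; split=> //; rewrite /preimage /= h2.
have sK : smooth_at Up KT sec 1%g.
  apply: (tilde_corestrict ce subU); first by apply: (mnear_sub nK) => w _ [].
  exact: (smooth_at_comp (N := Omega G) (f := id) (g := sec)).
have [k1 k2] : carrier KT (sec 1%g) /\ p (sec 1%g) = 1%g by note (mnear_self nK).
have [z zE] := (cext_exact ce k1.1).1 k2.
have [lam [sl nl lE]] : exists lam : (R -> T) -> R, [/\ smooth_at Up (vecMfd ln) (lam : _ -> ln) 1%g,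
    mnear Up 1%g (fun k => chi g (lift k) = circ (lam k)) &
    forall k k', chi g (lift k) = chi g (lift k') -> lam k = lam k'].
  apply: (chi_local_lift (a := fun=> g) (b := sec) _ sK).
  - exact: (smooth_at_cst lP (lie1 lU) pg).
  - by rewrite zE chi_incl.
  apply: (mnear_sub (mnearI nK (mnearT (lie1 lU)))) => w _ [[h1 h2] Uw] /=.
  by have [h3 h4] := liftP w Uw; apply: chi_lift; rewrite ?h2.
apply: (HB _ _ lam (mnearT (lie1 lU)) _ sl nl lE) => // k l Uk Ul _.
have [k3 k4] := liftP k Uk; have [l3 l4] := liftP l Ul.
have [m3 m4] := liftP _ (lieM lU Uk Ul).
rewrite -chiM//; apply: chi_lift => //; first exact: (lieM lK).
by rewrite m4 (cext_pM ce k3.1 l3.1) k4 l4.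
Qed.

(** For [g'] near 1 the element [alpha g' x * x^-1] lies over [B], where every [chi g] is trivial,
    so [chi g (alpha g' x) = chi g x]. As [B] serves all [g], so does [N]. *)
Lemma chi_local_hom x : carrier KT x -> exists N, mnear P 1%g N /\
  forall g g', carrier P g -> carrier P g' -> N g' ->
    chi (g * g')%g x = (chi g x * chi g' x)%g.
Proof.
move=> hx; have [B nB HB] := chi_trivial_near.
exists [set g' | B (p (alpha g' x * x^-1)%g)]; split; last first.
  move=> g g' pg pg' /= Bg; have hx' := act_carrier ha pg' hx.
  rewrite chi_comp// circle_mulC; congr (_ * _)%g.
  have hw : carrier KT (alpha g' x * x^-1)%g by apply: (lieM lK) => //; exact: (lieV lK).
  by rewrite -{1}[alpha g' x](mulgVK x) (chiM pg hw hx) (HB g _ pg hw Bg) mul1g.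
have P1 := lie1 lP.
have sx : smooth_at P Up (fun g' => p (alpha g' x * x^-1)%g) 1%g.
  have sKx : smooth_at P KT (fun g' => alpha g' x * x^-1)%g 1%g.
    apply: (smooth_at_mul lK); last by apply: smooth_at_cst => //; exact: (lieV lK).
    apply: (smooth_at_comp (N := prodMfd P KT) (f := fun g' => (g', x)) (g := fun q => alpha q.1 q.2)).
      by apply: smooth_at_pair; [exact: smooth_at_id|exact: smooth_at_cst].
    by apply: (smooth_map_at (cm_smooth ha.1)).
  apply: (smooth_at_comp (N := KT) (f := fun g' => (alpha g' x * x^-1)%g) (g := p) sKx).
  apply: (tilde_p_smooth hG ce); apply: (lieM lK); first exact: (act_carrier ha P1 hx).
  exact: (lieV lK).
apply: (smooth_at_near sx).
by rewrite (cm_act1 ha.1 hx) mulgV (cext_p1 ce).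
Qed.

Lemma chi_near_trivial x : carrier KT x -> mnear P 1%g [set g | chi g x = 1%g].
Proof.
move=> hx; have [N [nN NM]] := chi_local_hom hx; have P1 := lie1 lP.
have [lam [sl nl lE]] : exists lam : (R -> T) -> R, [/\ smooth_at P (vecMfd ln) (lam : _ -> ln) 1%g,
    mnear P 1%g (fun k => chi k x = circ (lam k)) & forall k k', chi k x = chi k' x -> lam k = lam k'].
  apply: (chi_local_lift (a := id) (b := fun=> x)).
  - exact: smooth_at_id.
  - exact: (smooth_at_cst lK P1 hx).
  - by apply: chi_eq => //; rewrite (cm_act1 ha.1 hx) (cm_act1 hb.1 hx) (cext_i1 ce) mul1g.
  by apply: (mnear_sub (mnearT P1)).
apply: (path_character_trivial hG hO ss nN _ sl nl lE) => [//|k pk k1].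
by have [h hh <-] := closed_path_lift pk k1; exact: chi_peiffer.
Qed.

(** The two paths differ by a closed path [t h], which acts by conjugation with [h]; [chi g],
    multiplicative with values in a commutative group, does not see it. *)
Lemma chi_endpoint g g' x : carrier P g -> carrier P g' -> carrier KT x -> g pi = g' pi ->
  chi g x = chi g' x.
Proof.
move=> pg pg' hx e; have pd : carrier P (g^-1 * g')%g by apply: (lieM lP) => //; exact: (lieV lP).
have [|h hh th] := closed_path_lift pd; first by rewrite fun_mulE fun_invE e mulVg.
have -> : g' = (g * t h)%g by rewrite th mulVKg.
have ph : carrier P (t h) by rewrite th.
have hV := lieV lK hh.
rewrite chi_comp// chi_peiffer// mul1g (cm_peiffer ha.1)// !chiM//; last exact: (lieM lK).
have c1 : chi g 1%g = 1%g by rewrite -(cext_i1 ce) chi_incl.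
by rewrite [(chi g h * _)%g]circle_mulC -mulgA -chiM// mulgV c1 mulg1.
Qed.

Lemma mnear_translate a U : carrier G a -> mnear G 1%g U -> mnear G a [set b | U (a^-1 * b)%g].
Proof.
move=> Ga nU.
have s : smooth_at G G (fun b => a^-1 * b)%g a.
  apply: (smooth_at_mul hG); last exact: smooth_at_id.
  by apply: (smooth_at_cst hG) => //; exact: (lieV hG).
by apply: (smooth_at_near s); rewrite mulVg.
Qed.

Lemma chi1 (hGconn : mconnected G) g x : carrier P g -> carrier KT x -> chi g x = 1%g.
Proof.
move=> pg hx; have [N [nN NM]] := chi_local_hom hx.
have P1 := lie1 lP.
pose V := [set g | [/\ N g, chi g x = 1%g & carrier P g]].
have nV : mnear P 1%g V.
  apply: (mnear_sub (mnearI (mnearI nN (chi_near_trivial hx)) (mnearT P1))) => k _ [[? ?] ?].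
  by split.
have nE := endpoints_near hG hO nV.
(* By [chi_endpoint] the path chosen to reach [a] does not matter. Both [O] and its complement are
   open, since multiplying by paths in [V] or their inverses keeps the value of [chi] while the end
   points fill a neighbourhood. *)
pose O : set T := [set a | exists g, [/\ carrier P g, g pi = a & chi g x = 1%g]].
have carP k : carrier P k -> carrier G (k pi).
  by move=> /pathsP[_ sk _]; exact: csm_carrier (sk pi).
have OG : O `<=` carrier G by move=> _ [k [pk <- _]]; exact: carP.
have oO : mopen G O.
  apply/mopenP; split=> // a Oa; have Ga := OG a Oa.
  apply: (mnear_sub (mnear_translate Ga nE)) => b _ /= [k [Nk k1 pk] kb].
  have [l [pl la l1]] := Oa; exists (l * k)%g; split; first exact: (lieM lP).
    by rewrite fun_mulE la kb mulVKg.
  by rewrite NM// l1 k1 mulg1.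
have oC : mopen G (carrier G `\` O).
  apply/mopenP; split=> [a []//|a [Ga Oa]].
  apply: (mnear_sub (mnear_translate Ga nE)) => b Gb /= [k [Nk k1 pk] kb]; split=> // -[l [pl lb l1]].
  apply: Oa; have pV := lieV lP pk; have plk := lieM lP pl pV.
  exists (l * k^-1)%g; split=> //; first by rewrite fun_mulE fun_invE lb kb invgM invgK mulVKg.
  by have := NM (l * k^-1)%g k plk pk Nk; rewrite mulgVK l1 k1 mulg1.
have [Oe|OE] := hGconn O oO oC.
  have : O (g pi * (g pi)^-1)%g; last by rewrite Oe.
  rewrite mulgV; exists 1%g; split=> //.
  by apply: chi_eq => //; rewrite (cm_act1 ha.1 hx) (cm_act1 hb.1 hx) (cext_i1 ce) mul1g.
have [l [pl le l1]] : O (g pi) by rewrite OE; exact: carP.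
by rewrite -l1; apply: chi_endpoint.
Qed.

Lemma crossed_action_unique (hGconn : mconnected G) g x : carrier P g -> carrier KT x ->
  beta g x = alpha g x.
Proof. by move=> pg hx; rewrite chiP// chi1// (cext_i1 ce) mul1g. Qed.

End Uniqueness.

Theorem theorem1p2 (R : realType) (T : groupType) (n : nat)
    (G : mfd T (@eucl R n)) (hG : is_lie G) (hGconn : mconnected G)
    (T' : groupType) (E : frechetModel R) (Ht : mfd T' E)
    (i : circle R -> T') (p : T' -> (R -> T))
    (hext : central_extension (Omega G) Ht i p)
    (hdc : disjoint_commutative G Ht p) :
  central_crossed_module (tildeOmegaUpper G Ht i p) (PathGroup G)
    (restrict_path p) (canonical_action Ht p) /\
  (semisimple G ->
   forall alpha : (R -> T) -> T' -> T',
     central_crossed_module (tildeOmegaUpper G Ht i p) (PathGroup G)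
       (restrict_path p) alpha ->
     forall gam x, carrier (PathGroup G) gam ->
       carrier (tildeOmegaUpper G Ht i p) x ->
       alpha gam x = canonical_action Ht p gam x).

Proof.
have ca := canonical_crossed_module hG hext hdc; split=> // ss alpha ha gam x pg hx.
exact: (crossed_action_unique hG hext ca ha ss hGconn pg hx).
Qed.
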